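(* Assume Hypothesis B (stated in the context) holds. For all sufficiently large $r$, the extremal matroids of rank $r$ of $\mathcal{AC}_4$ and of $\mathcal{GM}$ are (up to isomorphism) exactly $T_r^2$, $G_r$, and $HP_r$. Consequently $h_{\mathcal{AC}_4}(r)=h_{\mathcal{GM}}(r)=\binom{r+3}{2}-5$ for all sufficiently large $r$.
   Context: $\mathcal{GM}$ is the class of matroids representable by a real matrix all of whose nonzero subdeterminants are $\pm\tau^i$ ($i\in\mathbb{Z}$), $\tau=\frac{1+\sqrt5}2$. $\mathcal{AC}_4$ is the class of $\mathrm{GF}(4)$-representable matroids representable over some field of every characteristic. For a minor-closed class $\mathcal{M}$, $h_{\mathcal{M}}(r)$ is the maximum number of elements of a simple matroid in $\mathcal{M}$ of rank at most $r$, and an extremal matroid of $\mathcal{M}$ is a simple rank-$r$ matroid in $\mathcal{M}$ with $h_{\mathcal{M}}(r)$ rank-one flats. Over $\mathrm{GF}(4)$ let $\alpha^2=\alpha+1$. $D_n$ is the $n\times\binom n2$ matrix whose columns are all distinct with exactly two nonzero entries, the first $1$ and the second $-1$. $\bar c$ denotes a constant row vector of entries $c$. $T_r^2$ is the column matroid of $\big[I_r \mid \binom{\bar 0}{D_{r-1}}\mid\binom{\bar 1}{I_{r-1}}\mid\binom{\bar\alpha}{I_{r-1}}\mid\binom{\bar{\alpha^2}}{I_{r-1}}\big]$ (one top row, $r-1$ lower rows). With two top rows and $r-2$ lower rows, and $c_1,c_2,c_3$ the columns with top entries $(1,1),(1,\alpha),(1,\alpha^2)$ and zeros below: $G_r$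 is the column matroid of $\big[I_r\mid (\bar0;\bar0;D_{r-2})\mid(\bar1;\bar0;I_{r-2})\mid(\bar0;\bar1;I_{r-2})\mid(\bar\alpha;\bar0;I_{r-2})\mid(\bar0;\bar\alpha;I_{r-2})\mid c_1\mid c_2\mid c_3\big]$, and $HP_r$ of $\big[I_r\mid (\bar0;\bar0;D_{r-2})\mid(\bar\alpha;\bar0;I_{r-2})\mid(\bar0;\bar1;I_{r-2})\mid(\bar\alpha;\bar\alpha;I_{r-2})\mid(\bar{\alpha^2};\bar1;I_{r-2})\mid c_1\mid c_2\mid c_3\big]$. Represented matroids: for a field $\mathbb{F}$, an $\mathbb{F}$-represented matroid is a pair $(E,U)$, $U$ a subspace of $\mathbb{F}^E$, represented by any matrix $A$ with row space $U$ ($M(A)$); dual $(E,U^\perp)$; $M|X=(X,U|X)$, $M\backslash X=M|(E-X)$, $M/X=(M^*\backslash X)^*$; simplicity, connectivity, minors come from the abstract column matroid. $\mathbb{F}_p$ is the prime subfield. A matroid is vertically $k$-connected if for every $X\subseteq E$ with $r(X)+r(E-X)-r(M)<k$, $X$ or $E-X$ is spanning; cyclically $k$-connected if its dual is vertically $k$-connected. Frame templates: for $\Gamma\le\mathbb{F}^\times$, a $\Gamma$-frame matrix has at most two nonzero entries per column, each nonzero column contains a $1$, and a second nonzero entry (if any) equals $-\gamma$, $\gamma\in\Gamma$. A frame template over $\mathbb{F}$ is $\Phi=(\Gamma,C,X,Y_0,Y_1,A_1,\Delta,\Lambda)$ with $\Gamma\le\mathbb{F}^\times$; $C,X,Y_0,Y_1$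 pairwise disjoint finite sets; $A_1\in\mathbb{F}^{X\times(C\cup Y_0\cup Y_1)}$; $\Lambda\le\mathbb{F}^X$, $\Delta\le\mathbb{F}^{C\cup Y_0\cup Y_1}$ additive subgroups closed under scaling by $\Gamma$. $A'\in\mathbb{F}^{B\times E}$ respects $\Phi$ if $X\subseteq B$, $C,Y_0,Y_1\subseteq E$, $A'[X,C\cup Y_0\cup Y_1]=A_1$, and there is $Z\subseteq E-(C\cup Y_0\cup Y_1)$ with $A'[X,Z]=0$, columns of $A'[B-X,Z]$ unit vectors, $A'[B-X,E-(C\cup Y_0\cup Y_1\cup Z)]$ a $\Gamma$-frame matrix, columns of $A'[X,E-(C\cup Y_0\cup Y_1\cup Z)]$ in $\Lambda$, rows of $A'[B-X,C\cup Y_0\cup Y_1]$ in $\Delta$. $A$ conforms to $\Phi$ if for some such $A',Z$: $A[B,E-Z]=A'[B,E-Z]$ and each column $i\in Z$ of $A$ is the sum of columns $i$ and some $j\in Y_1$ of $A'$. An $\mathbb{F}$-represented matroid conforms to $\Phi$ if isomorphic to $M(A)/C\backslash Y_1$ for some conforming $A$; $\mathcal{M}(\Phi)$ is the set of these. Hypothesis B: for every finite field $\mathbb{F}$, positive integer $m$, and minor-closed class $\mathcal{M}$ of $\mathbb{F}$-represented matroids, there exist $k,n\in\mathbb{Z}_+$ and frame templates $\Phi_1,\dots,\Phi_s,\Psi_1,\dots,\Psi_t$ over $\mathbb{F}$ with (1) $\mathcal{M}\supseteq\mathcal{M}(\Phi_i)$; (2) $\mathcal{M}$ contains duals of members of each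 $\mathcal{M}(\Psi_j)$; (3) every simple vertically $k$-connected $M\in\mathcal{M}$ with an $M(K_n)$-minor but no $\mathrm{PG}(m-1,\mathbb{F}_p)$-minor lies in some $\mathcal{M}(\Phi_i)$; (4) for every cosimple cyclically $k$-connected $M\in\mathcal{M}$ with an $M^*(K_n)$-minor but no $\mathrm{PG}(m-1,\mathbb{F}_p)$-minor, $M^*$ lies in some $\mathcal{M}(\Psi_j)$. *)

(* Defs.v *)
From HB Require Import structures.
From mathcomp Require Import all_boot all_order all_algebra all_fingroup zify.
From mathcomp Require Import reals.

Set Implicit Arguments.
Unset Strict Implicit.
Unset Printing Implicit Defensive.

Import Order.TTheory GRing.Theory Num.Theory.
Local Open Scope ring_scope.

Record matroid (E : finType) := Matroid {
  rk : {set E} -> nat;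
  rk_card : forall X, (rk X <= #|X|)%N;
  rk_mono : forall X Y : {set E}, X \subset Y -> (rk X <= rk Y)%N;
  rk_submod : forall X Y : {set E},
    (rk (X :|: Y) + rk (X :&: Y) <= rk X + rk Y)%N }.

Definition mrank (E : finType) (M : matroid E) : nat := rk M [set: E].

Definition miso (E E' : finType) (M : matroid E) (N : matroid E') : Prop :=
  exists2 f : E -> E', bijective f & forall X : {set E}, rk N (f @: X) = rk M X.

Definition msimple (E : finType) (M : matroid E) : Prop :=
  forall X : {set E}, (#|X| <= 2)%N -> rk M X = #|X|.

Definition spanning (E : finType) (M : matroid E) (X : {set E}) : Prop :=
  rk M X = mrank M.

Definition mflat (E : finType) (M : matroid E) (X : {set E}) : bool :=
  [forall e, (e \notin X) ==> (rk M X < rk M (e |: X))%N].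

Definition rank_one_flats (E : finType) (M : matroid E) : {set {set E}} :=
  [set X | mflat M X & rk M X == 1%N].

Section MatroidConstructions.
Variables (E : finType) (M : matroid E).

Definition restr_rk (X : {set E}) (Y : {set {x : E | x \in X}}) : nat :=
  rk M (val @: Y).

Fact restr_rk_card (X : {set E}) (Y : {set {x : E | x \in X}}) : (restr_rk Y <= #|Y|)%N.
Proof. by rewrite -(card_imset (mem Y) val_inj) rk_card. Qed.

Fact restr_rk_mono (X : {set E}) (Y Z : {set {x : E | x \in X}}) :
  Y \subset Z -> (restr_rk Y <= restr_rk Z)%N.
Proof. by move=> sYZ; rewrite rk_mono // imsetS. Qed.

Fact restr_rk_submod (X : {set E}) (Y Z : {set {x : E | x \in X}}) :
  (restr_rk (Y :|: Z) + restr_rk (Y :&: Z) <= restr_rk Y + restr_rk Z)%N.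
Proof.
rewrite /restr_rk imsetU imsetI; last by move=> ? ? _ _; apply: val_inj.
exact: rk_submod.
Qed.

Definition mrestrict (X : {set E}) : matroid {x : E | x \in X} :=
  Matroid (@restr_rk_card X) (@restr_rk_mono X) (@restr_rk_submod X).

Definition dual_rk (X : {set E}) : nat := (#|X| + rk M (~: X) - mrank M)%N.

Fact mrank_le (X : {set E}) : (mrank M <= #|X| + rk M (~: X))%N.
Proof.
rewrite /mrank -(setUCr X); have := rk_submod M X (~: X); have := rk_card M X.
lia.
Qed.

Fact dual_rk_card X : (dual_rk X <= #|X|)%N.
Proof. by have := rk_mono M (subsetT (~: X)); rewrite /dual_rk /mrank; lia. Qed.

Fact dual_rk_mono (X Y : {set E}) : X \subset Y -> (dual_rk X <= dual_rk Y)%N.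
Proof.
move=> sXY; rewrite /dual_rk.
have eX : ~: X = ~: Y :|: (Y :\: X).
  apply/setP=> e; rewrite !inE; case: (boolP (e \in X)) => [/(subsetP sXY) ->|] //.
  by case: (e \in Y).
have := rk_submod M (~: Y) (Y :\: X); rewrite -eX.
have := rk_card M (Y :\: X); rewrite cardsDS //.
have := subset_leq_card sXY; have := mrank_le X; have := mrank_le Y; lia.
Qed.

Fact dual_rk_submod (X Y : {set E}) :
  (dual_rk (X :|: Y) + dual_rk (X :&: Y) <= dual_rk X + dual_rk Y)%N.
Proof.
have := rk_submod M (~: X) (~: Y); rewrite -setCU -setCI /dual_rk.
have := cardsUI X Y; have := mrank_le (X :|: Y); have := mrank_le (X :&: Y).
have := mrank_le X; have := mrank_le Y; lia.
Qed.

Definition mdual : matroid E := Matroid dual_rk_card dual_rk_mono dual_rk_submod.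

End MatroidConstructions.

Definition mdelete (E : finType) (M : matroid E) (X : {set E}) :
  matroid {x : E | x \in ~: X} := mrestrict M (~: X).

Definition mcontract (E : finType) (M : matroid E) (X : {set E}) :
  matroid {x : E | x \in ~: X} := mdual (mdelete (mdual M) X).

Definition has_minor (E E' : finType) (M : matroid E) (N : matroid E') : Prop :=
  exists (C : {set E}) (D : {set {x : E | x \in ~: C}}),
    miso N (mdelete (mcontract M C) D).

Definition vertically_connected (E : finType) (k : nat) (M : matroid E) : Prop :=
  forall X : {set E}, (rk M X + rk M (~: X) - mrank M < k)%N ->
    spanning M X \/ spanning M (~: X).

Section VectorMatroid.
Variables (F : fieldType) (vT : vectType F) (E : finType) (v : E -> vT).

Definition vspan (X : {set E}) : {vspace vT} := (\sum_(e in X) <[v e]>)%VS.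

Lemma vspanS (X Y : {set E}) : X \subset Y -> (vspan X <= vspan Y)%VS.
Proof.
move=> sXY; rewrite {1}/vspan; apply/subv_sumP=> e eX.
exact: (sumv_sup e (subsetP sXY e eX) (subvv _)).
Qed.

Lemma vspanU (X Y : {set E}) : vspan (X :|: Y) = (vspan X + vspan Y)%VS.
Proof.
apply: subv_anti; apply/andP; split; last first.
  by rewrite subv_add !vspanS ?subsetUl ?subsetUr.
rewrite {1}/vspan; apply/subv_sumP=> e; rewrite inE => /orP[eX|eY].
  exact: subv_trans (sumv_sup e eX (subvv _)) (addvSl _ _).
exact: subv_trans (sumv_sup e eY (subvv _)) (addvSr _ _).
Qed.

Lemma dimv_addl_leq (U V : {vspace vT}) : (\dim (U + V) <= \dim U + \dim V)%N.
Proof. by rewrite -dimv_sum_cap leq_addr. Qed.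

Fact vspan_card (X : {set E}) : (\dim (vspan X) <= #|X|)%N.
Proof.
rewrite /vspan -sum1_card; elim/big_rec2: _ => [|e n V _ leVn]; first by rewrite dimv0.
apply: leq_trans (dimv_addl_leq _ _) _.
by rewrite leq_add // dim_vline leq_b1.
Qed.

Fact vspan_mono (X Y : {set E}) :
  X \subset Y -> (\dim (vspan X) <= \dim (vspan Y))%N.
Proof. by move=> sXY; apply/dimvS/vspanS. Qed.

Fact vspan_submod (X Y : {set E}) :
  (\dim (vspan (X :|: Y)) + \dim (vspan (X :&: Y))
     <= \dim (vspan X) + \dim (vspan Y))%N.
Proof.
rewrite -(dimv_sum_cap (vspan X)) vspanU leq_add2l dimvS // subv_cap.
by rewrite !vspanS ?subsetIl ?subsetIr.
Qed.

Definition vmatroid : matroid E := Matroid vspan_card vspan_mono vspan_submod.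

End VectorMatroid.

Definition column_matroid (F : fieldType) (m n : nat) (A : 'M[F]_(m, n)) :
  matroid 'I_n := vmatroid (fun j => col j A).

Definition representable (F : fieldType) (E : finType) (M : matroid E) : Prop :=
  exists (m n : nat) (A : 'M[F]_(m, n)), miso M (column_matroid A).

Definition Kedge (n : nat) : finType := {p : 'I_n * 'I_n | (p.1 < p.2)%N}.

Section CycleMatroid.
Variable n : nat.

Definition Kadj (T : {set Kedge n}) : rel 'I_n :=
  fun x y => [exists e in T, (val e == (x, y)) || (val e == (y, x))].

(* No edge of T lies on a cycle of T. *)
Definition forest (T : {set Kedge n}) : bool :=
  [forall e in T, ~~ connect (Kadj (T :\ e)) (val e).1 (val e).2].

Definition forest_rk (S : {set Kedge n}) : nat :=
  \max_(T : {set Kedge n} | (T \subset S) && forest T) #|T|.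

Let inc (e : Kedge n) : 'rV[rat]_n :=
  delta_mx 0 (val e).1 - delta_mx 0 (val e).2.

Lemma Kadj_sub (S T : {set Kedge n}) : S \subset T -> subrel (Kadj S) (Kadj T).
Proof.
move=> sST x y /existsP[e /andP[eS he]]; apply/existsP; exists e.
by rewrite (subsetP sST).
Qed.

Lemma Kadj_sym (S : {set Kedge n}) : symmetric (Kadj S).
Proof. by move=> x y; apply: eq_existsb => e; rewrite orbC. Qed.

Lemma forest_sub (S T : {set Kedge n}) : S \subset T -> forest T -> forest S.
Proof.
move=> sST /forall_inP fT; apply/forall_inP=> e eS.
have := fT _ (subsetP sST _ eS); apply: contra; apply: connect_sub => x y xy.
by apply/connect1/(Kadj_sub _ xy)/setSD.
Qed.

Lemma inc_connect (S : {set Kedge n}) x y : connect (Kadj S) x y ->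
  (delta_mx 0 x - delta_mx 0 y : 'rV[rat]_n) \in vspan inc S.
Proof.
case/connectP=> p + ->; elim: p x => [|z p IHp] x /=; first by rewrite subrr mem0v.
case/andP=> /existsP[e /andP[eS he]] /IHp.
have ->: delta_mx 0 x - delta_mx 0 (last z p) =
  (delta_mx 0 x - delta_mx 0 z) + (delta_mx 0 z - delta_mx 0 (last z p)) :> 'rV[rat]_n.
  by rewrite addrA subrK.
apply: rpredD.
have incS : inc e \in vspan inc S.
  by rewrite memvE (sumv_sup e).
case/orP: he => /eqP he; move: incS; rewrite /inc he //=.
by rewrite -opprB rpredN.
Qed.

Lemma inc_notin (T : {set Kedge n}) e : e \in T -> forest T ->
  inc e \notin vspan inc (T :\ e).
Proof.
move=> eT /forall_inP/(_ _ eT) nc.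
set K := connect (Kadj (T :\ e)) (val e).1 in nc.
pose f (w : 'rV[rat]_n) : rat^o := \sum_(i | K i) w 0 i.
have fl : linear f.
  move=> a u w; rewrite /f scaler_sumr -big_split /=; apply: eq_bigr => i _.
  by rewrite !mxE.
pose fM := GRing.isLinear.Build _ _ _ _ f fl.
pose fL : {linear 'rV[rat]_n -> rat^o} := HB.pack f fM.
have finc e' : f (inc e') = (K (val e').1)%:R - (K (val e').2)%:R.
  have fd j : f (delta_mx 0 j) = (K j)%:R.
    rewrite /f big_mkcond (bigD1 j) //= big1 ?addr0 => [|i ne].
      by rewrite mxE !eqxx; case: (K j).
    by rewrite mxE (negPf ne) andbF; case: ifP.
  by rewrite -!fd -[f]/(fL : _ -> _) linearB.
apply/negP=> he.
have : (vspan inc (T :\ e) <= lker (linfun fL))%VS.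
  rewrite {1}/vspan; apply/subv_sumP=> e' e'T; rewrite -memvE memv_ker lfunE /= finc.
  suff ->: K (val e').1 = K (val e').2 by rewrite subrr.
  have a12 : Kadj (T :\ e) (val e').1 (val e').2.
    by apply/existsP; exists e'; rewrite e'T -surjective_pairing eqxx.
  apply/idP/idP => h; apply: connect_trans h (connect1 _) => //.
  by rewrite Kadj_sym.
move/subvP/(_ _ he); rewrite memv_ker lfunE /= finc (negPf nc) /K connect0.
by rewrite subr0 oner_eq0.
Qed.

Lemma forest_vspan (T : {set Kedge n}) :
  forest T = (rk (vmatroid inc) T == #|T|).
Proof.
apply/idP/eqP => [|rT]; last first.
  apply/forall_inP=> e eT; apply/negP=> /inc_connect he.
  have : (vspan inc T <= vspan inc (T :\ e))%VS.
    rewrite -{1}(setD1K eT) vspanU subv_add subvv andbT /vspan big_set1.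
    by rewrite -memvE.
  move/dimvS; rewrite -[\dim (vspan inc T)]/(rk (vmatroid inc) T) rT.
  move=> /leq_trans/(_ (rk_card (vmatroid inc) (T :\ e))).
  by rewrite (cardsD1 e T) eT ltnn.
move: {2}#|T| (erefl #|T|) => k; elim: k T => [|k IHk] T cT fT.
  by apply/eqP; rewrite eqn_leq rk_card cT.
have [e eT] : exists e, e \in T by apply/set0Pn; rewrite -card_gt0 cT.
have cTe : #|T :\ e| = k by move: cT; rewrite (cardsD1 e) eT => -[].
have := IHk _ cTe (forest_sub (subsetDl _ _) fT); rewrite cTe cT /= => rTe.
rewrite -(setD1K eT).
rewrite vspanU {1}/vspan big_set1 dimv_disjoint_sum; last first.
  apply/eqP; rewrite -subv0; apply/subvP=> w; rewrite memv_cap memv0.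
  case/andP=> /vlineP[a ->]; case: (eqVneq a 0) => [->|a0]; first by rewrite scale0r.
  by rewrite rpredZeq (negPf a0) (negPf (inc_notin eT fT)).
rewrite rTe dim_vline; case: eqP => // e0.
by move: (inc_notin eT fT); rewrite e0 mem0v.
Qed.

Lemma forest_rkE (S : {set Kedge n}) : forest_rk S = rk (vmatroid inc) S.
Proof.
apply/eqP; rewrite eqn_leq; apply/andP; split.
  apply/bigmax_leqP=> T /andP[sTS]; rewrite forest_vspan => /eqP <-.
  exact: rk_mono.
have [T /andP[sTS fT] maxT] : {T : {set Kedge n} | (T \subset S) && forest T &
    forall T' : {set Kedge n}, (T' \subset S) && forest T' -> (#|T'| <= #|T|)%N}.
  case: (@arg_maxnP _ set0 (fun T : {set Kedge n} => (T \subset S) && forest T)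
           (fun T => #|T|)).
    by rewrite sub0set /=; apply/forall_inP=> e; rewrite inE.
  by move=> T h1 h2; exists T.
have leT : (#|T| <= forest_rk S)%N.
  by rewrite /forest_rk (bigD1 T) /= ?sTS // leq_max leqnn.
apply: leq_trans leT; have := fT; rewrite forest_vspan => /eqP <-; apply: dimvS.
rewrite {1}/vspan; apply/subv_sumP=> e eS; rewrite -memvE; apply/negPn/negP=> ne.
have eT : e \notin T.
  apply: contra ne => eT; by rewrite memvE (sumv_sup e).
have : (#|e |: T| <= #|T|)%N; last by rewrite cardsU1 eT ltnn.
apply: maxT; rewrite subUset sub1set eS sTS /= forest_vspan cardsU1 eT /=.
rewrite vspanU {1}/vspan big_set1 dimv_disjoint_sum.
  move: fT; rewrite forest_vspan => /eqP /= ->; rewrite dim_vline.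
  suff ->: inc e != 0 by [].
  by apply: contraNneq ne => ->; rewrite mem0v.
apply/eqP; rewrite -subv0; apply/subvP=> w; rewrite memv_cap memv0.
case/andP=> /vlineP[a ->]; case: (eqVneq a 0) => [->|a0]; first by rewrite scale0r.
by rewrite rpredZeq (negPf a0) (negPf ne).
Qed.

Fact forest_rk_card S : (forest_rk S <= #|S|)%N.
Proof. by rewrite forest_rkE rk_card. Qed.

Fact forest_rk_mono (S T : {set Kedge n}) :
  S \subset T -> (forest_rk S <= forest_rk T)%N.
Proof. by rewrite !forest_rkE; apply: rk_mono. Qed.

Fact forest_rk_submod (S T : {set Kedge n}) :
  (forest_rk (S :|: T) + forest_rk (S :&: T) <= forest_rk S + forest_rk T)%N.
Proof. by rewrite !forest_rkE; apply: rk_submod. Qed.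

Definition MK : matroid (Kedge n) :=
  Matroid forest_rk_card forest_rk_mono forest_rk_submod.

End CycleMatroid.

(* A point of PG(m - 1, K) is given by its unique spanning vector whose first
   nonzero coordinate is 1. *)
Definition PGpoint (K : finFieldType) (m : nat) : finType :=
  {v : 'rV[K]_m |
    [exists i, (v 0 i == 1) && [forall j : 'I_m, (j < i)%N ==> (v 0 j == 0)]]}.

Definition PG (K : finFieldType) (m : nat) : matroid (PGpoint K m) :=
  vmatroid (fun v : PGpoint K m => val v).

Definition repmatroid (F : fieldType) (E : finType) : Type :=
  {vspace {ffun E -> F^o}}.

Section Represented.
Variables (F : fieldType) (E : finType).
Implicit Types (U : repmatroid F E) (X : {set E}).

Definition ffrestr X (u : {ffun E -> F^o}) : {ffun {x : E | x \in X} -> F^o} :=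
  [ffun x => u (val x)].

Fact ffrestr_linear X : linear (@ffrestr X).
Proof. by move=> a u v; apply/ffunP=> x; rewrite !ffunE. Qed.
HB.instance Definition _ X :=
  GRing.isLinear.Build F _ _ _ (@ffrestr X) (@ffrestr_linear X).

Definition rrestrict U X : repmatroid F {x : E | x \in X} :=
  (linfun (@ffrestr X) @: U)%VS.

Definition rdelete U X : repmatroid F {x : E | x \in ~: X} := rrestrict U (~: X).

Definition ffdot (u v : {ffun E -> F^o}) : F := \sum_e u e * v e.

Definition basis_dots U (v : {ffun E -> F^o}) : {ffun 'I_(\dim U) -> F^o} :=
  [ffun i : 'I_(\dim U) => ffdot (vbasis U)`_i v].

Fact basis_dots_linear U : linear (basis_dots U).
Proof.
move=> a v w; apply/ffunP=> i; rewrite !ffunE /ffdot scaler_sumr -big_split /=.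
by apply: eq_bigr => e _; rewrite !ffunE mulrDr; congr (_ + _); rewrite mulrCA.
Qed.
HB.instance Definition _ U :=
  GRing.isLinear.Build F _ _ _ (basis_dots U) (@basis_dots_linear U).

(* The orthogonal complement of U, see rdualP. *)
Definition rdual U : repmatroid F E := lker (linfun (basis_dots U)).

Lemma rdualP U v :
  reflect (forall u, u \in U -> ffdot u v = 0) (v \in rdual U).
Proof.
rewrite memv_ker lfunE; apply: (iffP eqP) => [h u uU|h].
  rewrite (coord_vbasis uU) /ffdot.
  under eq_bigr do rewrite sum_ffunE mulr_suml.
  rewrite exchange_big big1 //= => i _.
  under eq_bigr do rewrite ffunE -mulrA.
  rewrite -mulr_sumr; move/ffunP/(_ i): h; rewrite !ffunE /ffdot => ->.
  by rewrite mulr0.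
apply/ffunP=> i; rewrite !ffunE; apply: h; apply: vbasis_mem.
by rewrite mem_nth // size_tuple.
Qed.

(* The column matroid of the matrix whose rows form a basis of U. *)
Definition abstract U : matroid E :=
  vmatroid (fun e => [ffun i : 'I_(\dim U) => (vbasis U)`_i e] :
                       {ffun 'I_(\dim U) -> F^o}).

Definition row_space (B : finType) (A : B -> E -> F) : repmatroid F E :=
  (\sum_(b : B) <[ [ffun e => A b e] : {ffun E -> F^o} ]>)%VS.

End Represented.

Definition rcontract (F : fieldType) (E : finType) (U : repmatroid F E)
    (X : {set E}) : repmatroid F {x : E | x \in ~: X} :=
  rdual (rdelete (rdual U) X).

(* Represented matroids are considered up to relabelling and up to scaling the
   coordinates (the columns of a representing matrix) by nonzero scalars. *)
Definition riso (F : fieldType) (E E' : finType)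
    (U : repmatroid F E) (U' : repmatroid F E') : Prop :=
  exists (f : E -> E') (d : E -> F),
    [/\ bijective f, (forall e, d e != 0) &
        forall u : {ffun E' -> F^o},
          (u \in U') = ([ffun e => d e * u (f e)] \in U)].

Definition repclass (F : fieldType) := forall E : finType, repmatroid F E -> Prop.

Definition minor_closed (F : fieldType) (C : repclass F) : Prop :=
  [/\ forall (E E' : finType) (U : repmatroid F E) (U' : repmatroid F E'),
        riso U U' -> C E U -> C E' U',
      forall (E : finType) (U : repmatroid F E) (X : {set E}),
        C E U -> C _ (rdelete U X) &
      forall (E : finType) (U : repmatroid F E) (X : {set E}),
        C E U -> C _ (rcontract U X)].

(* The pairwise disjoint sets C, Y_0, Y_1 are the summands of a sum type. *)
Record frame_template (F : finFieldType) := FrameTemplate {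
  tG : {group {unit F}};
  tC : finType;
  tX : finType;
  tY0 : finType;
  tY1 : finType;
  tA1 : tX -> tC + tY0 + tY1 -> F;
  tDelta : {set {ffun tC + tY0 + tY1 -> F^o}};
  tLambda : {set {ffun tX -> F^o}};
  tDelta_zmod : zmod_closed tDelta;
  tDelta_scale : forall g w, g \in tG -> w \in tDelta -> val g *: w \in tDelta;
  tLambda_zmod : zmod_closed tLambda;
  tLambda_scale : forall g w, g \in tG -> w \in tLambda -> val g *: w \in tLambda }.

(* Column c, restricted to the set S of rows, is a column of a G-frame matrix. *)
Definition frame_column (F : finFieldType) (G : {group {unit F}}) (B : finType)
    (S : {set B}) (c : B -> F) : Prop :=
  let N := [set b in S | c b != 0] in
  (#|N| <= 2)%N /\
  (N != set0 -> exists b, [/\ b \in N, c b = 1 &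
     forall b', b' \in N -> b' != b -> exists2 g, g \in G & c b' = - val g]).

Section Templates.
Variables (F : finFieldType) (Phi : frame_template F) (B E : finType).
Variables (iX : tX Phi -> B) (iE : tC Phi + tY0 Phi + tY1 Phi -> E).

Definition rowsX : {set B} := [set iX x | x : tX Phi].
Definition colsC : {set E} := [set iE (inl (inl c)) | c : tC Phi].
Definition colsY1 : {set E} := [set iE (inr y) | y : tY1 Phi].
Definition colsCY : {set E} := [set iE y | y : tC Phi + tY0 Phi + tY1 Phi].

(* The injections iX and iE realize the inclusions of X in B and of C, Y_0, Y_1
   in E. *)
Record respects (A' : B -> E -> F) (Z : {set E}) : Prop := Respects {
  resp_iX : injective iX;
  resp_iE : injective iE;
  resp_A1 : forall x y, A' (iX x) (iE y) = tA1 x y;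
  resp_Z : Z \subset ~: colsCY;
  resp_XZ : forall x z, z \in Z -> A' (iX x) z = 0;
  resp_unit : forall z, z \in Z ->
    exists2 b, b \notin rowsX & forall b', b' \notin rowsX -> A' b' z = (b' == b)%:R;
  resp_frame : forall e, e \notin colsCY :|: Z ->
    frame_column (tG Phi) (~: rowsX) (fun b => A' b e);
  resp_Lambda : forall e, e \notin colsCY :|: Z ->
    [ffun x => A' (iX x) e : F^o] \in tLambda Phi;
  resp_Delta : forall b, b \notin rowsX ->
    [ffun y => A' b (iE y) : F^o] \in tDelta Phi }.

Definition mx_conforms (A : B -> E -> F) : Prop :=
  exists (A' : B -> E -> F) (Z : {set E}),
    [/\ respects A' Z,
        forall b e, e \notin Z -> A b e = A' b e &
        forall z, z \in Z -> exists j : tY1 Phi,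
          forall b, A b z = A' b z + A' b (iE (inr j))].

End Templates.

Definition template_class (F : finFieldType) (Phi : frame_template F) : repclass F :=
  fun E U =>
  exists (B E' : finType) (iX : tX Phi -> B) (iE : tC Phi + tY0 Phi + tY1 Phi -> E')
         (A : B -> E' -> F),
    mx_conforms iX iE A /\
    riso U (rdelete (rcontract (row_space A) (colsC iE)) (val @^-1: colsY1 iE)).

Definition HypothesisB : Prop :=
  forall (F : finFieldType) (p : nat), p \in [pchar F] ->
  forall m : nat, (0 < m)%N ->
  forall C : repclass F, minor_closed C ->
  exists (k n s t : nat)
         (Phi : 'I_s -> frame_template F) (Psi : 'I_t -> frame_template F),
    [/\ (0 < k)%N /\ (0 < n)%N,
        forall i (E : finType) (U : repmatroid F E), template_class (Phi i) U -> C E U,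
        forall j (E : finType) (U : repmatroid F E),
          template_class (Psi j) U -> C E (rdual U),
        forall (E : finType) (U : repmatroid F E), C E U ->
          msimple (abstract U) -> vertically_connected k (abstract U) ->
          has_minor (abstract U) (MK n) -> ~ has_minor (abstract U) (PG 'F_p m) ->
          exists i, template_class (Phi i) U &
        forall (E : finType) (U : repmatroid F E), C E U ->
          msimple (abstract (rdual U)) ->
          vertically_connected k (abstract (rdual U)) ->
          has_minor (abstract U) (mdual (MK n)) ->
          ~ has_minor (abstract U) (PG 'F_p m) ->
          exists j, template_class (Psi j) (rdual U)].

Definition matroid_class := forall E : finType, matroid E -> Prop.

Definition golden_ratio (R : realType) : R := (1 + Num.sqrt 5) / 2.

Definition GM (R : realType) : matroid_class := fun E M =>
  exists (m n : nat) (A : 'M[R]_(m, n)),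
    (forall (k : nat) (f : 'I_k -> 'I_m) (g : 'I_k -> 'I_n),
       injective f -> injective g -> \det (mxsub f g A) != 0 ->
       exists i : int, \det (mxsub f g A) = golden_ratio R ^ i \/
                       \det (mxsub f g A) = - golden_ratio R ^ i) /\
    miso M (column_matroid A).

Definition AC4 (F4 : finFieldType) : matroid_class := fun E M =>
  [/\ representable F4 M,
      exists2 K : fieldType, [pchar K] =i pred0 & representable K M &
      forall p : nat, prime p ->
        exists2 K : fieldType, p \in [pchar K] & representable K M].

Definition extremal_value (C : matroid_class) (r h : nat) : Prop :=
  (exists (E : finType) (M : matroid E),
     [/\ C E M, msimple M, (mrank M <= r)%N & #|E| = h]) /\
  (forall (E : finType) (M : matroid E),
     C E M -> msimple M -> (mrank M <= r)%N -> (#|E| <= h)%N).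

Definition extremal (C : matroid_class) (r : nat) (E : finType) (M : matroid E) : Prop :=
  [/\ C E M, msimple M, mrank M = r & extremal_value C r #|rank_one_flats M|].

Section Families.
Variables (F : fieldType) (a : F).

Definition Dmx (n : nat) : 'M[F]_(n, #|Kedge n|) :=
  \matrix_(i, j) let p := val (enum_val j) in
    if i == p.1 then 1 else if i == p.2 then -1 else 0.

Definition blk1 (n : nat) (c : F) : 'M[F]_(1 + n, n) := col_mx (const_mx c) 1%:M.

Definition T2mx (n : nat) :=
  row_mx (1%:M : 'M[F]_(1 + n))
 (row_mx (col_mx 0 (Dmx n) : 'M_(1 + n, _))
 (row_mx (blk1 n 1)
 (row_mx (blk1 n a)
         (blk1 n (a ^+ 2))))).

Definition blk2 (n : nat) (c d : F) : 'M[F]_(1 + (1 + n), n) :=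
  col_mx (const_mx c) (col_mx (const_mx d) 1%:M).

Definition ccol (n : nat) (c d : F) : 'cV[F]_(1 + (1 + n)) :=
  col_mx c%:M (col_mx d%:M 0).

Definition Gmx (n : nat) :=
  row_mx (1%:M : 'M[F]_(1 + (1 + n)))
 (row_mx (col_mx 0 (col_mx 0 (Dmx n)) : 'M_(1 + (1 + n), _))
 (row_mx (blk2 n 1 0)
 (row_mx (blk2 n 0 1)
 (row_mx (blk2 n a 0)
 (row_mx (blk2 n 0 a)
 (row_mx (ccol n 1 1)
 (row_mx (ccol n 1 a)
         (ccol n 1 (a ^+ 2))))))))).

Definition HPmx (n : nat) :=
  row_mx (1%:M : 'M[F]_(1 + (1 + n)))
 (row_mx (col_mx 0 (col_mx 0 (Dmx n)) : 'M_(1 + (1 + n), _))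
 (row_mx (blk2 n a 0)
 (row_mx (blk2 n 0 1)
 (row_mx (blk2 n a a)
 (row_mx (blk2 n (a ^+ 2) 1)
 (row_mx (ccol n 1 1)
 (row_mx (ccol n 1 a)
         (ccol n 1 (a ^+ 2))))))))).

(* The intended ranks are r >= 1 for T2 and r >= 2 for Gr and HP. *)
Definition T2 (r : nat) := column_matroid (T2mx r.-1).
Definition Gr (r : nat) := column_matroid (Gmx r.-2).
Definition HP (r : nat) := column_matroid (HPmx r.-2).

End Families.

(* Main.v *)
From HB Require Import structures.
From mathcomp Require Import all_boot all_order all_algebra all_fingroup all_field finfield zify
  ring.
From mathcomp Require Import reals.
From Stdlib Require Import Classical.
Require Import Defs.

(** A quaternary matroid that is also representable in characteristic 3 has no Fano minor, and both
classes consist of such matroids, so Hypothesis B applies. Simple matroids of quadratic size have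
large clique minors, so a highly connected one comes from a template, and characteristic 3 makes the
group of the template trivial: its matroids are graphs whose edges run over a bounded set [p] of
vectors attached to each vertex. Relations among the [p] transfer to characteristic 3 with unchanged
support, which leaves finitely many affine patterns: a line of GF(4), or the two five-point sets of
[G] and [HP]. Low-order separations lose linearly many points by convexity. Conversely the three
families lift to [Z[tau]]: pivoting preserves the shape of their columns, so the subdeterminants
reduce to 1x1 and 2x2 ones, and reduction to any root of [t^2 = t + 1] keeps powers of [tau]
nonzero. *)

Set Implicit Arguments.
Unset Strict Implicit.
Unset Printing Implicit Defensive.

Import Order.TTheory GRing.Theory Num.Theory.
Local Open Scope ring_scope.
Local Notation vec F R := {ffun R -> F^o}.
Local Notation framed F V R := (V * vec F R)%type.
Local Notation "f <$> u" := (fun x=> f (u x)) (at level 50, only parsing).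
Local Notation vdim u X := (\dim (vspan u X)).
Implicit Types (F K L : fieldType) (E R T : finType).

Section VectorFamilies.
Variable F : fieldType.
Implicit Types vT uT wT : vectType F.

Lemma mem_vspan vT E (v : E -> vT) (X : {set E}) e : e \in X -> v e \in vspan v X.
Proof. by move=> eX; rewrite memvE /vspan (sumv_sup e). Qed.

Lemma vspan_sub vT E (v : E -> vT) (X : {set E}) (U : {vspace vT}) :
  (forall e, e \in X -> v e \in U) -> (vspan v X <= U)%VS.
Proof. by move=> vU; apply/subv_sumP=> e /vU; rewrite memvE. Qed.

Lemma eq_vspan vT E (v u : E -> vT) (X : {set E}) : v =1 u -> vspan v X = vspan u X.
Proof. by move=> vu; apply: eq_bigr=> e _; rewrite vu. Qed.

Lemma vspan_imset vT E E' (v : E -> vT) (g : E' -> E) (X : {set E'}) :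
  vspan (v <$> g) X = vspan v (g @: X).
Proof.
apply: subv_anti; apply/andP; split; apply: vspan_sub=> e.
  by move=> eX; apply/mem_vspan/imset_f.
by case/imsetP=> e' e'X ->; apply: (mem_vspan (v <$> g)).
Qed.

Lemma vspan_lfun vT uT E (v : E -> vT) (f : 'Hom(vT, uT)) (X : {set E}) :
  vspan (f <$> v) X = (f @: vspan v X)%VS.
Proof. by rewrite /vspan limg_sum; apply: eq_bigr=> e _; rewrite limg_line. Qed.

Lemma vspan_scale vT E (v u : E -> vT) (c : E -> F) (X : {set E}) :
  (forall e, c e != 0) -> (forall e, u e = c e *: v e) -> vspan u X = vspan v X.
Proof.
move=> c0 uE; rewrite /vspan; apply: eq_bigr=> e _; rewrite uE.
apply: subv_anti; rewrite -!memvE rpredZ ?memv_line //=.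
by rewrite -{1}[v e](scalerK (c0 e)) rpredZ ?memv_line.
Qed.

Lemma vspan_seq vT E (v : E -> vT) (s : seq E) : vspan v [set e in s] = <<map v s>>%VS.
Proof.
apply: subv_anti; apply/andP; split.
  by apply: vspan_sub=> e; rewrite inE=> es; apply/memv_span/map_f.
by apply/span_subvP=> x /mapP[e es ->]; apply: mem_vspan; rewrite inE.
Qed.

Lemma mem_vspanP vT E (v : E -> vT) (X : {set E}) x :
  reflect (exists c : E -> F, x = \sum_(e in X) c e *: v e) (x \in vspan v X).
Proof.
apply: (iffP idP)=> [/memv_sumP[y yv ->]|[c ->]]; last first.
  by apply: rpred_sum=> e eX; apply/rpredZ/mem_vspan.
have /fin_all_exists[c cE] e: exists k, e \in X -> y e = k *: v e.
  by case: (boolP (e \in X))=> [/yv /vlineP[k ->]|_]; [exists k|exists 0].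
by exists c; apply: eq_bigr.
Qed.

Definition lincomb vT E (v : E -> vT) (X : {set E}) (c : vec F E) : vT := \sum_(e in X) c e *: v e.

Fact lincomb_linear vT E (v : E -> vT) (X : {set E}) : linear (lincomb v X).
Proof.
move=> a c d; rewrite /lincomb scaler_sumr -big_split /=; apply: eq_bigr=> e _.
by rewrite !ffunE scalerDl scalerA.
Qed.
HB.instance Definition _ vT E v X :=
  GRing.isLinear.Build F _ _ _ (@lincomb vT E v X) (lincomb_linear v X).

Lemma limg_lincomb vT E (v : E -> vT) (X : {set E}) : limg (linfun (lincomb v X)) = vspan v X.
Proof.
apply: subv_anti; apply/andP; split; apply/subvP=> x.
  by case/memv_imgP=> c _ ->; rewrite lfunE; apply/mem_vspanP; exists c.
case/mem_vspanP=> c ->; apply/memv_imgP; exists [ffun e=> c e : F^o].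
  exact: memvf.
by rewrite lfunE; apply: eq_bigr=> e _; rewrite ffunE.
Qed.

Lemma dim_vspan_rel vT uT E (v : E -> vT) (u : E -> uT) (X : {set E}) : (forall c : E -> F,
     (\sum_(e in X) c e *: v e == 0) = (\sum_(e in X) c e *: u e == 0)) -> vdim v X = vdim u X.
Proof.
move=> vu; rewrite -!limg_lincomb.
have eqk: lker (linfun (lincomb v X)) = lker (linfun (lincomb u X)).
  by apply/vspaceP=> c; rewrite !memv_ker !lfunE /= /lincomb vu.
have := limg_ker_dim (linfun (lincomb v X)) fullv.
have := limg_ker_dim (linfun (lincomb u X)) fullv.
by rewrite !capfv eqk=> <- /addnI.
Qed.

Lemma sum_delta (V : lmodType F) E (A : {set E}) (g : E -> V) y :
  \sum_(x in A) (x == y)%:R *: g x = (y \in A)%:R *: g y.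
Proof.
case: (boolP (y \in A))=> yA; last first.
  rewrite scale0r big1=> // x xA.
  by rewrite (negPf (memPn yA x xA)) scale0r.
rewrite (bigD1 y) //= eqxx big1 ?addr0=> // x /andP[_ /negPf ->].
by rewrite scale0r.
Qed.

Lemma sum_deltaT (V : lmodType F) E (g : E -> V) y : \sum_x (x == y)%:R *: g x = g y.
Proof.
rewrite -[RHS]scale1r -[X in X *: _](congr1 (fun b : bool=> b%:R) (in_setT y)).
by rewrite -sum_delta; apply: eq_bigl=> x; rewrite inE.
Qed.

Definition unit_vec E (b : E) : vec F E := [ffun x=> (x == b)%:R].

Lemma ffun_unit_sum E (x : vec F E) : x = \sum_b x b *: unit_vec b.
Proof.
apply/ffunP=> b; rewrite sum_ffunE -[LHS](sum_deltaT (x : E -> F^o)).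
by apply: eq_bigr=> y _; rewrite !ffunE eq_sym; apply: mulrC.
Qed.

Lemma ex_quotient vT (S : {vspace vT}) : exists f : 'End(vT), lker f = S.
Proof.
exists (\1 - projv S)%VF; apply/vspaceP=> x.
rewrite memv_ker !lfun_simp /= subr_eq0; apply/eqP/idP=> [->|xS].
  exact: memv_proj.
by rewrite projv_id.
Qed.

Definition contracts vT uT E (v : E -> vT) (D : {set E}) (f : 'Hom(vT, uT)) :=
  forall x, x \in vspan v [set: E] -> (f x == 0) = (x \in vspan v D).

Lemma contracts_ker vT uT E (v : E -> vT) (D : {set E}) (f : 'Hom(vT, uT)) :
  lker f = vspan v D -> contracts v D f.
Proof. by move=> kf x _; rewrite -memv_ker kf. Qed.

Lemma contracts0 vT E (v : E -> vT) : contracts v set0 \1%VF.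
Proof. by move=> x _; rewrite lfunE /= /vspan big_set0 memv0. Qed.

Lemma ex_contraction vT E (v : E -> vT) (D : {set E}) :
  exists2 f : 'End(vT), contracts v D f & lker f = vspan v D.
Proof.
by have [f kf] := ex_quotient (vspan v D); exists f; first exact: contracts_ker.
Qed.

Lemma dim_contracts vT uT E (v : E -> vT) (D : {set E}) (f : 'Hom(vT, uT)) X :
  contracts v D f -> \dim (f @: vspan v X) = (vdim v (X :|: D) - vdim v D)%N.
Proof.
move=> cf; have sub Y := subvP (vspanS v (subsetT Y)).
have ->: (f @: vspan v X = f @: vspan v (X :|: D))%VS.
  rewrite vspanU limgD -!vspan_lfun; symmetry; apply/addv_idPl/vspan_sub=> e eD.
  by have /eqP ->: f (v e) == 0; rewrite ?mem0v ?cf ?mem_vspan ?inE.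
rewrite -(limg_ker_dim f (vspan v (X :|: D))).
suff ->: (vspan v (X :|: D) :&: lker f = vspan v D)%VS by rewrite addKn.
apply/vspaceP=> x; rewrite memv_cap memv_ker; apply/andP/idP=> [[/sub xX]|xD].
  by rewrite cf.
have xX := subvP (vspanS v (subsetUr X D)) x xD.
by split=> //; rewrite cf // (sub _ _ xX).
Qed.

Lemma contracts_comp vT uT wT E (v : E -> vT) (D D' : {set E}) (f : 'Hom(vT, uT))
  (f' : 'Hom(uT, wT)) : contracts v D f -> contracts (f <$> v) D' f' ->
  contracts v (D :|: D') (f' \o f)%VF.
Proof.
move=> cf cf' x xv; have sub Y := subvP (vspanS v (subsetT Y)).
rewrite comp_lfunE cf'; last by rewrite vspan_lfun memv_img.
rewrite vspan_lfun vspanU.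
apply/memv_imgP/memv_addP=> [[y yD' fxy]|[y yD [z zD' ->]]].
  exists (x - y); last by exists y; rewrite ?subrK.
  by rewrite -cf ?rpredB ?(sub _ _ yD') // linearB /= subr_eq0 fxy.
exists z=> //; rewrite linearD /= -[RHS]add0r; congr (_ + _).
by apply/eqP; rewrite cf // (sub _ _ yD).
Qed.

End VectorFamilies.

Arguments contracts0 {F vT E} v.
Arguments unit_vec {F E} b.

Section SameRank.
Definition same_rk F K (vT : vectType F) (wT : vectType K) E (v : E -> vT) (w : E -> wT) : Prop :=
  forall X, vdim v X = vdim w X.

Lemma same_rk_sym F K (vT : vectType F) (wT : vectType K) E (v : E -> vT) (w : E -> wT) :
  same_rk v w -> same_rk w v.
Proof. by move=> vw X; rewrite vw. Qed.

Lemma same_rk_trans F K L (vT : vectType F) (uT : vectType K) (wT : vectType L) E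
  (v : E -> vT) (u : E -> uT) (w : E -> wT) : same_rk v u -> same_rk u w -> same_rk v w.
Proof. by move=> vu uw X; rewrite vu. Qed.

Lemma same_rk_rel F (vT uT : vectType F) E (v : E -> vT) (u : E -> uT) : (forall c : vec F E,
     (\sum_e c e *: v e == 0) = (\sum_e c e *: u e == 0)) -> same_rk v u.
Proof.
move=> vu X; apply: dim_vspan_rel=> c.
have sumE (T: vectType F) (x : E -> T) : \sum_e [ffun e=> if e \in X then c e else 0 : F^o] e *: x e
    = \sum_(e in X) c e *: x e.
  rewrite [RHS]big_mkcond; apply: eq_bigr=> e _; rewrite ffunE.
  by case: ifP=> // _; rewrite scale0r.
by rewrite -!sumE vu.
Qed.

Lemma mem_span_dim F (vT : vectType F) (x : vT) (s : seq vT) :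
  (x \in <<s>>%VS) = (\dim <<x :: s>> == \dim <<s>>)%VS.
Proof.
have sub: (<<s>> <= <<x :: s>>)%VS.
  by apply: sub_span=> y ys; rewrite inE ys orbT.
rewrite eq_sym dimv_leqif_eq //= span_cons; apply/idP/idP=> [xs|/eqP ->].
  by rewrite eq_sym; apply/eqP/addv_idPr; rewrite -memvE.
by rewrite memvE addvSl.
Qed.

Variables (F K : fieldType) (vT : vectType F) (wT : vectType K) (E : finType).
Variables (v : E -> vT) (w : E -> wT).
Hypothesis vw : same_rk v w.

Lemma same_rk_seq s : \dim <<map v s>>%VS = \dim <<map w s>>%VS.
Proof. by rewrite -!vspan_seq vw. Qed.

Lemma same_rk_free s : free (map v s) = free (map w s).
Proof. by rewrite /free same_rk_seq !size_map. Qed.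

Lemma same_rk_mem e s : (v e \in <<map v s>>%VS) = (w e \in <<map w s>>%VS).
Proof. by rewrite !mem_span_dim (same_rk_seq (e :: s)) same_rk_seq. Qed.

End SameRank.

Section Characteristic3.
Definition rep_char3 F (vT : vectType F) E (v : E -> vT) : Prop :=
  exists2 K : fieldType, 3 \in [pchar K] & exists (wT : vectType K) (w : E -> wT), same_rk v w.

Lemma rep_char3_same F K (vT : vectType F) (uT : vectType K) E (v : E -> vT) (u : E -> uT) :
  same_rk u v -> rep_char3 v -> rep_char3 u.
Proof.
by move=> uv [L L3 [wT [w vw]]]; exists L=> //; exists wT, w=> X; rewrite uv.
Qed.

Lemma rep_char3_minor F (vT uT : vectType F) E E' (v : E -> vT) (g : E' -> E)
  (D : {set E}) (f : 'Hom(vT, uT)) (c : E' -> F) (u : E' -> uT) :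
  contracts v D f -> (forall e, c e != 0) ->
  (forall e, u e = c e *: f (v (g e))) -> rep_char3 v -> rep_char3 u.
Proof.
move=> cf c0 uE [K K3 [wT [w vw]]]; exists K=> //.
have [f' cf' _] := ex_contraction w D; exists wT, (fun e=> f' (w (g e)))=> X.
rewrite (vspan_scale _ c0 uE) !vspan_lfun (vspan_imset v) (vspan_imset w).
by rewrite (dim_contracts _ cf) (dim_contracts _ cf') !vw.
Qed.

Lemma rep_char3_contract F (vT uT : vectType F) E (v : E -> vT) (D : {set E}) (f : 'Hom(vT, uT)) :
  contracts v D f -> rep_char3 v -> rep_char3 (f <$> v).
Proof.
move=> cf; apply: (rep_char3_minor (g:=id) (c:=fun=> 1) cf).
  by move=> _; apply: oner_neq0.
by move=> e; rewrite scale1r.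
Qed.

Lemma rep_char3_sub F (vT : vectType F) E E' (v : E -> vT) (g : E' -> E) :
  rep_char3 v -> rep_char3 (v <$> g).
Proof.
move=> [K K3 [wT [w vw]]]; exists K=> //; exists wT, (w <$> g)=> X.
by rewrite (vspan_imset v) (vspan_imset w) vw.
Qed.

End Characteristic3.

Section Fano.
Lemma free3P K (vT : vectType K) (a b c : vT) :
  reflect (forall x y z, x *: a + y *: b + z *: c = 0 -> [/\ x = 0, y = 0 & z = 0])
          (free [:: a; b; c]).
Proof.
apply: (iffP (@freeP _ _ _ [tuple a; b; c]))=> [fr x y z|fr k]; last first.
  rewrite !big_ord_recl big_ord0 /= addr0 !addrA=> /fr[k0 k1 k2].
  by case=> [[|[|[|//]]] lt]; [rewrite -[RHS]k0|rewrite -[RHS]k1|rewrite -[RHS]k2];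
    congr (k _); apply: val_inj.
have := fr (fun i : 'I_3=> [:: x; y; z]`_i).
rewrite !big_ord_recl big_ord0 /= addr0 !addrA=> k /k {}k.
by split; [apply: (k ord0)|apply: (k (lift ord0 ord0))| apply: (k (lift ord0 (lift ord0 ord0)))].
Qed.

Lemma span2P K (vT : vectType K) (a b x : vT) :
  reflect (exists k l, x = k *: a + l *: b) (x \in <<[:: a; b]>>%VS).
Proof.
rewrite !span_cons span_nil addv0; apply: (iffP idP)=> [|[k [l ->]]].
  by case/memv_addP=> y /vlineP[k ->] [z /vlineP[l ->] ->]; exists k, l.
by apply: memv_add; apply/vlineP; eexists.
Qed.

Lemma span3P K (vT : vectType K) (a b c x : vT) :
  reflect (exists k l m, x = k *: a + l *: b + m *: c) (x \in <<[:: a; b; c]>>%VS).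
Proof.
rewrite span_cons; apply: (iffP idP)=> [|[k [l [m ->]]]].
  case/memv_addP=> y /vlineP[k ->] [z /span2P[l [m ->]] ->].
  by exists k, l, m; rewrite addrA.
rewrite -addrA; apply: memv_add; first by apply/vlineP; eexists.
by apply/span2P; exists l, m.
Qed.

Lemma span2_scale K (vT : vectType K) (a b x : vT) (k l : K) : k != 0 -> l != 0 ->
  x \in <<[:: a; b]>>%VS -> x \in <<[:: k *: a; l *: b]>>%VS.
Proof.
move=> k0 l0 /span2P[y [z ->]]; apply/span2P; exists (y / k), (z / l).
by rewrite !scalerA !divfK.
Qed.

Lemma quadrangle_diagonal K (vT : vectType K) (a b c d : vT) : free [:: a; b; c] ->
  d \in <<[:: a; b]>>%VS -> d \in <<[:: c; (a + b + c)%R]>>%VS -> exists k, d = k *: (a + b).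
Proof.
move=> /free3P fr /span2P[k [l ->]] /span2P[m [n eq_d]].
have [] := fr (k - n) (l - n) (- (m + n)).
  rewrite !scalerBl scaleNr scalerDl opprD !addrA.
  rewrite [LHS](ACl (1 * 3 * (2 * 4 * 5 * 6)))/= eq_d !scalerDr !addrA.
  by rewrite [LHS](ACl (1 * 7 * (2 * 5) * (3 * 6) * (4 * 8)))/= !subrr !addr0.
by move=> /subr0_eq -> /subr0_eq -> _; exists n; rewrite scalerDr.
Qed.

Lemma fano_char2 K (vT : vectType K) (a b c d e f g : vT) : free [:: a; b; c] ->
  d \in <<[:: a; b]>>%VS -> d \in <<[:: c; g]>>%VS ->
  e \in <<[:: a; c]>>%VS -> e \in <<[:: b; g]>>%VS ->
  f \in <<[:: b; c]>>%VS -> f \in <<[:: a; g]>>%VS -> f != 0 ->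
  f \in <<[:: d; e]>>%VS -> g \in <<[:: a; b; c]>>%VS ->
  g \notin <<[:: a; b]>>%VS -> g \notin <<[:: a; c]>>%VS ->
  g \notin <<[:: b; c]>>%VS -> 2%:R = 0 :> K.
Proof.
move=> /free3P fr dab dcg eac ebg fbc fag f0 fde /span3P[x [y [z gE]]] gab gac gbc.
have x0: x != 0.
  by apply: contraNneq gbc=> x0; apply/span2P; exists y, z; rewrite gE x0 scale0r add0r.
have y0: y != 0.
  by apply: contraNneq gac=> y0; apply/span2P; exists x, z; rewrite gE y0 scale0r addr0.
have z0: z != 0.
  by apply: contraNneq gab=> z0; apply/span2P; exists x, y; rewrite gE z0 scale0r addr0.
have frs: forall k l m, k *: (x *: a) + l *: (y *: b) + m *: (z *: c) = 0 ->
    [/\ k = 0, l = 0 & m = 0].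
  move=> k l m; rewrite !scalerA=> /fr[/eqP + /eqP + /eqP].
  by rewrite !mulf_eq0 (negPf x0) (negPf y0) (negPf z0) !orbF=> /eqP -> /eqP -> /eqP ->.
move: frs (span2_scale x0 y0 dab) (span2_scale x0 z0 eac) (span2_scale y0 z0 fbc).
have g1 w k: w \in <<[:: k; g]>>%VS -> w \in <<[:: 1 *: k; 1 *: g]>>%VS.
  by rewrite !scale1r.
move: (span2_scale z0 (oner_neq0 K) dcg) (span2_scale y0 (oner_neq0 K) ebg).
move: (span2_scale x0 (oner_neq0 K) fag); rewrite !scale1r {}gE.
move: (x *: a) (y *: b) (z *: c)=> {x0 y0 z0 fr dab dcg eac ebg fbc fag gab gac gbc g1} a' b' c'.
move=> fag dcg ebg frs dab eac fbc.
have [k1 dE] := quadrangle_diagonal (introT (free3P _ _ _) frs) dab dcg.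
have [k2 eE]: exists k, e = k *: (a' + c').
  apply: (@quadrangle_diagonal _ _ a' c' b')=> //; last by rewrite addrAC.
  by apply/free3P=> k l m; rewrite addrAC=> /frs[].
have [k3 fE]: exists k, f = k *: (b' + c').
  apply: (@quadrangle_diagonal _ _ b' c' a')=> //; last by rewrite addrC addrA.
  by apply/free3P=> k l m; rewrite addrC addrA=> /frs[].
have k30: k3 != 0 by apply: contraNneq f0=> k30; rewrite fE k30 scale0r.
move: fde; rewrite dE eE fE=> /span2P[l [m]]; rewrite !scalerA !scalerDr=> eq_f.
have [] := frs (l * k1 + m * k2) (l * k1 - k3) (m * k2 - k3).
  rewrite !scalerBl scalerDl !addrA.
  by rewrite [LHS](ACl ((1 * 3) * (2 * 5) * (4 * 6)))/= -eq_f -opprD subrr.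
move=> + /subr0_eq lk /subr0_eq mk; rewrite lk mk -mulr2n -[_ *+ _]mulr_natl=> /eqP.
by rewrite mulf_eq0 (negPf k30) orbF=> /eqP.
Qed.

Definition is_point F (vT : vectType F) E (v : E -> vT) (x : vT) : Prop :=
  exists e k, k != 0 /\ v e = k *: x.

Lemma is_point_lfun F (vT uT : vectType F) E (v : E -> vT) (f : 'Hom(vT, uT)) x :
  is_point v x -> is_point (f <$> v) (f x).
Proof. by case=> e [k [k0 vE]]; exists e, k; rewrite vE linearZ. Qed.

Lemma rep_char3_points F (vT : vectType F) E T (v : E -> vT) (w : T -> vT) :
  rep_char3 v -> (forall t, is_point v (w t)) -> rep_char3 w.
Proof.
move=> r3 vw.
have /fin_all_exists[g gP] t: exists g : E * F, g.2 != 0 /\ v g.1 = g.2 *: w t.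
  by have [e [k ek]] := vw t; exists (e, k).
apply: (rep_char3_minor (g:=fun t=> (g t).1) (c:=fun t=> (g t).2^-1) (contracts0 v) _ _ r3).
  by move=> t; have [k0 _] := gP t; rewrite invr_eq0.
by move=> t; have [k0 vE] := gP t; rewrite id_lfunE vE scalerK.
Qed.

Lemma no_fano F E (vT : vectType F) (v : E -> vT) (a b c : vT) :
  2 \in [pchar F] -> rep_char3 v -> free [:: a; b; c] ->
  (forall x, x \in [:: a; b; c; a + b; a + c; b + c; a + b + c] -> is_point v x) -> False.
Proof.
set s := [:: a; b; c; _; _; _; _]=> F2 r3 abc vs.
pose u (i : 'I_7) := s`_i.
have [K K3 [wT [w uw]]]: rep_char3 u.
  by apply: rep_char3_points r3 _=> i; apply/vs/(mem_nth 0 (ltn_ord i : (i < size s)%N)).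
pose o n (lt : (n < 7)%N) : 'I_7 := Ordinal lt.
have sum2 i j l: u l = u i + u j -> w l \in <<[:: w i; w j]>>%VS.
  move=> ul; rewrite -(same_rk_mem uw l [:: i; j]); apply/span2P; exists 1, 1.
  by rewrite !scale1r.
have dbl (x: vT) : x + x = 0 by rewrite -mulr2n -scaler_nat (pcharf0 F2) scale0r.
have fr := elimT (free3P _ _ _) abc.
have notin i j: (forall x y, exists x' y' z', [|| x' != 0, y' != 0 | z' != 0] /\
      a + b + c - (x *: u i + y *: u j) = x' *: a + y' *: b + z' *: c) ->
    w (o 6 isT) \notin <<[:: w i; w j]>>%VS.
  move=> out; rewrite -(same_rk_mem uw (o 6 isT) [:: i; j]).
  apply/negP=> /span2P[x [y gE]]; have [x' [y' [z' [nz E0]]]] := out x y.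
  move: E0; rewrite -gE subrr=> /esym/fr[x0 y0 z0].
  by move: nz; rewrite x0 y0 z0 eqxx.
have K20: 2%:R = 0 :> K.
  apply: (@fano_char2 K wT (w (o 0 isT)) (w (o 1 isT)) (w (o 2 isT)) (w (o 3 isT))
    (w (o 4 isT)) (w (o 5 isT)) (w (o 6 isT))).
  - by rewrite -(same_rk_free uw [:: o 0 isT; o 1 isT; o 2 isT]).
  - exact: sum2.
  - by apply: sum2; rewrite /u /= [RHS]addrCA dbl addr0.
  - exact: sum2.
  - by apply: sum2; rewrite /u /= [a + b + c]addrAC [RHS]addrCA dbl addr0.
  - exact: sum2.
  - by apply: sum2; rewrite /u /= -[a + b + c]addrA [RHS]addrA dbl add0r.
  - have := uw [set o 5 isT]; rewrite /vspan !big_set1 !dim_vline.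
    suff ->: u (o 5 isT) != 0 by case: (_ == 0).
    apply/eqP=> bc0; have [] := fr 0 1 1; first by rewrite scale0r add0r !scale1r.
    by move=> _ /eqP; rewrite oner_eq0.
  - by apply: sum2; rewrite /u /= addrACA dbl add0r.
  - rewrite -(same_rk_mem uw (o 6 isT) [:: o 0 isT; o 1 isT; o 2 isT]).
    by apply/span3P; exists 1, 1, 1; rewrite !scale1r.
  - apply: notin=> x y; exists (1 - x), (1 - y), 1; rewrite oner_neq0 !orbT; split=> //.
    by rewrite !scalerBl !scale1r opprD !addrA [LHS](ACl (1 * 4 * 2 * 5 * 3)).
  - apply: notin=> x y; exists (1 - x), 1, (1 - y); rewrite oner_neq0 !orbT; split=> //.
    by rewrite !scalerBl !scale1r opprD !addrA [LHS](ACl (1 * 4 * 2 * 3 * 5)).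
  apply: notin=> x y; exists 1, (1 - x), (1 - y); rewrite oner_neq0; split=> //.
  by rewrite !scalerBl !scale1r opprD !addrA [LHS](ACl (1 * 2 * 4 * 3 * 5)).
by have := pcharf0 K3; rewrite -[3]/(1 + 2)%N natrD K20 addr0=> /eqP; rewrite oner_eq0.
Qed.

End Fano.

Section RepresentedRank.
Variable F : fieldType.

Definition rep_vec E (U : repmatroid F E) (e : E) : vec F ('I_(\dim U)) :=
  [ffun i : 'I_(\dim U)=> (vbasis U)`_i e].

Lemma rk_abstract E (U : repmatroid F E) (X : {set E}) : rk (abstract U) X = vdim (rep_vec U) X.
Proof. by []. Qed.

Lemma ffdotC E (u w : vec F E) : ffdot u w = ffdot w u.
Proof. by apply: eq_bigr=> e _; rewrite mulrC. Qed.

Lemma rep_vec_rel E (U : repmatroid F E) (c : vec F E) :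
  (\sum_e c e *: rep_vec U e == 0) = (c \in rdual U).
Proof.
rewrite memv_ker lfunE; congr (_ == _); apply/ffunP=> i; rewrite sum_ffunE !ffunE.
by apply: eq_bigr=> e _; rewrite !ffunE mulrC.
Qed.

Lemma rdualK E (U : repmatroid F E) : rdual (rdual U) = U.
Proof.
apply: subv_anti; apply/andP; split; apply/subvP=> x; last first.
  by move=> xU; apply/rdualP=> u /rdualP/(_ x xU) <-; apply: ffdotC.
move=> /rdualP xd; have [f kf] := ex_quotient U.
rewrite -kf memv_ker; apply/eqP/ffunP=> e; rewrite ffunE.
pose d : vec F E := [ffun b=> f (unit_vec b) e].
have dE y: ffdot d y = f y e.
  rewrite {2}(ffun_unit_sum y) linear_sum sum_ffunE; apply: eq_bigr=> b _.
  by rewrite linearZ !ffunE mulrC.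
rewrite -dE; apply: xd; apply/rdualP=> u; rewrite ffdotC dE -kf memv_ker=> /eqP ->.
by rewrite ffunE.
Qed.

Definition col_vec (B : finType) E (A : B -> E -> F) (e : E) : vec F B := [ffun b=> A b e].

Lemma row_space_rel (B : finType) E (A : B -> E -> F) (c : vec F E) :
  (\sum_e c e *: col_vec A e == 0) = (c \in rdual (row_space A)).
Proof.
have rowE b: ffdot [ffun e=> A b e : F^o] c = (\sum_e c e *: col_vec A e) b.
  by rewrite sum_ffunE; apply: eq_bigr=> e _; rewrite !ffunE mulrC.
apply/eqP/rdualP=> [c0 u|c0]; last first.
  apply/ffunP=> b; rewrite -rowE c0 ?ffunE // memvE.
  exact: (sumv_sup b).
case/memv_sumP=> y yA ->; rewrite /ffdot.
under eq_bigr do rewrite sum_ffunE mulr_suml.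
rewrite exchange_big big1 //= => b _; have /vlineP[k ->] := yA b isT.
under eq_bigr do rewrite ffunE -mulrA.
by rewrite -mulr_sumr -/(ffdot _ c) rowE c0 ffunE mulr0.
Qed.

Lemma row_space_rk (B : finType) E (A : B -> E -> F) : same_rk (rep_vec (row_space A)) (col_vec A).
Proof. by apply: same_rk_rel=> c; rewrite rep_vec_rel row_space_rel. Qed.

Lemma sum_setC (V : nmodType) E (X : {set E}) (g : E -> V) :
  \sum_e g e = \sum_(e in X) g e + \sum_(e in ~: X) g e.
Proof. by rewrite (bigID (mem X)) /=; congr (_ + _); apply: eq_bigl=> e; rewrite inE. Qed.

Definition ext0 E (X : {set E}) (c : {ffun {x | x \in X} -> F^o}) : vec F E :=
  [ffun e=> if insub e is Some x then c x else 0].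

Lemma sum_ext0 (V : lmodType F) E (X : {set E}) c (g : E -> V) :
  \sum_e @ext0 E X c e *: g e = \sum_x c x *: g (val x).
Proof.
rewrite (sum_setC X) [X in _ + X]big1 ?addr0=> [|e]; last first.
  by rewrite inE=> eX; rewrite ffunE insubN ?scale0r.
by rewrite big_sub; apply: eq_bigr=> x _; rewrite ffunE valK.
Qed.

Lemma ffdot_ext0 E (X : {set E}) c (u : vec F E) :
  ffdot u (@ext0 E X c) = ffdot (linfun (@ffrestr F E X) u) c.
Proof.
rewrite !(ffdotC _ c) ffdotC; have := sum_ext0 c (fun e=> u e : F^o).
by move=> /= cE; rewrite /ffdot [LHS]cE; apply: eq_bigr=> x _; rewrite lfunE ffunE.
Qed.

Lemma rdelete_rk E (U : repmatroid F E) (X : {set E}) :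
  same_rk (rep_vec (rdelete U X)) (fun e : {x | x \in ~: X}=> rep_vec U (val e)).
Proof.
apply: same_rk_rel=> c; rewrite rep_vec_rel -sum_ext0 rep_vec_rel.
apply/rdualP/rdualP=> cU u uU; first by rewrite ffdot_ext0 cU // memv_img.
by case/memv_imgP: uU=> u' u'U ->; rewrite -ffdot_ext0 cU.
Qed.

Lemma rcontract_rk E (U : repmatroid F E) (X : {set E}) (uT : vectType F)
  (f : 'Hom(vec F ('I_(\dim U)), uT)) : contracts (rep_vec U) X f ->
  same_rk (rep_vec (rcontract U X)) (fun e : {x | x \in ~: X}=> f (rep_vec U (val e))).
Proof.
move=> cf; apply: same_rk_rel=> c; rewrite rep_vec_rel rdualK.
have ->: \sum_e c e *: f (rep_vec U (val e)) = f (\sum_e ext0 c e *: rep_vec U e).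
  by rewrite sum_ext0 linear_sum; apply: eq_bigr=> e _; rewrite linearZ.
rewrite cf; last by apply: rpred_sum=> e _; apply/rpredZ/mem_vspan; rewrite inE.
rewrite sum_ext0; apply/memv_imgP/mem_vspanP=> [[u uU ->]|[d dE]].
  move: uU; rewrite -rep_vec_rel (sum_setC X) addr_eq0=> /eqP uX.
  exists (fun e=> - u e); under [RHS]eq_bigr do rewrite scaleNr.
  rewrite sumrN uX opprK [RHS]big_sub; apply: eq_bigr=> x _.
  by rewrite lfunE ffunE.
exists [ffun e=> if e \in X then - d e else ext0 c e].
  rewrite -rep_vec_rel (sum_setC X) (eq_bigr (fun e=> - (d e *: rep_vec U e))).
    rewrite sumrN -dE addrC subr_eq0 big_sub; apply/eqP/eq_bigr=> x _.
    by have := valP x; rewrite inE !ffunE=> /negPf ->; rewrite valK.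
  by move=> e eX; rewrite ffunE eX scaleNr.
apply/ffunP=> x; rewrite lfunE !ffunE; have := valP x; rewrite inE=> /negPf ->.
by rewrite valK.
Qed.

Lemma riso_rk E T (U : repmatroid F E) (W : repmatroid F T) :
  riso U W -> exists (f : E -> T) (d : E -> F), [/\ bijective f, forall e, d e != 0 &
      same_rk (rep_vec U) (fun e=> d e *: rep_vec W (f e))].
Proof.
case=> f [d [bf d0 UW]]; exists f, d; split=> //; apply: same_rk_rel=> c.
have [g fK gK] := bf; pose c' : vec F T := [ffun x=> c (g x) * d (g x)].
have onf (V: nmodType) (h : T -> V) : \sum_x h x = \sum_e h (f e).
  by rewrite (reindex f) //; exists g=> x _; rewrite ?fK ?gK.
have dotE (u: vec F T) : ffdot [ffun e=> d e * u (f e) : F^o] c = ffdot u c'.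
  by rewrite /ffdot onf; apply: eq_bigr=> e _; rewrite !ffunE fK; ring.
have ->: \sum_e c e *: (d e *: rep_vec W (f e)) = \sum_x c' x *: rep_vec W x.
  by rewrite onf; apply: eq_bigr=> e _; rewrite !ffunE fK scalerA.
rewrite !rep_vec_rel; apply/rdualP/rdualP=> [cU u|cW u uU].
  by rewrite UW -dotE; apply: cU.
have uE: u = [ffun e=> d e * [ffun x=> (d (g x))^-1 * u (g x) : F^o] (f e)].
  by apply/ffunP=> e; rewrite !ffunE fK mulVKf.
by rewrite uE dotE cW // UW -uE.
Qed.

Definition char3_class : repclass F := fun E U=> rep_char3 (rep_vec U).

Lemma char3_class_minor_closed : minor_closed char3_class.
Proof.
split=> [E T U W /riso_rk[f [d [[g fK gK] d0 UW]]] r3|E U X r3|E U X r3].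
- apply: (rep_char3_minor (g:=g) (c:=fun x=> (d (g x))^-1) (contracts0 _) _ _
           (rep_char3_same (same_rk_sym UW) r3))=> x; first by rewrite invr_eq0.
  by rewrite lfunE /= gK scalerA mulVf // scale1r.
- apply: rep_char3_same (@rdelete_rk _ U X) _; exact: rep_char3_sub.
have [f cf _] := ex_contraction (rep_vec U) X.
apply: rep_char3_same (rcontract_rk cf) _.
exact: (rep_char3_sub _ (rep_char3_contract cf r3)).
Qed.

Lemma template_rk (B T : finType) E (A : B -> T -> F) (U : repmatroid F E)
  (C : {set T}) (Y : {set {x : T | x \in ~: C}}) (uT : vectType F) (f : 'Hom(vec F B, uT)) :
  contracts (col_vec A) C f -> riso U (rdelete (rcontract (row_space A) C) Y) ->
  exists (g : E -> T) (d : E -> F), [/\ injective g, forall e, d e != 0,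
      forall t, (exists e, g e = t) <-> exists2 x : {x : T | x \in ~: C}, x \notin Y & t = val x &
      same_rk (rep_vec U) (fun e=> d e *: f (col_vec A (g e)))].
Proof.
move=> cf /riso_rk[g [d [bg d0 UW]]].
exists (fun e=> val (val (g e))), d; split=> //.
- by move=> e e' /val_inj/val_inj; apply: bij_inj.
- have [g' gK g'K] := bg; move=> t; split=> [[e <-]|[x xY ->]].
    by exists (val (g e))=> //; have := valP (g e); rewrite inE.
  have xY': x \in ~: Y by rewrite inE.
  by exists (g' (exist _ x xY')); rewrite g'K.
have [h ch _] := ex_contraction (rep_vec (row_space A)) C.
move=> X; rewrite UW !(vspan_scale _ d0 (fun=> erefl)).
rewrite (vspan_imset (rep_vec _)) rdelete_rk.
rewrite (vspan_imset (fun e : {x | x \in ~: Y}=> f (col_vec A (val (val e))))).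
rewrite (vspan_imset (rep_vec _)) (rcontract_rk ch).
rewrite (vspan_imset (fun e : {x | x \in ~: C}=> f (col_vec A (val e)))).
rewrite (vspan_imset (fun e=> h (rep_vec _ e))) (vspan_imset (fun e=> f (col_vec A e))).
by rewrite !vspan_lfun (dim_contracts _ ch) (dim_contracts _ cf) !row_space_rk.
Qed.

Lemma representable_family E (M : matroid E) : representable F M ->
  exists (vT : vectType F) (v : E -> vT), forall X, rk M X = vdim v X.
Proof.
move=> [m [n [A [f bf fM]]]]; exists 'cV[F]_m, (fun e=> col (f e) A)=> X.
by rewrite (vspan_imset (fun j=> col j A)) -fM.
Qed.

End RepresentedRank.

Section Independent.
Variables (F : fieldType) (vT : vectType F) (E : finType) (v : E -> vT).
Implicit Types (I J A : {set E}).

Definition indep I : bool := vdim v I == #|I|.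

Lemma indep0 : indep set0.
Proof. by rewrite /indep /vspan big_set0 dimv0 cards0. Qed.

Lemma dim_vspanU1 A e : v e \notin vspan v A -> vdim v (e |: A) = (vdim v A).+1.
Proof.
move=> ve; rewrite vspanU {1}/vspan big_set1 dimv_disjoint_sum.
  by rewrite dim_vline (_ : v e != 0) //; apply: contraNneq ve=> ->; rewrite mem0v.
apply/eqP; rewrite -subv0; apply/subvP=> w; rewrite memv_cap memv0.
case/andP=> /vlineP[a ->]; have [->|a0] := eqVneq a 0; first by rewrite scale0r.
by rewrite rpredZeq (negPf a0) (negPf ve).
Qed.

Lemma indepU1 I e : indep I -> v e \notin vspan v I -> indep (e |: I).
Proof.
move=> /eqP iI ve; have eI: e \notin I by apply: contra ve; apply: mem_vspan.
by rewrite /indep dim_vspanU1 // cardsU1 eI iI.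
Qed.

Lemma indep_notin I e : indep I -> e \in I -> v e \notin vspan v (I :\ e).
Proof.
move=> /eqP iI eI; apply/negP=> ve.
have: (vspan v I <= vspan v (I :\ e))%VS.
  by rewrite -{1}(setD1K eI) vspanU subv_add subvv andbT /vspan big_set1 -memvE.
move/dimvS; rewrite iI=> /leq_trans/(_ (vspan_card v (I :\ e))).
by rewrite (cardsD1 e I) eI ltnn.
Qed.

Lemma ex_basis I A : I \subset A -> indep I ->
  exists J, [/\ I \subset J, J \subset A, indep J & vspan v J = vspan v A].
Proof.
move=> IA iI; pose P J := [&& I \subset J, J \subset A & indep J].
have PI: P I by rewrite /P subxx IA iI.
have [J /and3P[IJ JA iJ] maxJ] := arg_maxnP (fun J=> #|J|) PI.
exists J; split=> //; apply: subv_anti; rewrite vspanS //=.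
apply: vspan_sub=> e eA; apply/negPn/negP=> ne.
have eJ: e \notin J by apply: contra ne; apply: mem_vspan.
have: (#|e |: J| <= #|J|)%N; last by rewrite cardsU1 eJ ltnn.
apply: maxJ; rewrite /P subUset sub1set eA JA (subset_trans IJ) ?subsetUr //=.
exact: indepU1.
Qed.

Lemma ex_basis0 A : exists J, [/\ J \subset A, indep J, vspan v J = vspan v A & #|J| = vdim v A].
Proof.
have [J [_ JA iJ sJ]] := ex_basis (sub0set A) indep0.
by exists J; split=> //; rewrite -sJ (eqP iJ).
Qed.

Lemma indep_coef I (c : E -> F) : indep I -> \sum_(e in I) c e *: v e = 0 ->
  forall e, e \in I -> c e = 0.
Proof.
move=> iI s0 e eI; apply/eqP; apply: contraT=> ce.
case/negP: (indep_notin iI eI); rewrite -(scalerK ce (v e)) rpredZ //.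
move: s0; rewrite (bigD1 e) //= => /eqP; rewrite addr_eq0=> /eqP ->; rewrite rpredN.
by apply: rpred_sum=> x /andP[xI xe]; apply/rpredZ/mem_vspan; rewrite !inE xe.
Qed.

Lemma indepP I : (forall c : E -> F, \sum_(e in I) c e *: v e = 0 ->
  forall e, e \in I -> c e = 0) -> indep I.
Proof.
move=> coef0; have [J [JI iJ eJ _]] := ex_basis0 I.
suff IJ: I \subset J by have ->: I = J by apply/eqP; rewrite eqEsubset IJ JI.
apply/subsetP=> e eI; apply/negPn/negP=> neJ.
have /mem_vspanP[c cE]: v e \in vspan v J by rewrite eJ mem_vspan.
have := coef0 (fun x=> (x == e)%:R - (if x \in J then c x else 0)).
move=> /(_ _ e eI); rewrite eqxx (negPf neJ) subr0=> e0.
case/eqP: (oner_neq0 F); apply: e0; under eq_bigr do rewrite scalerBl.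
rewrite sumrB sum_delta eI scale1r cE; apply/eqP; rewrite subr_eq0; apply/eqP.
rewrite [LHS]big_mkcond [RHS]big_mkcond /=; apply: eq_bigr=> x _.
by case: (boolP (x \in J))=> [/(subsetP JI) ->|_] //; rewrite scale0r if_same.
Qed.

Lemma indepS I J : I \subset J -> indep J -> indep I.
Proof.
move=> IJ iJ; apply: indepP=> c s0 e eI.
have := @indep_coef J (fun x=> if x \in I then c x else 0) iJ.
move=> /(_ _ e (subsetP IJ e eI)); rewrite eI; apply.
rewrite -[RHS]s0 [LHS]big_mkcond [RHS]big_mkcond /=; apply: eq_bigr=> x _.
by case: (boolP (x \in I))=> [/(subsetP IJ) -> //|_]; rewrite scale0r if_same.
Qed.

Lemma indep_neq0 I e : indep I -> e \in I -> v e != 0.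
Proof.
move=> iI eI; have := indep_notin iI eI; apply: contraNneq=> ->; exact: mem0v.
Qed.

Lemma indep_inj I x y k : indep I -> x \in I -> y \in I -> v x = k *: v y -> x = y.
Proof.
move=> iI xI yI vE; apply/eqP; apply: contraTT isT=> xy.
have := indep_notin iI xI; rewrite vE rpredZ // mem_vspan // !inE yI eq_sym.
by rewrite xy.
Qed.

Lemma ex_coord J : indep J -> exists f : 'Hom(vT, vec F E),
  [/\ forall x, x \in vspan v J -> x = \sum_(e in J) f x e *: v e,
      forall x e, e \notin J -> f x e = 0 & forall e, e \in J -> f (v e) = unit_vec e].
Proof.
move=> iJ; pose L := linfun (lincomb v J).
pose restr (c : vec F E) : vec F E := [ffun e=> if e \in J then c e else 0].
have restr_linear: linear restr.
  by move=> a c d; apply/ffunP=> e; rewrite !ffunE; case: ifP; rewrite // scaler0 addr0.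
pose restrM := GRing.isLinear.Build _ _ _ _ restr restr_linear.
pose restrL : {linear (vec F E) -> vec F E} := HB.pack restr restrM.
have LE x: x \in vspan v J -> \sum_(e in J) (L^-1)%VF x e *: v e = x.
  by rewrite -limg_lincomb=> xJ; have := limg_lfunVK xJ; rewrite lfunE.
exists (linfun restrL \o L^-1)%VF; split.
- move=> x xJ; rewrite comp_lfunE lfunE /= -{1}(LE x xJ); apply: eq_bigr=> e eJ.
  by rewrite ffunE eJ.
- by move=> x e eJ; rewrite comp_lfunE lfunE /= ffunE (negPf eJ).
move=> e eJ; apply/ffunP=> x; rewrite comp_lfunE lfunE /= !ffunE.
have [xJ|xJ] := boolP (x \in J); last by rewrite (negPf (memPnC xJ e eJ)).
apply/eqP; rewrite -subr_eq0; apply/eqP.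
apply: (indep_coef (c:=fun y=> (L^-1)%VF (v e) y - (y == e)%:R) iJ)=> //.
under eq_bigr do rewrite scalerBl.
by rewrite sumrB LE ?mem_vspan // sum_delta eJ scale1r subrr.
Qed.

(* Decrease every positive weight by one and extend the independent set obtained to a basis
of the support. *)
Lemma weighted_basis (R : {set E}) (w : E -> nat) (L : nat) :
  (forall A, A \subset R -> (#|A| <= L * vdim v A)%N) -> exists I, [/\ I \subset R, indep I &
  (\sum_(e in R) w e <= L * \sum_(e in I) w e)%N].
Proof.
move=> sparse; suff: exists I, [/\ I \subset [set e in R | 0 < w e]%N, indep I &
    (\sum_(e in R) w e <= L * \sum_(e in I) w e)%N].
  case=> I [IR iI le]; exists I; split=> //; apply: subset_trans IR _.
  by apply/subsetP=> e; rewrite inE=> /andP[].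
have [m le_m]: exists m, (\sum_(e in R) w e <= m)%N by eexists.
elim: m w le_m=> [|m IH] w le_m.
  by exists set0; rewrite sub0set indep0 big_set0 muln0.
set P := [set e in R | (0 < w e)%N].
have [P0|P0] := eqVneq P set0.
  exists set0; rewrite sub0set indep0 big_set0 muln0 leqn0; split=> //; rewrite sum_nat_eq0.
  apply/forall_inP=> e eR; have /setP/(_ e) := P0.
  by rewrite !inE eR lt0n=> /negbFE.
have PR: P \subset R by apply/subsetP=> e; rewrite inE=> /andP[].
have decr (I: {set E}) : I \subset P -> (\sum_(e in I) w e = \sum_(e in I) (w e).-1 + #|I|)%N.
  move=> IP; rewrite -sum1_card -big_split /=; apply: eq_bigr=> e /(subsetP IP).
  by rewrite inE addn1=> /andP[_ /prednK].
have sumP (g: E -> nat) : (forall e, w e = 0 -> g e = 0)%N ->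
    (\sum_(e in R) g e = \sum_(e in P) g e)%N.
  move=> g0; rewrite (big_setID P) (setIidPr PR) /= [X in (_ + X)%N]big1 ?addn0 // => e.
  by rewrite /P !inE=> /andP[+ eR]; rewrite eR lt0n negbK=> /eqP/g0.
have w1 e: w e = 0%N -> (w e).-1 = 0%N by move=> ->.
have [|I1 [I1P iI1 le1]] := IH (fun e=> (w e).-1).
  by rewrite -ltnS sumP //; apply: leq_trans le_m; rewrite sumP // decr // -addn1 leq_add2l
    card_gt0.
have [|I [I1I IP iI sI]] := @ex_basis I1 P _ iI1.
  apply: subset_trans I1P _; apply/subsetP=> e; rewrite !inE=> /andP[->].
  by case: (w e).
exists I; split=> //; rewrite sumP // !decr // mulnDr; apply: leq_add; last first.
  by rewrite -(eqP iI) sI sparse.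
rewrite -sumP //; apply: leq_trans le1 _; rewrite leq_mul2l; apply/orP; right.
by rewrite [leqRHS](big_setID I1) /= (setIidPr I1I) leq_addr.
Qed.

End Independent.

Section IndependentImages.
Variable F : fieldType.
Implicit Types vT uT : vectType F.

Lemma indep_lfun vT uT E (v : E -> vT) (f : 'Hom(vT, uT)) (I : {set E}) :
  indep (f <$> v) I -> indep v I.
Proof.
move=> iI; apply: indepP=> c s0; apply: (indep_coef iI).
have := congr1 f s0; rewrite linear_sum linear0=> fs0; rewrite -[RHS]fs0.
by apply: eq_bigr=> e _; rewrite linearZ.
Qed.

Lemma indep_ker_ext vT uT E (v : E -> vT) (f : 'Hom(vT, uT)) (A B : {set E}) :
  indep (f <$> v) A -> indep v B -> (forall e, e \in B -> f (v e) = 0) -> indep v (A :|: B).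
Proof.
move=> /eqP iA /eqP iB fB; rewrite /indep eqn_leq vspan_card.
apply: leq_trans (leq_card_setU A B) _.
rewrite -(limg_ker_dim f (vspan v (A :|: B))) addnC -{1}iA -{1}iB.
apply: leq_add; apply: dimvS; last by rewrite vspan_lfun limgS // vspanS // subsetUl.
rewrite subv_cap vspanS ?subsetUr //=; apply: vspan_sub=> e eB.
by rewrite memv_ker fB.
Qed.

Lemma indep_cap_ker vT uT E (v : E -> vT) (f : 'Hom(vT, uT)) (A : {set E}) :
  indep (f <$> v) A -> (vspan v A :&: lker f = 0)%VS.
Proof.
move=> /eqP; rewrite vspan_lfun=> iA; apply/eqP; rewrite -dimv_eq0.
have := limg_ker_dim f (vspan v A); have := vspan_card v A; rewrite iA; lia.
Qed.

Lemma rk_lker vT uT (wT : vectType F) E (v : E -> vT) (g : 'Hom(vT, uT)) (h : 'Hom(vT, wT))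
  (X : {set E}) :
  lker g = lker h -> vdim (g <$> v) X = vdim (h <$> v) X.
Proof.
move=> gh; rewrite !vspan_lfun; apply/eqP.
rewrite -(eqn_add2l (\dim (vspan v X :&: lker g))) limg_ker_dim {1}gh.
by rewrite limg_ker_dim.
Qed.

Lemma lker_comp_img vT uT (wT : vectType F) (f : 'Hom(vT, uT)) (g : 'Hom(uT, wT)) (W : {vspace vT})
  :
  lker g = (f @: W)%VS -> lker (g \o f)%VF = (lker f + W)%VS.
Proof.
move=> kg; apply/vspaceP=> x; rewrite memv_ker comp_lfunE -memv_ker kg.
apply/memv_imgP/memv_addP=> [[w wW fx]|[y yf [w wW ->]]].
  exists (x - w); last by exists w; rewrite ?subrK.
  by rewrite memv_ker linearB /= fx subrr.
by exists w; rewrite // linearD /= (eqP (_ : f y == 0)) ?add0r -?memv_ker.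
Qed.

Lemma vspan_cap vT E (v : E -> vT) (G A B : {set E}) : indep v G ->
  A \subset G -> B \subset G -> (vspan v A :&: vspan v B)%VS = vspan v (A :&: B).
Proof.
move=> iG AG BG; apply/esym/eqP; rewrite eqEdim subv_cap !vspanS ?subsetIl ?subsetIr //=.
have := dimv_sum_cap (vspan v A) (vspan v B); rewrite -vspanU.
have cardE (X: {set E}) : X \subset G -> vdim v X = #|X|.
  by move=> XG; apply/eqP/(indepS XG).
rewrite !cardE ?subUset ?AG ?BG // ?(subset_trans (subsetIl _ _)) //.
by have := cardsUI A B; lia.
Qed.

End IndependentImages.

Section AffineLift.
Variable F : fieldType.
Implicit Types vT : vectType F.

Definition lift1 vT T (g : T -> vT) (x : T) : (vT * F^o)%type := (g x, 1).

Lemma lift1_sum vT T (g : T -> vT) (A : {set T}) (c : T -> F) :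
  \sum_(x in A) c x *: lift1 g x = (\sum_(x in A) c x *: g x, \sum_(x in A) c x).
Proof.
elim/big_rec3: _=> // x a b d _ ->; congr (_, _); congr (_ + _).
exact: mulr1.
Qed.

Lemma sub_in_lift1 vT T (g : T -> vT) (A : {set T}) w :
  w \in vspan (fun p : T * T=> g p.1 - g p.2) (setX A A) -> (w, 0) \in vspan (lift1 g) A.
Proof.
case/mem_vspanP=> c ->; elim/big_rec: _=> [|p w' + w'A].
  exact: mem0v.
rewrite inE=> /andP[p1 p2].
have ->: (c p *: (g p.1 - g p.2) + w', 0)
    = c p *: (lift1 g p.1 - lift1 g p.2) + (w', 0) :> (vT * F^o)%type.
  congr (_, _); rewrite addr0 [RHS](_ : _ = c p *: (1 - 1 : F^o)) //.
  by rewrite subrr scaler0.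
by rewrite rpredD ?rpredZ // rpredB ?mem_vspan.
Qed.

End AffineLift.

Section GraphicRank.
Variables (F : fieldType) (n : nat).
Implicit Types S : {set Kedge n}.

Definition incv (e : Kedge n) : vec F 'I_n := unit_vec (val e).1 - unit_vec (val e).2.

Lemma Kedge_lt (e : Kedge n) : ((val e).1 < (val e).2)%N.
Proof. exact: (valP e). Qed.

Lemma Kedge_neq (e : Kedge n) : (val e).1 != (val e).2.
Proof. by apply/eqP=> e12; have := Kedge_lt e; rewrite e12 ltnn. Qed.

Lemma incv_connect S x y : connect (Kadj S) x y -> unit_vec x - unit_vec y \in vspan incv S.
Proof.
case/connectP=> p + ->; elim: p x=> [|z p IHp] x /=; first by rewrite subrr mem0v.
case/andP=> /existsP[e /andP[eS he]] /IHp zp.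
rewrite -(subrK (unit_vec z) (unit_vec x)) -addrA; apply: rpredD zp.
have := mem_vspan incv eS; rewrite /incv.
by case/orP: he=> /eqP -> //=; rewrite -opprB rpredN.
Qed.

Lemma incv_notin (T : {set Kedge n}) e : e \in T -> forest T -> incv e \notin vspan incv (T :\ e).
Proof.
move=> eT /forall_inP/(_ _ eT) nc; apply/negP=> /mem_vspanP[d dE].
set K := connect (Kadj (T :\ e)) (val e).1 in nc.
pose cut (w : vec F 'I_n) : F^o := \sum_(x in [set x | K x]) w x.
have cut_inc e': cut (incv e') = (K (val e').1)%:R - (K (val e').2)%:R.
  have cut_unit y: \sum_(x in [set x | K x]) (x == y)%:R = (K y)%:R :> F.
    have := sum_delta [set x | K x] (fun=> 1 : F^o) y; rewrite inE=> cutE.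
    rewrite -[RHS]mulr1 -[RHS]cutE; apply: eq_bigr=> x _; exact/esym/mulr1.
  by rewrite -!cut_unit -sumrB; apply: eq_bigr=> x _; rewrite !ffunE.
have: cut (incv e) = 0.
  rewrite dE /cut; under eq_bigr do rewrite sum_ffunE.
  rewrite exchange_big big1 //= => e' e'T; under eq_bigr do rewrite ffunE.
  rewrite -scaler_sumr -/(cut _) cut_inc.
  suff ->: K (val e').1 = K (val e').2 by rewrite subrr scaler0.
  have adj: Kadj (T :\ e) (val e').1 (val e').2.
    by apply/existsP; exists e'; rewrite e'T -surjective_pairing eqxx.
  apply/idP/idP=> h; apply: connect_trans h (connect1 _)=> //.
  by rewrite Kadj_sym.
by rewrite cut_inc (negPf nc) /K connect0 subr0=> /eqP; rewrite oner_eq0.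
Qed.

Lemma forest_indep (T : {set Kedge n}) : forest T = indep incv T.
Proof.
apply/idP/idP=> [fT|iT].
  have [J [JT iJ sJ _]] := ex_basis0 incv T.
  suff /eqP <-: J == T by [].
  rewrite eqEsubset JT; apply/subsetP=> e eT; apply: contraT=> eJ.
  case/negP: (incv_notin eT fT); have := mem_vspan incv eT; rewrite -sJ.
  apply/subvP/vspanS/subsetP=> x xJ; rewrite !inE (subsetP JT x xJ) andbT.
  exact: (memPn eJ).
apply/forall_inP=> e eT; apply/negP=> /incv_connect; apply/negP.
exact: indep_notin.
Qed.

Lemma rk_MK S : rk (MK n) S = vdim incv S.
Proof.
apply/eqP; rewrite /= /forest_rk eqn_leq; apply/andP; split.
  apply/bigmax_leqP=> T /andP[TS]; rewrite forest_indep=> /eqP <-.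
  exact: vspan_mono.
have [J [JS iJ _ <-]] := ex_basis0 incv S.
apply: (@leq_bigmax_cond _ _ (fun T : {set Kedge n}=> #|T|) J).
by rewrite JS forest_indep.
Qed.

Lemma incv_neq0 e : incv e != 0.
Proof.
apply/eqP=> /ffunP/(_ (val e).1)/eqP.
by rewrite !ffunE eqxx (negPf (Kedge_neq e)) subr0 oner_eq0.
Qed.

Lemma incv_inj e e' a : incv e = a *: incv e' -> e = e'.
Proof.
move=> incE; have supp x: x \in [:: (val e).1; (val e).2] -> x \in [:: (val e').1; (val e').2].
  rewrite !inE=> xe; have: incv e x != 0.
    case/orP: xe=> /eqP ->; rewrite !ffunE eqxx ?[(_ == (val e).1)]eq_sym;
      by rewrite (negPf (Kedge_neq e)) ?subr0 ?sub0r ?oppr_eq0 oner_eq0.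
  rewrite incE !ffunE; apply: contraNT; rewrite negb_or=> /andP[/negPf -> /negPf ->].
  by rewrite subrr scaler0.
have := supp (val e).1; have := supp (val e).2; rewrite !inE !eqxx !orbT.
move=> /(_ isT) s2 /(_ isT) s1; apply: val_inj.
have := Kedge_lt e; have := Kedge_lt e'; move: s1 s2.
case: (val e) (val e')=> [i j] [i' j'] /= /orP[]/eqP -> /orP[]/eqP -> //; lia.
Qed.

Lemma lift1_incv (vT : vectType F) (h : 'I_n -> vT) S : indep (lift1 h) setT ->
  vdim (fun e : Kedge n=> h (val e).1 - h (val e).2) S = vdim incv S.
Proof.
move=> ih; pose L := linfun (lincomb (lift1 h) setT).
have LE e: L (incv e) = (h (val e).1 - h (val e).2, 0).
  have L1 i: L (unit_vec i) = lift1 h i.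
    rewrite lfunE /= /lincomb; under eq_bigr do rewrite ffunE.
    by rewrite sum_delta inE scale1r.
  by rewrite linearB /= !L1; congr (_, _); apply: subrr.
have L0: lker L = 0%VS.
  apply/eqP; rewrite -subv0; apply/subvP=> c; rewrite memv_ker lfunE /= memv0.
  move=> /eqP c0; apply/eqP/ffunP=> i; rewrite ffunE.
  by apply: (indep_coef ih c0); rewrite inE.
transitivity (vdim (fun e=> L (incv e)) S); last first.
  by rewrite vspan_lfun limg_dim_eq // L0 capv0.
apply: dim_vspan_rel=> c; under [in RHS]eq_bigr do rewrite LE.
have ->: \sum_(e in S) c e *: ((h (val e).1 - h (val e).2, 0) : (vT * F^o)%type)
    = (\sum_(e in S) c e *: (h (val e).1 - h (val e).2), 0).
  elim/big_rec2: _=> // e a b _ ->; congr (_, _).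
  by rewrite /= scaler0 addr0.
by rewrite xpair_eqE eqxx andbT.
Qed.

End GraphicRank.

Section MinorRank.
Variables (E : finType) (M : matroid E).

Lemma rk_le_mrank (X : {set E}) : (rk M X <= mrank M)%N.
Proof. exact/rk_mono/subsetT. Qed.

Lemma imset_valC (D : {set E}) (X : {set {x | x \in ~: D}}) :
  ~: (val @: (~: X)) = D :|: (val @: X) :> {set E}.
Proof.
apply/setP=> e; rewrite !inE; have [eD|eD] := boolP (e \in D).
  by apply/imsetP=> -[x _ ex]; have := valP x; rewrite -ex inE eD.
have eD': e \in ~: D by rewrite inE.
have [x ->]: exists x : {x | x \in ~: D}, e = val x by exists (exist _ e eD').
by rewrite !mem_imset ?inE ?negbK //; apply: val_inj.
Qed.

Lemma rk_mcontract (C : {set E}) (X : {set {x | x \in ~: C}}) :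
  rk (mcontract M C) X = (rk M (C :|: val @: X) - rk M C)%N.
Proof.
have cardv (Y: {set {x | x \in ~: C}}) : #|val @: Y| = #|Y|.
  by rewrite card_imset //; apply: val_inj.
have compl: ~: (val @: [set: {x | x \in ~: C}]) = C :> {set E}.
  by have := imset_valC (set0 : {set {x | x \in ~: C}}); rewrite setC0 imset0 setU0.
rewrite [LHS]/= /dual_rk /mrank [LHS]/= /restr_rk [LHS]/= /dual_rk imset_valC compl.
rewrite !cardv -/(mrank M) cardsT -(cardsC X).
have := mrank_le M (val @: (~: X)); rewrite imset_valC cardv.
have := mrank_le M (val @: [set: {x | x \in ~: C}]); rewrite compl cardv cardsT -(cardsC X).
have := rk_le_mrank C; have := rk_le_mrank (C :|: val @: X).
have := rk_mono M (subsetUl C (val @: X)).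
move: (rk M (C :|: _)) (rk M C) (mrank M) #|X| #|~: X|; lia.
Qed.

End MinorRank.

Section Clique.
Variables (F : fieldType) (n : nat).
Implicit Types vT uT : vectType F.

Definition has_clique vT E (v : E -> vT) : Prop :=
  exists (D : {set E}) (ep : Kedge n -> E), forall X : {set Kedge n},
  vdim v (ep @: X :|: D) = (vdim v D + vdim (@incv F n) X)%N.

Lemma has_clique_minor E (M : matroid E) vT (v : E -> vT) :
  (forall X, rk M X = vdim v X) -> has_clique v -> has_minor M (MK n).
Proof.
move=> rkM [D [ep cliqueE]].
have epC e: ep e \in ~: D.
  rewrite inE; apply/negP=> eD; have := cliqueE [set e].
  rewrite imset_set1 (setUidPr _) ?sub1set // -[LHS]addn0=> /addnI.
  by rewrite {1}/vspan big_set1 dim_vline incv_neq0.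
have epI: injective ep.
  move=> e e' ee; apply/eqP; apply: contraT=> ne.
  have := cliqueE [set e; e']; rewrite imsetU !imset_set1 ee setUid -imset_set1 cliqueE.
  move/addnI/eqP; rewrite dim_vspanU1 ?eqn_leq ?ltnn ?andbF //.
  rewrite /vspan big_set1; by apply: contra ne=> /vlineP[a /incv_inj ->].
pose ep1 e : {x | x \in ~: D} := exist _ (ep e) (epC e).
have ep1I: injective ep1 by move=> e e' /(congr1 val)/epI.
pose D2 : {set {x | x \in ~: D}} := ~: (ep1 @: [set: Kedge n]).
have ep1C e: ep1 e \in ~: D2 by rewrite setCK imset_f ?inE.
exists D, D2, (fun e=> exist _ (ep1 e) (ep1C e)).
  apply: inj_card_bij=> [e e' /(congr1 val)/ep1I //|].
  rewrite card_sig -cardsT -(card_imset _ ep1I) /D2 setCK.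
  by apply/eq_leq/eq_card=> x; rewrite inE.
move=> X; rewrite [LHS](rk_mcontract M) (rk_MK F) !rkM -!imset_comp setUC.
by rewrite cliqueE addKn.
Qed.

Lemma has_clique_contract E vT uT (v : E -> vT) (D : {set E}) (f : 'Hom(vT, uT)) :
  contracts v D f -> has_clique (f <$> v) -> has_clique v.
Proof.
move=> cf [D' [ep cliqueE]]; exists (D' :|: D), ep=> X; have := cliqueE X.
rewrite !vspan_lfun !(dim_contracts _ cf) setUA.
have := vspan_mono v (subsetUr D' D); have := vspan_mono v (subsetUr (ep @: X :|: D') D).
lia.
Qed.

Lemma has_clique_sub vT E E' (v : E -> vT) (g : E' -> E) (c : E' -> F) (u : E' -> vT) :
  (forall e, c e != 0) -> (forall e, u e = c e *: v (g e)) -> has_clique u -> has_clique v.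
Proof.
move=> c0 uE [D [ep cliqueE]]; exists (g @: D), (g <$> ep)=> X.
have spanE Y: vspan u Y = vspan v (g @: Y).
  by rewrite (vspan_scale _ c0 uE) (vspan_imset v).
by have := cliqueE X; rewrite !spanE imsetU -imset_comp.
Qed.

Lemma has_clique_intro vT uT E (v : E -> vT) (D : {set E}) (f : 'Hom(vT, uT)) (h : 'I_n -> uT) :
  contracts v D f -> indep (lift1 h) setT ->
  (forall i j, i != j -> exists e k, k != 0 /\ f (v e) = k *: (h i - h j)) -> has_clique v.
Proof.
move=> cf ih edge; have /fin_all_exists[ep epP] (e: Kedge n) := edge _ _ (Kedge_neq e).
have [k kP] := fin_all_exists epP.
exists D, ep=> X; rewrite addnC; have := dim_contracts (ep @: X) cf.
rewrite -vspan_lfun -(vspan_imset (f <$> v)).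
rewrite (@vspan_scale _ _ _ (fun e : Kedge n=> h (val e).1 - h (val e).2) _ k).
- by rewrite lift1_incv // => ->; rewrite subnK // vspan_mono // subsetUr.
- by move=> e; have [] := kP e.
by move=> e; have [] := kP e.
Qed.

End Clique.

(** * Clique minors of dense graphs *)

Section Contraction.
Variable T : finType.
Implicit Types (r : rel T) (S : {set T}).

Definition nbhd r S x : {set T} := [set y in S | r x y].

Definition deg_sum r S : nat := \sum_(x in S) #|nbhd r S x|.

Definition contr_rel r (u v : T) : rel T := fun x y =>
  (x != y) && [|| r x y, (x == u) && r v y | (y == u) && r x v].

Lemma contr_rel_sym r u v : symmetric r -> symmetric (contr_rel r u v).
Proof.
move=> sr x y; rewrite /contr_rel eq_sym [r x y]sr [r x v]sr [r v y]sr.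
by rewrite [X in _ || X]orbC.
Qed.

Lemma deg_sum_contr r S u v : symmetric r -> irreflexive r -> u \in S -> v \in S -> r u v ->
  (deg_sum r S <= deg_sum (contr_rel r u v) (S :\ v) + 2 * #|nbhd r S u :&: nbhd r S v| + 2)%N.
Proof.
move=> sr ir uS vS ruv; have uv: u != v by apply: contraTneq ruv=> ->; rewrite ir.
set C := _ :&: _; set r' := contr_rel r u v; set S' := S :\ v.
have uS': u \in S' by rewrite !inE uv.
have deg_u: (#|nbhd r S u| + #|nbhd r S v| <= #|nbhd r' S' u| + #|C| + 2)%N.
  rewrite -cardsUI addnAC leq_add2r.
  apply: (@leq_trans #|nbhd r' S' u :|: [set u; v]|); last first.
    by rewrite (leq_trans (leq_card_setU _ _)) // leq_add2l cards2 uv.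
  apply/subset_leq_card/subsetP=> y; rewrite !inE /r' /contr_rel eqxx [u == y]eq_sym.
  have [->|yu] := eqVneq y u; rewrite ?orbT // orbF.
  have [->|yv] := eqVneq y v; rewrite ?orbT // !orbF /=.
  by case: (y \in S); case: (r u y); case: (r v y).
have deg_x x: x \in S' :\ u -> (#|nbhd r S x| <= #|nbhd r' S' x| + (x \in C))%N.
  rewrite !inE=> /and3P[xu xv xS]; rewrite xS [r u x]sr [r v x]sr /=.
  have [rxv|rxv] := boolP (r x v); rewrite ?andbT ?andbF ?addn0; last first.
    apply/subset_leq_card/subsetP=> y; rewrite !inE=> /andP[yS rxy].
    rewrite yS /r' /contr_rel rxy andbT; apply/andP; split.
      by apply: contraNneq rxv=> <-.
    by rewrite andbT; apply: contraTneq rxy=> ->; rewrite ir.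
  have vN: v \in nbhd r S x by rewrite inE vS.
  have sub: u |: nbhd r S x :\ v \subset nbhd r' S' x.
    apply/subsetP=> y; rewrite !inE=> /orP[/eqP ->|/and3P[yv yS rxy]].
      by rewrite uv uS /r' /contr_rel xu eqxx rxv !orbT.
    rewrite yv yS /r' /contr_rel rxy /= andbT.
    by apply: contraTneq rxy=> ->; rewrite ir.
  move: (subset_leq_card sub) (cardsD1 v (nbhd r S x)).
  by rewrite vN cardsU1 !inE uv uS /=; case: (r x u); lia.
rewrite /deg_sum (bigD1 v) //= (bigD1 u) ?uS //= [in leqRHS](bigD1 u) //=.
have le_rest: (\sum_(x in S' :\ u) #|nbhd r S x| <= \sum_(x in S' :\ u) #|nbhd r' S' x| + #|C|)%N.
  apply: (@leq_trans (\sum_(x in S' :\ u) (#|nbhd r' S' x| + (x \in C)))).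
    exact: leq_sum.
  rewrite big_split /= leq_add2l.
  rewrite -sum1_card [leqRHS]big_mkcond [leqLHS]big_mkcond /=.
  by apply: leq_sum=> x _; do 2!case: (_ \in _).
have eqS' (h: T -> nat) : (\sum_(x in S | (x != v) && (x != u)) h x = \sum_(x in S' :\ u) h x)%N.
  by apply: eq_bigl=> x; rewrite !inE andbC -andbA; case: (x != u); rewrite ?andbF.
have eqS'' (h: T -> nat) : (\sum_(x in S' | x != u) h x = \sum_(x in S' :\ u) h x)%N.
  by apply: eq_bigl=> x; rewrite !inE andbC.
under eq_bigl do rewrite -andbA; rewrite eqS' eqS''; move: deg_u le_rest; lia.
Qed.

End Contraction.

Fixpoint mader_const (n : nat) : nat := if n is m.+1 then (2 * mader_const m + 2)%N else 0%N.

Section DenseGraph.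
Variables (F : fieldType) (vT : vectType F) (E T : finType).
Implicit Types (v : E -> vT) (g : T -> vT) (r : rel T) (S : {set T}).

Definition represents_graph v g r S : Prop := indep (lift1 g) S /\
  forall x y, x \in S -> y \in S -> r x y -> exists e k, k != 0 /\ v e = k *: (g x - g y).

(* The kernel condition lets a vertex outside [S] survive the contraction. *)
Definition clique_on n v g S : Prop := exists (D : {set E}) (f : 'End(vT)) (x : 'I_n -> T),
  [/\ contracts v D f, (lker f <= vspan (fun p : T * T=> g p.1 - g p.2) (setX S S))%VS,
      forall i, x i \in S, indep (lift1 (fun i=> f (g (x i)))) setT & forall i j, i != j ->
        exists e k, k != 0 /\ f (v e) = k *: (f (g (x i)) - f (g (x j)))].

Lemma represents_graph_contr v g r S x y (e : E) (k : F) (f : 'End(vT)) :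
  represents_graph v g r S -> x \in S -> y \in S -> x != y ->
  k != 0 -> v e = k *: (g x - g y) -> lker f = vspan v [set e] ->
  represents_graph (f <$> v) (f <$> g) (contr_rel r x y) (S :\ y).
Proof.
move=> [ig edge] xS yS xy k0 vE kf.
have kerE w: f w = 0 -> exists m, w = m *: (g x - g y).
  move=> /eqP; rewrite -memv_ker kf /vspan big_set1 vE=> /vlineP[m ->].
  by exists (m * k); rewrite scalerA.
have fxy: f (g y) = f (g x).
  apply/eqP; rewrite eq_sym -subr_eq0 -linearB -memv_ker kf -(scalerK k0 (g x - g y)).
  by rewrite -vE rpredZ // mem_vspan ?set11.
split=> [|z t]; last first.
  rewrite !inE=> /andP[zy zS] /andP[ty tS] /andP[_ /or3P[rzt|/andP[/eqP zx ryt]|]].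
  - by have [e' [k' [k0' vE']]] := edge _ _ zS tS rzt; exists e', k';
    rewrite vE' linearZ /= linearB.
  - have [e' [k' [k0' vE']]] := edge _ _ yS tS ryt; exists e', k'.
    by rewrite vE' linearZ /= linearB /= zx fxy.
  case/andP=> /eqP tx rzy; have [e' [k' [k0' vE']]] := edge _ _ zS yS rzy.
  by exists e', k'; rewrite vE' linearZ /= linearB /= tx fxy.
apply: indepP=> c; rewrite lift1_sum=> -[s1 s0].
have [m mE]: exists m, \sum_(z in S :\ y) c z *: g z = m *: (g x - g y).
  by apply: kerE; rewrite linear_sum -[RHS]s1; apply: eq_bigr=> z _; rewrite linearZ.
have sumE: \sum_(z in S :\ y) c z *: lift1 g z = m *: (lift1 g x - lift1 g y).
  rewrite lift1_sum s0 mE; congr (_, _).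
  by rewrite [RHS](_ : _ = m *: (1 - 1 : F^o)) // subrr scaler0.
have m0: m = 0.
  apply/eqP; apply: contraT=> m0; case/negP: (indep_notin ig yS).
  have ->: lift1 g y = lift1 g x - m^-1 *: \sum_(z in S :\ y) c z *: lift1 g z.
    by rewrite sumE scalerK // opprB addrC subrK.
  rewrite rpredB ?mem_vspan ?rpredZ ?inE ?xy //.
  by apply: rpred_sum=> z zS; rewrite rpredZ // mem_vspan.
apply: indep_coef (indepS (subsetDl _ _) ig) _; by rewrite sumE m0 scale0r.
Qed.

Lemma clique_on_contr n v g S x y (e : E) (k : F) (f : 'End(vT)) :
  x \in S -> y \in S -> v e = k *: (g x - g y) ->
  contracts v [set e] f -> lker f = vspan v [set e] ->
  clique_on n (f <$> v) (f <$> g) (S :\ y) -> clique_on n v g S.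
Proof.
move=> xS yS vE cf kf [D [f' [z [cf' kf' zS iz edge]]]].
exists (D :|: [set e]), (f' \o f)%VF, z; split.
- by rewrite setUC; apply: contracts_comp.
- apply/subvP=> w; rewrite memv_ker comp_lfunE -memv_ker=> /(subvP kf').
  case/mem_vspanP=> c wE.
  pose w' := \sum_(p in setX (S :\ y) (S :\ y)) c p *: (g p.1 - g p.2).
  have w'S: w' \in vspan (fun p : T * T=> g p.1 - g p.2) (setX S S).
    apply: rpred_sum=> p; rewrite !inE=> /andP[/andP[_ p1] /andP[_ p2]].
    by rewrite rpredZ // (mem_vspan (fun p=> g p.1 - g p.2)) // inE p1.
  rewrite -(subrK w' w) rpredD // .
  have: w - w' \in lker f.
    rewrite memv_ker linearB /= wE linear_sum subr_eq0; apply/eqP/eq_bigr=> p _.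
    by rewrite -linearB -linearZ.
  rewrite kf /vspan big_set1=> /vlineP[m ->]; rewrite vE !rpredZ //.
  by rewrite (mem_vspan (fun p=> g p.1 - g p.2) (e:=(x, y))) // inE xS.
- by move=> i; have := zS i; rewrite !inE=> /andP[].
- rewrite /indep -(eq_vspan _ (v:=lift1 (fun i=> f' (f (g (z i)))))) //.
  by move=> i; rewrite /lift1 comp_lfunE.
by move=> i j /edge[e' [k' [k0 vE']]]; exists e', k'; rewrite !comp_lfunE.
Qed.

Lemma clique_on_cone n v g r S x : represents_graph v g r S -> irreflexive r ->
  symmetric r -> x \in S -> clique_on n v g (nbhd r S x) -> clique_on n.+1 v g S.
Proof.
move=> [ig edge] ir sr xS [D [f [z [cf kf zN iz cl]]]].
have NS: nbhd r S x \subset S by apply/subsetP=> y; rewrite inE=> /andP[].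
have xN: x \notin nbhd r S x by rewrite inE ir andbF.
pose z' (i : 'I_n.+1) := if unlift ord0 i is Some j then z j else x.
have adj j: exists e k, k != 0 /\ f (v e) = k *: (f (g x) - f (g (z j))).
  have := zN j; rewrite inE=> /andP[zS rxz]; have [e [k [k0 vE]]] := edge _ _ xS zS rxz.
  by exists e, k; rewrite vE linearZ /= linearB.
exists D, f, z'; split=> //.
- by apply: subv_trans kf _; apply: vspanS; apply: setXS.
- by move=> i; rewrite /z'; case: unliftP=> [j _|_] //; apply: (subsetP NS).
- apply: indepP=> c; rewrite lift1_sum (eq_bigl predT)=> [|i]; last by rewrite inE.
  rewrite [X in (_, X)](eq_bigl predT)=> [|i]; last by rewrite inE.
  rewrite !big_ord_recl /z' unlift_none; under eq_bigr do rewrite liftK.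
  move=> -[s1 s0]; have c0: c ord0 = 0.
    apply/eqP; apply: contraT=> c0; case/negP: (indep_notin ig xS).
    apply: (subvP (vspanS _ (_ : nbhd r S x \subset _))).
      by rewrite subsetD1 NS.
    rewrite -(scalerK c0 (lift1 g x)) rpredZ //.
    pose w := c ord0 *: g x + \sum_(i < n) c (lift ord0 i) *: g (z i).
    have ->: c ord0 *: lift1 g x = (w, 0) - \sum_(i < n) c (lift ord0 i) *: lift1 g (z i).
      apply/eqP; rewrite -subr_eq opprK; apply/eqP; have := lift1_sum (g <$> z) setT
        (fun i=> c (lift ord0 i)).
      under eq_bigl do rewrite inE; under [X in _ = (X, _)]eq_bigl do rewrite inE.
      under [X in _ = (_, X)]eq_bigl do rewrite inE.
      by rewrite /= => ->; congr (_, _); rewrite -[RHS]s0; congr (_ + _); apply: mulr1.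
    rewrite rpredB ?sub_in_lift1 //; last first.
      by apply: rpred_sum=> i _; rewrite rpredZ // mem_vspan.
    apply: (subvP kf); rewrite memv_ker /w linearD linearZ linear_sum; apply/eqP.
    by rewrite -[RHS]s1; congr (_ + _); apply: eq_bigr=> i _; rewrite linearZ.
  move=> i _; have [j ->|->] := unliftP ord0 i; last by [].
  apply: (indep_coef iz (c:=fun j=> c (lift ord0 j))) (in_setT j).
  rewrite lift1_sum; under eq_bigl do rewrite inE.
  under [X in (_, X)]eq_bigl do rewrite inE.
  by move: s1 s0; rewrite c0 scale0r !add0r=> -> ->.
move=> i j; rewrite /z'; case: unliftP=> [i' ->|->]; case: unliftP=> [j' ->|->] //.
- by rewrite (inj_eq lift_inj); apply: cl.
- move=> _; have [e [k [k0 vE]]] := adj i'; exists e, (- k).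
  by rewrite oppr_eq0 vE scaleNr -scalerN opprB.
Qed.

Lemma mader n v g r S : symmetric r -> irreflexive r -> S != set0 ->
  represents_graph v g r S -> (mader_const n * #|S| <= deg_sum r S)%N -> clique_on n.+1 v g S.
Proof.
elim: n v g r S=> [|n IHn] v g r S sr ir S0 vg le.
  have [x xS] := set0Pn _ S0; exists set0, \1%VF, (fun=> x); split=> //.
  - exact: contracts0.
  - by apply/subvP=> w; rewrite memv_ker lfunE /= => /eqP ->; rewrite mem0v.
  - apply: indepP=> c; rewrite lift1_sum=> -[_ s0] i _.
    rewrite -[RHS]s0 (_ : setT = [set i]) ?big_set1 //; apply/setP=> j.
    by rewrite !inE !ord1 eqxx.
  by move=> i j; rewrite !ord1 eqxx.
have [m] := ubnPleq #|S|; elim: m v g r S sr ir S0 vg le=> [|m IHm] v g r S sr ir S0 vg le cS.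
  by rewrite leqn0 cards_eq0 (negPf S0) in cS.
have [] := boolP [exists p : T * T, [&& p.1 \in S, p.2 \in S, r p.1 p.2 &
    (#|nbhd r S p.1 :&: nbhd r S p.2| <= mader_const n)%N]].
  case/existsP=> -[x y] /= /and4P[xS yS rxy few].
  have xy: x != y by apply: contraTneq rxy=> ->; rewrite ir.
  have [e [k [k0 vE]]] := vg.2 x y xS yS rxy; have [f cf kf] := ex_contraction v [set e].
  apply: (clique_on_contr xS yS vE cf kf); apply: (IHm _ _ (contr_rel r x y)).
  - exact: contr_rel_sym.
  - by move=> z; rewrite /contr_rel eqxx.
  - by apply/set0Pn; exists x; rewrite !inE xy.
  - exact: (represents_graph_contr vg xS yS xy k0 vE kf).
  - have := deg_sum_contr sr ir xS yS rxy; move: le few.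
    by rewrite (cardsD1 y S) yS /=; lia.
  by move: cS; rewrite (cardsD1 y S) yS; lia.
rewrite negb_exists=> /forallP many.
have [x xS Nx]: exists2 x, x \in S & nbhd r S x != set0.
  apply/exists_inP; apply: contraTT le; rewrite negb_exists -ltnNge=> /forallP N0.
  rewrite /deg_sum big1=> [|x xS]; first by rewrite muln_gt0 /= addn2 card_gt0.
  by have := N0 x; rewrite xS negbK=> /eqP ->; rewrite cards0.
have NS: nbhd r S x \subset S by apply/subsetP=> y; rewrite inE=> /andP[].
apply: (clique_on_cone vg ir sr xS); apply: IHn=> //.
  split=> [|y z yN zN]; first exact: indepS vg.1.
  by apply: vg.2; apply: (subsetP NS).
rewrite /deg_sum mulnC -sum_nat_const; apply: leq_sum=> y; rewrite inE=> /andP[yS rxy].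
have := many (x, y); rewrite /= xS yS rxy -ltnNge=> /ltnW /leq_trans; apply.
apply/subset_leq_card/subsetP=> z; rewrite !inE=> /andP[/andP[-> ->] /andP[_ ->]].
by [].
Qed.

Lemma dense_graph_clique n v g r S : symmetric r -> irreflexive r -> S != set0 ->
  represents_graph v g r S -> (mader_const n * #|S| <= deg_sum r S)%N -> has_clique n.+1 v.
Proof.
move=> sr ir S0 vg le; have [D [f [x [cf _ _ ix edge]]]] := mader sr ir S0 vg le.
exact: has_clique_intro cf ix edge.
Qed.

End DenseGraph.

Section Counting.
Implicit Types U : finType.

Lemma fin_choice_in T (V : Type) (d : V) (A : {set T}) (P : T -> V -> Prop) :
  (forall x, x \in A -> exists y, P x y) -> exists f : T -> V, forall x, x \in A -> P x (f x).
Proof.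
move=> AP; have [|f fP] := @fin_all_exists T (fun=> V) (fun x y=> x \in A -> P x y).
  by move=> x; case: (boolP (x \in A))=> [/AP[y]|_]; [exists y|exists d].
by exists f.
Qed.

Lemma pigeonhole T U (A : {set T}) (f : T -> U) (m : nat) :
  (m * #|U| < #|A|)%N -> exists u, (m < #|[set x in A | f x == u]|)%N.
Proof.
move=> lt; apply/existsP; apply: contraLR lt; rewrite negb_exists -leqNgt=> /forallP le.
rewrite -sum1_card (partition_big f predT) //= mulnC -sum_nat_const.
apply: leq_sum=> u _; rewrite leqNgt; apply: contra (le u)=> /leq_trans; apply.
by rewrite -sum1_card; apply/eq_leq/eq_bigl=> x; rewrite inE.
Qed.

Lemma sum_fibers T U (A : {set T}) (g : T -> U) (R : {set U}) : (forall x, x \in A -> g x \in R) ->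
  (\sum_(y in R) #|[set x in A | g x == y]| = #|A|)%N.
Proof.
move=> gR; rewrite -[RHS]sum1_card (partition_big g (mem R)) //=.
by apply: eq_bigr=> y _; rewrite -sum1_card; apply: eq_bigl=> x; rewrite [LHS]inE.
Qed.

Lemma sum_card_exchange T U (A : {set T}) (B : {set U}) (P : T -> U -> bool) :
  (\sum_(x in A) #|[set y in B | P x y]| = \sum_(y in B) #|[set x in A | P x y]|)%N.
Proof.
transitivity (\sum_(x in A) \sum_(y in B | P x y) 1)%N.
  by apply: eq_bigr=> x _; rewrite -sum1_card; apply: eq_bigl=> y; rewrite inE.
rewrite (exchange_big_dep (mem B)) /=; last by move=> x y _ /andP[].
by apply: eq_bigr=> y yB; rewrite -sum1_card; apply: eq_bigl=> x; rewrite inE yB.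
Qed.

Lemma card_meet_once T (X : {set T}) : X != set0 ->
  (2 ^ #|T| <= 2 ^ #|X| * #|[set Z : {set T} | #|X :&: Z| == 1%N]|)%N.
Proof.
case/set0Pn=> x xX; rewrite -(cardsC X) expnD leq_mul2l; apply/orP; right.
have xZ (Z: {set T}) : Z \in powerset (~: X) -> x \notin Z.
  by rewrite inE=> ZX; apply/negP=> /(subsetP ZX); rewrite inE xX.
rewrite -card_powerset -(@card_in_imset _ _ (fun Z=> x |: Z) (powerset (~: X))).
  apply/subset_leq_card/subsetP=> _ /imsetP[Z + ->]; rewrite !inE=> ZX.
  have XZ: X :&: Z = set0.
    by apply/eqP; rewrite setI_eq0 disjoint_sym disjoints_subset.
  by rewrite setIUr XZ setU0 (setIidPr _) ?sub1set // cards1.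
by move=> Z1 Z2 /xZ x1 /xZ x2 eqZ; rewrite -(setU1K x1) eqZ setU1K.
Qed.

Lemma ex_meet_once T U (A : {set T}) (supp : T -> {set U}) s :
  (forall x, x \in A -> supp x != set0 /\ (#|supp x| <= s)%N) ->
  exists Z, (#|A| <= 2 ^ s * #|[set x in A | #|supp x :&: Z| == 1%N]|)%N.
Proof.
move=> hs; pose m (Z : {set U}) := #|[set x in A | #|supp x :&: Z| == 1%N]|.
have [Z _ maxZ] := @arg_maxnP _ set0 predT m isT; exists Z.
have cardU: #|[set: {set U}]| = (2 ^ #|U|)%N by rewrite -powersetT card_powerset cardsT.
suff: (2 ^ #|U| * #|A| <= 2 ^ #|U| * (2 ^ s * m Z))%N.
  by rewrite leq_pmul2l // expn_gt0.
apply: (@leq_trans (2 ^ s * \sum_(Z' in [set: {set U}]) m Z')); last first.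
  rewrite mulnCA leq_mul2l -cardU -sum_nat_const; apply/orP; right.
  by apply: leq_sum=> Z' _; apply: maxZ.
rewrite (sum_card_exchange _ _ (fun Z x=> #|supp x :&: Z| == 1%N)).
rewrite big_distrr /= mulnC -sum_nat_const.
apply: leq_sum=> x xA; have [s0 le_s] := hs x xA.
apply: leq_trans (card_meet_once s0) _.
apply: leq_mul; first by rewrite leq_exp2l.
by apply/subset_leq_card/subsetP=> Z'; rewrite !inE.
Qed.

Lemma ex_max_disjoint T U (A : {set T}) (supp : T -> {set U}) : exists K : {set T}, [/\ K \subset A,
  {in K &, forall k k', k != k' -> [disjoint supp k & supp k']} &
  forall y, y \in A -> supp y != set0 -> exists2 k, k \in K & supp y :&: supp k != set0].
Proof.
pose disj (K : {set T}) := (K \subset A) &&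
  [forall k in K, forall k' in K, (k != k') ==> [disjoint supp k & supp k']].
have disj0: disj set0 by rewrite /disj sub0set; apply/forall_inP=> k; rewrite inE.
have [K /andP[KA Kd] Kmax] := arg_maxnP (fun K : {set T}=> #|K|) disj0.
have {}Kd: {in K &, forall k k', k != k' -> [disjoint supp k & supp k']}.
  by move=> k k' kK k'K /=; have /forall_inP/(_ k' k'K)/implyP := forall_inP Kd k kK.
exists K; split=> // y yA s0; apply/exists_inP; apply: contraT; rewrite negb_exists_in.
move=> /forall_inP no; have yd k: k \in K -> [disjoint supp y & supp k].
  by move/no; rewrite negbK setI_eq0.
have yK: y \notin K by apply/negP=> /no; rewrite setIid s0.
have /Kmax: disj (y |: K); last by rewrite /= cardsU1 yK add1n ltnn.
rewrite /disj subUset sub1set yA KA; apply/forall_inP=> k; rewrite !inE=> kK.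
apply/forall_inP=> k'; rewrite !inE=> k'K; apply/implyP.
case/orP: kK k'K=> [/eqP->|kK] /orP[/eqP->|k'K]; rewrite ?eqxx //; first by rewrite yd.
  by rewrite disjoint_sym yd.
exact: Kd.
Qed.

End Counting.

Section SimpleFamilies.
Variable F : fieldType.
Implicit Types vT uT : vectType F.

Definition simple_on vT E (u : E -> vT) (P : {set E}) : Prop := (forall e, e \in P -> u e != 0) /\
  (forall e e' k, e \in P -> e' \in P -> u e = k *: u e' -> e = e').

Lemma simple_onS vT E (u : E -> vT) (P Q : {set E}) : Q \subset P -> simple_on u P -> simple_on u Q.
Proof.
by move=> /subsetP QP [u0 uinj]; split=> [e /QP/u0|e e' k /QP eP /QP e'P /uinj]; auto.
Qed.

Lemma ex_reps vT E (u : E -> vT) (P : {set E}) : (forall e, e \in P -> u e != 0) ->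
  exists rp : E -> E, simple_on u (rp @: P) /\
  forall e, e \in P -> rp e \in P /\ exists2 k, k != 0 & u e = k *: u (rp e).
Proof.
move=> u0; pose rp e := odflt e [pick x in P | <[u x]>%VS == <[u e]>%VS].
have rpP e: e \in P -> rp e \in P /\ <[u (rp e)]>%VS = <[u e]>%VS.
  move=> eP; rewrite /rp; case: pickP=> [x /andP[xP /eqP]|/(_ e)]; first by [].
  by rewrite eP eqxx.
have rpE e e': <[u e]>%VS = <[u e']>%VS -> e \in P -> e' \in P -> rp e = rp e'.
  move=> ee eP e'P; rewrite /rp (eq_pick (Q:=fun x=> (x \in P) && (<[u x]>%VS == <[u e']>%VS))).
    by case: pickP=> // /(_ e'); rewrite e'P eqxx.
  by move=> x; rewrite ee.
have scaleP e e': e \in P -> <[u e']>%VS = <[u e]>%VS -> exists2 k, k != 0 & u e = k *: u e'.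
  move=> eP ee; have /vlineP[k kE]: u e \in <[u e']>%VS by rewrite ee memv_line.
  by exists k=> //; apply: contraNneq (u0 e eP)=> k0; rewrite kE k0 scale0r.
have rp_in e: e \in P -> rp e \in P by case/rpP.
have line e: e \in P -> <[u (rp e)]>%VS = <[u e]>%VS by case/rpP.
exists rp; split; last by move=> e eP; split; [apply: rp_in|apply: scaleP (line e eP)].
split=> [_ /imsetP[e eP ->]|_ _ k /imsetP[e eP ->] /imsetP[e' e'P ->] uE].
  exact/u0/rp_in.
apply: rpE=> //; rewrite -(line e eP) -(line e' e'P) uE; apply: subv_anti.
have k0: k != 0.
  by apply: contraNneq (u0 _ (rp_in e eP))=> k0; rewrite uE k0 scale0r.
rewrite -!memvE rpredZ ?memv_line //= -{1}[u (rp e')](scalerK k0).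
by rewrite rpredZ ?memv_line.
Qed.

Lemma indep_contract vT uT E (u : E -> vT) (f : 'Hom(vT, uT)) (I J : {set E}) :
  indep u I -> J \subset I -> lker f = vspan u J -> indep (f <$> u) (I :\: J).
Proof.
move=> /eqP iI JI kf; rewrite /indep vspan_lfun; apply/eqP.
have cf: contracts u J f by apply: contracts_ker.
have dimJ: vdim u J = #|J| by apply/eqP/(indepS JI)/eqP.
have IJ: I :\: J :|: J = I by rewrite setUC -{1}(setIidPr JI) setID.
by rewrite (dim_contracts _ cf) IJ iI dimJ cardsDS.
Qed.

Lemma ex_complement vT E (u : E -> vT) (I J : {set E}) (W : {vspace vT}) :
  indep u I -> J \subset I -> (W <= vspan u (I :\: J))%VS ->
  exists Y : {set E}, [/\ J \subset Y, Y \subset I, (vspan u Y :&: W = 0)%VS & #|I :\: Y| = \dim W].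
Proof.
move=> iI JI WI; have [f kf] := ex_quotient W.
have JW: (vspan u J :&: lker f = 0)%VS.
  apply/eqP; rewrite -subv0 kf; apply: subv_trans (capvS (subvv _) WI) _.
  by rewrite (vspan_cap iI JI (subsetDl _ _)) setIDA (setIidPl JI) setDv /vspan big_set0 subvv.
have iJ: indep (f <$> u) J.
  by rewrite /indep vspan_lfun (limg_dim_eq JW); apply: (indepS JI).
have [Y [JY YI iY spanY]] := ex_basis JI iJ; exists Y; split=> //.
  by rewrite -kf; apply: indep_cap_ker iY.
have WI': (vspan u I :&: W = W)%VS.
  by apply/capv_idPr/(subv_trans WI)/vspanS/subsetDl.
rewrite cardsDS // -(eqP iY) spanY vspan_lfun -(eqP iI).
by have := limg_ker_dim f (vspan u I); rewrite kf WI'; lia.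
Qed.

End SimpleFamilies.

Lemma ex_equal_gains (K : finFieldType) (vT : vectType K) E (u w : E -> vT) (a : E -> K)
  (z : E -> E) (A J : {set E}) (m : nat) : simple_on u A ->
  (forall y, y \in A -> [/\ z y \in J, a y != 0 & u y = w y + a y *: u (z y)]) ->
  (#|J| + #|K| * m < #|A|)%N -> exists (g : K) (A' : {set E}) (rp : E -> E),
  [/\ g != 0, (m < #|A'|)%N, A' \subset A, simple_on w (rp @: A') &
   forall y, y \in A' -> rp y \in A /\ exists2 t, t != 0 & u y = t *: (w (rp y) + g *: u (z y))].
Proof.
move=> [u0 uinj] uE cA; pose A1 := [set y in A | w y != 0].
have A1A y: y \in A1 -> y \in A by rewrite inE=> /andP[].
have cA1: (#|A| <= #|A1| + #|J|)%N.
  rewrite -(cardsID A1 A); apply: leq_add; first exact/subset_leq_card/subsetIr.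
  have uz y: y \in A :\: A1 -> y \in A /\ u y = a y *: u (z y).
    rewrite !inE=> /andP[/nandP[|] + yA]; rewrite yA // negbK=> /eqP w0; split=> //.
    by have [_ _ ->] := uE y yA; rewrite w0 add0r.
  rewrite -(@card_in_imset _ _ z)=> [|y y' /uz[yA yE] /uz[y'A y'E] zz].
    by apply/subset_leq_card/subsetP=> _ /imsetP[y /uz[/uE[zJ _ _] _] ->].
  apply: (uinj y y' (a y / a y') yA y'A).
  by rewrite yE y'E zz scalerA mulfVK //; have [] := uE y' y'A.
have [rp [npR rpP]]: exists rp, simple_on w (rp @: A1) /\ forall e, e \in A1 ->
    rp e \in A1 /\ exists2 k, k != 0 & w e = k *: w (rp e).
  by apply: ex_reps=> e; rewrite inE=> /andP[].
have /(fin_choice_in 0)[t tP] y: y \in A1 -> exists k : K, k != 0 /\ w y = k *: w (rp y).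
  by case/rpP=> _ [k]; exists k.
have ltA1: (m * #|K| < #|A1|)%N by lia.
have [g ltg] := @pigeonhole _ _ A1 (fun y=> a y / t y) m ltA1.
set A' := [set y in A1 | _] in ltg; have A'P y: y \in A' -> y \in A1 /\ a y / t y = g.
  by rewrite inE=> /andP[-> /eqP].
have A'A1: A' \subset A1 by apply/subsetP=> y /A'P[].
exists g, A', rp; split=> //.
- have /set0Pn[y /A'P[yA <-]]: A' != set0 by rewrite -card_gt0; apply: leq_trans ltg.
  have [t0 _] := tP y yA; have [_ a0 _] := uE y (A1A y yA).
  by rewrite mulf_neq0 // invr_eq0.
- by apply/subsetP=> y /A'P[/A1A].
- exact: simple_onS (imsetS _ A'A1) npR.
move=> y /A'P[yA <-]; have [t0 wE] := tP y yA; have [rA _] := rpP y yA.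
split; first exact: A1A; exists (t y)=> //; have [_ _ ->] := uE y (A1A y yA).
by rewrite scalerDr -wE scalerA mulrC mulfVK.
Qed.

Section BipartiteGraphs.
Variables (F : fieldType) (vT : vectType F) (E : finType) (v : E -> vT).

Definition glue (U : Type) (T1 T2 : Type) (z : T1 -> U) (w : T2 -> U) (x : T1 + T2) : U :=
  match x with inl i => z i | inr j => w j end.

Lemma bipartite_graph_clique n T1 T2 (z : T1 -> vT) (w : T2 -> vT)
  (S : {set T1 + T2}) (D : {set T1 * T2}) : S != set0 -> indep (lift1 (glue z w)) S ->
  (forall p, p \in D -> [/\ inl p.1 \in S, inr p.2 \in S &
     exists e k, k != 0 /\ v e = k *: (z p.1 - w p.2)]) ->
  (mader_const n * #|S| <= #|D|)%N -> has_clique n.+1 v.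
Proof.
move=> S0 iS DP le; pose r (x y : T1 + T2) :=
  match x, y with
  | inl i, inr j | inr j, inl i => (i, j) \in D
  | _, _ => false end.
apply: (@dense_graph_clique _ _ _ _ n v (glue z w) r S)=> //.
- by move=> [i|j] [i'|j'].
- by move=> [i|j].
- split=> // -[i|j] [i'|j'] //= _ _ /DP[_ _ [e [k [k0 vE]]]]; first by exists e, k.
  by exists e, (- k); rewrite vE /=; rewrite oppr_eq0 k0 scaleNr -scalerN opprB.
pose edge (p : T1 * T2) : (T1 + T2) * (T1 + T2) := (inl p.1, inr p.2).
apply: leq_trans le _; rewrite /deg_sum.
have -> : (\sum_(x in S) #|nbhd r S x| = \sum_(x in S) \sum_(y in S | r x y) 1)%N.
  by apply: eq_bigr=> x _; rewrite -sum1_card; apply: eq_bigl=> y; rewrite inE.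
rewrite pair_big_dep /= sum1_card -(@card_imset _ _ edge).
  apply: subset_leq_card; apply/subsetP=> _ /imsetP[[i j] ijD ->].
  by rewrite unfold_in /= ijD andbT; have [-> -> _] := DP _ ijD.
by move=> [i j] [i' j'] [-> ->].
Qed.

Lemma equal_gain_clique n (w : E -> vT) (g : F) (rp z : E -> E) (I J A : {set E}) :
  g != 0 -> simple_on v A -> indep (glue w v) (inl @: I :|: inr @: J) ->
  (forall y, y \in A -> [/\ rp y \in I, z y \in J &
     exists2 t, t != 0 & v y = t *: (w (rp y) + g *: v (z y))]) ->
  A != set0 -> (mader_const n * (#|I| + #|J|) <= #|A|)%N -> has_clique n.+1 v.
Proof.
move=> g0 [_ vinj] iIJ AP /set0Pn[y0 y0A] le; pose S := inl @: I :|: inr @: J : {set E + E}.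
have cardS: (#|S| <= #|I| + #|J|)%N.
  by rewrite (leq_trans (leq_card_setU _ _)) // leq_add // leq_imset_card.
have inS y: y \in A -> inl (rp y) \in S /\ inr (z y) \in S.
  by move=> /AP[yI yJ _]; rewrite !inE !imset_f ?orbT.
pose wg b := - g *: v b.
apply: (@bipartite_graph_clique n _ _ w wg S [set (rp y, z y) | y in A]).
- by apply/set0Pn; exists (inl (rp y0)); have [] := inS y0 y0A.
- apply: (@indep_lfun _ _ _ _ _ (linfun fst)).
  suff: indep (glue w wg) S.
    by rewrite /indep (eq_vspan (u:=glue w wg)) // => x; rewrite lfunE.
  rewrite /indep (@vspan_scale _ _ _ (glue w v) _ (glue (fun=> 1) (fun=> - g))) //.
    by case=> _ /=; rewrite ?oppr_eq0 ?oner_neq0.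
  by case=> x //=; rewrite scale1r.
- move=> _ /imsetP[y yA ->]; have [rS zS] := inS y yA; split=> //.
  have [_ _ [t t0 yE]] := AP y yA; exists y, t; split=> //.
  by rewrite /wg scaleNr opprK.
rewrite card_in_imset; first by apply: leq_trans le; rewrite leq_mul2l cardS orbT.
move=> y y' yA y'A [rr zz]; have [_ _ [t t0 yE]] := AP y yA.
have [_ _ [t' t'0 y'E]] := AP y' y'A; apply: (vinj y y' (t / t') yA y'A).
by rewrite yE y'E rr zz scalerA mulfVK.
Qed.

End BipartiteGraphs.

Fixpoint dense_const (q c s : nat) : nat :=
  if s is s'.+1 then (2 ^ s * (1 + q * (c.+1 * dense_const q c s').+1))%N else 0%N.

Lemma dense_const_mono q c : {homo dense_const q c : s t / (s <= t)%N}.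
Proof.
suff step s: (dense_const q c s <= dense_const q c s.+1)%N by apply: (homo_leq leqnn leq_trans
  step).
elim: s=> // s IH /=; apply: leq_mul; first by rewrite leq_exp2l.
by rewrite leq_add2l leq_mul2l ltnS leq_mul2l IH !orbT.
Qed.

Section DenseFamilies.
Variables (F : finFieldType) (vT : vectType F) (E : finType) (n : nat).
Implicit Types (u w : E -> vT) (I J A Y : {set E}).
Let c := mader_const n.
Let Lam := dense_const #|F| c.

Definition sparse_comb u I (s : nat) (x : vT) : Prop :=
  exists S : {set E}, [/\ S \subset I, (#|S| <= s)%N & x \in vspan u S].

Lemma sparse_combP u I s x : sparse_comb u I s x ->
  exists (S : {set E}) (a : E -> F), [/\ S \subset I, (#|S| <= s)%N,
  x = \sum_(e in S) a e *: u e & forall e, e \in S -> a e != 0].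
Proof.
case=> S [SI le /mem_vspanP[a xE]]; have sub: [set e in S | a e != 0] \subset S.
  by apply/subsetP=> e; rewrite inE=> /andP[].
exists [set e in S | a e != 0], a; split; first exact: subset_trans SI.
- exact: leq_trans (subset_leq_card sub) le.
- rewrite xE (big_setID [set e in S | a e != 0]) /= (setIidPr sub).
  rewrite [X in _ + X]big1 ?addr0 // => e; rewrite !inE=> /andP[+ eS].
  by rewrite eS negbK=> /eqP->; rewrite scale0r.
by move=> e; rewrite inE=> /andP[].
Qed.

Lemma sparse_comb_lfun u I Y s x (f : 'End(vT)) :
  (forall e, e \in I -> e \notin Y -> f (u e) = 0) -> sparse_comb u I s x ->
  sparse_comb (f <$> u) Y s (f x).
Proof.
move=> fY [S [/subsetP SI le xS]]; exists (S :&: Y).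
rewrite subsetIr (leq_trans (subset_leq_card (subsetIl _ _)) le); split=> //.
have: f x \in vspan (f <$> u) S by rewrite vspan_lfun memv_img.
apply: subvP (vspan_sub _) _=> e eS; have [eY|/(fY e (SI e eS))->] := boolP (e \in Y).
  by apply: (mem_vspan (f <$> u)); rewrite inE eS.
exact: mem0v.
Qed.

Lemma ex_split_combs u I A s :
  (forall y, y \in A -> u y != 0) -> (forall y, y \in A -> sparse_comb u I s.+1 (u y)) ->
  exists (J A' : {set E}) (z : E -> E) (a : E -> F) (w : E -> vT),
  [/\ J \subset I, A' \subset A, (#|A| <= 2 ^ s.+1 * #|A'|)%N &
   forall y, y \in A' -> sparse_comb u (I :\: J) s (w y) /\
     [/\ z y \in J, a y != 0 & u y = w y + a y *: u (z y)]].
Proof.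
move=> u0 sp; pose comb y (S : {set E}) (a : E -> F) := [/\ S \subset I, (#|S| <= s.+1)%N,
  u y = \sum_(e in S) a e *: u e & forall e, e \in S -> a e != 0].
have /(fin_choice_in (set0, fun=> 0))[p pP] y : y \in A -> exists p, comb y p.1 p.2.
  by case/sp/sparse_combP=> S [a Sa]; exists (S, a).
pose S y := (p y).1; pose a y := (p y).2.
have [Z cZ]: exists Z, (#|A| <= 2 ^ s.+1 * #|[set y in A | #|S y :&: Z| == 1%N]|)%N.
  apply: ex_meet_once=> y yA; have [_ le yE _] := pP y yA; split=> //.
  by apply: contraNneq (u0 y yA)=> S0; rewrite yE -/(S y) S0 big_set0.
set A' := [set y in A | _] in cZ.
have /(fin_choice_in id)[h hP] y: y \in A' -> exists z, S y :&: Z = [set z y].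
  by rewrite inE=> /andP[_ /cards1P[e eE]]; exists (fun=> e).
pose z y := h y y; have zP y: y \in A' -> S y :&: Z = [set z y] := @hP y.
exists (I :&: Z), A', z, (fun y=> a y (z y)), (fun y=> \sum_(e in S y :\ z y) a y e *: u e).
split=> //; first exact: subsetIl; first by apply/subsetP=> y; rewrite inE=> /andP[].
move=> y yA'; have yA: y \in A by move: yA'; rewrite inE=> /andP[].
have [SI le yE a0] := pP y yA; have zy: z y \in S y :&: Z by rewrite zP ?set11.
move: (zy); rewrite inE=> /andP[zS zZ]; split; last first.
  by rewrite inE (subsetP SI) // zZ a0 // {1}yE addrC -big_setD1.
exists (S y :\ z y); split; last by apply/mem_vspanP; exists (a y).
  apply/subsetP=> e; rewrite !inE=> /andP[ez eS]; rewrite (subsetP SI) // andbT.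
  by have := in_set1 e (z y); rewrite -zP // inE eS (negPf ez)=> ->.
by move: le; rewrite -/(S y) (cardsD1 (z y)) zS.
Qed.

Definition dense_cliques s : Prop := forall u I A, indep u I -> simple_on u A ->
  (forall y, y \in A -> sparse_comb u I s (u y)) -> (Lam s * #|I| < #|A|)%N -> has_clique n.+1 u.

(* Contracting a complement of the span of [w] maps the elements of [R] onto their images
under [w]. *)
Lemma dense_subspace_clique s u w I J (R : {set E}) : dense_cliques s -> indep u I -> J \subset I ->
  simple_on w R ->
  (forall y, y \in R -> sparse_comb u (I :\: J) s (w y) /\ u y - w y \in vspan u J) ->
  (Lam s * vdim w R < #|R|)%N -> has_clique n.+1 u.
Proof.
move=> IH iI JI [w0 winj] RP cR.
have wI: (vspan w R <= vspan u (I :\: J))%VS.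
  by apply: vspan_sub=> y /RP[[S [SI _ /(subvP (vspanS u SI))]]].
have [Y [JY YI YR cY]] := ex_complement iI JI wI.
have [f cf kf] := ex_contraction u Y.
have fu e: e \in Y -> f (u e) = 0.
  by move=> eY; apply/eqP; rewrite -memv_ker kf mem_vspan.
have fw y: y \in R -> f (u y) = f (w y).
  move=> yR; apply/eqP; rewrite -subr_eq0 -linearB -memv_ker kf.
  by apply: subvP (vspanS u JY) _ _; have [] := RP y yR.
have f_inj x: x \in vspan w R -> f x = 0 -> x = 0.
  move=> xR fx; apply/eqP; rewrite -memv0 -YR memv_cap xR andbT -kf memv_ker fx.
  exact: eqxx.
apply: (has_clique_contract cf); apply: (IH _ (I :\: Y) R).
- exact: indep_contract iI YI kf.
- split=> [y yR|y y' k yR y'R].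
    rewrite fw //; apply: contra (w0 y yR)=> /eqP fy; apply/eqP.
    by apply: f_inj fy; apply: mem_vspan.
  rewrite !fw // => /eqP; rewrite -linearZ -subr_eq0 -linearB=> /eqP fy.
  apply: (winj y y' k yR y'R); apply/eqP; rewrite -subr_eq0; apply/eqP.
  by apply: f_inj fy; rewrite rpredB ?rpredZ ?mem_vspan.
- move=> y yR; rewrite fw //; have [spw _] := RP y yR.
  apply: sparse_comb_lfun spw; by move=> e; rewrite !inE=> /andP[_ eI]; rewrite eI andbT negbK;
    apply: fu.
by rewrite cY.
Qed.

Lemma glue_indep u w I J (R : {set E}) : indep u I -> J \subset I ->
  (vspan w R <= vspan u (I :\: J))%VS -> indep w R ->
  indep (glue w u) (inl @: R :|: inr @: J) /\ (#|R| + #|J| <= #|I|)%N.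
Proof.
move=> iI JI wI iR.
have cap0: (vspan w R :&: vspan u J = 0)%VS.
  apply/eqP; rewrite -subv0; apply: subv_trans (capvS wI (subvv _)) _.
  by rewrite (vspan_cap iI (subsetDl _ _) JI) setIC setIDA (setIidPl JI) setDv
    /vspan big_set0 subvv.
have iJ := indepS JI iI; have dimRJ: \dim (vspan w R + vspan u J) = (#|R| + #|J|)%N.
  by rewrite dimv_disjoint_sum // (eqP iR) (eqP iJ).
split; last first.
  rewrite -dimRJ -(eqP iI); apply: dimvS; rewrite subv_add vspanS // andbT.
  exact: subv_trans wI (vspanS _ (subsetDl _ _)).
rewrite /indep vspanU -!vspan_imset dimRJ eqn_leq.
have := vspan_card (glue w u) (inl @: R :|: inr @: J).
rewrite vspanU -!vspan_imset dimRJ=> ->.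
by rewrite (leq_trans (leq_card_setU _ _)) // leq_add // leq_imset_card.
Qed.

Lemma dense_clique s : dense_cliques s.
Proof.
elim: s=> [|s IH] u I A iI simA sp cA.
  have /set0Pn[y yA]: A != set0 by rewrite -card_gt0; apply: leq_ltn_trans cA.
  have [S [_ + yS]] := sp y yA; rewrite leqn0 cards_eq0=> /eqP S0.
  by move: yS (simA.1 y yA); rewrite S0 /vspan big_set0 memv0=> ->.
have [J [A1 [z [a [w [JI A1A cA1 A1P]]]]]] := ex_split_combs simA.1 sp.
have leJ := subset_leq_card JI.
have [] := @ex_equal_gains _ _ _ u w a z A1 J ((c.+1 * Lam s).+1 * #|I|) (simple_onS A1A simA).
- by move=> y /A1P[].
- have: (2 ^ s.+1 * ((1 + #|F| * (c.+1 * Lam s).+1) * #|I|) < 2 ^ s.+1 * #|A1|)%N.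
    by rewrite mulnA; apply: leq_trans cA1.
  by rewrite ltn_pmul2l ?expn_gt0 // mulnDl mul1n mulnA; apply: leq_ltn_trans; rewrite leq_add2r.
move=> g [A2 [rp [g0 cA2 A2A1 simR A2P]]]; pose R := rp @: A2.
have RP x: x \in R -> sparse_comb u (I :\: J) s (w x) /\ u x - w x \in vspan u J.
  case/imsetP=> y /A2P[/A1P[spw [zJ _ uE]] _] ->; split; first by [].
  by rewrite uE addrC addKr rpredZ ?mem_vspan.
case: (boolP [forall R' : {set E}, (R' \subset R) ==> (#|R'| <= Lam s * vdim w R')%N]); last first.
  rewrite negb_forall=> /existsP[R']; rewrite negb_imply -ltnNge=> /andP[R'R cR'].
  apply: (dense_subspace_clique IH iI JI (simple_onS R'R simR) _ cR').
  by move=> y /(subsetP R'R)/RP.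
move=> /forallP sparse; pose wt x := #|[set y in A2 | rp y == x]|.
have [R' R'R|I1 [I1R iI1 wI1]] := @weighted_basis _ _ _ w R wt (Lam s).
  exact: implyP (sparse R') R'R.
pose A3 := [set y in A2 | rp y \in I1].
have A3A2 y: y \in A3 -> y \in A2 /\ rp y \in I1 by rewrite inE=> /andP.
have {wI1} cA3: (#|A2| <= Lam s * #|A3|)%N.
  have <- : (\sum_(x in I1) wt x = #|A3|)%N.
    rewrite -(@sum_fibers _ _ A3 rp I1)=> [|y /A3A2[]//]; apply: eq_bigr=> x xI1.
    by apply: eq_card=> y; rewrite !inE; case: eqP=> [->|]; rewrite ?xI1 ?andbT ?andbF.
  by apply: leq_trans wI1; rewrite (@sum_fibers _ _ A2 rp R) // => y; apply: imset_f.
have wI: (vspan w I1 <= vspan u (I :\: J))%VS.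
  by apply: vspan_sub=> x /(subsetP I1R)/RP[[S [SI _ /(subvP (vspanS u SI))]]].
have [iIJ cIJ] := glue_indep iI JI wI iI1.
have A3A: A3 \subset A.
  by apply/subsetP=> y /A3A2[/(subsetP A2A1)/(subsetP A1A)].
apply: (equal_gain_clique g0 (simple_onS A3A simA) iIJ (z:=z) (rp:=rp)).
- move=> y /A3A2[yA2 rI1]; have [_ tE] := A2P y yA2.
  by have [_ [zJ _ _]] := A1P y (subsetP A2A1 y yA2).
- by rewrite -card_gt0; case: #|A3| cA3=> //; rewrite muln0; lia.
have: (Lam s * (c * #|I|) < Lam s * #|A3|)%N.
  apply: leq_ltn_trans (leq_trans cA2 cA3); rewrite mulnA [(Lam s * c)%N]mulnC leq_mul2r.
  by apply/orP; right; apply: leqW; rewrite leq_mul2r leqnSn orbT.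
rewrite ltn_mul2l=> /andP[_ /ltnW]; apply: leq_trans.
by rewrite leq_mul2l cIJ orbT.
Qed.

Lemma sparse_bound u I A s : ~ has_clique n.+1 u -> indep u I -> simple_on u A ->
  (forall y, y \in A -> sparse_comb u I s (u y)) -> (#|A| <= Lam s * #|I|)%N.
Proof.
move=> noK iI simA spA; rewrite leqNgt; apply/negP=> lt; apply: noK.
exact: dense_clique iI simA spA lt.
Qed.

Section NearbyCombinations.
Variables (u : E -> vT) (I K A : {set E}) (co : E -> E -> F) (s : nat).
Hypotheses (iI : indep u I) (uK : forall k, k \in K -> u k = \sum_(x in I) co k x *: u x).
Let supp k := [set x in I | co k x != 0].
Hypothesis longK : forall k, k \in K -> (s < #|supp k|)%N.
Hypothesis disjK : {in K &, forall k k', k != k' -> [disjoint supp k & supp k']}.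

Let pick (a : 'I_s.+1) k := nth k (enum (supp k)) a.
Let transversal a := pick a @: K.

Let pick_supp a k : k \in K -> pick a k \in supp k.
Proof.
move=> kK; rewrite -mem_enum mem_nth // -cardE; apply: leq_trans (longK kK).
exact: ltn_ord.
Qed.

Let supp_pick a k k' : k \in K -> k' \in K -> pick a k' \in supp k -> k' = k.
Proof.
move=> kK k'K pk; apply/eqP; apply: contraT=> ne; have /pred0P/(_ (pick a k')) := disjK k'K kK ne.
by rewrite /= pk pick_supp.
Qed.

Let pick_inj a a' k k' : k \in K -> k' \in K -> pick a k = pick a' k' -> a = a' /\ k = k'.
Proof.
move=> kK k'K pp; have kk: k = k' by apply: (@supp_pick a)=> //; rewrite pp pick_supp.
have lt (b: 'I_s.+1) : (b < size (enum (supp k)))%N.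
  by rewrite -cardE; apply: leq_trans (longK kK); apply: ltn_ord.
split=> //; subst k'; apply/val_inj/eqP.
by rewrite -(nth_uniq k (lt a) (lt a') (enum_uniq _)); apply/eqP.
Qed.

Let basis a := (I :\: transversal a) :|: K.

Let basis_indep a : indep u (basis a) /\ (#|basis a| <= #|I|)%N.
Proof.
have XI: transversal a \subset I.
  by apply/subsetP=> _ /imsetP[k /(pick_supp a) + ->]; rewrite inE=> /andP[].
have cX: #|transversal a| = #|K|.
  by apply: card_in_imset=> k k' kK k'K /(pick_inj kK k'K)[].
have card_basis: (#|basis a| <= #|I|)%N.
  rewrite (leq_trans (leq_card_setU _ _)) // cardsDS // cX subnK // -cX.
  exact: subset_leq_card.
suff II: (vspan u I <= vspan u (basis a))%VS.
  split=> //; rewrite /indep eqn_leq vspan_card (leq_trans card_basis) //.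
  by rewrite -(eqP iI) dimvS.
have basisI x: x \in I -> x \notin transversal a -> u x \in vspan u (basis a).
  by move=> xI xX; apply: mem_vspan; rewrite !inE xX xI.
apply: vspan_sub=> x xI; have [/imsetP[k kK xE]|xX] := boolP (x \in transversal a);
  last exact: basisI.
have := pick_supp a kK; rewrite -xE inE=> /andP[_ cx].
rewrite -(scalerK cx (u x)) rpredZ //.
have -> : co k x *: u x = u k - \sum_(y in I | y != x) co k y *: u y.
  by rewrite [u k]uK // (bigD1 x) //= addrK.
rewrite rpredB ?mem_vspan ?inE ?kK ?orbT //; apply: rpred_sum=> y /andP[yI yx].
have [->|cy] := eqVneq (co k y) 0; first by rewrite scale0r mem0v.
apply/rpredZ/basisI=> //; apply/imsetP=> -[k' k'K yE]; case/eqP: yx.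
by rewrite yE xE (@supp_pick a k k') // -yE inE yI.
Qed.

(* The [s.+1] transversals of the supports are pairwise disjoint, so one of them
avoids a given combination of at most [s] vectors. *)
Lemma nearby_bound : ~ has_clique n.+1 u -> simple_on u A ->
  (forall y, y \in A -> exists k t, k \in K /\ sparse_comb u I s (u y - t *: u k)) ->
  (#|A| <= s.+1 * (Lam s.+1 * #|I|))%N.
Proof.
move=> noK simA near.
have /(fin_choice_in set0)[far farP] y: y \in A -> exists S : {set E},
    [/\ S \subset I, (#|S| <= s)%N & exists k t, k \in K /\ u y - t *: u k \in vspan u S].
  by case/near=> k [t [kK [S [SI le yS]]]]; exists S; split=> //; exists k, t.
pose B a := [set y in A | [disjoint far y & transversal a]].
apply: (@leq_trans (\sum_a #|B a|)); last first.
  rewrite -[X in (_ <= X * _)%N]card_ord -sum_nat_const; apply: leq_sum=> a _.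
  have [ib cb] := basis_indep a.
  apply: (@leq_trans (Lam s.+1 * #|basis a|)); last by rewrite leq_mul2l cb orbT.
  apply: sparse_bound noK ib (simple_onS _ simA) _.
    by apply/subsetP=> y; rewrite inE=> /andP[].
  move=> y; rewrite inE=> /andP[yA dy]; have [fI le [k [t [kK yf]]]] := farP y yA.
  exists (k |: far y); split.
  - rewrite subUset sub1set inE kK orbT /=; apply/subsetP=> x xf.
    by rewrite !inE (disjointFr dy xf) (subsetP fI).
  - by rewrite cardsU1 -add1n leq_add ?leq_b1.
  rewrite -[u y](subrK (t *: u k)) rpredD ?rpredZ ?mem_vspan ?setU11 //.
  exact: subvP (vspanS u (subsetUr _ _)) _ yf.
have -> : (\sum_a #|B a| = \sum_(a in [set: 'I_s.+1]) #|B a|)%N.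
  by apply: eq_bigl=> a; rewrite inE.
rewrite (sum_card_exchange _ _ (fun a y=> [disjoint far y & transversal a])).
rewrite -sum1_card; apply: leq_sum=> y yA; have [_ le _] := farP y yA.
rewrite card_gt0; apply: contraL le=> /eqP none; rewrite -ltnNge.
have /fin_all_exists[x xP] (a: 'I_s.+1) : exists x, x \in far y /\ x \in transversal a.
  have := in_set0 a; rewrite -none !inE /=.
  by case/negbT/pred0Pn=> x /andP[]; exists x.
rewrite -[s.+1]card_ord -(card_imset _ (f:=x)).
  by apply/subset_leq_card/subsetP=> _ /imsetP[a _ ->]; have [] := xP a.
move=> a a' xx; have [_ /imsetP[k1 k1K xE]] := xP a; have [_ /imsetP[k2 k2K xE']] := xP a'.
by have [] := @pick_inj a a' k1 k2 k1K k2K; rewrite -?xE -?xE'.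
Qed.

End NearbyCombinations.

End DenseFamilies.

Section Char2.
Variable F : fieldType.
Implicit Types vT : vectType F.
Hypothesis F2 : 2 \in [pchar F].

Lemma addvv_pchar2 vT (x : vT) : x + x = 0.
Proof. by rewrite -mulr2n -scaler_nat (pcharf0 F2) scale0r. Qed.

Lemma oppv_pchar2 vT (x : vT) : - x = x.
Proof. by apply/eqP; rewrite eq_sym -addr_eq0 addvv_pchar2. Qed.

(* The points [h1], [h2], [e], their pairwise sums and [h1 + h2 + e] become a Fano
plane after the contraction of [D], which makes [h3] equal to [h1 + h2]. *)
Lemma no_fano_contraction vT E (u : E -> vT) (D : {set E}) (e h1 h2 h3 : vT) :
  rep_char3 u -> is_point u e ->
  (forall h, h \in [:: h1; h2; h3] -> is_point u h /\ is_point u (h + e)) ->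
  (forall x y z, x *: h1 + y *: h2 + z *: e \in vspan u D -> [/\ x = 0, y = 0 & z = 0]) ->
  h1 + h2 + h3 \in vspan u D -> False.
Proof.
move=> r3 ptE ptH fr hD; have [f cf kf] := ex_contraction u D.
have f3: f h3 = f h1 + f h2.
  by apply/eqP; rewrite -[f h3]oppv_pchar2 eq_sym -subr_eq0 opprK -!linearD -memv_ker kf.
have pt x: is_point u x -> is_point (f <$> u) (f x) by apply: is_point_lfun.
have [p1E q1E] := ptH h1 (mem_head _ _).
have [p2E q2E]: is_point u h2 /\ is_point u (h2 + e) by apply: ptH; rewrite !inE eqxx orbT.
have [p3E q3E]: is_point u h3 /\ is_point u (h3 + e) by apply: ptH; rewrite !inE eqxx !orbT.
apply: (no_fano (a:=f h1) (b:=f h2) (c:=f e) F2 (rep_char3_contract cf r3)).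
  by apply/free3P=> x y z; rewrite -!linearZ -!linearD=> /eqP; rewrite -memv_ker kf=> /fr.
move=> x; rewrite -f3 -linearD -linearD -linearD !inE.
by do 6?[case/orP]=> /eqP->; apply: pt.
Qed.

Lemma free3_functionals vT E (u : E -> vT) (D : {set E}) (e h1 h2 : vT) (p0 p1 p2 : 'Hom(vT, F^o)) :
  (forall p, p \in [:: p0; p1; p2] -> forall d, d \in D -> p (u d) = 0) ->
  [/\ p0 e = 1, p0 h1 = 0 & p0 h2 = 0] -> [/\ p1 e = 0, p1 h1 = 1 & p1 h2 = 0] ->
  [/\ p2 e = 0, p2 h1 = 0 & p2 h2 = 1] ->
  forall x y z, x *: h1 + y *: h2 + z *: e \in vspan u D -> [/\ x = 0, y = 0 & z = 0].
Proof.
move=> pD [p0e p01 p02] [p1e p11 p12] [p2e p21 p22] x y z xD.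
have p_xyz p: p \in [:: p0; p1; p2] -> x * p h1 + y * p h2 + z * p e = 0.
  move=> pP; have := subvP (_ : vspan u D <= lker p)%VS _ xD.
  rewrite memv_ker !linearD !linearZ /= => pxD; apply/eqP/pxD/vspan_sub=> d dD.
  by rewrite memv_ker (pD p pP).
have := (p_xyz p0, p_xyz p1, p_xyz p2); rewrite !inE !eqxx !orbT.
rewrite p0e p01 p02 p1e p11 p12 p2e p21 p22 !mulr0 !mulr1 !addr0 !add0r.
by case=> [[/(_ isT) -> /(_ isT) ->] /(_ isT) ->].
Qed.

End Char2.

Section Quaternary.
Variables (F : finFieldType) (al : F).
Hypotheses (F4 : #|F| = 4%N) (alE : al ^+ 2 = al + 1).

Lemma F4_char2 : 2 \in [pchar F].
Proof. exact: (@card_finPcharP F 2 2). Qed.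

Lemma F4_cases (x : F) : [\/ x = 0, x = 1, x = al | x = al + 1].
Proof.
have two0: 2%:R = 0 :> F := pcharf0 F4_char2.
have x4: x ^+ 4 = x by rewrite -[in LHS]F4 expf_card.
have: x * (x - 1) * ((x - al) * (x - (al + 1))) == 0.
  have -> : x * (x - 1) * ((x - al) * (x - (al + 1))) = x ^+ 4 - x
      + 2%:R * (x ^+ 2 * (2%:R * al + 1) - x ^+ 3 * (al + 1) - x * al).
    by ring: alE.
  by rewrite x4 two0 subrr mul0r addr0.
by rewrite !mulf_eq0 !subr_eq0 -orbA=> /or4P[] /eqP ->;
  [exact: Or41|exact: Or42|exact: Or43|exact: Or44].
Qed.

Lemma al_neq0 : al != 0.
Proof. by apply: contra_eq_neq alE=> ->; rewrite expr0n add0r eq_sym oner_eq0. Qed.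

Lemma F4_sum3 (a b c : F) : a != 0 -> b != 0 -> c != 0 -> a != b -> a != c -> b != c ->
  a + b + c = 0.
Proof.
have two0: 2%:R = 0 :> F := pcharf0 F4_char2.
by case: (F4_cases a)=> ->; rewrite ?eqxx //; case: (F4_cases b)=> ->; rewrite ?eqxx //;
  case: (F4_cases c)=> ->; rewrite ?eqxx // => _ _ _ _ _ _; ring: two0.
Qed.

End Quaternary.

Section Functionals.
Variables (F : fieldType) (E : finType).
Implicit Types (t c : vec F E).

Fact ffdot_linear t : linear (ffdot t : vec F E -> F^o).
Proof.
move=> a b c; rewrite /ffdot scaler_sumr -big_split; apply: eq_bigr=> e _.
by rewrite !ffunE mulrDr; congr (_ + _); apply: mulrCA.
Qed.
HB.instance Definition _ t := GRing.isLinear.Build F _ _ _ (ffdot t) (ffdot_linear t).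

Lemma ffdot_indicator (S : {set E}) c : ffdot [ffun x=> (x \in S)%:R : F^o] c = \sum_(x in S) c x.
Proof.
rewrite /ffdot [RHS]big_mkcond; apply: eq_bigr=> x _; rewrite ffunE.
by case: ifP; rewrite ?mul1r ?mul0r.
Qed.

Lemma ffdot_unit x c : ffdot (unit_vec x) c = c x.
Proof.
rewrite /ffdot (bigD1 x) //= big1 ?addr0=> [|y /negPf yx]; rewrite ffunE ?eqxx ?mul1r //.
by rewrite yx mul0r.
Qed.

End Functionals.

Section DoubledPoints.
Variables (F : finFieldType) (al : F).
Hypotheses (F4 : #|F| = 4%N) (alE : al ^+ 2 = al + 1).
Variables (vT : vectType F) (E : finType) (u : E -> vT) (e0 : E) (I : {set E}).
Hypotheses (r3 : rep_char3 u) (e0I : e0 \notin I).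
Hypothesis doubled : forall x, x \in I -> is_point u (u x + u e0).
Variable f : 'Hom(vT, vec F E).
Hypothesis fE : forall z, z \in vspan u (e0 |: I) -> z = \sum_(x in e0 |: I) f z x *: u x.
Hypothesis fu : forall e, e \in e0 |: I -> f (u e) = unit_vec e.

Let F2 := F4_char2 F4.
Let oppF (x : F) : - x = x := oppr_pchar2 F2 x.

Let neq_e0 x : x \in I -> (x == e0) = false.
Proof. by move=> xI; apply: contraNF e0I=> /eqP <-. Qed.

Section FanoLocal.
Variables (D0 X0 : {set E}) (t : vec F E) (x1 x2 x3 : E) (z : vT).
Hypotheses (X1 : x1 \in I :\: X0) (X2 : x2 \in I :\: X0) (X3 : x3 \in I :\: X0).
Hypotheses (x12 : x1 != x2) (x23 : x2 != x3) (x31 : x3 != x1).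
Hypotheses (te0 : t e0 = 1) (t01 : forall x, x \in I :\: X0 -> t x = 0 \/ t x = 1).
Hypothesis D0P : forall d, d \in D0 ->
  [/\ ffdot t (f (u d)) = 0, f (u d) x1 = f (u d) x3 & f (u d) x2 = f (u d) x3].
Hypotheses (zD0 : z \in vspan u D0) (zI : z \in vspan u (e0 |: I)).
Hypotheses (z1 : f z x1 != 0) (zX0 : forall x, x \in X0 -> f z x = 0).

Let L : 'Hom(vT, F^o) := (linfun (ffdot t : _ -> F^o) \o f)%VF.
Let phi x : 'Hom(vT, F^o) := (linfun (ffdot (unit_vec x - unit_vec x3) : _ -> F^o) \o f)%VF.
Let h x := u x - t x *: u e0.
Let R := I :\: X0 :\: [set x1; x2; x3].
Let D := D0 :|: [set d | [exists x in R, u d \in <[h x]>%VS]].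

Let IX x : x \in I :\: X0 -> x \in I.
Proof. by rewrite inE=> /andP[]. Qed.

Let RP x : x \in R -> [/\ x \in I :\: X0, x != x1, x != x2 & x != x3].
Proof. by rewrite /R in_setD=> /andP[+ xI]; rewrite in_setU in_set2 in_set1 !negb_or -andbA=>
  /and3P[]. Qed.

Let LE w : L w = ffdot t (f w).
Proof. by rewrite comp_lfunE lfunE. Qed.

Let phiE x w : phi x w = f w x - f w x3.
Proof. by rewrite comp_lfunE lfunE /= ffdotC linearB /= !(ffdotC (f w)) !ffdot_unit. Qed.

Let Lu e : e \in e0 |: I -> L (u e) = t e.
Proof. by move=> eI; rewrite LE fu // ffdotC ffdot_unit. Qed.

Let f_e0 x : x \in I -> f (u e0) x = 0.
Proof. by move=> xI; rewrite fu ?setU11 // ffunE neq_e0. Qed.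

Let Lh x : x \in I -> L (h x) = 0.
Proof.
move=> xI; rewrite linearB linearZ /= !Lu ?setU11 ?setU1r // te0.
by rewrite -[X in _ - X]/(t x * 1) mulr1 subrr.
Qed.

Let fh x y : x \in I -> y \in I -> f (h x) y = (y == x)%:R.
Proof.
move=> xI yI; rewrite linearB linearZ !ffunE /= f_e0 // scaler0 subr0.
by rewrite fu ?setU1r // ffunE.
Qed.

Let point_h x : x \in I :\: X0 -> is_point u (h x) /\ is_point u (h x + u e0).
Proof.
have pt e: is_point u (u e) by exists e, 1; rewrite oner_neq0 scale1r.
move=> xIX; rewrite /h; have [->|->] := t01 xIX; rewrite ?scale0r ?scale1r ?subr0.
  by split; [apply: pt|apply/doubled/IX].
by rewrite subrK oppv_pchar2 //; split; [apply/doubled/IX|apply: pt].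
Qed.

Let kills_D (p : 'Hom(vT, F^o)) : (forall d, d \in D0 -> p (u d) = 0) ->
  (forall x, x \in R -> p (h x) = 0) -> forall d, d \in D -> p (u d) = 0.
Proof.
move=> pD0 pR d; rewrite !inE=> /orP[/pD0 //|/exists_inP[x xR /vlineP[k ->]]].
by rewrite linearZ /= pR // scaler0.
Qed.

Let phi_h x y : x \in R -> y \in [set x1; x2] -> phi y (h x) = 0.
Proof.
case/RP=> xI n1 n2 n3 y12; rewrite phiE !fh ?(IX xI) ?(IX X3) //.
  rewrite [x3 == x]eq_sym (negPf n3) eq_sym.
  by move: y12; rewrite !inE=> /orP[]/eqP->; rewrite ?(negPf n1) ?(negPf n2) subrr.
by move: y12; rewrite !inE=> /orP[]/eqP->; apply: IX.
Qed.

Let z_comb : z = \sum_(x in I) f z x *: h x.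
Proof.
have: L z = 0.
  apply/eqP; rewrite -memv_ker; apply: subvP zD0; apply: vspan_sub=> d /D0P[Ld _ _].
  by rewrite memv_ker LE Ld.
rewrite {1 2}(fE zI) !(big_setU1 _ e0I) /= linearD linear_sum linearZ /= Lu ?setU11 // te0.
rewrite -[X in X + _]/(f z e0 * 1) mulr1=> /eqP; rewrite addr_eq0=> /eqP ->.
rewrite scaleNr scaler_suml -sumrN -big_split; apply: eq_bigr=> x xI /=.
have -> : L (f z x *: u x) = f z x * t x by rewrite linearZ /= Lu ?setU1r.
by rewrite scalerBr scalerA addrC.
Qed.

Let sum_h : h x1 + h x2 + h x3 \in vspan u D.
Proof.
have [z13 z23]: f z x1 = f z x3 /\ f z x2 = f z x3.
  split; apply/eqP; rewrite -subr_eq0 -phiE -memv_ker; apply: subvP zD0;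
    by apply: vspan_sub=> d /D0P[_ e1 e2]; rewrite memv_ker phiE ?e1 ?e2 subrr.
have -> : h x1 + h x2 + h x3 = (f z x1)^-1 *: (z - \sum_(x in R) f z x *: h x).
  have -> : z - \sum_(x in R) f z x *: h x = f z x1 *: (h x1 + h x2 + h x3);
    last by rewrite scalerK.
  rewrite {1}z_comb (bigD1 x1 (IX X1)) /= (bigD1 x2) /=; last by apply/andP; rewrite eq_sym; split=>
    //; exact: IX X2.
  rewrite (bigD1 x3) /=; last by rewrite x31 eq_sym x23 !andbT; exact: IX X3.
  have -> : \sum_(x | (mem I) x && (x != x1) && (x != x2) && (x != x3)) f z x *: h x
      = \sum_(x in R) f z x *: h x.
    rewrite (bigID (mem X0)) /= big1 ?add0r=> [|x /andP[_ /zX0 ->]]; last by rewrite scale0r.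
    apply: eq_bigl=> x; rewrite !inE !negb_or.
    by case: (x \in I); case: (x \in X0); rewrite ?andbF //= -?andbA ?andbT.
  rewrite z23 z13; move: (h x1) (h x2) (h x3) (\sum_(x in R) _)=> h1 h2 h3 S.
  by rewrite !addrA addrK !scalerDr.
rewrite rpredZ // rpredB //; first exact: subvP (vspanS u (subsetUl _ _)) _ zD0.
apply: rpred_sum=> x xR; apply: rpredZ; have [xI _ _ _] := RP xR.
have [[d [k [k0 dE]]] _] := point_h xI; rewrite -[h x](scalerK k0) -dE.
apply/rpredZ/mem_vspan; rewrite !inE; apply/orP; right; apply/exists_inP; exists x=> //.
by rewrite dE rpredZ ?memv_line.
Qed.

Lemma fano_local : False.
Proof.
apply: (no_fano_contraction (e:=u e0) F2 r3 _ _ _ sum_h).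
- by exists e0, 1; rewrite oner_neq0 scale1r.
- by move=> w; rewrite !inE=> /or3P[]/eqP->; apply: point_h.
apply: (free3_functionals (p0:=L) (p1:=phi x1) (p2:=phi x2)).
- move=> p; rewrite !inE=> /or3P[]/eqP-> d dD; apply: kills_D dD=> [d' /D0P[d0 d1 d2]|x xR].
  + by rewrite LE.
  + by have [/IX xI _ _ _] := RP xR; apply: Lh.
  + by rewrite phiE d1 subrr.
  + by rewrite phi_h // !inE eqxx.
  + by rewrite phiE d2 subrr.
  by rewrite phi_h // !inE eqxx orbT.
- by rewrite Lu ?setU11 // !Lh ?IX.
- rewrite !phiE !fh ?f_e0 ?IX // !eqxx (negPf x31) (negPf x12) [x3 == x2]eq_sym (negPf x23).
  by rewrite subrr !subr0.
rewrite !phiE !fh ?f_e0 ?IX // !eqxx (negPf x31) [x2 == x1]eq_sym (negPf x12).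
by rewrite [x3 == x2]eq_sym (negPf x23) subrr !subr0.
Qed.

End FanoLocal.

Definition lsupp y := [set x in I | f (u y) x != 0].

Lemma long_combination y : u y \in vspan u (e0 |: I) -> (8 < #|lsupp y|)%N ->
  exists c g, [/\ c != 0, forall x, x \in I -> f (u y) x = c * (x \in lsupp y)%:R,
  f (u y) e0 = c * g & g = al \/ g = al + 1].
Proof.
move=> yI long; have [t]: exists t, (2 < #|[set x in lsupp y | f (u y) x == t]|)%N.
  by apply: pigeonhole; rewrite F4.
case/card_gt2P=> x1 [x2 [x3 [[]]]]; rewrite !inE.
move=> /andP[/andP[X1 c0] /eqP c1] /andP[/andP[X2 _] /eqP c2] /andP[/andP[X3 _] /eqP c3].
move=> [x12 x23 x31]; rewrite c1 in c0.
have sum_neq0 (T: {set E}) : T \subset I -> f (u y) e0 + \sum_(x in T) f (u y) x != 0.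
  move=> TI; apply/negP=> /eqP s0; have e0T: e0 \notin T by apply: contra e0I; apply: (subsetP TI).
  apply: (@fano_local [set y] set0 [ffun x=> (x \in e0 |: T)%:R] x1 x2 x3 (u y));
    rewrite ?setD0 ?c1 ?inE //.
  - by rewrite ffunE setU11.
  - by move=> x _; rewrite ffunE; case: (x \in _); [right|left].
  - move=> d; rewrite inE=> /eqP->; rewrite c1 c2 c3; split=> //.
    by rewrite ffdot_indicator big_setU1.
  - by rewrite mem_vspan ?inE.
  by move=> x; rewrite inE.
have g0: f (u y) e0 != 0 by have := sum_neq0 set0 (sub0set _); rewrite big_set0 addr0.
have gx x: x \in I -> f (u y) e0 != f (u y) x.
  by move=> xI; have := sum_neq0 [set x]; rewrite sub1set xI big_set1 addr_eq0 oppF; apply.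
have const x: x \in I -> f (u y) x != 0 -> f (u y) x = t.
  move=> xI xn; apply/eqP; apply: contraT=> xt.
  have xx1: x != x1 by apply: contraNneq xt=> ->; rewrite c1.
  have := sum_neq0 [set x; x1]; rewrite subUset !sub1set xI X1 big_setU1 ?inE //= big_set1 c1.
  by rewrite addrA (F4_sum3 F4 alE) ?gx // -?c1 ?gx ?c1 // eqxx=> /(_ isT).
exists t, (f (u y) e0 / t); split=> //.
- move=> x xI; rewrite !inE xI.
  by case: (eqVneq (f (u y) x) 0)=> [->|/(const x xI)->]; rewrite ?mulr0 ?mulr1.
- by rewrite mulrC mulfVK.
have n1: f (u y) e0 / t != 1.
  by apply/negP=> /eqP/divr1_eq yt; have := gx x1 X1; rewrite c1 yt eqxx.
have n0: f (u y) e0 / t != 0 by rewrite mulf_neq0 ?invr_eq0.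
by case: (F4_cases F4 alE (f (u y) e0 / t)) n0 n1=> ->; rewrite ?eqxx //; [left|right].
Qed.

Lemma long_combinations_close y y' : u y \in vspan u (e0 |: I) -> (8 < #|lsupp y|)%N ->
  u y' \in vspan u (e0 |: I) -> (8 < #|lsupp y'|)%N ->
  lsupp y :&: lsupp y' != set0 -> (#|lsupp y :\: lsupp y'| <= 2)%N.
Proof.
move=> yI ly y'I ly' /set0Pn[x0]; rewrite inE=> /andP[x0S x0S'].
have [c [g [c0 fc fg gE]]] := long_combination yI ly.
have [c' [g' [c'0 fc' fg' g'E]]] := long_combination y'I ly'.
rewrite leqNgt; apply/negP=> /card_gt2P[x1 [x2 [x3 [[]]]]].
rewrite !in_setD=> /andP[n1 X1] /andP[n2 X2] /andP[n3 X3] [x12 x23 x31].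
have SI x: x \in lsupp y -> x \in I by rewrite inE=> /andP[].
have ne x: x \notin lsupp y' -> (x == x0) = false.
  by move=> xn; apply: contraNF xn=> /eqP->.
pose d : F := (g != g')%:R.
have ggd: g + g' + d = 0.
  rewrite /d; have [->|] /= := eqVneq g g'; first by rewrite addr0 (addrr_pchar2 F2).
  have two0: 2%:R = 0 :> F := pcharf0 F2.
  by case: gE g'E=> -> [] ->; rewrite ?eqxx // => _; ring: two0.
pose t := unit_vec e0 + g' *: unit_vec x0 + d *: unit_vec x1 : vec F E.
have tE w: ffdot t w = w e0 + g' * w x0 + d * w x1.
  by rewrite ffdotC !linearD !linearZ /= !(ffdotC w) !ffdot_unit.
apply: (@fano_local [set y; y'] [set x0] t x1 x2 x3 (c^-1 *: u y + c'^-1 *: u y'))=> //.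
- by rewrite !inE ne // SI.
- by rewrite !inE ne // SI.
- by rewrite !inE ne // SI.
- rewrite !ffunE eqxx eq_sym neq_e0 ?SI // eq_sym neq_e0 ?SI //.
  by rewrite !scaler0 !addr0.
- move=> x; rewrite !inE=> /andP[/negPf x0x xI]; rewrite !ffunE neq_e0 // x0x scaler0 !add0r.
  case: (x == x1); last by left; rewrite scaler0.
  by rewrite -[d *: _]/(d * 1) mulr1 /d; case: (g != g'); [right|left].
- move=> e; rewrite !inE=> /orP[]/eqP->; rewrite tE ?fg ?fg' ?fc ?fc' ?SI // ?X1 ?X2 ?X3 ?x0S ?x0S'
    ?(negPf n1) ?(negPf n2) ?(negPf n3) !mulr1 ?mulr0 ?addr0; split=> //.
    by rewrite [g' * c]mulrC [_ * c]mulrC -!mulrDr ggd mulr0.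
  by rewrite [g' * c']mulrC (addrr_pchar2 F2).
- by rewrite rpredD // rpredZ // mem_vspan // !inE eqxx ?orbT.
- by rewrite rpredD // rpredZ.
- rewrite linearD !linearZ !ffunE /= fc ?fc' ?SI // X1 (negPf n1) mulr0 mulr1.
  by rewrite scaler0 addr0 -[X in X != _]/(c^-1 * c) mulVf // oner_neq0.
move=> x; rewrite inE=> /eqP->; rewrite linearD !linearZ !ffunE /= fc ?fc' ?SI // x0S x0S' !mulr1.
by rewrite -[LHS]/(c^-1 * c + c'^-1 * c') !mulVf // (addrr_pchar2 F2).
Qed.

Variable q : 'End(vT).
Hypothesis kq : lker q = <[u e0]>%VS.

Let image_comb y : u y \in vspan u (e0 |: I) -> q (u y) = \sum_(x in I) f (u y) x *: q (u x).
Proof.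
move=> yI; have q0: q (u e0) = 0 by apply/eqP; rewrite -memv_ker kq memv_line.
rewrite {1}(fE yI) big_setU1 //= linearD linearZ /= q0 scaler0 add0r linear_sum.
by apply: eq_bigr=> x _; rewrite linearZ.
Qed.

Lemma doubled_basis_bound n (A : {set E}) : ~ has_clique n.+1 u ->
  indep (q <$> u) I -> simple_on (q <$> u) A -> (forall y, y \in A -> u y \in vspan u (e0 |: I)) ->
  (#|A| <= 6 * (dense_const #|F| (mader_const n) 8 * #|I|))%N.
Proof.
move=> noK iI simA AI; set Lam := dense_const _ _.
have noKq: ~ has_clique n.+1 (q <$> u).
  move=> clq; apply: noK; apply: has_clique_contract clq; apply: (contracts_ker (D:=[set e0])).
  by rewrite kq /vspan big_set1.
pose A1 := [set y in A | #|lsupp y| <= 8]%N; pose A2 := A :\: A1.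
have A2P y: y \in A2 -> y \in A /\ (8 < #|lsupp y|)%N.
  by rewrite !inE=> /andP[+ yA]; rewrite yA /= -ltnNge.
have A1A: A1 \subset A by apply/subsetP=> y; rewrite inE=> /andP[].
have le1: (#|A1| <= Lam 8 * #|I|)%N.
  apply: sparse_bound noKq iI (simple_onS A1A simA) _=> y; rewrite inE=> /andP[yA ly].
  exists (lsupp y); split=> //; first by apply/subsetP=> x; rewrite inE=> /andP[].
  apply/mem_vspanP; exists (f (u y)); rewrite image_comb ?AI // [RHS]big_mkcond [LHS]big_mkcond.
  by apply: eq_bigr=> x _; rewrite inE; case: (x \in I)=> //=; case: eqP=> [->|//]; rewrite scale0r.
have [K [KA2 Kd Kmax]] := ex_max_disjoint A2 lsupp.
have near y: y \in A2 -> exists k t, k \in K /\ sparse_comb (q <$> u) I 4 (q (u y) - t *: q (u k)).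
  move=> yA2; have [yA ly] := A2P y yA2.
  have [|k kK yk] := Kmax y yA2; first by rewrite -card_gt0; apply: leq_trans ly.
  have [kA lk] := A2P k (subsetP KA2 k kK).
  have [c [g [c0 fc _ _]]] := long_combination (AI y yA) ly.
  have [c' [g' [c'0 fc' _ _]]] := long_combination (AI k kA) lk.
  exists k, (c / c'); split=> //.
  exists ((lsupp y :\: lsupp k) :|: (lsupp k :\: lsupp y)); split.
  - by apply/subsetP=> x; rewrite !inE=> /orP[]/andP[_ /andP[]].
  - apply: leq_trans (leq_card_setU _ _) _; apply: (@leq_trans (2 + 2))=> //.
    by apply: leq_add; apply: long_combinations_close; rewrite ?AI // setIC.
  rewrite !image_comb ?AI // scaler_sumr -sumrB; apply: rpred_sum=> x xI.
  rewrite scalerA -scalerBl fc // fc' // mulrA mulfVK // -mulrBr.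
  case: (boolP (x \in lsupp y)); case: (boolP (x \in lsupp k))=> xk xy;
    rewrite ?subrr ?mulr0 ?scale0r ?mem0v //; apply/rpredZ/(mem_vspan (q <$> u));
    by rewrite in_setU !in_setD ?xy ?xk ?(negPf xy) ?(negPf xk).
have le2: (#|A2| <= 5 * (Lam 5 * #|I|))%N.
  apply: (nearby_bound iI (K:=K) (co:=fun y=> f (u y)) _ _ _ noKq _ near).
  - by move=> k /(subsetP KA2)/A2P[kA _]; apply/image_comb/AI.
  - by move=> k /(subsetP KA2)/A2P[_ /(leq_trans _)]; apply.
  - exact: Kd.
  exact: simple_onS (subsetDl _ _) simA.
have mono: (Lam 5 * #|I| <= Lam 8 * #|I|)%N.
  by rewrite leq_mul2r; apply/orP; right; apply: dense_const_mono.
have := cardsID A1 A; rewrite -/A2; have := subset_leq_card (subsetIr A A1); lia.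
Qed.

End DoubledPoints.

Definition doubled_by F (vT : vectType F) E (u : E -> vT) (e x : E) : Prop :=
  exists2 m, m != 0 & is_point u (m *: u x + u e).

Lemma doubled_by_lfun F (vT uT : vectType F) E (u : E -> vT)
  (f : 'Hom(vT, uT)) e x : doubled_by u e x -> doubled_by (f <$> u) e x.
Proof.
by case=> m m0 /(is_point_lfun f); rewrite linearD linearZ; exists m.
Qed.

Definition doubled_const n := (6 * dense_const 4 (mader_const n) 8)%N.

Lemma doubled_bound (F : finFieldType) (al : F) n (vT : vectType F) E (u : E -> vT) (e0 : E)
  (q : 'End(vT)) (I A : {set E}) :
  #|F| = 4%N -> al ^+ 2 = al + 1 -> rep_char3 u -> ~ has_clique n.+1 u ->
  lker q = <[u e0]>%VS -> u e0 != 0 -> indep (q <$> u) I ->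
  (forall x, x \in I -> doubled_by u e0 x) -> simple_on (q <$> u) A ->
  (forall y, y \in A -> q (u y) \in vspan (q <$> u) I) -> (#|A| <= doubled_const n * #|I|)%N.
Proof.
move=> F4 alE r3 noK kq e00 iI dbl [A0 Ainj] AI.
have q0: q (u e0) = 0 by apply/eqP; rewrite -memv_ker kq memv_line.
have e0I: e0 \notin I by apply/negP=> /(indep_neq0 iI)/eqP.
have /(fin_choice_in 0)[m mP] x: x \in I -> exists m : F, m != 0 /\ is_point u (m *: u x + u e0).
  by case/dbl=> m m0 pm; exists m.
pose d x := if x \in I then m x else 1; pose w x := d x *: u x.
have d0 x: d x != 0 by rewrite /d; case: ifP=> [/mP[]//|_]; apply: oner_neq0.
have we0: w e0 = u e0 by rewrite /w /d (negPf e0I) scale1r.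
have pt_w x: is_point u x -> is_point w x.
  by case=> e [k [k0 eE]]; exists e, (d e * k); rewrite mulf_neq0 // /w eE scalerA.
have spE X: vspan w X = vspan u X by apply: (vspan_scale _ d0).
have spqE X: vspan (q <$> w) X = vspan (q <$> u) X.
  by apply: (vspan_scale _ d0)=> e; rewrite /w linearZ.
have iqI: indep (q <$> w) I by rewrite /indep spqE.
have iw: indep w (e0 |: I).
  rewrite setUC; apply: (indep_ker_ext iqI)=> [|e].
    by rewrite /indep /vspan big_set1 dim_vline we0 e00 cards1.
  by rewrite inE=> /eqP->; rewrite we0.
have [f [fE _ fw]] := ex_coord iw.
have noKw: ~ has_clique n.+1 w by move=> clq; apply: noK; apply: has_clique_sub clq=> [//|e].
rewrite /doubled_const -mulnA (_ : dense_const 4 = dense_const #|F|); last by rewrite F4.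
apply: (doubled_basis_bound (u:=w) F4 alE _ e0I _ fE fw _ noKw iqI).
- apply: (rep_char3_minor (g:=id) (c:=d) (contracts0 u) d0 _ r3)=> e.
  by rewrite lfunE.
- by move=> x xI; rewrite we0 /w /d xI; apply/pt_w; have [] := mP x xI.
- by rewrite kq we0.
- split=> [e eA|e e' k eA e'A]; first by rewrite linearZ scaler_eq0 negb_or d0 A0.
  rewrite !linearZ /= scalerA=> /(canRL (scalerK (d0 e))); rewrite scalerA.
  exact: Ainj.
move=> y yA; rewrite spE; have /mem_vspanP[c qE] := AI y yA.
have: u y - \sum_(x in I) c x *: u x \in <[u e0]>%VS.
  rewrite -kq memv_ker linearB /= qE linear_sum subr_eq0; apply/eqP/eq_bigr=> x _.
  by rewrite linearZ.
case/vlineP=> k /eqP; rewrite subr_eq=> /eqP uE; rewrite /w rpredZ // uE.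
rewrite rpredD ?rpredZ ?mem_vspan ?setU11 //; apply: rpred_sum=> x xI.
by rewrite rpredZ // mem_vspan // setU1r.
Qed.

Lemma ex_simple_contraction (F : finFieldType) (vT : vectType F) E (u : E -> vT)
  (P : {set E}) (e0 : E) (q : 'End(vT)) : simple_on u P -> u e0 != 0 -> lker q = <[u e0]>%VS ->
  exists P' Q : {set E}, [/\ P' \subset P, simple_on (q <$> u) P', Q \subset P',
      forall x, x \in Q -> doubled_by u e0 x & (#|P| <= 1 + #|P'| + #|F| * #|Q|)%N].
Proof.
move=> [P0 Pinj] e00 kq; pose P1 := [set e in P | q (u e) != 0].
have P1P e: e \in P1 -> e \in P by rewrite inE=> /andP[].
have on_e0 x: q x = 0 -> exists l, x = l *: u e0.
  by move=> /eqP; rewrite -memv_ker kq=> /vlineP[l ->]; exists l.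
have cP1: (#|P| <= 1 + #|P1|)%N.
  rewrite -(cardsID P1 P) addnC; apply: leq_add; last exact/subset_leq_card/subsetIr.
  apply/card_le1_eqP=> e e'; rewrite !inE=> /andP[e1 eP] /andP[e1' e'P].
  rewrite eP e'P /= !negbK in e1 e1'.
  have [[l lE] [l' lE']] := (on_e0 _ (eqP e1), on_e0 _ (eqP e1')).
  apply: (Pinj e' e (l' / l) e'P eP); rewrite lE lE' scalerA mulfVK //.
  by apply: contraNneq (P0 e eP)=> l0; rewrite lE l0 scale0r.
have [rp [simP' rpP]]: exists rp, simple_on (q <$> u) (rp @: P1) /\
    forall e, e \in P1 -> rp e \in P1 /\ exists2 k, k != 0 & q (u e) = k *: q (u (rp e)).
  by apply: ex_reps=> e; rewrite inE=> /andP[].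
have /(fin_choice_in 0)[m mP] e: e \in P1 ->
    exists m, exists2 k, k != 0 & u e = k *: (u (rp e) + m *: u e0).
  case/rpP=> _ [k k0 qE].
  have [l lE]: exists l, u e - k *: u (rp e) = l *: u e0.
    by apply: on_e0; rewrite linearB linearZ /= qE subrr.
  exists (l / k), k; rewrite // scalerDr scalerA mulrC mulfVK // -lE addrC.
  by rewrite subrK.
pose fib x := [set e in P1 | rp e == x].
have fibF x: (#|fib x| <= #|F|)%N.
  rewrite -(@card_in_imset _ _ m) ?max_card // => e e'; rewrite !inE.
  move=> /andP[eP /eqP re] /andP[e'P /eqP re'] mm.
  have [k k0 uE]: exists2 k, k != 0 & u e = k *: (u (rp e) + m e *: u e0).
    by apply: mP; rewrite inE.
  have [k' k'0 uE']: exists2 k, k != 0 & u e' = k *: (u (rp e') + m e' *: u e0).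
    by apply: mP; rewrite inE.
  apply: (Pinj e e' (k / k')); rewrite ?P1P ?inE //.
  by rewrite uE uE' re re' mm scalerA mulfVK.
have P'1 x: x \in rp @: P1 -> x \in P1 by case/imsetP=> e /rpP[+ _] ->.
pose Q := [set x in rp @: P1 | (1 < #|fib x|)%N].
exists (rp @: P1), Q; split=> //; first by apply/subsetP=> x /P'1/P1P.
- by apply/subsetP=> x; rewrite inE=> /andP[].
- move=> x; rewrite inE=> /andP[/P'1 xP /card_gt1P[e1 [e2 [f1 f2 e12]]]].
  have [e [ef ex]]: exists e, e \in fib x /\ e != x.
    by have [e1x|] := eqVneq e1 x; [exists e2; split; rewrite // -e1x eq_sym|exists e1].
  move: ef; rewrite inE=> /andP[eP /eqP re]; have [k k0 uE] := mP e eP.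
  have m0: m e != 0.
    apply: contraNneq ex=> m0; apply/eqP/(Pinj e x k); rewrite ?P1P //.
    by rewrite uE m0 re scale0r addr0.
  exists (m e)^-1; rewrite ?invr_eq0 //; exists e, (k * m e); rewrite mulf_neq0 //.
  by rewrite uE re [X in _ = X]scalerDr !scalerA mulfK // scalerDr scalerA.
apply: leq_trans cP1 _; rewrite -addnA leq_add2l.
rewrite -(@sum_fibers _ _ P1 rp (rp @: P1))=> [|e]; last exact: imset_f.
rewrite mulnC -sum_nat_const -sum1_card.
have -> : (\sum_(x in Q) #|F| = \sum_(x in rp @: P1) if 1 < #|fib x| then #|F| else 0)%N.
  by rewrite -big_mkcondr; apply: eq_bigl=> x; rewrite [LHS]inE.
rewrite -big_split /=; apply: leq_sum=> x _; case: ltnP=> [_|]; last by rewrite addn0.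
by apply: leq_trans (fibF x) (leq_addl _ _).
Qed.

(** * Quadratic bounds without large cliques *)

Section SumsOfSubspaces.
Variables (F : fieldType) (vT : vectType F) (T : finType) (V : T -> {vspace vT}).
Implicit Types (J N : {set T}).

Definition sumV J : {vspace vT} := (\sum_(j in J) V j)%VS.

Lemma sumVU1 J j : (sumV (j |: J) = V j + sumV J)%VS.
Proof.
case: (boolP (j \in J))=> jJ; last by rewrite /sumV big_setU1.
rewrite setUC (setUidPl _) ?sub1set //.
by apply/esym/addv_idPr; rewrite /sumV (sumv_sup j).
Qed.

Lemma sumVS J N : J \subset N -> (sumV J <= sumV N)%VS.
Proof. by move=> /subsetP JN; apply/subv_sumP=> j /JN jN; apply: (sumv_sup j). Qed.

(* [J] maximizes [2 * d * \dim (sumV J) - #|J| * r]. *)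
Lemma ex_almost_spanning (d r : nat) : (0 < r)%N ->
  (forall j, (r <= d * \dim (V j))%N) -> (\dim (sumV [set: T]) <= r)%N ->
  exists J, (#|J| <= 2 * d)%N /\ forall j, j \notin J -> (r <= 2 * d * \dim (V j :&: sumV J))%N.
Proof.
move=> r0 le_rV dr; have sr J: (\dim (sumV J) <= r)%N.
  by apply: leq_trans dr; apply/dimvS/sumVS/subsetT.
pose m J := (2 * d * \dim (sumV J) + (#|T| - #|J|) * r)%N.
have [J _ Jmax] := @arg_maxnP _ set0 predT m isT; rewrite /m in Jmax; exists J; split.
  have := Jmax set0 isT; rewrite /sumV big_set0 dimv0 cards0 -/(sumV J)=> le0.
  rewrite -(leq_pmul2r r0); have := leq_mul (leqnn (2 * d)) (sr J).
  by have := max_card J; move: le0=> /=; nia.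
move=> j jJ; have := Jmax (j |: J) isT; rewrite /= cardsU1 jJ sumVU1.
have cJ: (#|J| < #|T|)%N.
  rewrite -cardsT; apply: proper_card; rewrite properT.
  by apply: contraNneq jJ=> ->; rewrite inE.
have := dimv_sum_cap (V j) (sumV J); have := le_rV j; nia.
Qed.

Lemma ex_jump (rho c : nat) J N : (#|J| * c < #|N|)%N ->
  (forall j, j \in N -> (#|J| * rho < \dim (V j :&: sumV J))%N) ->
  exists J' j0 N', [/\ N' \subset N, (c <= #|N'|)%N & forall j, j \in N' ->
      (rho + \dim (V j :&: sumV J') < \dim (V j :&: sumV (j0 |: J')))%N].
Proof.
move: {2}#|J| (erefl #|J|)=> m; elim: m J N=> [|m IH] J N cJ cN hN.
  have /set0Pn[j jN]: N != set0 by rewrite -card_gt0; apply: leq_ltn_trans cN.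
  have J0: J = set0 by apply/eqP; rewrite -cards_eq0 cJ.
  by have := hN j jN; rewrite J0 cards0 /sumV big_set0 capv0 dimv0.
have /set0Pn[j0 j0J]: J != set0 by rewrite -card_gt0 cJ.
have cJ': #|J :\ j0| = m by move: cJ; rewrite (cardsD1 j0) j0J=> -[].
pose N1 := [set j in N | \dim (V j :&: sumV (J :\ j0)) <= m * rho]%N.
have N1N: N1 \subset N by apply/subsetP=> j; rewrite inE=> /andP[].
have [cN1|cN1] := leqP c #|N1|.
  exists (J :\ j0), j0, N1; split=> // j; rewrite inE setD1K // => /andP[jN small].
  by apply: leq_ltn_trans (hN j jN); rewrite cJ mulSn leq_add2l.
have [||J' [j1 [N' [sN' cN' hN']]]] := IH (J :\ j0) (N :\: N1) cJ'.
- by rewrite cJ' cardsDS //; move: cN; rewrite cJ mulSn; lia.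
- by move=> j; rewrite !inE cJ'=> /andP[+ jN]; rewrite jN /= -ltnNge.
by exists J', j1, N'; split=> //; apply: subset_trans sN' (subsetDl _ _).
Qed.

End SumsOfSubspaces.

Lemma vspan_bigcup F (vT : vectType F) E T (v : E -> vT) (I : T -> {set E}) (J : {set T}) :
  vspan v (\bigcup_(j in J) I j) = sumV (fun j=> vspan v (I j)) J.
Proof.
apply: subv_anti; apply/andP; split.
  apply: vspan_sub=> e /bigcupP[j jJ eI]; apply: subvP (mem_vspan v eI).
  exact: (sumv_sup j).
by apply/subv_sumP=> j jJ; apply/vspanS/(bigcup_sup j).
Qed.

(* Modulo [vspan v Dc], many of the sets [I j] have rank larger than [rho] inside
the span of a part of a single one of them. *)
Lemma ex_common_overlap F (vT : vectType F) E T (v : E -> vT) (I : T -> {set E}) (d r c rho : nat) :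
  (0 < r)%N -> (forall j, (r <= d * vdim v (I j))%N) ->
  (vdim v (\bigcup_j I j) <= r)%N -> (4 * d ^ 2 * rho < r)%N -> (2 * d * c + 2 * d < #|T|)%N ->
  exists (Dc I0 : {set E}) (j0 : T) (N : {set T}), [/\ indep v Dc, I0 \subset I j0, (c <= #|N|)%N &
   forall f : 'End(vT), lker f = vspan v Dc -> indep (f <$> v) I0 /\
     forall j, j \in N -> (vspan (f <$> v) (I j) <= vspan (f <$> v) I0)%VS /\
       (rho < vdim (f <$> v) (I j))%N].
Proof.
move=> r0 dV dU small big; pose V j := vspan v (I j).
have dS: (\dim (sumV V [set: T]) <= r)%N.
  by rewrite -vspan_bigcup (eq_bigl (mem predT)) // => j; rewrite inE.
have [J0 [cJ0 hJ0]] := ex_almost_spanning r0 dV dS.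
have [||J' [j0 [N [_ cN jump]]]] := @ex_jump _ _ _ V rho c J0 (~: J0).
- by have := cardsC J0; have := leq_mul cJ0 (leqnn c); lia.
- move=> j; rewrite inE=> /hJ0 le;
  have: (2 * d * (#|J0| * rho) < 2 * d * \dim (V j :&: sumV V J0))%N.
    apply: leq_trans le; apply: leq_ltn_trans small.
    by have := leq_mul cJ0 (leqnn rho); nia.
  by rewrite ltn_mul2l=> /andP[].
have [D1 [sD1 iD1 spD1 _]] := ex_basis0 v (\bigcup_(j in J') I j).
have [J1 [D1J1 sJ1 iJ1 spJ1]] := ex_basis (subsetUl D1 (I j0)) iD1.
have [G [J1G sG iG spG]] := ex_basis (subsetUl J1 (\bigcup_(j in N) I j)) iJ1.
have {}spD1: vspan v D1 = sumV V J' by rewrite spD1 vspan_bigcup.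
have {}spJ1: vspan v J1 = sumV V (j0 |: J') by rewrite spJ1 vspanU spD1 sumVU1 addvC.
pose I0 := J1 :\: D1; have I0G: I0 \subset G by apply: subset_trans J1G; apply: subsetDl.
exists (G :\: I0), I0, j0, N; split=> //.
- exact: indepS (subsetDl _ _) iG.
- by apply/subsetP=> x; rewrite inE=> /andP[xD /(subsetP sJ1)]; rewrite inE (negPf xD).
move=> f kf; have GI0: G :\: (G :\: I0) = I0.
  by rewrite setDDr setDv set0U; apply/setIidPr.
have iI0 := indep_contract iG (subsetDl _ _) kf; rewrite GI0 in iI0; split=> // j jN.
have fG: (f @: vspan v G = vspan (f <$> v) I0)%VS.
  have GE: G = (G :\: I0) :|: I0 by rewrite setUC -[LHS](setID G I0) (setIidPr I0G).
  rewrite vspan_lfun {1}GE vspanU limgD (_ : (f @: vspan v (G :\: I0))%VS = 0%VS) ?add0v //.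
  by apply/eqP; rewrite -lkerE kf subvv.
have VG: (V j <= vspan v G)%VS.
  by rewrite spG; apply/vspanS/subsetU; rewrite (bigcup_sup j) ?orbT.
split; first by rewrite -fG vspan_lfun limgS.
apply: (@leq_trans (\dim (f @: (V j :&: vspan v J1))%VS)); last first.
  by rewrite vspan_lfun dimvS ?limgS ?capvSl.
have := limg_ker_dim f (V j :&: vspan v J1); have := jump j jN; rewrite -spD1 -spJ1 kf -capvA.
rewrite (vspan_cap iG J1G (subsetDl _ _)).
have -> : J1 :&: (G :\: I0) = D1; last by lia.
apply/setP=> x; rewrite !inE; case: (boolP (x \in J1))=> xJ /=; last first.
  by apply/esym/negP=> /(subsetP D1J1); rewrite (negPf xJ).
by rewrite (subsetP J1G _ xJ) !andbT negbK.
Qed.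

Lemma bipartite_point_clique F (vT uT : vectType F) E T
  (u : E -> vT) (n : nat) (p : 'Hom(vT, uT)) (A : {set E}) (B : {set T}) (w : T -> vT) :
  indep (p <$> u) A -> (forall t, t \in B -> p (w t) = 0) ->
  (forall z t, z \in A -> t \in B -> is_point u (u z - w t)) ->
  (2 * mader_const n < #|A|)%N -> (2 * mader_const n < vdim (lift1 w) B)%N -> has_clique n.+1 u.
Proof.
move=> iA pw pts cA; have [B' [/subsetP B'B iB _ <-]] := ex_basis0 (lift1 w) B=> cB.
pose f := (p \o linfun fst : 'Hom((vT * F^o)%type, uT))%VF.
have fE x: f x = p x.1 by rewrite comp_lfunE lfunE.
have iS: indep (lift1 (glue u w)) (inl @: A :|: inr @: B').
  apply: (indep_ker_ext (f:=f)).
  - rewrite /indep -(vspan_imset (fun x=> f (lift1 (glue u w) x))) card_imset; last by move=>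
    ? ? [].
    by rewrite (eq_vspan (u:=fun z=> p (u z))) // => z; rewrite fE.
  - by rewrite /indep -vspan_imset card_imset // => ? ? [].
  by move=> _ /imsetP[t tB ->]; rewrite fE /= pw ?B'B.
apply: (bipartite_graph_clique _ iS (D:=setX A B')).
- have /set0Pn[z zA]: A != set0 by rewrite -card_gt0; apply: leq_ltn_trans cA.
  by apply/set0Pn; exists (inl z); rewrite inE imset_f.
- move=> [z t]; rewrite inE=> /andP[zA tB]; rewrite !inE !imset_f ?orbT //; split=> //.
  by have [e [k [k0 uE]]] := pts z t zA (B'B t tB); exists e, k.
rewrite cardsX; have le := leq_card_setU (inl @: A) (inr @: B' : {set E + T}).
rewrite !card_imset in le; [|by move=> ? ? []|by move=> ? ? []].
apply: leq_trans (leq_mul (leqnn _) le) _.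
by move: (mader_const n) cA cB le=> m cA cB _; nia.
Qed.

Lemma ex_overlap_modulo F (vT : vectType F) E T (u : E -> vT)
  (a : T -> E) (p : 'End(vT)) (I : T -> {set E}) (d r c rho : nat) :
  (0 < r)%N -> indep (u <$> a) [set: T] -> lker p = vspan (u <$> a) [set: T] ->
  (forall j, indep (p <$> u) (I j)) -> (forall j, (r <= d * #|I j|)%N) ->
  (vdim u (\bigcup_j I j) <= r)%N -> (4 * d ^ 2 * rho < r)%N -> (2 * d * c + 2 * d < #|T|)%N ->
  exists (Dc : {set E}) (f : 'End(vT)) (I0 : {set E}) (j0 : T) (N : {set T}),
  [/\ contracts u Dc f, indep (fun j=> f (u (a j))) [set: T], I0 \subset I j0, (c <= #|N|)%N &
   forall g : 'End(vT), lker g = vspan (fun j=> f (u (a j))) [set: T] ->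
     indep (fun e=> g (f (u e))) I0 /\ forall j, j \in N ->
       (vspan (fun e=> g (f (u e))) (I j) <= vspan (fun e=> g (f (u e))) I0)%VS /\
       (rho < vdim (fun e=> g (f (u e))) (I j))%N].
Proof.
move=> r0 ia kp iI cI dU rho_lt big.
have [||Dc [I0 [j0 [N [iDc I0I cN overlap]]]]] :=
  @ex_common_overlap _ _ _ _ (p <$> u) I d r c rho r0 _ _ rho_lt big.
- by move=> j; rewrite (eqP (iI j)).
- by rewrite vspan_lfun; apply: leq_trans dU; rewrite -(limg_ker_dim p (vspan u _)) leq_addl.
have [f cf kf] := ex_contraction u Dc; exists Dc, f, I0, j0, N; split=> //.
  by rewrite /indep vspan_lfun limg_dim_eq // kf -kp capvC (indep_cap_ker iDc).
move=> g kg; have [h kh] := ex_quotient (vspan (p <$> u) Dc).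
have rkE X: vdim (fun e=> g (f (u e))) X = vdim (fun e=> h (p (u e))) X.
  have kgf: lker (g \o f)%VF = (vspan u Dc + lker p)%VS.
    by rewrite (lker_comp_img (W:=lker p)) ?kf // kg kp -vspan_lfun.
  have khp: lker (h \o p)%VF = (lker p + vspan u Dc)%VS.
    by rewrite (lker_comp_img (W:=vspan u Dc)) // kh -vspan_lfun.
  have -> : vspan (fun e=> g (f (u e))) X = vspan (fun e=> (g \o f)%VF (u e)) X.
    by apply: eq_vspan=> e; rewrite comp_lfunE.
  have -> : vspan (fun e=> h (p (u e))) X = vspan (fun e=> (h \o p)%VF (u e)) X.
    by apply: eq_vspan=> e; rewrite comp_lfunE.
  by apply: rk_lker; rewrite kgf khp addvC.
have [iI0 {}overlap] := overlap h kh; split; first by rewrite /indep rkE.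
move=> j jN; have [sub rk_j] := overlap j jN; rewrite rkE; split=> //.
have /eqP -> : vspan (fun e=> g (f (u e))) I0 == vspan (fun e=> g (f (u e))) (I j :|: I0).
  by rewrite eqEdim vspanS ?subsetUr //= !rkE vspanU (addv_idPr sub) leqnn.
exact/vspanS/subsetUl.
Qed.

Definition apex F (vT : vectType F) E (u : E -> vT) (e : E) (I : {set E}) : Prop :=
  indep u I /\ forall x, x \in I -> doubled_by u e x.

Lemma indep_reps F (vT : vectType F) E (v : E -> vT) (rp : E -> E) (Y : {set E}) :
  indep v Y -> (forall y, y \in Y -> exists2 k, k != 0 & v y = k *: v (rp y)) -> indep v (rp @: Y).
Proof.
move=> /eqP iY rpP; rewrite /indep eqn_leq vspan_card (leq_trans (leq_imset_card _ _)) //.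
rewrite -iY; apply/dimvS/vspan_sub=> y yY; have [k _ ->] := rpP y yY.
exact/rpredZ/mem_vspan/imset_f.
Qed.

(* Pairwise independent apexes [a j] share most of the points that they double, so by
pigeonhole many points [u z] carry the same translates by combinations of the [a j]. *)
Section CommonApexPoints.
Variables (F : finFieldType) (vT uT : vectType F) (E : finType) (u : E -> vT) (M n : nat).
Variables (a : 'I_M -> E) (p : 'Hom(vT, uT)) (N : {set 'I_M}) (Y : 'I_M -> {set E}).
Hypothesis ia : indep (u <$> a) [set: 'I_M].
Hypothesis kp : lker p = vspan (u <$> a) [set: 'I_M].
Hypothesis iY : forall j, indep (p <$> u) (Y j).
Hypothesis dblY : forall j y, j \in N -> y \in Y j -> doubled_by u (a j) y.
Variables (A : {set E}) (rp : E -> E) (r : nat).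
Hypothesis rpA : forall j y, j \in N -> y \in Y j ->
  rp y \in A /\ exists2 k, k != 0 & p (u y) = k *: p (u (rp y)).

Let comb (s : {ffun 'I_M -> F}) : vT := \sum_j s j *: u (a j).
Let pattern : Type := ({ffun 'I_M -> F} * F)%type.
Let nn := (2 * mader_const n).+1.

Let p_comb s : p (comb s) = 0.
Proof.
apply/eqP; rewrite -memv_ker kp; apply: rpred_sum=> j _.
by rewrite rpredZ // (mem_vspan (u <$> a)) ?inE.
Qed.

Let ex_pattern j z : j \in N -> z \in rp @: Y j -> exists d : pattern,
  [/\ d.2 != 0, is_point u (u z + comb d.1) & is_point u (u z + comb d.1 + d.2 *: u (a j))].
Proof.
move=> jN /imsetP[y yY ->]; have [_ [k k0 pE]] := rpA jN yY.
have /mem_vspanP[s sE]: u y - k *: u (rp y) \in vspan (u <$> a) [set: 'I_M].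
  by rewrite -kp memv_ker linearB linearZ /= pE subrr.
pose d := [ffun j=> s j / k]; have uE: u y = k *: (u (rp y) + comb d).
  rewrite -[LHS](subrK (k *: u (rp y))) sE addrC scalerDr; congr (_ + _).
  rewrite scaler_sumr; apply: eq_big=> [i|i _]; first by rewrite inE.
  by rewrite ffunE scalerA mulrC mulfVK.
have [m m0 [e [l [l0 eE]]]] := dblY jN yY.
exists (d, (m * k)^-1); split=> /=; first by rewrite invr_eq0 mulf_neq0.
  by exists y, k.
exists e, (l * (m * k)); rewrite !mulf_neq0 //; split=> //; rewrite eE uE -scalerA; congr (_ *: _).
by rewrite [RHS]scalerDr !scalerA mulfV ?mulf_neq0 // scale1r.
Qed.

Let shared z := [set j in N | z \in rp @: Y j].

Let big := [set z in A | nn <= #|shared z|]%N.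

Let card_big : (nn * #|A| + r <= \sum_(j in N) #|Y j|)%N -> (r <= M * #|big|)%N.
Proof.
move=> le; have cY: (\sum_(j in N) #|Y j| <= \sum_(z in A) #|shared z|)%N.
  rewrite -(sum_card_exchange N A (fun j z=> z \in rp @: Y j)).
  apply: leq_sum=> j jN; rewrite -(@card_in_imset _ _ rp (Y j)).
    apply/subset_leq_card/subsetP=> _ /imsetP[y yY ->]; rewrite inE imset_f // andbT.
    by have [] := rpA jN yY.
  move=> y y' yY y'Y rr; have [_ [k k0 pE]] := rpA jN yY; have [_ [k' k'0 pE']] := rpA jN y'Y.
  by apply: (indep_inj (k:=k / k') (iY j) yY y'Y); rewrite pE pE' rr scalerA mulfVK.
have cA: (\sum_(z in A) #|shared z| <= nn * #|A| + M * #|big|)%N.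
  rewrite mulnC -sum_nat_const mulnC -sum_nat_const (big_setID big) /= addnC.
  apply: leq_add.
    apply: leq_trans (_ : \sum_(z in A :\: big) nn <= _)%N; last first.
      by rewrite !sum_nat_const leq_mul2r subset_leq_card ?orbT // subsetDl.
    by apply: leq_sum=> z; rewrite !inE=> /andP[+ zA]; rewrite zA /= -ltnNge=> /ltnW.
  have -> : A :&: big = big by apply/setIidPr/subsetP=> z; rewrite inE=> /andP[].
  by apply: leq_sum=> z _; rewrite -[X in (_ <= X)%N](card_ord M) max_card.
by rewrite -(leq_add2l (nn * #|A|)); apply: leq_trans le (leq_trans cY cA).
Qed.

Let ex_patterns : exists d : E * 'I_M -> pattern, forall z j, j \in shared z ->
  [/\ (d (z, j)).2 != 0, is_point u (u z + comb (d (z, j)).1) &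
   is_point u (u z + comb (d (z, j)).1 + (d (z, j)).2 *: u (a j))].
Proof.
have [|d dP] := @fin_choice_in _ pattern ([ffun=> 0], 0)
    [set zj : E * 'I_M | zj.2 \in shared zj.1] (fun zj d=> [/\ d.2 != 0,
  is_point u (u zj.1 + comb d.1) & is_point u (u zj.1 + comb d.1 + d.2 *: u (a zj.2))]).
  by case=> z j; rewrite !inE=> /andP[jN zY]; apply: ex_pattern.
by exists d=> z j zj; apply: (dP (z, j)); rewrite inE.
Qed.

Let pa j : p (u (a j)) = 0.
Proof. by apply/eqP; rewrite -memv_ker kp (mem_vspan (u <$> a)) ?inE. Qed.

Let rank_lifts (w : 'I_M * bool -> vT) (c : 'I_M -> F) (J : {set 'I_M}) :
  (forall j, w (j, false) - w (j, true) = c j *: u (a j)) ->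
  (forall j, j \in J -> c j != 0) -> (#|J| <= vdim (lift1 w) [set q | q.1 \in J])%N.
Proof.
move=> wE c0; pose diff j : vT * F^o := lift1 w (j, false) - lift1 w (j, true).
have idiff: indep diff J.
  have iJ: indep (u <$> a) J := indepS (subsetT _) ia.
  apply: (@indep_lfun _ _ _ _ _ (linfun fst)); apply: indepP=> b s0 j jJ.
  apply/eqP; rewrite -[_ == 0](orbF) -(negPf (c0 j jJ)) -mulf_eq0.
  apply/eqP/(indep_coef (c:=fun j=> b j * c j) iJ)=> //.
  rewrite -[RHS]s0; apply: eq_bigr=> i _; rewrite -scalerA -wE; congr (_ *: _).
  by rewrite lfunE.
rewrite -(eqP idiff); apply/dimvS/vspan_sub=> j jJ.
by rewrite rpredB //; apply: mem_vspan; rewrite inE.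
Qed.

Lemma common_apex_clique : (0 < M)%N -> (M * nn * #|{ffun 'I_M -> option pattern}| < r)%N ->
  (nn * #|A| + r <= \sum_(j in N) #|Y j|)%N -> has_clique n.+1 u.
Proof.
move=> M0 rbig /card_big cbig; have [d dP] := ex_patterns.
pose type z : {ffun 'I_M -> option pattern} :=
  [ffun j=> if j \in shared z then Some (d (z, j)) else None].
have [t0 cZ]: exists t0, (nn < #|[set z in big | type z == t0]|)%N.
  apply: pigeonhole; rewrite -(ltn_pmul2l M0) mulnA; exact: leq_trans rbig cbig.
set Z := [set z in big | _] in cZ.
have [z0 z0Z]: exists z, z \in Z by apply/set0Pn; rewrite -card_gt0; apply: leq_ltn_trans cZ.
have ZP z: z \in Z -> [/\ z \in A, (nn <= #|shared z|)%N & type z = t0].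
  by rewrite !inE=> /andP[/andP[-> ->] /eqP].
have [_ cJ t0E] := ZP z0 z0Z; pose J := shared z0.
have same z j: z \in Z -> j \in J -> j \in shared z /\ d (z, j) = d (z0, j).
  case/ZP=> _ _ zt jJ; have := congr1 (fun t : {ffun _}=> t j) (etrans zt (esym t0E)).
  by rewrite !ffunE jJ; case: ifP=> // _ [].
pose w (q : 'I_M * bool) := - (comb (d (z0, q.1)).1 +
  (if q.2 then (d (z0, q.1)).2 *: u (a q.1) else 0)).
apply: (@bipartite_point_clique _ _ _ _ _ u n p Z [set q | q.1 \in J] w).
- have /set0Pn[j1 j1J]: J != set0 by rewrite -card_gt0; apply: leq_trans cJ.
  have j1N: j1 \in N by move: j1J; rewrite inE=> /andP[].
  apply: indepS (indep_reps (rp:=rp) (iY j1) _).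
    by apply/subsetP=> z zZ; have [] := same z j1 zZ j1J; rewrite inE=> /andP[].
  by move=> y yY; have [] := rpA j1N yY.
- move=> q _; rewrite linearN linearD /= p_comb add0r; case: q.2; rewrite ?linear0 ?oppr0 //.
  by rewrite linearZ /= pa scaler0 oppr0.
- move=> z [j b] zZ; rewrite inE /= => jJ; have [jz dE] := same z j zZ jJ.
  have [_ pt1 pt2] := dP z j jz; rewrite dE in pt1 pt2.
  by rewrite /w opprK /=; case: b; rewrite ?addr0 // addrA.
- exact: ltnW.
apply: leq_trans cJ (rank_lifts (c:=fun j=> (d (z0, j)).2) _ _)=> j.
  by rewrite /w /= addr0 opprK addKr.
by case/dP.
Qed.

End CommonApexPoints.

Section Growth.
Variables (F : finFieldType) (al : F) (n : nat).
Implicit Types vT uT : vectType F.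
Hypotheses (F4 : #|F| = 4%N) (alE : al ^+ 2 = al + 1).
Let nn := (2 * mader_const n).+1.
Let La := doubled_const n.

Definition clique_free vT E (u : E -> vT) : Prop := rep_char3 u /\ ~ has_clique n.+1 u.

Lemma clique_free_contract vT uT E (u : E -> vT) (D : {set E}) (f : 'Hom(vT, uT)) :
  contracts u D f -> clique_free u -> clique_free (f <$> u).
Proof.
move=> cf [r3 noK]; split; first exact: rep_char3_contract cf r3.
by move=> clq; apply: noK; apply: has_clique_contract cf clq.
Qed.

Lemma sub_apexes (D M : nat) vT E (u : E -> vT) (P : {set E}) (r : nat) :
  (2 * D * M < r)%N -> P != set0 ->
  (forall e, e \in P -> exists I, [/\ apex u e I, I \subset P & (r <= D * #|I|)%N]) ->
  exists (a : 'I_M -> E) (p : 'End(vT)) (I : 'I_M -> {set E}),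
  [/\ indep (u <$> a) [set: 'I_M], lker p = vspan (u <$> a) [set: 'I_M],
  forall j, I j \subset P /\ (forall x, x \in I j -> doubled_by u (a j) x),
  forall j, indep (p <$> u) (I j) & forall j, (r <= 2 * D * #|I j|)%N].
Proof.
move=> rbig /set0Pn[e1 e1P] PI; have [I1 [[iI1 _] I1P cI1]] := PI e1 e1P.
have MI1: (M <= #|I1|)%N.
  have D0: (0 < D)%N by case: (D) cI1 rbig=> //; rewrite mul0n; lia.
  by rewrite -(leq_pmul2l D0); apply: leq_trans cI1; apply: leq_trans (ltnW rbig);
    rewrite leq_mul2r leq_pmull ?orbT.
pose a (j : 'I_M) := nth e1 (enum I1) j.
have lt_j (j: 'I_M) : (j < size (enum I1))%N by rewrite -cardE; apply: leq_trans (ltn_ord j) MI1.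
have aI j: a j \in I1 by rewrite -mem_enum mem_nth.
have a_inj: injective a.
  by move=> i j /eqP; rewrite nth_uniq ?enum_uniq // => /eqP/val_inj.
have ia: indep (u <$> a) [set: 'I_M].
  rewrite /indep (vspan_imset u) -(card_imset _ a_inj).
  by apply: indepS iI1; apply/subsetP=> _ /imsetP[j _ ->].
have [p kp] := ex_quotient (vspan (u <$> a) [set: 'I_M]).
have /fin_all_exists[I IP] j: exists I : {set E}, [/\ I \subset P,
    forall x, x \in I -> doubled_by u (a j) x, indep (p <$> u) I & (r <= 2 * D * #|I|)%N].
  have [I [[iI dbl] sI cI]] := PI (a j) (subsetP I1P _ (aI j)).
  have [J [JI iJ _ cJ]] := ex_basis0 (p <$> u) I; exists J; split=> //.
  - exact: subset_trans JI sI.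
  - by move=> x /(subsetP JI)/dbl.
  have dS: \dim (lker p) = M by rewrite kp (eqP ia) cardsT card_ord.
  have := limg_ker_dim p (vspan u I); rewrite (eqP iI) cJ vspan_lfun.
  have := dimvS (capvSr (vspan u I) (lker p)); rewrite dS; nia.
exists a, p, I; split=> // j; have [sI dbl iI cI] := IP j; by [].
Qed.

Lemma many_apexes (D c M : nat) vT E (u : E -> vT) (P : {set E}) (r : nat) :
  c = (4 * (2 * D) ^ 2 * (nn * La + 1))%N -> (2 * (2 * D) * c + 2 * (2 * D) < M)%N ->
  clique_free u -> (vdim u P <= r)%N ->
  (2 * D * M + M * nn * #|{ffun 'I_M -> option ({ffun 'I_M -> F} * F)}| < r)%N -> P != set0 ->
  (forall e, e \in P -> exists I, [/\ apex u e I, I \subset P & (r <= D * #|I|)%N]) -> False.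
Proof.
move=> cE ltM [r3 noK] dP rbig P0 PI.
have [|a [p [I [ia kp IP iI cI]]]] := @sub_apexes D M _ _ u P r _ P0 PI.
  by apply: leq_ltn_trans rbig; apply: leq_addr.
have M0: (0 < M)%N by apply: leq_ltn_trans ltM.
have r0: (0 < r)%N by apply: leq_ltn_trans rbig.
have D0: (0 < 4 * (2 * D) ^ 2)%N.
  by have := cI (Ordinal M0); case: (D)=> //; rewrite mul0n leqNgt r0.
pose rho := (r.-1 %/ (4 * (2 * D) ^ 2))%N.
have [rho_lt rho_ge]: (4 * (2 * D) ^ 2 * rho < r)%N /\ (r <= 4 * (2 * D) ^ 2 * rho.+1)%N.
  rewrite -(prednK r0) ltnS mulnC leq_trunc_div; split=> //.
  by rewrite mulnC ltn_ceil.
have [||Dc [fc [I0 [j0 [N [cfc ia1 I0I cN overlap]]]]]] :=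
  @ex_overlap_modulo _ _ _ _ u a p I (2 * D) r c rho r0 ia kp iI cI _ rho_lt.
- by apply: leq_trans dP; apply/dimvS/vspanS/bigcupsP=> j _; have [] := IP j.
- by rewrite card_ord.
pose u1 e := fc (u e); have [fa cfa kfa] := ex_contraction u1 (a @: [set~ j0]).
have [q kq] := ex_quotient <[fa (u1 (a j0))]>%VS; pose p1 := (q \o fa)%VF.
have kp1: lker p1 = vspan (u1 <$> a) [set: 'I_M].
  rewrite (lker_comp_img (W:=<[u1 (a j0)]>%VS)) ?limg_line // kfa -(vspan_imset u1 a).
  rewrite -[in RHS](setD1K (in_setT j0)) setTD vspanU addvC; congr (_ + _)%VS.
  by rewrite /vspan big_set1.
have p1E e: p1 (u1 e) = q (fa (u1 e)) by rewrite comp_lfunE.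
have [i1I0 {}overlap] := overlap p1 kp1.
have [Y YP] := fin_all_exists (fun j=> ex_basis0 (p1 <$> u1) (I j)).
pose U := \bigcup_(j in N) Y j.
have [|rp [simA rpP]] := @ex_reps _ _ _ (p1 <$> u1) U.
  by move=> y /bigcupP[j _ yY]; have [_ iY _ _] := YP j; apply: indep_neq0 iY yY.
have cA: (#|rp @: U| <= La * r)%N.
  apply: (@leq_trans (La * #|I0|)); last first.
    rewrite leq_mul2l (leq_trans _ dP) ?orbT // -(eqP (indep_lfun (indep_lfun i1I0))).
    by apply/dimvS/vspanS/(subset_trans I0I); have [] := IP j0.
  apply: (doubled_bound (u:=fun e=> fa (u1 e)) (e0:=a j0) F4 alE _ _ kq)=> //.
  - exact/(rep_char3_contract cfa)/(rep_char3_contract cfc).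
  - by move=> /(has_clique_contract cfa)/(has_clique_contract cfc).
  - rewrite -memv_ker kfa -(vspan_imset u1 a); have := indep_notin ia1 (in_setT j0).
    by rewrite setTD.
  - by rewrite /indep (eq_vspan (u:=fun e=> p1 (u1 e))) // => e; rewrite p1E.
  - move=> x /(subsetP I0I) xI; apply/doubled_by_lfun/doubled_by_lfun.
    by have [_ dbl] := IP j0; apply: dbl.
  - by split=> [e|e e' k]; rewrite -!p1E; [apply: simA.1|apply: simA.2].
  move=> _ /imsetP[y yU ->]; have [/bigcupP[j jN rY] _] := rpP y yU.
  rewrite -p1E (eq_vspan (u:=fun e=> p1 (u1 e)))=> [|e]; last by rewrite p1E.
  apply: subvP (overlap j jN).1 _ _; apply: (mem_vspan (p1 <$> u1)).
  by have [/subsetP sub _ _ _] := YP j; apply: sub.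
apply/noK/(has_clique_contract cfc).
apply: (@common_apex_clique _ _ _ _ u1 M n a p1 N Y ia1 kp1 _ _ (rp @: U) rp r).
- by move=> j; have [] := YP j.
- move=> j y jN yY; apply: doubled_by_lfun; have [_ dbl] := IP j; apply: dbl.
  by have [/subsetP sub _ _ _] := YP j; apply: sub.
- move=> j y jN yY; have yU: y \in U by apply/bigcupP; exists j.
  by split; [apply: imset_f|have [_ [k k0 kE]] := rpP y yU; exists k].
- exact: M0.
- by apply: leq_trans rbig; rewrite ltnS leq_addl.
apply: (@leq_trans (c * rho.+1)).
  rewrite cE; have := leq_mul (leqnn nn) cA; have := leq_mul (leqnn (nn * La + 1)) rho_ge.
  by rewrite [X in (_ <= X -> _)%N]mulnCA !mulnA mulnDl mul1n -!mulnA; lia.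
apply: (@leq_trans (\sum_(j in N) rho.+1)); first by rewrite sum_nat_const leq_mul2r cN orbT.
apply: leq_sum=> j jN; have [_ _ _ ->] := YP j.
by have [] := overlap j jN.
Qed.

Lemma contract_point vT E (u : E -> vT) (P : {set E}) e :
  clique_free u -> simple_on u P -> e \in P -> exists (I P' : {set E}) (q : 'End(vT)),
  [/\ apex u e I /\ I \subset P, clique_free (q <$> u) /\ simple_on (q <$> u) P',
      (vdim (q <$> u) P' < vdim u P)%N, (#|I| <= vdim u P)%N &
      (#|P| <= 1 + #|P'| + 4 * La * #|I|)%N].
Proof.
move=> cfu simP eP; have e0 := simP.1 e eP; have [q kq] := ex_quotient <[u e]>%VS.
have [P' [Q [P'P simP' QP' dbl cP]]] := ex_simple_contraction simP e0 kq.
have [I [IQ iI spI cI]] := ex_basis0 (q <$> u) Q.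
have dblI x: x \in I -> doubled_by u e x by move/(subsetP IQ)/dbl.
have IP: I \subset P := subset_trans IQ (subset_trans QP' P'P).
exists I, P', q; split=> //.
- by split=> //; split=> //; apply: indep_lfun iI.
- split=> //; apply: clique_free_contract cfu; apply: (contracts_ker (D:=[set e])).
  by rewrite kq /vspan big_set1.
- rewrite vspan_lfun; apply: leq_ltn_trans (dimvS (limgS q (vspanS u P'P))) _.
  rewrite -(limg_ker_dim q (vspan u P)) -[X in (X < _)%N]add0n ltn_add2r kq.
  by rewrite (capv_idPr _) ?dim_vline ?e0 // -memvE mem_vspan.
- by rewrite -(eqP (indep_lfun iI)); apply/dimvS/vspanS.
apply: leq_trans cP _; rewrite leq_add2l F4 -mulnA leq_mul2l /=.
apply: (doubled_bound F4 alE cfu.1 cfu.2 kq e0 iI dblI (simple_onS QP' simP')).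
by move=> y yQ; rewrite spI (mem_vspan (q <$> u)).
Qed.

Lemma clique_free_quadratic vT E (u : E -> vT) (P : {set E}) r :
  clique_free u -> simple_on u P -> (vdim u P <= r)%N -> (#|P| <= (1 + 4 * La) * r ^ 2)%N.
Proof.
elim: r u P=> [|r IH] u P cfu simP dP; have [->|[e eP]] := set_0Vmem P; rewrite ?cards0 //.
  have := mem_vspan u eP; move: dP (simP.1 e eP).
  by rewrite leqn0 dimv_eq0=> /eqP->; rewrite memv0=> /negPf->.
have [I [P' [q [_ [cfq simP'] dP' cI cP]]]] := contract_point cfu simP eP.
have := IH _ _ cfq simP' (leq_trans dP' dP : (_ <= r)%N).
have := leq_mul (leqnn (4 * La)%N) (leq_trans cI dP).
rewrite !mulnDl !mul1n; move: cP; move: (4 * La)%N #|P| #|P'| #|I| => t m m' i; nia.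
Qed.

Let D := (64 * La + 1)%N.

Definition many_apex_family vT E (u : E -> vT) (P : {set E}) (r : nat) : Prop :=
  [/\ clique_free u, simple_on u P, (vdim u P <= r)%N, P != set0 &
   forall e, e \in P -> exists I, [/\ apex u e I, I \subset P & (r <= D * #|I|)%N]].

Lemma contract_points r j vT E (u : E -> vT) (P : {set E}) :
  (16 <= r)%N -> (j <= r)%N -> clique_free u -> simple_on u P -> (vdim u P <= r)%N ->
  (exists (u' : E -> vT) (P' : {set E}), [/\ clique_free u', simple_on u' P',
     (vdim u' P' <= r - j)%N & (8 * #|P| <= 8 * #|P'| + j * r)%N]) \/
  exists (u' : E -> vT) (P' : {set E}), many_apex_family u' P' r.
Proof.
move=> r16; elim: j=> [|j IH] jr cfu simP dP.
  by left; exists u, P; rewrite subn0; split=> //; lia.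
case: (IH (ltnW jr) cfu simP dP)=> [[u' [P' [cfu' simP' dP' cP']]]|]; last by right.
have [P0|/set0Pn[e0 e0P]] := eqVneq P' set0.
  left; exists u', set0; split=> //; first by split=> [e|e e' k]; rewrite inE.
    by rewrite /vspan big_set0 dimv0.
  by move: cP'; rewrite P0 cards0 mulSn; lia.
have [good|[e [I [P2 [q [eP [_ [cfq simP2] dP2 _ cP2] small]]]]]] :
    (forall e, e \in P' -> exists I, [/\ apex u' e I, I \subset P' & (r <= D * #|I|)%N]) \/
    exists e (I P2 : {set E}) (q : 'End(vT)), [/\ e \in P', [/\ apex u' e I /\ I \subset P',
        clique_free (q <$> u') /\ simple_on (q <$> u') P2,
        (vdim (q <$> u') P2 < vdim u' P')%N, (#|I| <= vdim u' P')%N &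
        (#|P'| <= 1 + #|P2| + 4 * La * #|I|)%N] & (D * #|I| < r)%N].
- apply: NNPP=> none; case: (none); left=> e eP.
  have [I [P2 [q qP]]] := contract_point cfu' simP' eP; have [[apI IP] _ _ _ _] := qP.
  have [big|small] := leqP r (D * #|I|); first by exists I.
  by case: none; right; exists e, I, P2, q.
- right; exists u', P'; split=> //; first by apply: leq_trans dP' (leq_subr _ _).
  by apply/set0Pn; exists e0.
left; exists (q <$> u'), P2; split=> //; first by move: (leq_trans dP2 dP'); lia.
move: cP' cP2 small; rewrite /D mulnDl -!mulnA; move: (La * #|I|)%N=> t; lia.
Qed.

Definition eventually_sparse (m : nat) : Prop := exists r0, forall r, (r0 <= r)%N ->
  forall vT E (u : E -> vT) (P : {set E}),
  clique_free u -> simple_on u P -> (vdim u P <= r)%N -> (16 * #|P| < m * r ^ 2)%N.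

Fact contraction_ratio (k j s m m' : nat) : (4 <= k)%N -> (s < 4)%N -> (4 <= j)%N ->
  (k * (4 * j + s) ^ 2 <= 16 * m)%N -> (8 * m <= 8 * m' + j * (4 * j + s))%N ->
  (k.+1 * (3 * j + s) ^ 2 <= 16 * m')%N.
Proof.
move=> k4 s4 j4 big step.
suff: (k.+1 * (3 * j + s) ^ 2 + 2 * (j * (4 * j + s)) <= k * (4 * j + s) ^ 2)%N by lia.
have ss: (s * s <= j * j)%N by apply: leq_mul; lia.
have [k' ->]: exists k', k = (4 + k')%N by exists (k - 4)%N; lia.
rewrite -!mulnn; nia.
Qed.

Lemma no_many_apex_family : exists r0, forall r, (r0 <= r)%N ->
  forall vT E (u : E -> vT) (P : {set E}), ~ many_apex_family u P r.
Proof.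
eexists=> r ler vT E u P [cfu _ dP P0 PI].
by apply: (many_apexes erefl (ltnSn _) cfu dP _ P0 PI); apply: ler.
Qed.

(* Contracting [r %/ 4] points trades density [k / 16] for density [k.+1 / 16]. *)
Lemma eventually_sparse_pred k : (4 <= k)%N -> eventually_sparse k.+1 -> eventually_sparse k.
Proof.
move=> k4 [R1 sparse1]; have [R2 no_apexes] := no_many_apex_family.
exists (16 + 2 * R1 + R2)%N=> r ler vT E u P cfu simP dP.
have rE := divn_eq r 4; have ltr := ltn_pmod r (isT : (0 < 4)%N).
rewrite ltnNge; apply/negP=> big; have r16: (16 <= r)%N by lia.
have [[u' [P' [cfu' simP' dP' cP']]]|[u' [P' fam]]] :=
  contract_points r16 (leq_div r 4) cfu simP dP; last first.
  by apply: (no_apexes r _ _ _ u' P')=> //; lia.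
have := sparse1 (r - r %/ 4)%N _ _ _ u' P' cfu' simP' dP'; rewrite ltnNge=> /(_ _)/negP[].
  by lia.
move: big cP' rE ltr r16; move: (r %/ 4)%N (r %% 4)%N #|P| #|P'| => j s m m' big cP' rE ltr r16.
have -> : (r - j = 3 * j + s)%N by lia.
have rjs: r = (4 * j + s)%N by lia.
apply: (contraction_ratio (m:=m)); rewrite -?rjs //; lia.
Qed.

Lemma clique_free_sparse : exists r0, forall r, (r0 <= r)%N ->
  forall vT E (u : E -> vT) (P : {set E}),
  rep_char3 u -> ~ has_clique n.+1 u -> simple_on u P -> (vdim u P <= r)%N -> (4 * #|P| < r ^ 2)%N.
Proof.
have sparse0: eventually_sparse (4 + (16 * (1 + 4 * La) + 1)).
  exists 1%N=> r r1 vT E u P cfu simP dP; have := clique_free_quadratic cfu simP dP.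
  have: (0 < r ^ 2)%N by rewrite expn_gt0 r1.
  move: (r ^ 2)%N (1 + 4 * La)%N=> x t; nia.
have [R sparse4]: eventually_sparse (4 + 0).
  elim: (_ + 1)%N sparse0=> [//|m IH] sparse; apply/IH/eventually_sparse_pred.
    exact: leq_addr.
  by rewrite -addnS.
exists R=> r ler vT E u P r3 noK simP dP; have := sparse4 r ler vT E u P (conj r3 noK) simP dP.
by rewrite addn0; lia.
Qed.

End Growth.

(** * Templates whose members are representable in characteristic 3 *)

Definition frame_cfg F (wT : vectType F) (R P Q : finType) (p : P -> wT)
  (q : Q -> wT) (t : R * R + (R * P + Q)) : framed F wT R :=
  match t with
  | inl (i, j) => (0, unit_vec i - unit_vec j)
  | inr (inl (i, x)) => (p x, unit_vec i)
  | inr (inr y) => (q y, 0) end.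

Lemma riso_refl F E (U : repmatroid F E) : riso U U.
Proof.
exists id, (fun=> 1); split=> [|e|u]; [by exists id|exact: oner_neq0|].
by rewrite (_ : finfun _ = u) //; apply/ffunP=> e; rewrite ffunE mul1r.
Qed.

Section NoDowling.
Variables (F : fieldType) (vT : vectType F) (E : finType) (v : E -> vT).

Lemma line_coord K (wT : vectType K) (w : E -> wT) (a b d : E) (k : F) :
  same_rk v w -> free [:: v a; v b] -> k != 0 -> v d = v a - k *: v b ->
  exists sx : K * K, [/\ sx.1 != 0, sx.2 != 0 & w d = sx.1 *: (w a - sx.2 *: w b)].
Proof.
move=> vw fr k0 dE.
have [ab ba]: v a \notin <[v b]>%VS /\ v b \notin <[v a]>%VS.
  have fr': free [:: v b; v a] by rewrite (perm_free (Y:=[:: v a; v b])) // (perm_catC [:: _]).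
  by move: fr fr'; rewrite !free_cons !span_seq1=> /andP[-> _] /andP[-> _].
have [da db]: v d \notin <[v a]>%VS /\ v d \notin <[v b]>%VS.
  split; rewrite dE; first by rewrite rpredBl ?memv_line // rpredZeq (negPf k0).
  by rewrite rpredBr // rpredZ ?memv_line.
rewrite -[<[_]>%VS]span_seq1 (same_rk_mem vw d [:: a]) /= span_seq1 in da.
rewrite -[<[_]>%VS]span_seq1 (same_rk_mem vw d [:: b]) /= span_seq1 in db.
have: w d \in <<map w [:: a; b]>>%VS.
  by rewrite -(same_rk_mem vw); apply/span2P; exists 1, (- k); rewrite dE scale1r scaleNr.
case/span2P=> s [l wd].
have s0: s != 0 by apply: contraNneq db=> s0; rewrite wd s0 scale0r add0r memvZ ?memv_line.
have l0: l != 0 by apply: contraNneq da=> l0; rewrite wd l0 scale0r addr0 memvZ ?memv_line.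
exists (s, - l / s); rewrite /= mulf_neq0 ?oppr_eq0 ?invr_eq0 //; split=> //.
by rewrite wd scalerBr scalerA mulrC mulfVK // scaleNr opprK.
Qed.

(* In characteristic 3 the multiplication table of a group of order 3 would force a
primitive cube root of unity. *)
Lemma no_dowling (a b c : E) (A B C : 'I_3 -> E) (g : F) : rep_char3 v ->
  free [:: v a; v b; v c] -> g ^+ 3 = 1 -> g != 1 ->
  (forall k, v (A k) = v a - g ^+ k *: v b) -> (forall k, v (B k) = v b - g ^+ k *: v c) ->
  (forall k, v (C k) = v a - g ^+ k *: v c) -> False.
Proof.
case=> K K3 [wT [w vw]] fr g3 g1 vA vB vC.
have gk0 (k: 'I_3) : g ^+ k != 0.
  by rewrite expf_neq0 //; apply: contra_eq_neq g3=> ->; rewrite expr0n eq_sym oner_eq0.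
have fw: free [:: w a; w b; w c] by rewrite -(same_rk_free vw [:: a; b; c]).
have fr_ab: free [:: v a; v b] by apply: (@catl_free _ _ [:: v c] [:: v a; v b]).
have fr_bc: free [:: v b; v c] by apply: (@catr_free _ _ [:: v a] [:: v b; v c]).
have fr_ac: free [:: v a; v c].
  apply: (@catr_free _ _ [:: v b] [:: v a; v c]); rewrite (perm_free (Y:=[:: v a; v b; v c])) //.
  by rewrite (perm_catCA [:: v b] [:: v a]).
have [X XP] := fin_all_exists (fun k=> line_coord vw fr_ab (gk0 k) (vA k)).
have [Y YP] := fin_all_exists (fun k=> line_coord vw fr_bc (gk0 k) (vB k)).
have [Z ZP] := fin_all_exists (fun k=> line_coord vw fr_ac (gk0 k) (vC k)).
have table (k l m: 'I_3) : g ^+ m = g ^+ k * g ^+ l -> (Z m).2 = (X k).2 * (Y l).2.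
  move=> gm; have: v (C m) \in <<map v [:: A k; B l]>>%VS.
    apply/span2P; exists 1, (g ^+ k); rewrite vC vA vB gm scale1r scalerBr scalerA.
    by rewrite addrA subrK.
  rewrite (same_rk_mem vw)=> /span2P[x [y]]; have [_ _ ->] := XP k; have [_ _ ->] := YP l.
  have [s0 _ ->] := ZP m=> wC.
  have [|e1 e2 e3] := elimT (free3P _ _ _) fw ((Z m).1 - x * (X k).1)
    (x * (X k).1 * (X k).2 - y * (Y l).1) (y * (Y l).1 * (Y l).2 - (Z m).1 * (Z m).2).
    apply/eqP; move/eqP: wC; rewrite -subr_eq0 !scalerBr !scalerBl !scalerA opprD !opprB.
    by rewrite [X in _ -> X == 0](AC (2*2*2) ((1*6)*((3*2)*(5*4)))).
  have {e1}sE := subr0_eq e1; have {e2}yE := subr0_eq e2; have {e3} := subr0_eq e3.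
  by rewrite -yE -sE -!mulrA=> /(mulfI s0).
pose i0 : 'I_3 := inord 0; pose i1 : 'I_3 := inord 1; pose i2 : 'I_3 := inord 2.
have [v0 v1 v2]: [/\ i0 = 0%N :> nat, i1 = 1%N :> nat & i2 = 2%N :> nat] by split; rewrite inordK.
have [[a0 x0 A0] [_ x1 A1] _] := And3 (XP i0) (XP i1) isT; have [_ y0 _] := YP i0.
have xy00: (Z i0).2 = (X i0).2 * (Y i0).2 by apply: table; rewrite v0 mulr1.
have xy21: (Z i0).2 = (X i2).2 * (Y i1).2 by apply: table; rewrite v0 v1 v2 -exprSr g3.
have xy01: (Z i1).2 = (X i0).2 * (Y i1).2 by apply: table; rewrite v0 v1 mul1r.
have xy10: (Z i1).2 = (X i1).2 * (Y i0).2 by apply: table; rewrite v0 v1 mulr1.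
have xy11: (Z i2).2 = (X i1).2 * (Y i1).2 by apply: table; rewrite v1 v2.
have xy20: (Z i2).2 = (X i2).2 * (Y i0).2 by apply: table; rewrite v0 v2 mulr1.
pose r := (X i1).2 / (X i0).2.
have x1E: (X i1).2 = r * (X i0).2 by rewrite mulfVK.
have y1E: (Y i1).2 = r * (Y i0).2.
  by apply: (mulfI x0); rewrite -xy01 xy10 x1E mulrCA mulrA.
have x2E: (X i2).2 = r ^+ 2 * (X i0).2.
  by apply: (mulIf y0); rewrite -xy20 xy11 x1E y1E; ring.
have r3: r ^+ 3 = 1.
  by apply: (mulIf (mulf_neq0 x0 y0)); rewrite [RHS]mul1r -[RHS]xy00 [RHS]xy21 x2E y1E; ring.
have /eqP: (r - 1) ^+ 3 = 0.
  have three: 3%:R = 0 :> K by apply: pcharf0.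
  have -> : (r - 1) ^+ 3 = r ^+ 3 - 1 - 3%:R * (r ^+ 2 - r) by ring.
  by rewrite r3 three mul0r subrr subr0.
rewrite expf_eq0 subr_eq0 /= => /eqP r1; rewrite r1 mul1r in x1E.
have: v (A i1) \in <<map v [:: A i0]>>%VS.
  rewrite (same_rk_mem vw) /= span_seq1 A1 A0 x1E; apply/vlineP.
  by exists ((X i1).1 / (X i0).1); rewrite scalerA mulfVK.
rewrite /= span_seq1=> /vlineP[k]; rewrite !vA v0 v1 expr0 expr1 scale1r scalerBr=> kE.
have [|k1 k2 _] := elimT (free3P _ _ _) fr (1 - k) (k - g) 0.
  rewrite scale0r addr0 !scalerBl scale1r addrACA [- _ + _]addrC addrACA.
  by rewrite kE -[k *: v b - _]opprB subrr.
by case/negP: g1; rewrite -(subr0_eq k2) -(subr0_eq k1).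
Qed.

End NoDowling.

Section Template.
Variables (F : finFieldType) (al : F).
Hypotheses (F4 : #|F| = 4%N) (alE : al ^+ 2 = al + 1).
Variable Phi : frame_template F.
Hypothesis tc : forall E (U : repmatroid F E), template_class Phi U -> char3_class U.
Local Notation X := (tX Phi).
Local Notation CY := (tC Phi + tY0 Phi + tY1 Phi)%type.

Local Notation span_tC h := (vspan (fun c : tC Phi=> h (inl (inl c))) [set: tC Phi]).

Let F2 := F4_char2 F4.

Lemma rep_char3_conforming (B E' T : finType) (iX : X -> B) (iE : CY -> E') (A : B -> E' -> F)
  (uT : vectType F) (f : 'Hom(vec F B, uT)) (s : T -> E') :
  mx_conforms iX iE A -> contracts (col_vec A) (colsC iE) f ->
  (forall t, s t \notin colsC iE :|: colsY1 iE) -> rep_char3 (fun t=> f (col_vec A (s t))).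
Proof.
move=> cA cf sT; pose U := rdelete (rcontract (row_space A) (colsC iE)) (val @^-1: colsY1 iE).
have r3: char3_class U by apply: tc; exists B, E', iX, iE, A; split=> //; apply: riso_refl.
have [g [d [ginj d0 gim rk]]] := template_rk cf (riso_refl U).
apply: (rep_char3_points (rep_char3_same (same_rk_sym rk) r3))=> t.
have [_ gt] := gim (s t); have [|e <-] := gt; last by exists e, (d e).
have := sT t; rewrite inE negb_or=> /andP[nC nY].
have tC: s t \in ~: colsC iE by rewrite inE.
by exists (exist _ (s t) tC); rewrite // inE.
Qed.

Section Universal.
Variables (R : finType) (dl : R -> vec F CY).
Hypothesis dlP : forall r, dl r \in tDelta Phi.
Local Notation V := (vec F (X + R)).
Local Notation frame := (option (R * R * {g : {unit F} | g \in tG Phi}) *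
  {l | l \in tLambda Phi})%type.
Local Notation cols := (CY + (frame + R * tY1 Phi))%type.

Definition universal_mx0 (b : X + R) (e : cols) : F :=
  match e, b with
  | inl y, inl x => tA1 x y
  | inl y, inr r => dl r y
  | inr (inl (o, l)), inl x => val l x
  | inr (inl (None, l)), inr r => 0
  | inr (inl (Some (i, j, g), l)), inr r =>
      if r == i then 1 else if r == j then - val (val g) else 0
  | inr (inr (i, y)), inl x => 0
  | inr (inr (i, y)), inr r => (r == i)%:R end.

Definition universal_mx (b : X + R) (e : cols) : F :=
  universal_mx0 b e + (if e is inr (inr (i, y)) then universal_mx0 b (inl (inr y)) else 0).

Let in_rowsX (b : X + R) : (b \in rowsX (Phi:=Phi) inl) = if b is inl _ then true else false.
Proof. by apply/imsetP/idP=> [[x _ ->] //|]; case: b=> // x; exists x. Qed.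

Let in_colsCY (e : cols) : (e \in colsCY (Phi:=Phi) inl) = if e is inl _ then true else false.
Proof. by apply/imsetP/idP=> [[x _ ->] //|]; case: e=> // x; exists x. Qed.

Let frame_column_universal (o : option (R * R * {g : {unit F} | g \in tG Phi})) l :
  frame_column (tG Phi) (~: rowsX (Phi:=Phi) inl) (fun b=> universal_mx0 b (inr (inl (o, l)))).
Proof.
case: o=> [[[i j] g]|]; split.
- apply: leq_trans (_ : #|[set inr i; inr j : X + R]| <= 2)%N; last by rewrite cards2;
  case: (_ != _).
  apply/subset_leq_card/subsetP=> -[x|r]; rewrite !inE in_rowsX //=.
  case: (eqVneq r i)=> [->|_]; first by rewrite eqxx.
  by case: (eqVneq r j)=> [->|_]; rewrite ?eqxx ?orbT.
- move=> _; exists (inr i); split=> /=;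
  [by rewrite !inE in_rowsX /= eqxx oner_neq0|by rewrite eqxx|].
  move=> [x|r]; rewrite !inE in_rowsX //= => rij /eqP ri; exists (val g); first exact: valP.
  move: rij; case: (eqVneq r i)=> [rE|_]; first by case: ri; rewrite rE.
  by case: (eqVneq r j)=> // _; rewrite eqxx.
- rewrite (_ : [set _ in _ | _] = set0) ?cards0 //.
  by apply/setP=> -[x|r]; rewrite !inE in_rowsX ?eqxx ?andbF.
by case/set0Pn=> -[x|r]; rewrite !inE in_rowsX //= eqxx.
Qed.

Lemma universal_mx_conforms : mx_conforms inl inl universal_mx.
Proof.
pose Z : {set cols} := [set e | if e is inr (inr _) then true else false].
exists universal_mx0, Z; split.
- split=> //.
  + by move=> x y [].
  + by move=> x y [].
  + by apply/subsetP=> e; rewrite !inE in_colsCY; case: e=> [|[]].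
  + by move=> x e; rewrite inE; case: e=> [//|[//|[i y]]].
  + move=> e; rewrite inE; case: e=> [//|[//|[i y]]] _; exists (inr i); first by rewrite in_rowsX.
    by move=> [x|r]; rewrite in_rowsX.
  + move=> e; rewrite in_setU in_colsCY inE; case: e=> [//|[[o l]|//]] _.
    exact: frame_column_universal.
  + move=> e; rewrite in_setU in_colsCY inE; case: e=> [//|[[o l]|//]] _.
    rewrite (_ : finfun _ = val l) ?(valP l) //; apply/ffunP=> x; rewrite ffunE.
    by case: o=> [[[]]|].
  move=> [x|r]; rewrite in_rowsX // => _.
  by rewrite (_ : finfun _ = dl r) //; apply/ffunP=> y; rewrite ffunE.
- by move=> b [y|[[o l]|[i y]]]; rewrite /universal_mx ?addr0 // inE.
by move=> [y|[[o l]|[i y]]]; rewrite inE // => _; exists y=> b.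
Qed.

Definition lam_vec (w : X -> F) : V := [ffun b=> if b is inl x then w x else 0].
Definition col_CY (y : CY) : V := [ffun b => match b with inl x => tA1 x y | inr r => dl r y end].
Definition row_unit (r : R) : V := unit_vec (inr r).
Definition spanC : {vspace V} := span_tC col_CY.

Lemma col_vec_CY y : col_vec universal_mx (inl y) = col_CY y.
Proof. by apply/ffunP=> b; rewrite !ffunE /universal_mx addr0; case: b. Qed.

Lemma spanCE : vspan (col_vec universal_mx) (colsC (Phi:=Phi) inl) = spanC.
Proof.
apply: subv_anti; apply/andP; split; apply: vspan_sub; last first.
  by move=> c _; rewrite -col_vec_CY; apply/mem_vspan/imset_f.
move=> _ /imsetP[c _ ->]; rewrite col_vec_CY;
  apply: (mem_vspan (fun c : tC Phi=> col_CY (inl (inl c)))).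
exact: in_setT.
Qed.

Definition template_points (uT : vectType F) (f : V -> uT) T (v : T -> uT) : Prop :=
  [/\ forall l, l \in tLambda Phi -> is_point v (f (lam_vec l)),
      forall l i, l \in tLambda Phi -> is_point v (f (lam_vec l + row_unit i)),
      forall l i j g, l \in tLambda Phi -> g \in tG Phi -> i != j ->
        is_point v (f (lam_vec l + (row_unit i - val g *: row_unit j))),
      forall i y, is_point v (f (row_unit i + col_CY (inr y))) &
      forall y, is_point v (f (col_CY (inl (inr y))))].

Lemma universal_points (uT : vectType F) (f : 'Hom(V, uT)) : lker f = spanC ->
  exists (T : finType) (v : T -> uT), rep_char3 v /\ template_points f v.
Proof.
move=> kf; pose em (t : frame + R * tY1 Phi + tY0 Phi) : cols :=
  match t with inl x => inr x | inr y => inl (inl (inr y)) end.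
have r3 := rep_char3_conforming (s:=em) universal_mx_conforms
  (contracts_ker (etrans kf (esym spanCE))).
exists (frame + R * tY1 Phi + tY0 Phi)%type, (fun t=> f (col_vec universal_mx (em t))); split.
  by apply: r3=> t; rewrite inE negb_or; apply/andP; split; apply/negP=> /imsetP[z _];
    case: t=> [|].
have pt t x: col_vec universal_mx (em t) = x -> is_point (fun t=> f (col_vec universal_mx (em t)))
  (f x).
  by move=> <-; exists t, 1; rewrite oner_neq0 scale1r.
have unitE (r i: R) : (row_unit i : {ffun _ -> F}) (inr r) = (r == i)%:R by rewrite ffunE.
have gam1: {g : {unit F} | g \in tG Phi} := exist _ 1%g (group1 _).
split=> [l lL|l i lL|l i j g lL gG ij|i y|y].
- apply: (pt (inl (inl (None, exist _ l lL)))); apply/ffunP=> -[x|r];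
    by rewrite !ffunE /universal_mx /= addr0.
- apply: (pt (inl (inl (Some (i, i, gam1), exist _ l lL)))); apply/ffunP=> -[x|r];
    rewrite !ffunE /universal_mx /= addr0 // ?addr0 // add0r -[_ == inr i]/(r == i).
  by case: (r == i).
- apply: (pt (inl (inl (Some (i, j, exist _ g gG), exist _ l lL)))); apply/ffunP=> -[x|r];
    rewrite !ffunE /universal_mx /= addr0; first by rewrite scaler0 subr0 addr0.
  rewrite add0r -[inr r == inr i]/(r == i) -[inr r == inr j]/(r == j).
  case: (eqVneq r i)=> [->|_]; first by rewrite (negPf ij) scaler0 subr0.
  rewrite -[X in _ - X]/(val g * (r == j)%:R) sub0r.
  by case: (r == j); rewrite ?mulr1 ?mulr0 ?oppr0.
- by apply: (pt (inl (inr (i, y)))); apply/ffunP=> -[x|r]; rewrite !ffunE /universal_mx.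
by apply: (pt (inr y)); apply: col_vec_CY.
Qed.

End Universal.

Lemma lam_vec0 R : lam_vec R (0 : vec F X) = 0.
Proof. by apply/ffunP=> -[x|r]; rewrite !ffunE. Qed.

Lemma template_points_sums R (dl : R -> vec F CY) (uT : vectType F)
  (f : vec F (X + R) -> uT) T (v : T -> uT) : template_points dl f v ->
  [/\ forall i, is_point v (f (row_unit i)),
      forall i j, i != j -> is_point v (f (row_unit i + row_unit j)) &
      forall l i j, l \in tLambda Phi -> i != j ->
        is_point v (f (lam_vec R l + (row_unit i + row_unit j)))].
Proof.
case=> [ptL ptLi ptLij _ _]; have L0: (0 : vec F X) \in tLambda Phi := (tLambda_zmod Phi).1.
have ptS l i j: l \in tLambda Phi -> i != j ->
    is_point v (f (lam_vec R l + (row_unit i + row_unit j))).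
  move=> lL ij; have := ptLij l i j 1%g lL (group1 _) ij.
  by rewrite scale1r (oppv_pchar2 F2).
split=> // [i|i j ij]; first by have := ptLi 0 i L0; rewrite lam_vec0 add0r.
by have := ptS 0 i j L0 ij; rewrite lam_vec0 add0r.
Qed.

Lemma lambda_combination (l : vec F X) R (dl : R -> vec F CY) :
  l \in tLambda Phi -> (forall r, dl r \in tDelta Phi) ->
  exists c : tC Phi -> F, (forall x, \sum_y c y * tA1 x (inl (inl y)) = l x) /\
  (forall r, \sum_y c y * dl r (inl (inl y)) = 0).
Proof.
move=> lL dlP; pose R' : finType := (R + bool)%type.
pose dl' (r : R') : vec F CY := if r is inl r0 then dl r0 else 0.
have dlP' r: dl' r \in tDelta Phi by case: r=> [r|b] /=; rewrite ?dlP ?(tDelta_zmod Phi).1.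
have [f kf] := ex_quotient (spanC dl').
suff /mem_vspanP[c cE]: lam_vec R' l \in spanC dl'.
  have coord b: lam_vec R' l b = \sum_y c y * col_CY dl' (inl (inl y)) b.
    by rewrite {1}cE sum_ffunE; apply: eq_big=> [y|y _]; rewrite ?inE // ffunE.
  exists c; split=> [x|r].
    by have := coord (inl x); rewrite ffunE=> ->; apply: eq_bigr=> y _; rewrite ffunE.
  have := coord (inr (inl r)); rewrite ffunE=> /esym sum0; rewrite -[RHS]sum0.
  by apply: eq_bigr=> y _; rewrite ffunE.
apply: contraT=> nin; exfalso; have [T [v [r3 pts]]] := universal_points dlP' kf.
have [ptL ptLi _ _ _] := pts; have [pti ptij ptLij] := template_points_sums pts.
pose i1 : R' := inr true; pose i2 : R' := inr false.
apply: (no_fano (a:=f (row_unit i1)) (b:=f (row_unit i2)) (c:=f (lam_vec R' l)) F2 r3).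
  apply/free3P=> x y z; rewrite -!linearZ -!linearD=> /eqP; rewrite -memv_ker kf.
  case/mem_vspanP=> d dE; have row (b: bool) :
      (x *: row_unit i1 + y *: row_unit i2 + z *: lam_vec R' l) (inr (inr b)) = 0.
    by rewrite dE sum_ffunE big1 // => c _; rewrite !ffunE scaler0.
  have x0: x = 0.
    by have := row true; rewrite !ffunE /= -[LHS]/(x * 1 + y * 0 + z * 0) mulr1 !mulr0 !addr0.
  have y0: y = 0.
    by have := row false; rewrite !ffunE /= -[LHS]/(x * 0 + y * 1 + z * 0) mulr1 !mulr0 addr0 add0r.
  split=> //; apply/eqP; apply: contraNT nin=> z0; rewrite -(scalerK z0 (lam_vec R' l)) rpredZ //.
  by apply/mem_vspanP; exists d; rewrite -dE x0 y0 !scale0r !add0r.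
move=> x; rewrite -!linearD !inE; do 6?[case/orP]=> /eqP->; first exact: pti.
- exact: pti.
- exact: ptL.
- exact: ptij.
- by rewrite addrC; apply: ptLi.
- by rewrite addrC; apply: ptLi.
by rewrite addrC; apply: ptLij.
Qed.

Lemma is_point_span (vT : vectType F) T (v : T -> vT) (W : {vspace vT}) x :
  is_point v x -> x \in W -> x \in vspan v [set t | v t \in W].
Proof.
case=> t [k [k0 tE]] xW; rewrite -(scalerK k0 x) -tE.
by apply/rpredZ/mem_vspan; rewrite inE tE rpredZ.
Qed.

(* If [s := \sum_y u y * d y] were nonzero, four row units would sum to a vector in the span
of the template columns and generate a Fano plane. *)
Lemma delta_orthogonal (u : CY -> F) (d : vec F CY) : d \in tDelta Phi ->
  (forall x, \sum_y u y * tA1 x y = 0) -> \sum_y u y * d y = 0.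
Proof.
move=> dD uA; apply/eqP; apply: contraT; set s := \sum_y _=> s0; exfalso.
pose R := option 'I_4; pose dl (r : R) : vec F CY := if r is Some _ then d else 0.
have dlP r: dl r \in tDelta Phi by case: r=> [r|] /=; rewrite ?dD ?(tDelta_zmod Phi).1.
have [f kf] := ex_quotient (spanC dl); have [T [v [r3 pts]]] := universal_points dlP kf.
have [_ _ _ ptY1 ptY0] := pts; have [pti ptij _] := template_points_sums pts.
pose V0 : {vspace (vec F (X + R))} := (<[row_unit None]> + vspan (col_CY dl) [set: CY])%VS.
pose W : {vspace (vec F (X + R))} := (f @: V0)%VS.
have rowV0: row_unit None \in V0 by apply: subvP (addvSl _ _) _ (memv_line _).
have colV0 y: col_CY dl y \in V0.
  by apply: subvP (addvSr _ _) _ _; apply: mem_vspan; rewrite inE.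
have spanW: (vspan v [set t | v t \in W] = W)%VS.
  apply: subv_anti; apply/andP; split; first by apply: vspan_sub=> t; rewrite inE.
  have rowD: f (row_unit None) \in vspan v [set t | v t \in W].
    by apply: is_point_span; rewrite ?memv_img.
  rewrite {1}/W limgD limg_line -vspan_lfun subv_add -memvE rowD /=; apply: vspan_sub=> y _.
  case: y=> [[c|y]|y].
  - have /eqP -> : f (col_CY dl (inl (inl c))) == 0; last exact: mem0v.
    by rewrite -memv_ker kf (mem_vspan (fun c : tC Phi=> col_CY dl (inl (inl c)))) ?inE.
  - by apply: is_point_span; rewrite ?memv_img.
  rewrite -[X in X \in _](addKr (f (row_unit None))) addrC rpredB // -linearD.
  by apply: is_point_span (ptY1 None y) _; rewrite memv_img ?rpredD.
have coordV0 z: z \in V0 -> forall i j : 'I_4, z (inr (Some i)) = z (inr (Some j)).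
  case/memv_addP=> z1 /vlineP[k ->] [z2 /mem_vspanP[c ->] ->] i j.
  by rewrite !ffunE !sum_ffunE /=; congr (_ + _); apply: eq_bigr=> y _; rewrite !ffunE.
have fV0 z: f z \in W -> z \in V0.
  case/memv_imgP=> z' z'V fz; rewrite -(subrK z' z) rpredD //.
  have: z - z' \in spanC dl by rewrite -kf memv_ker linearB /= fz subrr.
  by apply: subvP _ _; apply: vspan_sub.
pose e (k : nat) : vec F (X + R) := row_unit (Some (inord k)).
have ord_eq (r: 'I_4) k : (k < 4)%N ->
    (inr (Some r) == inr (Some (inord k)) :> X + R) = (r == k :> nat).
  by move=> k4; rewrite -[LHS]/(r == inord k) -val_eqE /= inordK.
have e4: e 1%N + e 2%N + (e 0%N + e 3%N) \in V0.
  rewrite -(scalerK s0 (_ + _)) rpredZ //.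
  have -> : s *: (e 1%N + e 2%N + (e 0%N + e 3%N)) = \sum_y u y *: col_CY dl y.
    apply/ffunP=> b; rewrite sum_ffunE; case: b=> [x|[r|]].
    - transitivity (0 : F); first by rewrite !ffunE /= !addr0 scaler0.
      by rewrite -[LHS](uA x); apply: eq_bigr=> y _; rewrite !ffunE.
    - rewrite !ffunE !ord_eq // -[LHS]/(s * _).
      have -> : (r == 1%N :> nat)%:R + (r == 2%N :> nat)%:R + ((r == 0%N :> nat)%:R
          + (r == 3%N :> nat)%:R) = 1 :> F.
        by case: r=> [[|[|[|[|//]]]] lt] /=; rewrite ?addr0 ?add0r.
      by rewrite mulr1; apply: eq_bigr=> y _; rewrite !ffunE.
    rewrite !ffunE /= !addr0 scaler0 big1 // => y _.
    by rewrite !ffunE scaler0.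
  by apply: rpred_sum=> y _; rewrite rpredZ.
have ne i j: (i < 4)%N -> (j < 4)%N -> i != j -> Some (inord i) != Some (inord j) :> R.
  by move=> i4 j4; rewrite (inj_eq (@Some_inj _)) -val_eqE /= !inordK.
apply: (no_fano_contraction (D:=[set t | v t \in W]) (h1:=f (e 1%N)) (h2:=f (e 2%N))
  (h3:=f (e 0%N + e 3%N)) (e:=f (e 0%N)) F2 r3); rewrite ?spanW -?linearD.
- exact: pti.
- move=> h; rewrite !inE=> /or3P[]/eqP->; rewrite -linearD; split; try exact: pti.
  + by apply/ptij/ne.
  + by apply/ptij/ne.
  + by apply/ptij/ne.
  by rewrite addrAC (addvv_pchar2 F2) add0r; apply: pti.
- move=> x y z; rewrite -!linearZ -!linearD=> /fV0/coordV0 const.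
  have at_k (k: nat) : (k < 3)%N -> x * (k == 1%N)%:R + y * (k == 2%N)%:R + z * (k == 0%N)%:R = 0.
    move=> k3; have := const (inord k) (inord 3); rewrite !ffunE !ord_eq // !inordK //=.
      by rewrite !scaler0 !addr0.
    exact: ltnW.
  have := at_k 0%N isT; have := at_k 1%N isT; have := at_k 2%N isT.
  by rewrite /= !mulr0 !mulr1 !addr0 !add0r.
exact: memv_img.
Qed.

Lemma trivial_gains (g : {unit F}) : g \in tG Phi -> g = 1%g.
Proof.
move=> gG; apply/eqP; apply: contraT=> g1; exfalso.
pose dl (r : 'I_3) : vec F CY := 0.
have dlP r: dl r \in tDelta Phi by apply: (tDelta_zmod Phi).1.
have [f kf] := ex_quotient (spanC dl); have [T [v [r3 pts]]] := universal_points dlP kf.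
have [_ _ ptLij _ _] := pts; have [pti _ _] := template_points_sums pts.
pose e (i : 'I_3) : vec F (X + 'I_3) := row_unit i.
pose w (t : 'I_3 * 'I_3 * option 'I_3) := let: (i, j, o) := t in
  f (if o is Some k then (if i == j then e i else e i - val g ^+ k *: e j) else e i).
have r3w: rep_char3 w.
  apply: (rep_char3_points r3)=> -[[i j] [k|]]; rewrite /w; last exact: pti.
  have [_|ij] := eqVneq i j; first exact: pti.
  have := ptLij 0 i j (g ^+ k)%g (tLambda_zmod Phi).1 (groupX k gG) ij.
  by rewrite lam_vec0 add0r FinRing.val_unitX.
pose i0 : 'I_3 := inord 0; pose i1 : 'I_3 := inord 1; pose i2 : 'I_3 := inord 2.
have line i j k: i != j -> w (i, j, Some k) = w (i, i, None) - val g ^+ k *: w (j, j, None).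
  by move=> /negPf ij; rewrite /w ij linearB linearZ.
apply: (@no_dowling _ _ _ w (i0, i0, None) (i1, i1, None) (i2, i2, None)
  (fun k=> (i0, i1, Some k)) (fun k=> (i1, i2, Some k)) (fun k=> (i0, i2, Some k)) (val g) r3w).
- apply/free3P=> x y z; rewrite /w -!linearZ -!linearD=> /eqP; rewrite -memv_ker kf.
  case/mem_vspanP=> d dE; have row i: (x *: e i0 + y *: e i1 + z *: e i2) (inr i) = 0.
    by rewrite dE sum_ffunE big1 // => c _; rewrite !ffunE scaler0.
  have coord i: x * (i == i0)%:R + y * (i == i1)%:R + z * (i == i2)%:R = 0.
    by rewrite -[RHS](row i) !ffunE.
  have := coord i2; have := coord i1; have := coord i0.
  by rewrite -!val_eqE /= !inordK //= !mulr0 !mulr1 !addr0 !add0r.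
- have g0: val g != 0 by rewrite -unitfE; apply: valP.
  have al3: al ^+ 3 = 1.
    by rewrite exprS alE mulrDr mulr1 -expr2 alE addrAC (addrr_pchar2 F2) add0r.
  case: (F4_cases F4 alE (val g))=> gE; rewrite gE ?expr1n //; first by rewrite gE eqxx in g0.
  by rewrite -alE -exprM mulnC exprM al3 expr1n.
- by apply: contraNneq g1=> gE; apply/eqP/val_inj.
- by move=> k; apply: line; rewrite -val_eqE /= !inordK.
- by move=> k; apply: line; rewrite -val_eqE /= !inordK.
by move=> k; apply: line; rewrite -val_eqE /= !inordK.
Qed.

Lemma frame_column_cases (B : finType) (S : {set B}) (c : B -> F) : frame_column (tG Phi) S c ->
  [\/ forall b, b \in S -> c b = 0, exists2 i, i \in S & forall b, b \in S -> c b = (b == i)%:R |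
     exists i j, [/\ i \in S, j \in S, i != j &
       forall b, b \in S -> c b = (b == i)%:R - (b == j)%:R]].
Proof.
case=> cN hN; set N := [set b in S | c b != 0] in cN hN.
have N0 b: b \in S -> b \notin N -> c b = 0 by move=> bS; rewrite inE bS negbK=> /eqP.
have [N00|[b0 b0N]] := set_0Vmem N.
  by apply: Or31=> b bS; apply: N0=> //; rewrite N00 inE.
have [|i [iN ci hi]] := hN; first by apply/set0Pn; exists b0.
have iS: i \in S by move: iN; rewrite inE=> /andP[].
have [N1|[j]] := set_0Vmem (N :\ i).
  apply: Or32; exists i=> // b bS; have [->//|bi] := eqVneq b i; apply: N0=> //.
  by have := in_set0 b; rewrite -N1 in_setD1 bi=> /negbT.
rewrite in_setD1=> /andP[ji jN]; have jS: j \in S by move: jN; rewrite inE=> /andP[].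
apply: Or33; exists i, j; split; rewrite 1?eq_sym // => b bS.
have [g gG cg] := hi j jN ji; rewrite (trivial_gains gG) in cg.
have [->|bi] := eqVneq b i; first by rewrite eq_sym (negPf ji) subr0.
have [->|bj] := eqVneq b j; first by rewrite sub0r.
rewrite subr0; apply: N0=> //; apply: contraL cN=> bN; rewrite -ltnNge.
apply/card_gt2P; exists i, j, b; split=> //.
by rewrite eq_sym ji eq_sym bj bi.
Qed.

Lemma delta_row (d : vec F CY) : d \in tDelta Phi ->
  exists ph : X -> F, forall y, d y = \sum_x ph x * tA1 x y.
Proof.
move=> dD; have: d \in row_space (@tA1 F Phi).
  rewrite -(rdualK (row_space _)); apply/rdualP=> u; rewrite -row_space_rel=> /eqP uA.
  rewrite /ffdot; apply: (delta_orthogonal dD)=> x; have /ffunP/(_ x) := uA.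
  by rewrite sum_ffunE ffunE=> uAx; rewrite -[RHS]uAx; apply: eq_bigr=> y _; rewrite !ffunE.
case/memv_sumP=> r rE ->.
have /fin_all_exists[k kE] x: exists k, r x = k *: [ffun e=> tA1 x e : F^o].
  by have /vlineP := rE x isT.
exists k=> y; rewrite sum_ffunE; apply: eq_bigr=> x _; by rewrite kE !ffunE.
Qed.

Section Reduction.
Variables (B R : finType) (iX : X -> B) (iR : R -> B) (ph : R -> X -> F).
Variable pi : 'End(vec F X).

Definition reduce (z : vec F B) : (vec F X * vec F R)%type :=
  (pi [ffun x=> z (iX x)], [ffun r=> z (iR r) - \sum_x ph r x * z (iX x)]).

Fact reduce_linear : linear reduce.
Proof.
move=> a z z'; congr (_, _).
  rewrite -[RHS]/(a *: pi [ffun x=> z (iX x)] + pi [ffun x=> z' (iX x)]) -linearP.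
  by congr (pi _); apply/ffunP=> x; rewrite !ffunE.
apply/ffunP=> r; rewrite !ffunE -[a *: (_ - _)]/(a * (_ - _)) mulrBr [RHS]addrACA -opprD.
congr (_ - _); rewrite mulr_sumr -big_split /=; apply: eq_bigr=> x _.
by rewrite !ffunE mulrDr -[a *: _]/(a * _) mulrCA.
Qed.
HB.instance Definition _ := GRing.isLinear.Build F _ _ _ reduce reduce_linear.

Hypothesis cover : forall b, (exists x, b = iX x) \/ exists r, b = iR r.
Let A1 (y : CY) : vec F X := [ffun x=> tA1 x y].
Hypothesis kpi : lker pi = span_tC A1.
Variable col : CY -> vec F B.
Hypotheses (colX : forall x y, col y (iX x) = tA1 x y).
Hypothesis (colR : forall r y, col y (iR r) = \sum_x ph r x * col y (iX x)).

Lemma reduce_col y : reduce (col y) = (pi (A1 y), 0).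
Proof.
congr (_, _); first by congr (pi _); apply/ffunP=> x; rewrite !ffunE colX.
by apply/ffunP=> r; rewrite !ffunE colR subrr.
Qed.

Lemma lker_reduce : lker (linfun reduce) = span_tC col.
Proof.
have piC (c: tC Phi) : pi (A1 (inl (inl c))) = 0.
  by apply/eqP; rewrite -memv_ker kpi (mem_vspan (fun c : tC Phi=> A1 (inl (inl c)))) ?inE.
apply: subv_anti; apply/andP; split; last first.
  by apply: vspan_sub=> c _; rewrite memv_ker lfunE /= reduce_col piC.
apply/subvP=> z; rewrite memv_ker lfunE /= => /eqP[/eqP + zR].
rewrite -memv_ker kpi=> /mem_vspanP[c zE]; apply/mem_vspanP; exists c.
set z' := \sum_(_ in _) _; have zX x: z (iX x) = z' (iX x).
  move/ffunP/(_ x): zE; rewrite ffunE sum_ffunE=> ->; rewrite sum_ffunE.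
  by apply: eq_bigr=> y _; rewrite !ffunE colX.
have z'R: (reduce z').2 = 0.
  rewrite -[reduce]/(GRing.Linear.sort (reduce : {linear _ -> _})) linear_sum.
  by rewrite big1 // => y _; rewrite linearZ /= reduce_col piC scaler0.
apply/ffunP=> b; case: (cover b)=> [[x ->]|[r ->]]; first exact: zX.
move/ffunP/(_ r): zR; move/ffunP/(_ r): z'R; rewrite !ffunE=> /eqP; rewrite subr_eq0=> /eqP ->.
by move/eqP; rewrite subr_eq0=> /eqP ->; apply: eq_bigr=> x _; rewrite zX.
Qed.

End Reduction.

Let A1 (y : CY) : vec F X := [ffun x=> tA1 x y].

Section FrameConfiguration.
Variable pi : 'End(vec F X).
Hypothesis kpi : lker pi = span_tC A1.

Let piC (c : tC Phi) : pi (A1 (inl (inl c))) = 0.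
Proof. by apply/eqP; rewrite -memv_ker kpi (mem_vspan (fun c : tC Phi=> A1 (inl (inl c)))) ?inE.
  Qed.

Definition apex_vec (o : option (tY1 Phi)) : vec F X := if o is Some y then pi (A1 (inr y)) else 0.

Definition extra_vec (y : tY0 Phi) : vec F X := pi (A1 (inl (inr y))).

Lemma rep_char3_frame_cfg R : rep_char3 (@frame_cfg F _ R _ _ apex_vec extra_vec).
Proof.
pose dl (r : R) : vec F CY := 0; pose ph (r : R) (x : X) : F := 0.
have dlP r: dl r \in tDelta Phi by apply: (tDelta_zmod Phi).1.
pose rd : {linear (vec F (X + R)) -> _} := reduce inl inr ph pi.
have rdE y: rd (col_CY dl y) = (pi (A1 y), 0).
  apply: reduce_col=> [x y'|r y']; rewrite !ffunE // big1 // => x _.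
  by rewrite mul0r.
have kf: lker (linfun rd) = spanC dl.
  apply: lker_reduce=> [[x|r]|||]; [by left; exists x|by right; exists r|exact: kpi| |].
    by move=> x y; rewrite ffunE.
  by move=> r y; rewrite !ffunE big1 // => x _; rewrite mul0r.
have [T [v [r3 pts]]] := universal_points dlP kf.
have [ptL _ _ ptY1 ptY0] := pts; have [pti ptij _] := template_points_sums pts.
have rd_unit r: rd (row_unit r) = (0, unit_vec r).
  congr (_, _); first by rewrite (_ : finfun _ = 0) ?linear0 //; apply/ffunP=> x; rewrite !ffunE.
  apply/ffunP=> r'; rewrite !ffunE big1 ?subr0 // => x _.
  by rewrite mul0r.
apply: (rep_char3_points r3)=> -[[i j]|[[i [y|]]|y]] /=.
- have [->|ij] := eqVneq i j.
    by have := ptL 0 (tLambda_zmod Phi).1; rewrite lam_vec0 linear0 subrr.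
  have := ptij i j ij; rewrite lfunE linearD !rd_unit.
  by congr (is_point v _); congr (_, _); rewrite ?addr0 ?(oppv_pchar2 F2).
- have := ptY1 i y; rewrite lfunE linearD rd_unit rdE.
  by congr (is_point v _); congr (_, _); rewrite ?add0r ?addr0.
- by have := pti i; rewrite lfunE rd_unit.
by have := ptY0 y; rewrite lfunE rdE.
Qed.

Variables (B E' : finType) (iX : X -> B) (iE : CY -> E').
Variables (A' : B -> E' -> F) (Z : {set E'}).
Hypothesis resp : respects iX iE A' Z.
Variable A : B -> E' -> F.
Hypothesis AA' : forall b e, e \notin Z -> A b e = A' b e.
Hypothesis AZ : forall z, z \in Z -> exists y : tY1 Phi, forall b, A b z = A' b z + A' b
  (iE (inr y)).

Local Notation R := {b : B | b \in ~: rowsX iX}.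
Variable ph : R -> X -> F.
Hypothesis phE : forall (r : R) y, A' (val r) (iE y) = \sum_x ph r x * tA1 x y.

Let iR (r : R) : B := val r.
Let rd : {linear (vec F B) -> _} := reduce iX iR ph pi.

Let iE_notin_Z y : iE y \notin Z.
Proof. by case: resp=> _ _ _ /subsetP ZC _ _ _ _ _; apply/negP=> /ZC; rewrite inE imset_f. Qed.

Let A_X x y : col_vec A (iE y) (iX x) = tA1 x y.
Proof. by case: resp=> _ _ rA _ _ _ _ _ _; rewrite ffunE AA' // rA. Qed.

Let A_R r y : col_vec A (iE y) (iR r) = \sum_x ph r x * col_vec A (iE y) (iX x).
Proof. by rewrite ffunE AA' // phE; apply: eq_bigr=> x _; rewrite A_X. Qed.

Let rd_CY y : rd (col_vec A (iE y)) = (pi (A1 y), 0).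
Proof. exact: (reduce_col pi A_X A_R). Qed.

Lemma lker_conforming : lker (linfun rd) = vspan (col_vec A) (colsC iE).
Proof.
have -> : vspan (col_vec A) (colsC iE) = vspan (fun c=> col_vec A (iE (inl (inl c)))) [set: tC Phi].
  apply: subv_anti; apply/andP; split; apply: vspan_sub; last first.
    by move=> c _; apply/mem_vspan/imset_f.
  by move=> _ /imsetP[c _ ->]; apply: (mem_vspan (fun c=> col_vec A (iE (inl (inl c)))));
    rewrite inE.
apply: (lker_reduce _ kpi A_X A_R)=> b; have [/imsetP[x _ ->]|bX] := boolP (b \in rowsX iX).
  by left; exists x.
have bR: b \in ~: rowsX iX by rewrite inE.
by right; exists (exist _ b bR).
Qed.

Let iX_notin_R x (r : R) : (iX x == val r) = false.
Proof. by apply: contraTF (valP r)=> /eqP <-; rewrite inE negbK imset_f. Qed.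

Let rd_unit (r : R) : rd (unit_vec (val r)) = (0, unit_vec r).
Proof.
congr (_, _).
  by rewrite (_ : finfun _ = 0) ?linear0 //; apply/ffunP=> x; rewrite !ffunE iX_notin_R.
apply/ffunP=> r'; rewrite !ffunE big1 ?subr0=> [|x _]; last by rewrite ffunE iX_notin_R mulr0.
by rewrite -(inj_eq val_inj).
Qed.

Let rd_Z e : e \in Z -> exists t, frame_cfg apex_vec extra_vec t = rd (col_vec A e).
Proof.
case: resp=> _ _ _ _ rXZ runit _ _ _ eZ; have [b bX bE] := runit e eZ; have [y yE] := AZ eZ.
have bR: b \in ~: rowsX iX by rewrite inE.
exists (inr (inl (exist _ b bR, Some y))).
have -> : col_vec A e = unit_vec b + col_vec A (iE (inr y)).
  apply/ffunP=> b'; rewrite !ffunE yE [A _ (iE _)]AA' //; congr (_ + _).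
  have [/imsetP[x _ ->]|/bE //] := boolP (b' \in rowsX iX).
  by rewrite rXZ // (iX_notin_R x (exist _ b bR)).
rewrite linearD /= rd_CY (rd_unit (exist _ b bR)).
by congr (_, _); rewrite ?add0r ?addr0.
Qed.

Hypothesis dD : forall r : R, [ffun y=> A' (val r) (iE y) : F^o] \in tDelta Phi.

Let rd_frame_part e : e \notin colsCY iE :|: Z ->
  rd (col_vec A e) = (0, [ffun r : R=> A' (val r) e]).
Proof.
case: resp=> _ _ _ _ _ _ _ rL _ eCZ; have := rL e eCZ; set l := finfun _=> lL.
have eZ: e \notin Z by apply: contra eCZ; rewrite inE orbC=> ->.
have [c [cA cD]] := lambda_combination lL dD.
have lE x: A (iX x) e = \sum_y c y * tA1 x (inl (inl y)) by rewrite cA ffunE AA'.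
congr (_, _).
  rewrite (_ : finfun _ = \sum_(y : tC Phi) c y *: A1 (inl (inl y))).
    by rewrite linear_sum big1 // => y _; rewrite linearZ /= piC scaler0.
  by apply/ffunP=> x; rewrite !ffunE lE sum_ffunE; apply: eq_bigr=> y _; rewrite !ffunE.
apply/ffunP=> r; rewrite !ffunE AA' // [X in _ - X](_ : _ = 0) ?subr0 //.
rewrite -[RHS](cD r); transitivity (\sum_x \sum_y c y * (ph r x * tA1 x (inl (inl y)))).
  by apply: eq_bigr=> x _; rewrite ffunE lE mulr_sumr; apply: eq_bigr=> y _; rewrite mulrCA.
rewrite exchange_big; apply: eq_bigr=> y _; rewrite -mulr_sumr ffunE.
by rewrite phE.
Qed.

Lemma frame_cfg_conforming e : e \notin colsC iE :|: colsY1 iE -> rd (col_vec A e) != 0 ->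
  exists t, frame_cfg apex_vec extra_vec t = rd (col_vec A e).
Proof.
move=> eCY1 nz; have [/imsetP[[[c|y]|y] _ eE]|eCY] := boolP (e \in colsCY iE).
- by case/negP: eCY1; rewrite inE eE imset_f.
- by exists (inr (inr y)); rewrite eE rd_CY.
- by case/negP: eCY1; rewrite inE eE [X in _ || X]imset_f ?orbT.
have [/rd_Z //|eZ] := boolP (e \in Z).
have eCZ: e \notin colsCY iE :|: Z by rewrite inE negb_or eCY.
have rdE (z: vec F R) : (forall r : R, A' (val r) e = z r) -> rd (col_vec A e) = (0, z).
  by move=> zE; rewrite rd_frame_part //; congr (_, _); apply/ffunP=> r; rewrite ffunE zE.
case: resp=> _ _ _ _ _ _ rF _ _.
case: (frame_column_cases (rF e eCZ))=> [f0|[i iS fi]|[i [j [iS jS ij fij]]]].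
- by case/eqP: nz; rewrite (rdE 0) // => r; rewrite ffunE; apply: f0; apply: valP.
- exists (inr (inl (exist _ i iS, None))); rewrite (rdE (unit_vec (exist _ i iS))) // => r.
  by rewrite ffunE fi ?(valP r) // -(inj_eq val_inj).
exists (inl (exist _ i iS, exist _ j jS)).
rewrite (rdE (unit_vec (exist _ i iS) - unit_vec (exist _ j jS))) // => r.
by rewrite !ffunE fij ?(valP r) // -!(inj_eq val_inj).
Qed.

End FrameConfiguration.

Lemma template_frame_cfg : exists (wT : vectType F) (p : option (tY1 Phi) -> wT) (q : tY0 Phi ->
  wT),
  [/\ p None = 0, forall R, rep_char3 (@frame_cfg F wT R _ _ p q) &
   forall E (U : repmatroid F E), template_class Phi U -> (forall e, rep_vec U e != 0) ->
     exists (R : finType) (g : E -> R * R + (R * option (tY1 Phi) + tY0 Phi)),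
     same_rk (rep_vec U) (fun e=> frame_cfg p q (g e))].
Proof.
have [pi kpi] := ex_quotient (span_tC A1).
exists (vec F X), (apex_vec pi), (extra_vec pi); split=> // [R|E U].
  exact: rep_char3_frame_cfg kpi R.
case=> B [E' [iX [iE [A [[A' [Z [resp AA' AZ]]] ri]]]]] U0.
pose R : finType := {b : B | b \in ~: rowsX iX}.
have dD (r: R) : [ffun y=> A' (val r) (iE y) : F^o] \in tDelta Phi.
  by case: resp=> _ _ _ _ _ _ _ _; apply; have := valP r; rewrite inE.
have [ph phE] := fin_all_exists (fun r=> delta_row (dD r)).
have {}phE r y: A' (val r) (iE y) = \sum_x ph r x * tA1 x y by rewrite -phE ffunE.
have kf := lker_conforming kpi resp AA' phE.
have [g [d [ginj d0 gim rk]]] := template_rk (contracts_ker kf) ri.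
have gY e: g e \notin colsC iE :|: colsY1 iE.
  have [/(_ (ex_intro _ e erefl))[x xY ->] _] := gim (g e).
  by rewrite inE negb_or; have := valP x; rewrite inE=> ->; move: xY; rewrite inE.
have nz e: reduce iX val ph pi (col_vec A (g e)) != 0.
  apply/negP=> /eqP r0; have := rk [set e]; rewrite /vspan !big_set1 !dim_vline U0 lfunE /= r0.
  by rewrite scaler0 eqxx.
have [t tE] := fin_all_exists (fun e=> frame_cfg_conforming kpi resp AA' AZ phE dD (gY e) (nz e)).
exists R, t=> S; rewrite rk; congr (\dim _).
apply: (vspan_scale _ d0)=> e.
by rewrite tE lfunE.
Qed.

End Template.

(** * Dependencies that balance over the blocks of a partition *)

Section VectorCoordinates.
Variables (K : fieldType) (vT : vectType K).

Definition vcoord i (x : vT) : K := coord (vbasis {:vT}) i x.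

Lemma vcoord_inj (x y : vT) : (forall i, vcoord i x = vcoord i y) -> x = y.
Proof.
move=> xy; rewrite (coord_vbasis (memvf x)) (coord_vbasis (memvf y)).
by apply: eq_bigr=> i _; rewrite -[coord _ i x]/(vcoord i x) xy.
Qed.

Lemma vcoordD i (x y : vT) : vcoord i (x + y) = vcoord i x + vcoord i y.
Proof. exact: linearD. Qed.

Lemma vcoordN i (x : vT) : vcoord i (- x) = - vcoord i x.
Proof. exact: linearN. Qed.

Lemma vcoordZ i a (x : vT) : vcoord i (a *: x) = a * vcoord i x.
Proof. exact: linearZ. Qed.

Lemma vcoord0 i : vcoord i 0 = 0.
Proof. exact: linear0. Qed.

End VectorCoordinates.

Ltac vring := apply: vcoord_inj => ?; rewrite ?(vcoordD, vcoordN, vcoordZ, vcoord0); ring.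

Section Dependencies.
Variables (K : fieldType) (vT : vectType K) (P : finType).
Implicit Types (z p : P -> vT) (A : {set P}).

Lemma depP z A : reflect
  (exists c : P -> K, [/\ \sum_x c x *: z x = 0, forall x, x \notin A -> c x = 0 &
     exists x, c x != 0]) (~~ indep z A).
Proof.
have sumA (c: P -> K) : (forall x, x \notin A -> c x = 0) ->
    \sum_x c x *: z x = \sum_(x in A) c x *: z x.
  by move=> c0; rewrite (bigID (mem A)) /= [X in _ + X]big1 ?addr0 // => x /c0 ->; rewrite scale0r.
apply: (iffP idP)=> [dA|[c [s0 c0 [x cx]]]]; last first.
  apply: contra cx=> iA; have [xA|/c0-> //] := boolP (x \in A).
  by rewrite (indep_coef iA _ xA) // -sumA.
apply: NNPP=> no; case/negP: dA; apply: indepP=> c s0 x xA; apply: NNPP=> cx; case: no.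
pose d y := if y \in A then c y else 0.
have d0 y: y \notin A -> d y = 0 by rewrite /d=> /negPf->.
exists d; split=> //; last by exists x; rewrite /d xA; apply/eqP.
by rewrite sumA // -[RHS]s0; apply: eq_bigr=> y yA; rewrite /d yA.
Qed.

Lemma mem_vspan_dep z A e : e \notin A -> z e \in vspan z A ->
  exists c : P -> K, [/\ \sum_x c x *: z x = 0, c e = 1 & forall x, x \notin e |: A -> c x = 0].
Proof.
move=> eA /mem_vspanP[d dE].
exists (fun x=> if x == e then 1 else if x \in A then - d x else 0); split.
- rewrite (bigD1 e) //= eqxx scale1r {1}dE [X in _ + X](bigID (mem A)) /=.
  rewrite [X in _ + (_ + X)]big1 ?addr0=> [|x /andP[/negPf-> /negPf->]]; last by rewrite scale0r.
  apply/eqP; rewrite addr_eq0 -sumrN; apply/eqP; apply: eq_big=> [x|x xA].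
    by case: eqP=> [->|_]; rewrite ?(negPf eA) ?andbT.
  by rewrite xA ifN ?scaleNr ?opprK //; apply: contraNneq eA=> <-.
- by rewrite eqxx.
by move=> x; rewrite !inE negb_or=> /andP[/negPf-> /negPf->].
Qed.

Definition dep_blocks (L : finType) p (be : P -> L) : Prop :=
  exists2 c : P -> K, exists x, c x != 0 &
  \sum_x c x *: p x = 0 /\ forall b, \sum_(x | be x == b) c x = 0.

Lemma dep_blocks_ker (L L' : finType) p (be : P -> L) (be' : P -> L') :
  (forall x y, (be x == be y) = (be' x == be' y)) -> dep_blocks p be -> dep_blocks p be'.
Proof.
move=> bb' [c cx [s0 blk]]; exists c=> //; split=> // b.
case: (pickP (fun x=> be' x == b))=> [x /eqP<-|no]; last by rewrite big1 // => x; rewrite no.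
by rewrite -[RHS](blk (be x)); apply: eq_bigl=> y; rewrite bb'.
Qed.

Lemma lift1_sumT p (c : P -> K) : \sum_x c x *: lift1 p x = (\sum_x c x *: p x, \sum_x c x).
Proof.
have := lift1_sum p [set: P] c.
by under eq_bigl do rewrite inE; under [X in (X, _)]eq_bigl do rewrite inE;
  under [X in (_, X)]eq_bigl do rewrite inE.
Qed.

End Dependencies.

Arguments depP {K vT P z A}.

Lemma dep_blocks_lift1 K (vT : vectType K) (P L : finType) (p : P -> vT) (be : P -> L) :
  dep_blocks (lift1 p) be <-> dep_blocks p be.
Proof.
split=> -[c cx [s0 blk]]; exists c=> //; split=> //; first by move: s0; rewrite lift1_sumT=> -[].
by rewrite lift1_sumT s0 (partition_big be predT) //= big1.
Qed.

Definition same_blocks F K (vT : vectType F) (uT : vectType K) (P : finType)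
  (p : P -> vT) (ph : P -> uT) : Prop :=
  forall (L : finType) (be : P -> L), dep_blocks p be <-> dep_blocks ph be.

Lemma lift1_indep_blocks K (vT : vectType K) (P : finType) (p : P -> vT) (A : {set P}) :
  ~~ indep (lift1 p) A <-> dep_blocks p (fun x=> if x \in A then None else Some x).
Proof.
have blk (c: P -> K) : (forall x, x \notin A -> c x = 0) <->
    forall y, \sum_(x | (if x \in A then None else Some x) == Some y) c x = 0.
  split=> [c0 y|sc y yA]; first by rewrite big1 // => x; case: ifPn=> // /c0 ->.
  rewrite -[RHS](sc y) (big_pred1 y) // => x /=; case: ifPn=> [xA|_ //].
  by apply/esym/negbTE; apply: contraNneq yA=> <-.
split=> [/depP[c [s0 c0 cx]]|/dep_blocks_lift1[c cx [s0 sc]]].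
  apply/dep_blocks_lift1; exists c=> //; split=> // -[y|]; first by move/blk: c0.
  move: s0; rewrite lift1_sumT=> -[_ s1]; rewrite -[RHS]s1 [RHS](bigID (mem A)) /=.
  rewrite [X in _ = _ + X]big1 ?addr0; last exact: c0.
  by apply: eq_bigl=> x; case: (x \in A).
by apply/depP; exists c; split=> //; apply/blk=> y; apply: sc.
Qed.

Lemma same_blocks_indep F K (vT : vectType F) (uT : vectType K) (P : finType)
  (p : P -> vT) (ph : P -> uT) (A : {set P}) :
  same_blocks p ph -> indep (lift1 p) A = indep (lift1 ph) A.
Proof.
by move=> pph; apply: negb_inj; apply/idP/idP=> /lift1_indep_blocks/pph/lift1_indep_blocks.
Qed.

(* If the vectors [e j] are independent modulo the [ph x], the vectors
[ph x + e (be x)] are dependent exactly when some dependency of the [ph x] sums to zero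
over each fibre of [be]. *)
Lemma dep_blocks_split K (uT : vectType K) (P R : finType) (u : P -> R -> uT)
  (b : P -> R -> K) (ph : P -> uT) (e : R -> uT) (be : P -> R) :
  (forall x j, b x j != 0 /\ u x j = b x j *: (ph x + e j)) ->
  (forall c d, \sum_j c j *: e j + \sum_x d x *: ph x = 0 -> forall j, c j = 0) ->
  dep_blocks ph be <-> ~~ indep (fun x=> u x (be x)) setT.
Proof.
move=> uE e_free; have b0 x j: b x j != 0 by have [] := uE x j.
have split_sum (c: P -> K) : \sum_x c x *: u x (be x) =
    \sum_j (\sum_(x | be x == j) c x * b x (be x)) *: e j + \sum_x (c x * b x (be x)) *: ph x.
  rewrite addrC; transitivity (\sum_x ((c x * b x (be x)) *: ph x + (c x * b x (be x)) *: e
    (be x))).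
    by apply: eq_bigr=> x _; have [_ ->] := uE x (be x); rewrite -scalerDr scalerA.
  rewrite big_split; congr (_ + _); rewrite (partition_big be predT) //=.
  by apply: eq_bigr=> j _; rewrite scaler_suml; apply: eq_bigr=> x /eqP->.
split=> [[c [x cx] [s0 blk]]|/depP[c [s0 _ [x cx]]]].
  apply/depP; exists (fun x=> c x / b x (be x)); split=> [|y|]; last 2 first.
  - by rewrite inE.
  - by exists x; rewrite mulf_neq0 ?invr_eq0.
  have cb y: c y / b y (be y) * b y (be y) = c y by rewrite divfK.
  rewrite split_sum big1 ?add0r=> [|j _]; first by under eq_bigr do rewrite cb.
  by under eq_bigr do rewrite cb; rewrite blk scale0r.
move: s0; rewrite split_sum=> s0; have blk := e_free _ _ s0.
exists (fun x=> c x * b x (be x)); first by exists x; rewrite mulf_neq0.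
by split=> //; move: s0; rewrite big1 ?add0r // => j _; rewrite blk scale0r.
Qed.

(* Over the second field the points on the lines through the joints [e_i] rescale to
[ph x + e_i], because all the gains between two joints agree. *)
Section FramePoints.
Variables (F : fieldType) (wT : vectType F) (R P Q : finType) (p : P -> wT) (q : Q -> wT).
Variables (K : fieldType) (uT : vectType K) (w : R * R + (R * P + Q) -> uT).
Hypothesis vw : same_rk (frame_cfg (R:=R) p q) w.
Variables (r0 r1 : R) (o : P).
Hypothesis r01 : r1 != r0.

Local Notation v := (frame_cfg (R:=R) p q).
Local Notation pt x i := (inr (inl (i, x))).
Local Notation chord i j := (inl (i, j)).

Lemma frame_cfg_free x (s : seq R) : uniq s -> free (map v [seq pt x i | i <- s]).
Proof.
move=> us; set t := map v _.
have st: size t = size s by rewrite !size_map.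
apply/(@freeP _ _ _ (in_tuple t))=> c s0 i; have lti: (i < size s)%N by rewrite -st.
have := congr1 snd s0; rewrite raddf_sum=> /ffunP/(_ (nth r0 s i)); rewrite sum_ffunE ffunE=> ci.
have tE k: (k < size s)%N -> t`_k = v (pt x (nth r0 s k)).
  by move=> ltk; rewrite /t -map_comp (nth_map r0).
have coordE (j: 'I_(size t)) : (c j *: t`_j).2 (nth r0 s i) = c j * (i == j)%:R.
  by have ltj: (j < size s)%N; rewrite -?st // tE //= !ffunE nth_uniq.
rewrite -[RHS]ci (bigD1 i) //= big1=> [|j ji]; rewrite coordE ?eqxx ?addr0 ?mulr1 //.
by rewrite eq_sym (negPf ji) mulr0.
Qed.

Lemma chordE x i j : v (chord i j) = v (pt x i) - v (pt x j).
Proof. by rewrite /=; congr (_, _); rewrite subrr. Qed.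

Lemma points_free x i j k : i != j -> i != k -> j != k ->
  free [:: w (pt x i); w (pt x j); w (pt x k)].
Proof.
move=> ij ik jk; have := @frame_cfg_free x [:: i; j; k]; rewrite (same_rk_free vw); apply.
by rewrite /= !inE negb_or ij ik jk.
Qed.

Lemma chord_span i j k : w (chord j k) \in <<[:: w (chord i j); w (chord i k)]>>%VS.
Proof.
have: v (chord j k) \in <<map v [:: chord i j; chord i k]>>%VS; last by rewrite (same_rk_mem vw).
apply/span2P; exists (-1), 1; rewrite scaleN1r scale1r.
by congr (_, _); rewrite /= ?oppr0 ?addr0 // opprB addrA subrK.
Qed.

Lemma chord_coord x i j : i != j -> exists sa : K * K,
  [/\ sa.1 != 0, sa.2 != 0 & w (chord i j) = sa.1 *: (w (pt x i) - sa.2 *: w (pt x j))].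
Proof.
move=> ij; apply: (line_coord vw _ (oner_neq0 F)); last by rewrite scale1r (chordE x).
by have := @frame_cfg_free x [:: i; j]; apply; rewrite /= inE ij.
Qed.

Section Rescaled.
Variables (a s : P -> R -> K).
Local Notation f x j := (a x j *: w (pt x j)).
Hypothesis a0 : forall x j, a x j != 0.
Hypothesis s0 : forall x j, s x j != 0.
Hypothesis sE : forall x j, j != r0 -> w (chord r0 j) = s x j *: (f x r0 - f x j).

Lemma rescaled_free x j k c d e : j != r0 -> k != r0 -> j != k ->
  c *: f x r0 + d *: f x j + e *: f x k = 0 -> [/\ c = 0, d = 0 & e = 0].
Proof.
move=> jr kr jk; have fr := @points_free x r0 j k.
rewrite !scalerA; have {fr}fr: free [:: w (pt x r0); w (pt x j); w (pt x k)].
  by apply: fr; rewrite // eq_sym.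
case/(elimT (free3P _ _ _) fr); by do 3![move=> /eqP; rewrite mulf_eq0 (negPf (a0 _ _)) orbF=>
  /eqP->].
Qed.

Lemma rescaled_chord x j k : j != r0 -> k != r0 -> j != k ->
  exists2 t, t != 0 & w (chord j k) = t *: (f x j - f x k).
Proof.
move=> jr kr jk; have [[t y] [/= t0 y0 gE]] := chord_coord x jk.
have /span2P[c [d]] := chord_span r0 j k; rewrite (sE x jr) (sE x kr) gE=> gE'.
have XE i: w (pt x i) = (a x i)^-1 *: f x i by rewrite scalerK.
have dep: (- (c * s x j) - d * s x k) *: f x r0 + (t / a x j + c * s x j) *: f x j
    + (d * s x k - t * y / a x k) *: f x k = 0.
  by move/eqP: gE'; rewrite -subr_eq0 {1}(XE j) {1}(XE k)=> /eqP E; rewrite -[RHS]E; vring.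
have [h0 hj hk] := rescaled_free jr kr jk dep.
exists (d * s x k); first by rewrite (subr0_eq hk) !mulf_neq0 ?invr_eq0.
by rewrite gE' !scalerA -(subr0_eq h0); vring.
Qed.

Lemma gains_agree x j k : j != r0 -> k != r0 -> s o j / s x j = s o k / s x k.
Proof.
move=> jr kr; case: (eqVneq j k)=> [->//|jk].
have df y i: i != r0 -> f y r0 - f y i = (s o i / s y i) *: (f o r0 - f o i).
  by move=> ir; rewrite mulrC -scalerA -(sE o ir) (sE y ir) scalerK.
have [t t0 tE] := rescaled_chord x jr kr jk; have [t' _ tE'] := rescaled_chord o jr kr jk.
have dx: f x j - f x k = (t' / t) *: (f o j - f o k) by rewrite mulrC -scalerA -tE' tE scalerK.
set m := t' / t in dx; have [h0 hj hk]: [/\ s o k / s x k - s o j / s x j = 0,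
    s o j / s x j - m = 0 & m - s o k / s x k = 0].
  apply: (@rescaled_free o j k)=> //; move: (df x j jr) (df x k kr) dx=> dj dk dx.
  transitivity ((s o k / s x k) *: (f o r0 - f o k) - (s o j / s x j) *: (f o r0 - f o j)
      - m *: (f o j - f o k)); first by vring.
  by rewrite -dj -dk -dx; vring.
exact/esym/subr0_eq.
Qed.

End Rescaled.

Lemma frame_points_split : exists (b : P -> R -> K) (ph : P -> uT) (e : R -> uT),
  ph o = 0 /\ forall x j, b x j != 0 /\ w (pt x j) = b x j *: (ph x + e j).
Proof.
have ex (xj: P * R) : exists sa : K * K, [/\ sa.1 != 0, sa.2 != 0 & xj.2 != r0 ->
    w (chord r0 xj.2) = sa.1 *: (w (pt xj.1 r0) - sa.2 *: w (pt xj.1 xj.2))].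
  case: (eqVneq xj.2 r0)=> jr; first by exists (1, 1); rewrite oner_neq0.
  by have [|sa [? ? ?]] := @chord_coord xj.1 r0 xj.2; [rewrite eq_sym|exists sa].
have [sa saE] := fin_all_exists ex.
pose a x j := if j == r0 then 1 else (sa (x, j)).2; pose s x j := (sa (x, j)).1.
have a0 x j: a x j != 0 by rewrite /a; case: ifP=> _; rewrite ?oner_neq0 //; have [] := saE (x, j).
have s0 x j: s x j != 0 by have [] := saE (x, j).
have sE x j: j != r0 -> w (chord r0 j) = s x j *: (a x r0 *: w (pt x r0) - a x j *: w (pt x j)).
  by move=> jr; have [_ _ ->] := saE (x, j); rewrite //= /a eqxx (negPf jr) scale1r.
pose f x j := a x j *: w (pt x j); pose k x := s o r1 / s x r1.
have k0 x: k x != 0 by rewrite mulf_neq0 ?invr_eq0.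
have fE x j: f x j = f x r0 - k x *: (f o r0 - f o j).
  case: (eqVneq j r0)=> [->|jr]; first by rewrite subrr scaler0 subr0.
  rewrite /k (gains_agree a0 s0 sE x r01 jr) [X in _ - X *: _]mulrC -scalerA.
  by rewrite -(sE o j jr) (sE x j jr) scalerK // subKr.
exists (fun x j=> (a x j)^-1 * k x), (fun x=> (k x)^-1 *: f x r0 - f o r0), (f o).
have ko: k o = 1 by rewrite /k divff.
split=> [|x j]; first by rewrite ko invr1 scale1r subrr.
split; first by rewrite mulf_neq0 ?invr_eq0.
rewrite -scalerA scalerDr scalerBr scalerA mulfV // scale1r.
by rewrite -[LHS](scalerK (a0 x j)) -/(f x j) (fE x j); congr (_ *: _); vring.
Qed.

Lemma mem_vspan_frame t (A : {set R * R + (R * P + Q)}) : (v t \in vspan v A) = (w t \in vspan w A).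
Proof.
have memE (L: fieldType) (vT : vectType L) (u : _ -> vT) :
    (u t \in vspan u A) = (vdim u (t |: A) == vdim u A).
  apply/idP/eqP=> [ut|ut]; last by apply: contraT=> /dim_vspanU1; rewrite ut; lia.
  congr (\dim _); apply/eqP; rewrite eqEsubv !vspan_sub // => e; last first.
    by case/setU1P=> [->|/mem_vspan].
  by move=> eA; rewrite mem_vspan // setU1r.
by rewrite !memE !vw.
Qed.

Section Split.
Variables (b : P -> R -> K) (ph : P -> uT) (e : R -> uT).
Hypothesis pho : ph o = 0.
Hypothesis wE : forall x j, b x j != 0 /\ w (pt x j) = b x j *: (ph x + e j).

(* A relation expressing [e j] through the other joints and the [ph x] would put [pt x j]
in the span of the points on the other joints, all of which vanish at [j]. *)
Lemma joints_free (c : R -> K) (d : P -> K) :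
  \sum_j c j *: e j + \sum_x d x *: ph x = 0 -> forall j, c j = 0.
Proof.
move=> s0 j; apply: contraTeq isT=> cj.
pose A : {set R * R + (R * P + Q)} := [set pt ix.2 ix.1 | ix in [set ix : R * P | ix.1 != j]].
have [i0 ij]: exists i, i != j by have [<-|] := eqVneq r0 j; [exists r1 | exists r0].
have ptA x i: i != j -> ph x + e i \in vspan w A.
  move=> ij'; have [bi wi] := wE x i; rewrite -(scalerK bi (ph x + e i)) -wi rpredZ //.
  by apply/mem_vspan/imsetP; exists (i, x); rewrite ?inE.
have eA i: i != j -> e i \in vspan w A by move=> /(ptA o); rewrite pho add0r.
have phA x: ph x \in vspan w A by rewrite -[ph x](addrK (e i0)) rpredB ?eA ?ptA.
have ejA: e j \in vspan w A.
  move/eqP: s0; rewrite (bigD1 j) //= -addrA addr_eq0=> /eqP cE.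
  rewrite -(scalerK cj (e j)) cE rpredZ // rpredN rpredD //; apply: rpred_sum=> i ?.
    by rewrite rpredZ ?eA.
  by rewrite rpredZ.
have [bj wj] := wE o j; have: v (pt o j) \in vspan v A.
  by rewrite mem_vspan_frame wj pho add0r rpredZ.
case/mem_vspanP=> h /(congr1 snd); rewrite raddf_sum=> /ffunP/(_ j); rewrite sum_ffunE big1=> [|t].
  by rewrite !ffunE eqxx=> /eqP; rewrite oner_eq0.
by case/imsetP=> -[i x]; rewrite inE=> ij' ->; rewrite !ffunE eq_sym (negPf ij') scaler0.
Qed.

Lemma frame_same_blocks (be : P -> R) : dep_blocks p be <-> dep_blocks ph be.
Proof.
have vE x j: (1 : F) != 0 /\ v (pt x j) = 1 *: (((p x, 0) : wT * vec F R) + (0, unit_vec j)).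
  by rewrite oner_neq0 scale1r; split=> //; congr (_, _); rewrite ?addr0 ?add0r.
have vfree (c: R -> F) (d : P -> F) : \sum_j c j *: ((0, unit_vec j) : wT * vec F R)
    + \sum_x d x *: (p x, 0) = 0 -> forall j, c j = 0.
  move/(congr1 snd); rewrite /= !raddf_sum /= [X in _ + X]big1 ?addr0=> [s0 j|x _];
    last exact: scaler0.
  have/ffunP/(_ j) : [ffun i=> c i : F^o] = 0; last by rewrite !ffunE.
  by rewrite [LHS]ffun_unit_sum -[RHS]s0; apply: eq_bigr=> i _; rewrite ffunE.
have pE: dep_blocks p be <-> dep_blocks (fun x=> (p x, 0) : wT * vec F R) be.
  split=> -[c cx [s0 blk]]; exists c=> //; split=> //.
    rewrite [LHS]surjective_pairing !raddf_sum /= s0; congr (_, _).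
    by rewrite big1 // => x _; rewrite scaler0.
  by have := congr1 fst s0; rewrite raddf_sum.
apply: (iff_trans pE); apply: (iff_trans (dep_blocks_split be vE vfree)).
apply: iff_sym; apply: (iff_trans (dep_blocks_split be wE joints_free)).
rewrite /indep (vspan_imset v (fun x=> pt x (be x))) (vspan_imset w (fun x=> pt x (be x))) vw.
exact: iff_refl.
Qed.

End Split.
End FramePoints.

Lemma rep_char3_same_blocks F (wT : vectType F) (P Q : finType) (p : P -> wT)
  (q : Q -> wT) (o : P) : rep_char3 (@frame_cfg F wT (option P) P Q p q) ->
  exists2 K : fieldType, 3 \in [pchar K] & exists (uT : vectType K) (ph : P -> uT), same_blocks p
  ph.
Proof.
case=> K K3 [uT [w vw]]; exists K=> //.
have r01: Some o != None :> option P by [].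
have [b [ph [e [pho wE]]]] := frame_points_split vw o r01; exists uT, ph=> L be.
pose rp x := odflt x [pick y | be y == be x]; pose be' x : option P := Some (rp x).
have rpE x y: (be x == be y) = (be' x == be' y).
  have rpK z: be (rp z) = be z by rewrite /rp; case: pickP=> [u /eqP|].
  apply/eqP/eqP=> [xy|[xy]]; last by rewrite -(rpK x) xy rpK.
  by rewrite /be' /rp xy; case: pickP=> // /(_ y); rewrite eqxx.
have Pbe := frame_same_blocks vw r01 pho wE be'.
have toP (K': fieldType) (vT : vectType K') (r : P -> vT) : dep_blocks r be <-> dep_blocks r be'.
  by split; apply: dep_blocks_ker=> x y; rewrite rpE.
by apply: (iff_trans (toP _ _ _)); apply: (iff_trans Pbe); apply: iff_sym.
Qed.

Section FundamentalSystem.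
Variables (K : fieldType) (vT : vectType K) (P : finType) (l : P -> vT) (Bs : {set P}).

Definition fund_system (w : P -> P -> K) : Prop := indep l Bs /\ forall e, e \notin Bs ->
  [/\ \sum_x w e x *: l x = 0, w e e = 1, forall x, x \notin Bs -> x != e -> w e x = 0 &
      \sum_x w e x = 0].

Variable w : P -> P -> K.
Hypothesis fw : fund_system w.

Lemma fund_decomp (c : P -> K) : \sum_x c x *: l x = 0 ->
  forall x, c x = \sum_(e | e \notin Bs) c e * w e x.
Proof.
move=> s0 x; apply/eqP; rewrite -subr_eq0; have [iB hw] := fw.
pose d y := c y - \sum_(e | e \notin Bs) c e * w e y; rewrite -/(d x).
have d0 y: y \notin Bs -> d y = 0.
  move=> yB; rewrite /d (bigD1 y) //= big1 ?addr0=> [|e /andP[eB ey]].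
    by have [_ -> _ _] := hw y yB; rewrite mulr1 subrr.
  by have [_ _ w0 _] := hw e eB; rewrite w0 ?mulr0 // eq_sym.
apply: contraTT isT=> dx; have/depP/negP[] : exists d : P -> K, [/\ \sum_y d y *: l y = 0,
    forall y, y \notin Bs -> d y = 0 & exists y, d y != 0]; last by [].
exists d; split=> //; last by exists x.
under eq_bigr do rewrite scalerBl scaler_suml; rewrite sumrB s0 sub0r exchange_big big1 ?oppr0 //.
move=> e eB; under eq_bigr do rewrite -scalerA; rewrite -scaler_sumr.
by have [-> _ _ _] := hw e eB; rewrite scaler0.
Qed.

Section Labels.
Variables (S : {set P}) (L : finType) (lab : P -> L).
Hypothesis SB : [disjoint S & Bs].

Definition block_label (x : P) : L + P := if x \in S :|: Bs then inl (lab x) else inr x.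

(* A dependency supported on [S] and the basis is a combination of the fundamental
dependencies of the elements of [S]. *)
Lemma fund_dep_blocks : dep_blocks l block_label <->
  exists2 t : P -> K, exists2 e, e \in S & t e != 0 &
  forall b, \sum_(x | lab x == b) \sum_(e in S) t e * w e x = 0.
Proof.
have [iB hw] := fw; have SnB e: e \in S -> e \notin Bs.
  by move=> eS; apply/negP=> eB; move/pred0P/(_ e): SB; rewrite /= eS eB.
pose comb (t : P -> K) x := \sum_(e in S) t e * w e x.
have comb_out t x: x \notin S :|: Bs -> comb t x = 0.
  rewrite !inE negb_or=> /andP[xS xB]; apply: big1=> e eS.
  have [_ _ w0 _] := hw e (SnB e eS); rewrite w0 ?mulr0 //.
  by apply: contraNneq xS=> ->.
have combS t e: e \in S -> comb t e = t e.
  move=> eS; rewrite /comb (bigD1 e) //= big1=> [|f /andP[fS fe]].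
    by have [_ -> _ _] := hw e (SnB e eS); rewrite mulr1 addr0.
  by have [_ _ w0 _] := hw f (SnB f fS); rewrite w0 ?mulr0 // 1?eq_sym // SnB.
have blkE (c: P -> K) b : (forall x, x \notin S :|: Bs -> c x = 0) ->
    \sum_(x | block_label x == inl b) c x = \sum_(x | lab x == b) c x.
  move=> c0; rewrite big_mkcond [RHS]big_mkcond; apply: eq_bigr=> x _.
  by rewrite /block_label; case: (boolP (x \in _))=> [_ //|/c0->]; case: ifP.
split=> [[c [x cx] [s0 blk]]|[t [e eS te] blk]].
  have c_out y: y \notin S :|: Bs -> c y = 0.
    move=> yT; rewrite -[RHS](blk (inr y)) (big_pred1 y) // => z; rewrite /block_label.
    by case: ifPn=> // zT; apply/esym/negbTE; apply: contraNneq yT=> <-.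
  have cE y: c y = comb c y.
    rewrite (fund_decomp s0 y) (bigID (mem S)) /= [X in _ + X]big1 ?addr0.
      by apply: eq_bigl=> e; case eS: (e \in S); rewrite ?andbT ?andbF ?SnB.
    by move=> e /andP[eB eS]; rewrite c_out ?mul0r // inE negb_or eS.
  exists c=> [|b]; last by rewrite -[RHS](blk (inl b)) blkE //; apply: eq_bigr=> y _;
    rewrite -/(comb c y) -cE.
  apply/exists_inP; apply: contraR cx; rewrite negb_exists_in=> /forall_inP c0.
  by rewrite cE /comb big1 // => e eS; have := c0 e eS; rewrite negbK=> /eqP->; rewrite mul0r.
exists (comb t); first by exists e; rewrite combS.
split=> [|[b|x]]; last 2 first.
- by rewrite blkE //; apply: comb_out.
- by rewrite big1 // => y; rewrite /block_label; case: ifPn=> // /comb_out.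
rewrite /comb; under eq_bigr do rewrite scaler_suml; rewrite exchange_big big1 // => f fS.
under eq_bigr do rewrite -scalerA; rewrite -scaler_sumr.
by have [-> _ _ _] := hw f (SnB f fS); rewrite scaler0.
Qed.

End Labels.

Lemma fund_dep1 (A : {set P}) e : e \notin Bs ->
  dep_blocks l (block_label [set e] (mem A)) <-> \sum_(x in A) w e x = 0.
Proof.
move=> eB; have [_ _ _ we] := fw.2 e eB.
have SB: [disjoint [set e] & Bs] by rewrite disjoints1.
have sumE (t: P -> K) (Q : pred P) :
    \sum_(x | Q x) \sum_(f in [set e]) t f * w f x = t e * \sum_(x | Q x) w e x.
  by rewrite mulr_sumr; apply: eq_bigr=> x _; rewrite big_set1.
split=> [/(fund_dep_blocks _ SB)[t [f /set1P-> te] blk]|sA].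
  by apply: (mulfI te); rewrite mulr0 -[RHS](blk true) sumE; congr (_ * _); apply: eq_bigl=> x;
    rewrite eqb_id.
apply/(fund_dep_blocks _ SB); exists (fun=> 1); first by exists e; rewrite ?set11 ?oner_neq0.
move=> b; rewrite sumE mul1r; case: b.
  by rewrite -[RHS]sA; apply: eq_bigl=> x; rewrite eqb_id.
by rewrite -[RHS]we [RHS](bigID (mem A)) /= sA add0r; apply: eq_bigl=> x; rewrite eqbF_neg.
Qed.

Lemma ex_kernel2 (a b c d : K) :
  (exists s t : K, [/\ (s != 0) || (t != 0), s * a + t * c = 0 & s * b + t * d = 0]) <->
  a * d = c * b.
Proof.
split=> [[s [t [st ac bd]]]|det].
  have sE: s * (a * d - c * b) = 0.
    by transitivity (d * (s * a + t * c) - c * (s * b + t * d)); [ring|rewrite ac bd; ring].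
  have tE: t * (a * d - c * b) = 0.
    by transitivity (a * (s * b + t * d) - b * (s * a + t * c)); [ring|rewrite ac bd; ring].
  apply/subr0_eq/eqP; case/orP: st=> /negPf n0; [move/eqP: sE|move/eqP: tE]; by rewrite mulf_eq0 n0.
case: (eqVneq (a, c) (0, 0))=> [[a0 c0]|ac]; last first.
  exists (- c), a; split; [|ring|by rewrite mulNr -det; ring].
  by rewrite oppr_eq0 orbC -negb_and; apply: contra ac=> /andP[/eqP-> /eqP->].
case: (eqVneq (b, d) (0, 0))=> [[b0 d0]|bd].
  by exists 1, 0; rewrite oner_neq0 a0 b0 c0 d0; split=> //; ring.
exists (- d), b; rewrite a0 c0; split; [|ring|ring].
by rewrite oppr_eq0 orbC -negb_and; apply: contra bd=> /andP[/eqP-> /eqP->].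
Qed.

Definition side (A B : {set P}) (x : P) : option bool :=
  if x \in A then Some true else if x \in B then Some false else None.

Lemma fund_dep2 (A B : {set P}) e f : [disjoint A & B] -> e \notin Bs -> f \notin Bs -> e != f ->
  dep_blocks l (block_label [set e; f] (side A B)) <->
  (\sum_(x in A) w e x) * (\sum_(x in B) w f x) = (\sum_(x in A) w f x) * (\sum_(x in B) w e x).
Proof.
move=> dAB eB fB ef; have [_ _ _ we] := fw.2 e eB; have [_ _ _ wf] := fw.2 f fB.
have SB: [disjoint [set e; f] & Bs].
  by rewrite disjoints_subset; apply/subsetP=> x; rewrite !inE=> /orP[]/eqP->.
have sumE (t: P -> K) (Q : pred P) : \sum_(x | Q x) \sum_(g in [set e; f]) t g * w g x =
    t e * (\sum_(x | Q x) w e x) + t f * (\sum_(x | Q x) w f x).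
  rewrite !mulr_sumr -big_split; apply: eq_bigr=> x _.
  by rewrite big_setU1 ?inE //= big_set1.
have sideA x: (side A B x == Some true) = (x \in A) by rewrite /side; case: (x \in A)=> //;
  case: ifP.
have sideB x: (side A B x == Some false) = (x \in B).
  by rewrite /side; case: ifP=> xA; [move/pred0P/(_ x): dAB; rewrite /= xA|case: ifP].
have sideN x: (side A B x == None) = (x \notin A) && (x \notin B).
  by rewrite /side; case: (x \in A)=> //; case: (x \in B).
rewrite -ex_kernel2; split=> [/(fund_dep_blocks _ SB)[t [g gef tg] blk]|[s [t [st sA sB]]]].
  exists (t e), (t f); split; last 2 first.
  - by have := blk (Some true); rewrite sumE !(eq_bigl _ _ sideA).
  - by have := blk (Some false); rewrite sumE !(eq_bigl _ _ sideB).
  by move: gef; rewrite !inE=> /orP[]/eqP<-; rewrite tg ?orbT.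
apply/(fund_dep_blocks _ SB); exists (fun x=> if x == e then s else t).
  case/orP: st=> st; first by exists e; rewrite ?set21 ?eqxx.
  by exists f; rewrite ?set22 // ifN // eq_sym.
have rest g: \sum_x w g x = 0 ->
    \sum_(x | side A B x == None) w g x = - (\sum_(x in A) w g x + \sum_(x in B) w g x).
  move=> wg; apply/eqP; rewrite -addr_eq0 addrC -[X in _ == X]wg [X in _ == X](bigID (mem A)) /=.
  rewrite [X in _ == _ + X](bigID (mem B)) /= -addrA; apply/eqP; congr (_ + (_ + _)).
    by apply: eq_bigl=> x; case xB: (x \in B); rewrite ?andbT ?andbF //; case xA: (x \in A)=> //;
      move/pred0P/(_ x): dAB; rewrite /= xA xB.
  by apply: eq_bigl=> x; rewrite sideN.
move=> b; rewrite sumE eqxx [f == e]eq_sym (negPf ef).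
case: b=> [[]|]; [by rewrite !(eq_bigl _ _ sideA)|by rewrite !(eq_bigl _ _ sideB)|].
rewrite !rest // !mulrN -opprD !mulrDr addrACA sA sB; ring.
Qed.

End FundamentalSystem.

Lemma ex_fund K (vT : vectType K) (P : finType) (p : P -> vT) (Bs : {set P}) :
  indep (lift1 p) Bs -> (forall x, lift1 p x \in vspan (lift1 p) Bs) ->
  exists w, fund_system (lift1 p) Bs w.
Proof.
move=> iB sB; have ex e: exists c : P -> K, e \notin Bs ->
    [/\ \sum_x c x *: lift1 p x = 0, c e = 1, forall x, x \notin Bs -> x != e -> c x = 0 &
        \sum_x c x = 0].
  case: (boolP (e \in Bs))=> eB; first by exists (fun=> 0).
  have [c [s0 ce c0]] := mem_vspan_dep eB (sB e); exists c=> _; split=> // [x xB xe|].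
    by rewrite c0 // !inE negb_or xe.
  by move: s0; rewrite lift1_sumT=> -[].
by have [w hw] := fin_all_exists ex; exists w.
Qed.

Section SameBlocks.
Variables (F K : fieldType) (wT : vectType F) (uT : vectType K) (P : finType).
Variables (p : P -> wT) (ph : P -> uT) (Bs : {set P}).
Hypothesis pph : same_blocks p ph.
Hypothesis iB : indep (lift1 p) Bs.
Hypothesis sB : forall x, lift1 p x \in vspan (lift1 p) Bs.

Lemma same_blocks_system : exists (w : P -> P -> F) (w' : P -> P -> K),
  [/\ fund_system (lift1 p) Bs w, fund_system (lift1 ph) Bs w',
     forall e (A : {set P}), e \notin Bs ->
       (\sum_(x in A) w e x == 0) = (\sum_(x in A) w' e x == 0) &
     forall e f (A B : {set P}), [disjoint A & B] -> e \notin Bs -> f \notin Bs -> e != f ->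
       ((\sum_(x in A) w e x) * (\sum_(x in B) w f x) ==
        (\sum_(x in A) w f x) * (\sum_(x in B) w e x)) =
       ((\sum_(x in A) w' e x) * (\sum_(x in B) w' f x) ==
        (\sum_(x in A) w' f x) * (\sum_(x in B) w' e x))].
Proof.
have [w fw] := ex_fund iB sB.
have iB': indep (lift1 ph) Bs by rewrite -(same_blocks_indep _ pph).
have sB' x: lift1 ph x \in vspan (lift1 ph) Bs.
  apply: contraT=> nin; have xB: x \notin Bs by apply: contra nin; apply: mem_vspan.
  have := indepU1 iB' nin; rewrite -(same_blocks_indep _ pph)=> iBx.
  by have := indep_notin iBx (setU11 x Bs); rewrite setU1K ?sB.
have [w' fw'] := ex_fund iB' sB'.
have blocks (L: finType) (be : P -> L) : dep_blocks (lift1 p) be <-> dep_blocks (lift1 ph) be.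
  by split=> /dep_blocks_lift1/pph/dep_blocks_lift1.
exists w, w'; split=> // [e A eB|e f A B dAB eB fB ef].
  by apply/eqP/eqP; [move/(fund_dep1 fw A eB)/blocks/(fund_dep1 fw' A eB)
    |move/(fund_dep1 fw' A eB)/blocks/(fund_dep1 fw A eB)].
have det := fund_dep2 fw dAB eB fB ef; have det' := fund_dep2 fw' dAB eB fB ef.
by apply/eqP/eqP; [move/det/blocks/det'|move/det'/blocks/det].
Qed.

End SameBlocks.

(** * Pairs of dependencies over GF(4) *)

(* [(x, y)] encodes the element [x + y al] of GF(4), so that the classification below
can be computed. *)
Definition c4 := (bool * bool)%type.
Definition c0 : c4 := (false, false).
Definition c1 : c4 := (true, false).
Definition ca : c4 := (false, true).
Definition cb : c4 := (true, true).
Definition add4 (x y : c4) : c4 := (xorb x.1 y.1, xorb x.2 y.2).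
Definition mul4 (x y : c4) : c4 :=
  match x with
  | (false, false) => c0
  | (true, false) => y
  | (false, true) => (y.2, xorb y.1 y.2)
  | (true, true) => (xorb y.1 y.2, y.1) end.
Definition det4 (x y : c4 * c4) : c4 := add4 (mul4 x.1 y.2) (mul4 x.2 y.1).
Definition sum4 (B : seq (c4 * c4)) (s : seq nat) : c4 * c4 :=
  foldr (fun k r=> (add4 (nth (c0, c0) B k).1 r.1, add4 (nth (c0, c0) B k).2 r.2)) (c0, c0) s.

Definition nonzero_pairs : seq (c4 * c4) :=
  [seq (x, y) | x <- [:: c1; ca; cb], y <- [:: c0; c1; ca; cb]] ++
  [seq (c0, y) | y <- [:: c1; ca; cb]].

Definition nonzero_pair (z : c4 * c4) : bool := z != (c0, c0).

Fixpoint multisets (T : Type) (vs : seq T) (n : nat) : seq (seq T) := if vs is v :: vs' then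
    flatten [seq [seq nseq c v ++ m | m <- multisets vs' (n - c)] | c <- iota 0 n.+1]
  else [:: [::]].

(* Over characteristic 3 a value cannot repeat three times, nor can all values repeat. *)
Definition balanced_row (s : seq c4) : bool := (count_mem c1 s, count_mem ca s, count_mem cb s)
  \in [:: (1, 1, 1); (2, 2, 0); (2, 0, 2); (0, 2, 2)]%N.

(* The coordinates of a pair of fundamental dependencies off the frame, in normal form. *)
Definition good_forms : seq (seq (c4 * c4)) := [:: [:: (ca, cb); (cb, ca)]] ++
  [seq [:: (x, y); (mul4 x x, c0); (c0, mul4 y y)] | x <- [:: ca; cb], y <- [:: ca; cb]] ++
  [seq [:: (t, c1); (mul4 t t, t); (c0, t)] | t <- [:: ca; cb]] ++
  [seq [:: (c1, t); (t, mul4 t t); (t, c0)] | t <- [:: ca; cb]] ++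
  [seq [:: (c1, t); (t, c1); (t, t)] | t <- [:: ca; cb]].

Definition bad_distinct := [:: (c1, c0); (ca, c0); (c0, c1); (c0, ca); (c0, cb)].
Definition bad_repeated := [:: (c1, c0); (ca, c0); (c0, c1); (c0, c1); (c0, ca)].
Definition bad_three_lines := [:: (c1, c0); (c1, c0); (c0, c1); (c0, c1); (ca, cb)].
Definition bad_four_lines := [:: (c0, c1); (c1, ca); (cb, cb); (c1, c0); (cb, c0)].
Definition bad_hexagon := [:: (c1, c0); (ca, c0); (c0, c1); (c0, ca); (c1, c1); (ca, ca)].
Definition bad_forms :=
  [:: bad_distinct; bad_repeated; bad_three_lines; bad_four_lines; bad_hexagon].

Definition change_frame (x y : c4 * c4) (s t : c4) (z : c4 * c4) : c4 * c4 :=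
  (mul4 s (det4 z y), mul4 t (det4 x z)).

Definition has_bad_frame (l : seq (c4 * c4)) : bool :=
  has (fun x=> has (fun y=> if det4 x y == c0 then false else
  has (fun s=> has (fun t=> let l' := [seq change_frame x y s t z | z <- l] in
      has (fun B=> all (fun z=> count_mem z B <= count_mem z l')%N B) bad_forms)
  [:: c1; ca; cb]) [:: c1; ca; cb]) l) l.

Definition pair_form_check (m : seq (c4 * c4)) : bool := let l := [:: (c1, c0), (c0, c1) & m] in
  if balanced_row [seq z.1 | z <- l] then if balanced_row [seq z.2 | z <- l] then
      if all (fun x=> balanced_row [seq det4 x y | y <- l]) l then
        if has (fun g=> perm_eq g m) good_forms then true else has_bad_frame l else true else true
  else true.

Lemma pair_form_checked : all pair_form_check (multisets nonzero_pairs 6).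
Proof. by vm_compute. Qed.

Section BadForms.
Variable K : fieldType.
Hypothesis K3 : 1 + 1 + 1 = 0 :> K.
Implicit Types (B : seq (c4 * c4)) (X Y : nat -> K) (s t : seq nat).

Definition psum X s : K := foldr (fun k r=> X k + r) 0 s.

Definition same_dets B X Y : Prop :=
  forall s t, all (fun k=> k < size B)%N (s ++ t) -> uniq (s ++ t) ->
  (psum X s * psum Y t == psum Y s * psum X t) = (det4 (sum4 B s) (sum4 B t) == c0).

Lemma self_opp_eq0 (x : K) : x = - x -> x = 0.
Proof.
move=> xN; transitivity (x * (1 + 1 + 1)); last by rewrite K3 mulr0.
by rewrite !mulrDr !mulr1 {3}xN addrN add0r.
Qed.

Lemma cube_root_eq1 (x : K) : x * x + x + 1 = 0 -> x = 1.
Proof.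
move=> x0; apply/eqP; rewrite -subr_eq0 -[_ == 0]orbb -mulf_eq0; apply/eqP.
transitivity (x * x + x + 1 - (1 + 1 + 1) * x); first by ring.
by rewrite x0 K3 mul0r subr0.
Qed.

Lemma same_dets_eq B X Y s t : same_dets B X Y ->
  all (fun k=> k < size B)%N (s ++ t) -> uniq (s ++ t) ->
  (det4 (sum4 B s) (sum4 B t) == c0) = true -> psum X s * psum Y t = psum Y s * psum X t.
Proof. by move=> H lt_st ust d0; apply/eqP; rewrite H. Qed.

Lemma same_dets_neq B X Y s t : same_dets B X Y ->
  all (fun k=> k < size B)%N (s ++ t) -> uniq (s ++ t) ->
  (det4 (sum4 B s) (sum4 B t) == c0) = false -> psum X s * psum Y t <> psum Y s * psum X t.
Proof. by move=> H lt_st ust d0; apply/eqP; rewrite H // d0. Qed.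

Lemma psum_lin X Y a b s : psum (fun k=> a * X k + b * Y k) s = a * psum X s + b * psum Y s.
Proof. by elim: s=> [|k s /= ->]; rewrite /= ?mulr0 ?addr0 //; ring. Qed.

Lemma same_dets_frame B X Y i j : same_dets B X Y -> (i < size B)%N -> (j < size B)%N ->
  i != j -> (det4 (sum4 B [:: i]) (sum4 B [:: j]) == c0) = false ->
  exists X' Y', same_dets B X' Y' /\ [/\ X' i = 1, Y' i = 0, X' j = 0 & Y' j = 1].
Proof.
move=> H li lj ij nz.
have dn: X i * Y j - Y i * X j != 0.
  have := @same_dets_neq _ _ _ [:: i] [:: j] H; rewrite /= li lj inE ij /= !addr0 subr_eq0.
  by move=> dn; apply/eqP/dn.
pose d := X i * Y j - Y i * X j.
exists (fun k=> Y j / d * X k + - X j / d * Y k), (fun k=> - Y i / d * X k + X i / d * Y k).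
split; last by split; apply: (mulfI dn); rewrite ?mulr0 ?mulr1 /d; field.
move=> s t lt_st ust; rewrite -(H s t lt_st ust) !psum_lin -subr_eq0 -[RHS]subr_eq0.
set x := psum X s; set y := psum Y s; set x' := psum X t; set y' := psum Y t.
have -> : (Y j / d * x + - X j / d * y) * (- Y i / d * x' + X i / d * y') -
    (- Y i / d * x + X i / d * y) * (Y j / d * x' + - X j / d * y') = d^-1 * (x * y' - y * x').
  by rewrite /d; field.
by rewrite mulf_eq0 invr_eq0 (negPf dn).
Qed.

Ltac vanish H s t := have /= := @same_dets_eq _ _ _ s t H isT isT (erefl true).
Ltac nonzero H s t := have /= := @same_dets_neq _ _ _ s t H isT isT (erefl false).
Ltac simp01 := rewrite ?(addr0, add0r, mulr0, mul0r, mulr1, mul1r).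

Lemma eq_opp (x y : K) : x + y = 0 -> y = - x.
Proof. by move=> xy; apply/eqP; rewrite -addr_eq0 addrC xy. Qed.

Local Open Scope nat_scope.

Lemma not_bad_distinct X Y : ~ same_dets bad_distinct X Y.
Proof.
move=> /(same_dets_frame (i:=0) (j:=2))[//|//|//|//|{}X [{}Y [H [x0 y0 x2 y2]]]].
vanish H [:: 1] [:: 0]; rewrite x0 y0; simp01=> /esym y1.
vanish H [:: 3] [:: 2]; rewrite x2 y2; simp01=> x3.
vanish H [:: 4] [:: 2]; rewrite x2 y2; simp01=> x4.
vanish H [:: 2; 3; 4] [:: 0]; rewrite x0 y0 x2 y2 x3 x4; simp01=> /esym/eq_opp s.
vanish H [:: 0; 2] [:: 1; 3]; rewrite x0 y0 x2 y2 y1 x3; simp01=> a.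
vanish H [:: 0; 3] [:: 1; 4]; rewrite x0 y0 y1 x3 x4; simp01; rewrite a=> b.
move: s; rewrite a b=> s.
have /cube_root_eq1 x1: (X 1 * X 1 + X 1 + 1 = 0)%R.
  by rewrite [X in (X + 1)%R]addrC s addNr.
by nonzero H [:: 0; 3] [:: 1; 2]; apply; rewrite x0 y0 x2 y2 y1 x3; simp01; rewrite a x1 mulr1.
Qed.

Lemma not_bad_repeated X Y : ~ same_dets bad_repeated X Y.
Proof.
move=> /(same_dets_frame (i:=0) (j:=2))[//|//|//|//|{}X [{}Y [H [x0 y0 x2 y2]]]].
vanish H [:: 1] [:: 0]; rewrite x0 y0; simp01=> /esym y1.
vanish H [:: 3] [:: 2]; rewrite x2 y2; simp01=> x3.
vanish H [:: 4] [:: 2]; rewrite x2 y2; simp01=> x4.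
vanish H [:: 2; 3] [:: 0]; rewrite x0 y0 x2 y2 x3; simp01=> /esym/eq_opp s.
vanish H [:: 0; 2] [:: 1; 4]; rewrite x0 y0 x2 y2 y1 x4; simp01=> a.
vanish H [:: 0; 3] [:: 1; 4]; rewrite x0 y0 x3 y1 x4; simp01; rewrite s a mulN1r=> /self_opp_eq0 b.
by nonzero H [:: 1] [:: 2]; apply; rewrite x2 y1 b; simp01.
Qed.

Lemma not_bad_three_lines X Y : ~ same_dets bad_three_lines X Y.
Proof.
move=> /(same_dets_frame (i:=0) (j:=2))[//|//|//|//|{}X [{}Y [H [x0 y0 x2 y2]]]].
vanish H [:: 1] [:: 0]; rewrite x0 y0; simp01=> /esym y1.
vanish H [:: 3] [:: 2]; rewrite x2 y2; simp01=> x3.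
vanish H [:: 0; 1] [:: 2]; rewrite x0 y0 x2 y2 y1; simp01=> /eq_opp x1.
vanish H [:: 2; 3] [:: 0]; rewrite x0 y0 x2 y2 x3; simp01=> /esym/eq_opp y3.
vanish H [:: 0; 4] [:: 1; 3]; rewrite x0 y0 x1 y1 x3 y3; simp01=> a.
vanish H [:: 0; 4] [:: 1; 2]; rewrite x0 y0 x1 y1 x2 y2; simp01=> b.
move: a; rewrite mulrN1 b mulrN1 opprK=> /self_opp_eq0 c.
by nonzero H [:: 4] [:: 0]; apply; rewrite x0 y0 c; simp01.
Qed.

Lemma not_bad_hexagon X Y : ~ same_dets bad_hexagon X Y.
Proof.
move=> /(same_dets_frame (i:=0) (j:=2))[//|//|//|//|{}X [{}Y [H [x0 y0 x2 y2]]]].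
vanish H [:: 1] [:: 0]; rewrite x0 y0; simp01=> /esym y1.
vanish H [:: 3] [:: 2]; rewrite x2 y2; simp01=> x3.
vanish H [:: 2; 4] [:: 0]; rewrite x0 y0 x2 y2; simp01=> /esym/eq_opp y4.
vanish H [:: 0; 4] [:: 2]; rewrite x0 y0 x2 y2; simp01=> /eq_opp x4.
vanish H [:: 4] [:: 5]; rewrite x4 y4; simp01; rewrite !mulN1r=> /oppr_inj y5.
vanish H [:: 3; 5] [:: 0]; rewrite x0 y0 x3; simp01=> /esym/eq_opp y3.
vanish H [:: 1; 5] [:: 2]; rewrite x2 y2 y1; simp01=> /eq_opp x5.
vanish H [:: 1; 4] [:: 0; 3]; rewrite x0 y0 x3 y1 x4 y4; simp01=> a.
have y3E: Y 3 = X 1 by rewrite -[LHS]opprK -y3 y5 x5 opprK.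
have /cube_root_eq1 z: ((- X 1) * (- X 1) + (- X 1) + 1 = 0)%R.
  rewrite y3E in a; transitivity ((X 1 - 1) * X 1 + 1)%R; first by ring.
  by rewrite a addNr.
nonzero H [:: 0; 1] [:: 2]; apply; rewrite x0 y0 x2 y2 y1 -[X 1]opprK z; simp01.
by rewrite subrr.
Qed.

Lemma not_bad_four_lines X Y : ~ same_dets bad_four_lines X Y.
Proof.
move=> /(same_dets_frame (i:=3) (j:=0))[//|//|//|//|{}X [{}Y [H [x3 y3 x0 y0]]]].
vanish H [:: 4] [:: 3]; rewrite x3 y3; simp01=> /esym y4.
vanish H [:: 3; 1] [:: 0]; rewrite x0 y0 x3 y3; simp01=> /eq_opp x1.
vanish H [:: 4; 2] [:: 0]; rewrite x0 y0; simp01=> /eq_opp x2.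
vanish H [:: 0; 1; 2] [:: 3]; rewrite x3 y3 y0; simp01=> /esym s.
vanish H [:: 0; 4] [:: 1]; rewrite x0 y0 x1 y4; simp01=> a.
vanish H [:: 0; 3] [:: 2]; rewrite x0 y0 x3 y3 x2; simp01=> b.
have /cube_root_eq1 z: ((- X 4) * (- X 4) + (- X 4) + 1 = 0)%R.
  transitivity (- X 4 * (1 + (Y 1 - X 4)) + (X 4 * Y 1 + 1))%R; first by ring.
  by rewrite -b s a mulr0 add0r addNr.
nonzero H [:: 3; 4] [:: 0]; apply; rewrite x0 y0 x3 y3 y4 -[X 4]opprK z; simp01.
by rewrite subrr.
Qed.

Lemma not_bad_form B X Y : B \in bad_forms -> ~ same_dets B X Y.
Proof.
rewrite !inE=> /orP[/eqP->|/orP[/eqP->|/orP[/eqP->|/orP[/eqP->|/eqP->]]]].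
- exact: not_bad_distinct.
- exact: not_bad_repeated.
- exact: not_bad_three_lines.
- exact: not_bad_four_lines.
exact: not_bad_hexagon.
Qed.

End BadForms.

Lemma multisets_complete (T : eqType) (vs s : seq T) n : {subset s <= vs} -> (size s <= n)%N ->
  exists2 m, m \in multisets vs n & perm_eq s m.
Proof.
elim: vs s n=> [|v vs IH] s n svs sn.
  by case: s svs {sn}=> [|x s] svs; [exists [::] | have := svs x (mem_head _ _)].
set c := count_mem v s; set s' := filter (predC (pred1 v)) s.
have sz: (size s = c + size s')%N by rewrite size_filter -(count_predC (pred1 v)).
have [||m mm pm] := IH s' (n - c)%N; last first.
- exists (nseq c v ++ m).
    by apply/flatten_mapP; exists c; [rewrite mem_iota add0n ltnS; lia | apply/mapP; exists m].
  have vc: filter (pred1 v) s = nseq c v.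
    by rewrite /c; elim: (s)=> //= x r ->; case: eqP=> [->|].
  by rewrite -vc -(perm_cat2l (filter (pred1 v) s)) in pm *;
    rewrite -(permPr pm) perm_sym perm_filterC.
- lia.
by move=> x; rewrite mem_filter=> /andP[/= xv /svs]; rewrite inE (negPf xv).
Qed.

Lemma perm_map_ex (T U : eqType) (d : T) (f : T -> U) (s : seq T) (g : seq U) :
  perm_eq g (map f s) -> exists2 xs, perm_eq xs s & map f xs = g.
Proof.
move=> gs; have [Is pI gE] := perm_iotaP (f d) gs; exists [seq nth d s i | i <- Is].
  by apply/(perm_iotaP d); exists Is=> //; rewrite size_map in pI.
rewrite gE -map_comp; apply/eq_in_map=> i iI /=; rewrite (nth_map d) //.
by have := perm_mem pI i; rewrite iI mem_iota add0n size_map=> /esym.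
Qed.

Lemma three_of_count (T : eqType) (q : pred T) s : uniq s -> (2 < count q s)%N ->
  exists x y z, [/\ q x, q y, q z & uniq [:: x; y; z]].
Proof.
move=> us; rewrite -size_filter; have := filter_uniq q us; have := filter_all q s.
case: (filter q s)=> [|x [|y [|z r]]] //= /and4P[qx qy qz _].
rewrite !inE !negb_or=> /andP[/and3P[xy xz _] /andP[/andP[yz _] _]] _.
by exists x, y, z; rewrite /= !inE !negb_or xy xz yz qx qy qz.
Qed.

Lemma two_of_count (T : eqType) (q : pred T) s : uniq s -> (1 < count q s)%N ->
  exists x y, [/\ q x, q y & x != y].
Proof.
move=> us; rewrite -size_filter; have := filter_uniq q us; have := filter_all q s.
case: (filter q s)=> [|x [|y r]] //= /and3P[qx qy _]; rewrite !inE !negb_or.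
by move=> /andP[/andP[xy _] _] _; exists x, y.
Qed.

Lemma count_nonzero (s : seq c4) :
  count (fun c=> c != c0) s = (count_mem c1 s + count_mem ca s + count_mem cb s)%N.
Proof. by elim: s=> //= c s ->; case: c=> [[] []] /=; lia. Qed.

Lemma sum4_parity s : foldr add4 c0 s =
  (odd (count_mem c1 s + count_mem cb s), odd (count_mem ca s + count_mem cb s)).
Proof.
elim: s=> //= x s ->; rewrite /add4 !oddD.
by case: x=> [[] []] /=; do 3!case: (odd _).
Qed.

Lemma balanced_row_intro s : (forall c, c != c0 -> (count_mem c s <= 2)%N) ->
  ~ [/\ count_mem c1 s = 2, count_mem ca s = 2 & count_mem cb s = 2]%N ->
  (2 < count (fun c=> c != c0) s)%N -> foldr add4 c0 s = c0 -> balanced_row s.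
Proof.
move=> le2; rewrite count_nonzero sum4_parity /balanced_row.
move: (le2 c1 isT) (le2 ca isT) (le2 cb isT).
by case: (count_mem c1 s) (count_mem ca s) (count_mem cb s)=>
  [|[|[|]]] // [|[|[|]]] // [|[|[|]]] //= _ _ _ [].
Qed.

Lemma balanced_row_le4 s : balanced_row s -> (count (fun c=> c != c0) s <= 4)%N.
Proof. by rewrite count_nonzero /balanced_row !inE=> /or4P[]/eqP[-> -> ->]. Qed.

Definition is_basis K (vT : vectType K) (P : finType) (l : P -> vT) (Bs : {set P}) : Prop :=
  indep l Bs /\ forall x, l x \in vspan l Bs.

Section Exchange.
Variables (K : fieldType) (vT : vectType K) (P : finType) (l : P -> vT) (Bs : {set P}).
Variables (w : P -> P -> K) (e o : P).
Hypotheses (fw : fund_system l Bs w) (eB : e \notin Bs) (oB : o \in Bs) (eo : w e o != 0).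

Local Notation Bs' := (e |: (Bs :\ o)).

Lemma exchange_neq : o != e.
Proof. by apply: contraTneq oB=> ->. Qed.

Lemma exchange_out : o \notin Bs'.
Proof. by rewrite !inE negb_or exchange_neq eqxx. Qed.

Lemma exchange_notin f : f \notin Bs -> f != e -> f \notin Bs'.
Proof. by move=> fB fe; rewrite !inE negb_or fe negb_and fB orbT. Qed.

Lemma exchange_basis : is_basis l Bs -> is_basis l Bs'.
Proof.
move=> [iB sB]; have [e1 _ e3 _] := fw.2 e eB.
have cB: #|Bs'| = #|Bs| by rewrite cardsU1 !inE negb_and eB orbT (cardsD1 o Bs) oB.
have lo: l o \in vspan l Bs'.
  rewrite -(scalerK eo (l o)) rpredZ //; have /eqP := e1.
  rewrite (bigD1 o) //= addr_eq0=> /eqP->; rewrite rpredN; apply: rpred_sum=> x xo.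
  have [xB|] := boolP (x \in Bs'); first by rewrite rpredZ // mem_vspan.
  by rewrite !inE negb_or (negPf xo) /= => /andP[xe xB]; rewrite e3 // scale0r rpred0.
have sub: (vspan l Bs <= vspan l Bs')%VS.
  apply: vspan_sub=> x xB; case: (eqVneq x o)=> [->//|xo].
  by apply: mem_vspan; rewrite !inE xo xB orbT.
split; last by move=> x; apply: (subvP sub).
by rewrite /indep eqn_leq vspan_card cB -(eqP iB) dimvS.
Qed.

Variable w2 : P -> P -> K.
Hypothesis fw2 : fund_system l Bs' w2.

Lemma exchange_entering x : w2 o x = w e x / w e o.
Proof.
have [e1 _ e3 _] := fw.2 e eB.
have s0: \sum_y (w e y / w e o) *: l y = 0.
  under eq_bigr do rewrite mulrC -scalerA; by rewrite -scaler_sumr e1 scaler0.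
rewrite (fund_decomp fw2 s0 x) (bigD1 o) ?exchange_out //= mulfV // mul1r big1 ?addr0 // =>
  g /andP[].
by rewrite !inE negb_or=> /andP[ge] + go; rewrite go /= => gB; rewrite (e3 g) // !mul0r.
Qed.

Lemma exchange_other f x : f \notin Bs -> f != e -> w2 f x = w f x - w f o / w e o * w e x.
Proof.
move=> fB fe; have [e1 _ e3 _] := fw.2 e eB; have [f1 f2 f3 _] := fw.2 f fB.
have s0: \sum_y (w f y - w f o / w e o * w e y) *: l y = 0.
  under eq_bigr do rewrite scalerBl -[in X in _ - X]scalerA.
  by rewrite sumrB -scaler_sumr e1 f1 scaler0 subrr.
rewrite (fund_decomp fw2 s0 x) (bigD1 f) ?exchange_notin //= f2 (e3 f) // mulr0 subr0 mul1r.
rewrite big1 ?addr0 // => g /andP[]; rewrite !inE negb_or=> /andP[ge] + gf.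
case: (eqVneq g o)=> [-> _|go /= gB]; first by rewrite divfK // subrr mul0r.
by rewrite f3 // (e3 g) // mulr0 subrr mul0r.
Qed.

End Exchange.

Definition good_columns (s : seq (c4 * c4)) : bool :=
  has (fun g=> perm_eq g [seq z <- s | nonzero_pair z]) good_forms.

Definition triples4 : seq (c4 * c4 * c4) :=
  let all4 := [:: c0; c1; ca; cb] in [seq (xy, z) | xy <- [seq (x, y) | x <- all4, y <- all4], z <-
  all4].
Definition columns3 (r s : c4 * c4 * c4) : seq (c4 * c4) :=
  [:: (r.1.1, s.1.1); (r.1.2, s.1.2); (r.2, s.2)].
Definition triple_patterns (t : c4) : seq ((c4 * c4 * c4) * (c4 * c4 * c4)) :=
  [:: ((t, c1, t), (t, t, c1)); ((t, t, c1), (t, c1, t));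
      ((t, mul4 t t, c0), (t, c0, mul4 t t)); ((t, c0, mul4 t t), (t, mul4 t t, c0))].

Lemma triple_patterns_complete : all (fun t=> all (fun r =>
  if good_columns (columns3 r (c1, t, t)) then
  all (fun s=> if good_columns (columns3 s (c1, t, t)) then
      if good_columns (columns3 r s) then (r, s) \in triple_patterns t else true else true) triples4
  else true) triples4) [:: ca; cb].
Proof. by vm_compute. Qed.

Lemma mem_triples4 r : r \in triples4.
Proof. by case: r=> [[[[] []] [[] []]] [[] []]]. Qed.

Lemma good_forms_full_column :
  all (fun h=> (count (fun z=> z.2 != c0) h == 3) ==> (size h == 3)) good_forms.
Proof. by vm_compute. Qed.

Definition row_types := [:: [:: ca; cb]; [:: c1; ca; ca]; [:: c1; cb; cb]].

Lemma good_forms_rows : all (fun h =>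
  has (fun r=> perm_eq r [seq c <- unzip1 h | c != c0]) row_types) good_forms.
Proof. by vm_compute. Qed.

Definition crossing_form := [:: (ca, cb); (cb, ca)].
Definition overlap_forms : seq (seq (c4 * c4)) :=
  [seq [:: (x, y); (mul4 x x, c0); (c0, mul4 y y)] | x <- [:: ca; cb], y <- [:: ca; cb]].

Lemma good_forms_light : all (fun h => perm_eq [:: ca; cb] [seq c <- unzip1 h | c != c0] ==>
  perm_eq [:: ca; cb] [seq c <- unzip2 h | c != c0] ==>
  (h \in crossing_form :: overlap_forms)) good_forms.
Proof. by vm_compute. Qed.

Section QuaternaryPairs.
Variables (F : finFieldType) (F4 : #|F| = 4%N) (al : F) (alE : al ^+ 2 = al + 1).

Let F2 := F4_char2 F4.

Definition dec4 (c : c4) : F := c.1%:R + c.2%:R * al.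
Definition enc4 (x : F) : c4 :=
  if x == 0 then c0 else if x == 1 then c1 else if x == al then ca else cb.

Lemma al_neq1 : al != 1.
Proof. by apply/eqP=> al1; move/eqP: alE; rewrite al1 expr1n (addrr_pchar2 F2) oner_eq0. Qed.

Lemma dec4K : cancel dec4 enc4.
Proof.
have a0 := al_neq0 alE; have a1 := al_neq1.
case=> [[] []]; rewrite /dec4 /enc4 /= ?mul1r ?mul0r ?addr0 ?add0r ?eqxx ?oner_eq0 ?(negPf a0)
  ?(negPf a1) //.
have n0: 1 + al != 0 by rewrite addrC -alE expf_neq0.
have n1: 1 + al != 1 by rewrite -subr_eq0 addrC addrA addNr add0r.
have na: 1 + al != al by rewrite -subr_eq0 addrK oner_eq0.
by rewrite (negPf n0) (negPf n1) (negPf na).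
Qed.

Lemma enc4K : cancel enc4 dec4.
Proof.
move=> x; rewrite /enc4 /dec4; case: eqP=> [->|/eqP x0]; first by rewrite mul0r addr0.
case: eqP=> [->|/eqP x1]; first by rewrite mul0r addr0.
case: eqP=> [->|/eqP xa]; first by rewrite mul1r add0r.
rewrite /= mul1r addrC.
by case: (F4_cases F4 alE x) x0 x1 xa=> [->|->|->|->] //; rewrite eqxx.
Qed.

Lemma dec4_inj : injective dec4. Proof. exact: can_inj dec4K. Qed.

Lemma dec4_0 : dec4 c0 = 0. Proof. by rewrite /dec4 mul0r addr0. Qed.

Lemma dec4_1 : dec4 c1 = 1. Proof. by rewrite /dec4 mul0r addr0. Qed.

Lemma dec4E : (dec4 c0 = 0) * (dec4 c1 = 1) * (dec4 ca = al) * (dec4 cb = al ^+ 2).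
Proof. by rewrite alE dec4_0 dec4_1 /dec4 /= mul1r add0r addrC. Qed.

Lemma dec4_eq0 c : (dec4 c == 0) = (c == c0).
Proof. by rewrite -dec4_0 (inj_eq dec4_inj). Qed.

Lemma enc4_eq x c : (enc4 x == c) = (x == dec4 c).
Proof. by rewrite -(inj_eq dec4_inj) enc4K. Qed.

Lemma enc4_eq0 x : (enc4 x == c0) = (x == 0).
Proof. by rewrite enc4_eq dec4_0. Qed.

Lemma natr_xorb (i j : bool) : (xorb i j)%:R = i%:R + j%:R :> F.
Proof. by case: i; case: j; rewrite /= ?(addrr_pchar2 F2) ?addr0 ?add0r. Qed.

Lemma dec4D x y : dec4 (add4 x y) = dec4 x + dec4 y.
Proof. by rewrite /dec4 /= !natr_xorb mulrDl addrACA. Qed.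

Lemma dec4M x y : dec4 (mul4 x y) = dec4 x * dec4 y.
Proof.
have two0: 2%:R = 0 :> F := pcharf0 F2.
by case: x=> [[] []]; case: y=> [u v]; rewrite /dec4 /= ?natr_xorb; ring: alE two0.
Qed.

Lemma dec4_det x y : dec4 (det4 x y) = dec4 x.1 * dec4 y.2 + dec4 x.2 * dec4 y.1.
Proof. by rewrite /det4 dec4D !dec4M. Qed.

Variables (K : fieldType) (K3 : 1 + 1 + 1 = 0 :> K).

Section PairForm.
Variables (P : finType) (a b : P -> F) (a' b' : P -> K).
Hypothesis dets : forall s t : seq P, uniq (s ++ t) ->
  ((\sum_(x <- s) a x) * (\sum_(x <- t) b x) == (\sum_(x <- s) b x) * (\sum_(x <- t) a x)) =
  ((\sum_(x <- s) a' x) * (\sum_(x <- t) b' x) == (\sum_(x <- s) b' x) * (\sum_(x <- t) a' x)).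
Variables (e f : P).
Hypotheses (ef : e != f) (ae : a e = 1) (be : b e = 0) (af : a f = 0) (bf : b f = 1).
Hypotheses (sa : \sum_x a x = 0) (sb : \sum_x b x = 0).
Hypothesis weight : forall s t : F, (s != 0) || (t != 0) ->
  (2 < #|[set x | (s * a x + t * b x)%R != 0%R]|)%N.

Local Notation D x y := (a x * b y + b x * a y).
Local Notation D' x y := (a' x * b' y - b' x * a' y).

Lemma row_sum_eq0 x (s : seq P) : uniq (x :: s) ->
  (\sum_(y <- s) D x y == 0) = (\sum_(y <- s) D' x y == 0).
Proof.
move=> us; have := @dets s [:: x]; rewrite uniq_catC=> /(_ us);
  rewrite !big_seq1 big_split sumrB -!mulr_sumr /= => E.
rewrite subr_eq0 addr_eq0 (oppr_pchar2 F2) [a x * _]mulrC [b x * _]mulrC [a' x * _]mulrC.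
by rewrite [b' x * _]mulrC eq_sym E eq_sym.
Qed.

Lemma det_self x : D x x = 0.
Proof. by rewrite mulrC (addrr_pchar2 F2). Qed.

Lemma det_neq x u : D x u != 0 -> x != u.
Proof. by apply: contraNneq=> <-; rewrite det_self. Qed.

Lemma det_self_opp x u : D x u != 0 -> D' x u <> - D' x u.
Proof.
move=> xu /(self_opp_eq0 K3) xu0; have := @row_sum_eq0 x [:: u].
by rewrite !big_seq1 xu0 eqxx (negPf xu) /= inE (det_neq xu)=> /(_ isT).
Qed.

Lemma det_opp x u v : u != v -> D x u != 0 -> D x v = D x u -> D' x u = - D' x v.
Proof.
move=> uv xu vu; apply/eqP; rewrite -addr_eq0; have := @row_sum_eq0 x [:: u; v].
rewrite !big_cons !big_nil !addr0 vu (addrr_pchar2 F2) eqxx=> <- //.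
by rewrite /= !inE negb_or uv (det_neq xu) det_neq // vu.
Qed.

Lemma row_value_le2 x u v w : uniq [:: u; v; w] -> D x u != 0 -> D x v = D x u -> D x w <> D x u.
Proof.
rewrite /= !inE negb_or andbT=> /andP[/andP[uv uw] vw] xu vu wu; apply: (det_self_opp xu).
have wn: D x w != 0 by rewrite wu.
have uw': w != u by rewrite eq_sym.
rewrite {1}(det_opp uv xu vu) (@det_opp x v w) ?vu // opprK.
exact: det_opp uw' wn (esym wu).
Qed.

Lemma row_not222 x u1 u2 v1 v2 w1 w2 : u1 != u2 -> v1 != v2 -> w1 != w2 ->
  D x u1 = dec4 c1 -> D x u2 = dec4 c1 -> D x v1 = dec4 ca -> D x v2 = dec4 ca ->
  D x w1 = dec4 cb -> D x w2 = dec4 cb -> False.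
Proof.
move=> _ _ ww xu1 _ xv1 _ xw1 xw2.
have ne u v c d: D x u = dec4 c -> D x v = dec4 d -> c != d -> u != v.
  by move=> xu xv; apply: contraNneq=> uv; rewrite -(inj_eq dec4_inj) -xu -xv uv.
have nx u c: D x u = dec4 c -> c != c0 -> x != u.
  by move=> xu cn; apply: det_neq; rewrite xu dec4_eq0.
have sum3 w: D x w = dec4 cb -> D' x u1 + (D' x v1 + D' x w) = 0.
  move=> xw; have := @row_sum_eq0 x [:: u1; v1; w].
  rewrite !big_cons !big_nil !addr0 xu1 xv1 xw -!dec4D dec4_0 eqxx=> E; apply/eqP; rewrite -E //=.
  rewrite !inE !negb_or (nx _ _ xu1) // (nx _ _ xv1) // (nx _ _ xw) //.
  by rewrite (ne _ _ _ _ xu1 xv1) // (ne _ _ _ _ xu1 xw) // (ne _ _ _ _ xv1 xw).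
have n1: D x w1 != 0 by rewrite xw1 dec4_eq0.
apply: (det_self_opp n1); rewrite {1}(det_opp ww n1) ?xw2 ?xw1 //; congr (- _).
by have := sum3 w1 xw1; rewrite -(sum3 w2 xw2)=> /addrI/addrI.
Qed.

Definition pair_code (x : P) : c4 * c4 := (enc4 (a x), enc4 (b x)).
Let T : seq P := [seq x <- enum P | nonzero_pair (pair_code x)].

Lemma nonzero_pair_code x : nonzero_pair (pair_code x) = (a x != 0) || (b x != 0).
Proof. by rewrite /nonzero_pair xpair_eqE negb_and !enc4_eq0. Qed.

Lemma uniq_support : uniq T. Proof. by rewrite filter_uniq ?enum_uniq. Qed.

Lemma det4_code x y : det4 (pair_code x) (pair_code y) = enc4 (D x y).
Proof. by apply: dec4_inj; rewrite dec4_det /= !enc4K. Qed.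

Lemma sum_support (h : P -> F) : (forall x, ~~ nonzero_pair (pair_code x) -> h x = 0) ->
  dec4 (foldr add4 c0 [seq enc4 (h x) | x <- T]) = \sum_x h x.
Proof.
move=> h0; have -> : \sum_x h x = \sum_(x <- T) h x.
  rewrite /T big_filter -big_enum big_mkcond [RHS]big_mkcond /=; apply: eq_bigr=> x _.
  by case: ifPn=> // /h0.
by elim: T=> [|x s IH]; rewrite ?big_nil ?dec4_0 // big_cons /= dec4D enc4K IH.
Qed.

Lemma balanced_row_support x : nonzero_pair (pair_code x) ->
  balanced_row [seq det4 (pair_code x) (pair_code y) | y <- T].
Proof.
move=> nx; rewrite (eq_map (det4_code x)).
have cE c: count_mem c [seq enc4 (D x y) | y <- T] = count (fun y=> D x y == dec4 c) T.
  by rewrite count_map; apply: eq_count=> y /=; rewrite enc4_eq.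
have D0 y: ~~ nonzero_pair (pair_code y) -> D x y = 0.
  by rewrite nonzero_pair_code negb_or !negbK=> /andP[/eqP-> /eqP->]; rewrite !mulr0 addr0.
apply: balanced_row_intro=> [c cn|||].
- rewrite leqNgt cE; apply/negP=>
  /(three_of_count uniq_support)[u [v [w [/eqP xu /eqP xv /eqP xw uvw]]]].
  by apply: (row_value_le2 uvw (x:=x)); rewrite ?xu ?xv ?xw // dec4_eq0.
- rewrite !cE=> -[n1 na nb]; have two c := two_of_count uniq_support (q:=fun y=> D x y == dec4 c).
  have [|u1 [u2 [/eqP xu1 /eqP xu2 uu]]] := two c1; first by rewrite n1.
  have [|v1 [v2 [/eqP xv1 /eqP xv2 vv]]] := two ca; first by rewrite na.
  have [|w1 [w2 [/eqP xw1 /eqP xw2 ww]]] := two cb; first by rewrite nb.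
  exact: (row_not222 uu vv ww xu1 xu2 xv1 xv2 xw1 xw2).
- rewrite count_map; have -> : count (preim (fun y=> enc4 (D x y)) (fun c=> c != c0)) T
      = #|[set y | b x * a y + a x * b y != 0]|.
    rewrite cardsE cardE size_filter -enumT /T count_filter; apply: eq_count=> y /=.
    rewrite unfold_in /= enc4_eq0 addrC; case: (boolP (nonzero_pair (pair_code y)))=> ny;
      rewrite ?andbT ?andbF //.
    by have := D0 y ny; rewrite addrC=> ->; rewrite eqxx.
  by apply: weight; rewrite orbC -nonzero_pair_code.
by apply: dec4_inj; rewrite (sum_support D0) big_split -!mulr_sumr /= sa sb !mulr0 addr0 dec4_0.
Qed.

Lemma pair_code_e : pair_code e = (c1, c0).
Proof. by rewrite /pair_code ae be -dec4_0 -dec4_1 !dec4K. Qed.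

Lemma pair_code_f : pair_code f = (c0, c1).
Proof. by rewrite /pair_code af bf -dec4_0 -dec4_1 !dec4K. Qed.

Lemma perm_support : perm_eq T [:: e, f & rem f (rem e T)].
Proof.
have eT: e \in T by rewrite mem_filter mem_enum andbT pair_code_e.
apply: perm_trans (perm_to_rem eT) _; rewrite perm_cons; apply: perm_to_rem.
by rewrite mem_rem_uniq ?uniq_support // !inE eq_sym ef mem_filter mem_enum andbT pair_code_f.
Qed.

Lemma det4_e z : det4 (c1, c0) z = z.2.
Proof. by case: z=> [[[] []] [[] []]]. Qed.

Lemma det4_f z : det4 (c0, c1) z = z.1.
Proof. by case: z=> [[[] []] [[] []]]. Qed.

Lemma perm_balanced_row r s : perm_eq r s -> balanced_row r = balanced_row s.
Proof. by move=> rs; rewrite /balanced_row !(seq.permP rs). Qed.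

Lemma size_support : (size (rem f (rem e T)) <= 6)%N.
Proof.
have wb: (count (fun x=> b x != 0%R) T <= 4)%N.
  have /balanced_row_le4: balanced_row [seq det4 (pair_code e) (pair_code y) | y <- T].
    by apply: balanced_row_support; rewrite pair_code_e.
  by rewrite count_map; congr (_ <= _)%N; apply: eq_count=> y /=;
    rewrite pair_code_e det4_e enc4_eq0.
have wa: (count (fun x=> a x != 0%R) T <= 4)%N.
  have /balanced_row_le4: balanced_row [seq det4 (pair_code f) (pair_code y) | y <- T].
    by apply: balanced_row_support; rewrite pair_code_f.
  by rewrite count_map; congr (_ <= _)%N; apply: eq_count=> y /=;
    rewrite pair_code_f det4_f enc4_eq0.
have : (size T <= count (fun x=> a x != 0%R) T + count (fun x=> b x != 0%R) T)%N.
  rewrite -count_predUI (_ : count _ T = size T) ?leq_addr //; apply/eqP; rewrite -all_count.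
  by apply/allP=> x; rewrite mem_filter nonzero_pair_code=> /andP[].
have := perm_size perm_support=> /=; lia.
Qed.

Lemma change_frame_sum (xs : seq P) u v s t (B : seq (c4 * c4)) :
  B = [seq change_frame (pair_code u) (pair_code v) s t (pair_code z) | z <- xs] ->
  forall r, all (fun k=> k < size B)%N r -> let S := [seq nth e xs k | k <- r] in
  dec4 (sum4 B r).1 = dec4 s * ((\sum_(x <- S) a x) * b v + (\sum_(x <- S) b x) * a v) /\
  dec4 (sum4 B r).2 = dec4 t * (a u * (\sum_(x <- S) b x) + b u * (\sum_(x <- S) a x)).
Proof.
move=> BE; elim=> [_|k r IH /=]; first by rewrite /= !big_nil dec4_0; split; ring.
rewrite {1}BE size_map=> /andP[kB /IH[/= S1 S2]].
by rewrite !big_cons !dec4D S1 S2 BE (nth_map e) //= !dec4M !det4_code !enc4K; split; ring.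
Qed.

Lemma not_bad_frame (xs : seq P) u v s t B : uniq xs -> B \in bad_forms ->
  B = [seq change_frame (pair_code u) (pair_code v) s t (pair_code z) | z <- xs] ->
  s != c0 -> t != c0 -> D u v != 0 -> False.
Proof.
move=> uxs bB BE s0 t0 uv.
have szx: size B = size xs by rewrite BE size_map.
apply: (@not_bad_form K K3 B (fun k=> a' (nth e xs k)) (fun k=> b' (nth e xs k)) bB).
move=> p q ltB upq.
have psumE (h: P -> K) r : psum (fun k=> h (nth e xs k)) r =
    \sum_(x <- [seq nth e xs k | k <- r]) h x.
  by elim: r=> [|k r IH] /=; rewrite ?big_nil // big_cons IH.
rewrite !psumE -dets; last first.
  rewrite -map_cat map_inj_in_uniq // => i j /(allP ltB) iB /(allP ltB) jB /eqP.
  by rewrite nth_uniq -?szx // => /eqP.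
move: ltB; rewrite all_cat=> /andP[ltp ltq].
have [p1 p2] := change_frame_sum BE ltp; have [q1 q2] := change_frame_sum BE ltq.
rewrite -dec4_eq0 dec4_det p1 p2 q1 q2.
set Sp := [seq nth e xs k | k <- p]; set Sq := [seq nth e xs k | k <- q].
set A1 := \sum_(x <- Sp) a x; set B1 := \sum_(x <- Sp) b x.
set A2 := \sum_(x <- Sq) a x; set B2 := \sum_(x <- Sq) b x.
have two0: 2%:R = 0 :> F := pcharf0 F2.
have -> : dec4 s * (A1 * b v + B1 * a v) * (dec4 t * (a u * B2 + b u * A2)) +
    dec4 t * (a u * B1 + b u * A1) * (dec4 s * (A2 * b v + B2 * a v)) =
    dec4 s * dec4 t * D u v * (A1 * B2 + B1 * A2) by ring: two0.
rewrite !mulf_eq0 !dec4_eq0 (negPf s0) (negPf t0) (negPf uv) /=.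
by rewrite addr_eq0 (oppr_pchar2 F2).
Qed.

Lemma pair_form : has (fun g=> perm_eq g [seq pair_code x | x <- rem f (rem e T)]) good_forms.
Proof.
have subv: {subset [seq pair_code x | x <- rem f (rem e T)] <= nonzero_pairs}.
  move=> _ /mapP[x /mem_rem/mem_rem + ->]; rewrite mem_filter=> /andP[+ _].
  by case: (pair_code x)=> [[[] []] [[] []]].
have [|m mm pm] := multisets_complete (n:=6) subv; first by rewrite size_map size_support.
have := allP pair_form_checked m mm; rewrite /pair_form_check; set l := [:: (c1, c0), (c0, c1) & m].
have pl: perm_eq l [seq pair_code x | x <- T].
  rewrite perm_sym; apply: perm_trans (perm_map pair_code perm_support) _.
  by rewrite /= pair_code_e pair_code_f !perm_cons.
have okl z: z \in l -> balanced_row [seq det4 z y | y <- l].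
  rewrite (perm_mem pl)=> /mapP[x xT ->].
  rewrite (perm_balanced_row (perm_map _ pl)) -map_comp; apply: balanced_row_support.
  by move: xT; rewrite mem_filter=> /andP[].
rewrite -(eq_map det4_f) -(eq_map det4_e) !okl ?mem_head // ?inE ?eqxx ?orbT //.
rewrite (introT allP okl); case: ifP=> [/hasP[g gg pg] _|_].
  by apply/hasP; exists g=> //; rewrite (perm_trans pg) // perm_sym.
case/hasP=> z zl /hasP[y yl]; case: ifPn=> // dzy /hasP[s ss /hasP[t tt /hasP[B BB Bl]]].
move: zl yl; rewrite !(perm_mem pl)=> /mapP[u _ zE] /mapP[v _ yE].
have pT: perm_eq [seq change_frame z y s t x | x <- l] [seq change_frame z y s t (pair_code x) | x
  <- T].
  by rewrite [X in perm_eq _ X](map_comp (change_frame z y s t)) perm_map.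
have /count_subseqP[_ /subseqP[m' _ ->] pB] :
    forall x, (count_mem x B <= count_mem x [seq change_frame z y s t (pair_code x) | x <- T])%N.
  move=> x; rewrite -(seq.permP pT); case: (boolP (x \in B))=> [/(allP Bl)//|xB].
  by rewrite (count_memPn xB).
rewrite -map_mask in pB; have [xs pxs BE] := perm_map_ex e pB; exfalso.
apply: (@not_bad_frame xs u v s t B)=> //; rewrite -?zE -?yE //.
- by rewrite (perm_uniq pxs) mask_uniq ?uniq_support.
- by apply: contraTneq ss=> ->.
- by apply: contraTneq tt=> ->.
by move: dzy; rewrite zE yE det4_code enc4_eq0.
Qed.

Lemma pair_form_seq (s : seq P) : uniq s -> {in s, forall x, x != e /\ x != f} ->
  (forall x, x \notin s -> x != e -> x != f -> a x = 0 /\ b x = 0) ->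
  has (fun g=> perm_eq g [seq z <- [seq pair_code x | x <- s] | nonzero_pair z]) good_forms.
Proof.
move=> us sef out; have /hasP[g gg pg] := pair_form; apply/hasP; exists g=> //.
apply: perm_trans pg _; rewrite filter_map; apply: perm_map.
apply: uniq_perm=> [||x]; [by rewrite !rem_uniq ?uniq_support | by rewrite filter_uniq |].
rewrite mem_rem_uniq ?rem_uniq ?uniq_support // inE /= mem_rem_uniq ?uniq_support // inE /=.
have -> : (x \in T) = nonzero_pair (pair_code x) by rewrite mem_filter mem_enum andbT.
rewrite mem_filter /=; case: (boolP (nonzero_pair _))=> nx; rewrite ?andbF //= andbT.
apply/andP/idP=> [[xf xe]|/sef[] //]; apply: contraT=> xs.
by have [ax bx] := out x xs xe xf; move: nx; rewrite nonzero_pair_code ax bx eqxx.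
Qed.

End PairForm.

Section Core.
Variables (wT : vectType F) (uT : vectType K) (P : finType) (p : P -> wT) (ph : P -> uT).
Hypothesis pph : same_blocks p ph.
Hypothesis pinj : injective p.

Local Notation l := (lift1 p).

Record paired_system (Bs : {set P}) (w : P -> P -> F) (w' : P -> P -> K) : Prop := PairedSystem {
  paired_fund : fund_system l Bs w; paired_fund' : fund_system (lift1 ph) Bs w';
  paired_sum : forall e s, uniq s -> e \notin Bs ->
    (\sum_(x <- s) w e x == 0) = (\sum_(x <- s) w' e x == 0);
  paired_dets : forall e f s t, uniq (s ++ t) -> e \notin Bs -> f \notin Bs -> e != f ->
    ((\sum_(x <- s) w e x) * (\sum_(x <- t) w f x) == (\sum_(x <- s) w f x) * (\sum_(x <- t) w e x))
      =
    ((\sum_(x <- s) w' e x) * (\sum_(x <- t) w' f x) == (\sum_(x <- s) w' f x) *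
      (\sum_(x <- t) w' e x)) }.

Lemma ex_paired_system Bs : is_basis l Bs -> exists w w', paired_system Bs w w'.
Proof.
move=> [iB sB]; have [w [w' [fw fw' sums dets]]] := same_blocks_system pph iB sB; exists w, w'.
have sE (R: nmodType) (h : P -> R) s : uniq s -> \sum_(x <- s) h x = \sum_(x in [set y in s]) h x.
  by move=> us; rewrite big_uniq //; apply: eq_bigl=> x; rewrite inE.
split=> // [e s us eB|e f s t + eB fB ef]; first by rewrite !sE // sums.
rewrite cat_uniq=> /and3P[us dis ut]; rewrite !sE // dets // disjoint_subset.
apply/subsetP=> x; rewrite !inE=> xs; apply: contra dis=> xt.
by apply/hasP; exists x.
Qed.

Lemma dependency_weight (c : P -> F) : \sum_x c x *: l x = 0 -> (exists x, c x != 0) ->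
  (2 < #|[set x | c x != 0%R]|)%N.
Proof.
rewrite lift1_sumT=> -[cp cs] [z cz]; rewrite ltnNge (cardsD1 z) inE cz; apply/negP=> small.
have [y c0]: exists y, forall x, x != z -> x != y -> c x = 0.
  have [y yS|none] := pickP [pred x in [set x | c x != 0%R] :\ z]; [exists y|exists z]=> x xz xy.
    apply/eqP; apply: contraT=> cx; move: small; rewrite add1n ltnS=> /card_le1_eqP small.
    by case/eqP: xy; apply/esym/small; [rewrite !inE xz | exact: yS].
  by have := none x; rewrite !inE xz /= => /negbFE/eqP.
have sumE (V: nmodType) (h : P -> V) : y != z -> (forall x, x != z -> x != y -> h x = 0) ->
    \sum_x h x = h z + h y.
  by move=> yz h0; rewrite (bigD1 z) //= (bigD1 y) //= big1 ?addr0 // => x /andP[]; apply: h0.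
case: (eqVneq y z)=> [yz|yz].
  by move: cs; rewrite (bigD1 z) //= big1 ?addr0=> [/eqP|x xz]; rewrite ?(negPf cz) // c0 // yz.
move: cs cp; rewrite !sumE // => [/eqP|x xz xy]; last by rewrite c0 // scale0r.
rewrite addr_eq0=> /eqP czy; rewrite czy scaleNr addrC=> /subr0_eq/scalerI E.
by move: yz; rewrite (pinj (E _)) ?eqxx // -oppr_eq0 -czy.
Qed.

Section Basis.
Variables (Bs : {set P}) (w : P -> P -> F) (w' : P -> P -> K).
Hypothesis ps : paired_system Bs w w'.

Let fw e : e \notin Bs -> [/\ \sum_x w e x *: l x = 0, w e e = 1,
  forall x, x \notin Bs -> x != e -> w e x = 0 & \sum_x w e x = 0].
Proof. exact: (paired_fund ps).2. Qed.

Let fw' e : e \notin Bs -> w' e e = 1 /\ forall x, x \notin Bs -> x != e -> w' e x = 0.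
Proof. by case/(paired_fund' ps).2. Qed.

Lemma good_columns_pair e f (s : seq P) : e \notin Bs -> f \notin Bs -> e != f -> uniq s ->
  {subset s <= Bs} -> (forall x, x \in Bs -> x \notin s -> w e x = 0 /\ w f x = 0) ->
  good_columns [seq (enc4 (w e x), enc4 (w f x)) | x <- s].
Proof.
move=> eB fB ef us sB out; have [e1 e2 e3 e4] := fw eB; have [f1 f2 f3 f4] := fw fB.
have fe: f != e by rewrite eq_sym.
apply: (@pair_form_seq P (w e) (w f) (w' e) (w' f) _ e f)=> //; try by auto.
- by move=> s1 s2 u12; apply: (paired_dets ps).
- move=> a b ab; apply: (@dependency_weight (fun x=> a * w e x + b * w f x)).
    under eq_bigr do rewrite scalerDl -!scalerA.
    by rewrite big_split /= -!scaler_sumr e1 f1 !scaler0 addr0.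
  case/orP: ab=> ?; [exists e|exists f]; first by rewrite e2 f3 // mulr1 mulr0 addr0.
  by rewrite f2 e3 // mulr1 mulr0 add0r.
- by move=> x /sB xB; split; apply: contraTneq xB=> ->.
move=> x xs xe xf; have [xB|xB] := boolP (x \in Bs); first exact: out.
by rewrite e3 // f3.
Qed.

Definition supp e : seq P := [seq x <- enum P | (x \in Bs) && (w e x != 0)].
Definition supp2 e f : seq P := [seq x <- enum P | (x \in Bs) && ((w e x != 0) || (w f x != 0))].
Definition row e : seq c4 := [seq enc4 (w e x) | x <- supp e].

Lemma supp2_uniq e f : uniq (supp2 e f).
Proof. by rewrite filter_uniq ?enum_uniq. Qed.

Lemma mem_supp e x : (x \in supp e) = (x \in Bs) && (w e x != 0).
Proof. by rewrite mem_filter mem_enum andbT. Qed.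

Lemma mem_supp2 e f x : (x \in supp2 e f) = (x \in Bs) && ((w e x != 0) || (w f x != 0)).
Proof. by rewrite mem_filter mem_enum andbT. Qed.

Lemma pair_columns e f : e \notin Bs -> f \notin Bs -> e != f ->
  exists2 h, h \in good_forms & perm_eq h [seq (enc4 (w e x), enc4 (w f x)) | x <- supp2 e f].
Proof.
move=> eB fB ef.
have: good_columns [seq (enc4 (w e x), enc4 (w f x)) | x <- supp2 e f].
  apply: good_columns_pair (supp2_uniq e f) _ _=> // x; rewrite mem_supp2; first by case/andP.
  by move=> -> /=; rewrite negb_or !negbK=> /andP[/eqP-> /eqP->].
case/hasP=> h hg; rewrite (all_filterP _); first by exists h.
apply/allP=> _ /mapP[x + ->]; rewrite mem_supp2=> /andP[_].
by rewrite /nonzero_pair xpair_eqE !enc4_eq0 negb_and.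
Qed.

Lemma ex_support_order (e f : P) (h : seq (c4 * c4)) :
  perm_eq h [seq (enc4 (w e x), enc4 (w f x)) | x <- supp2 e f] -> exists xs : seq P,
  [/\ [seq (enc4 (w e x), enc4 (w f x)) | x <- xs] = h, uniq xs, {subset xs <= Bs} &
      forall x, x \in Bs -> x \notin xs -> w e x = 0 /\ w f x = 0].
Proof.
case/(perm_map_ex e)=> xs pxs xE; exists xs; split=> // [|x|x xB];
  rewrite ?(perm_uniq pxs) ?supp2_uniq //.
  by rewrite (perm_mem pxs) mem_supp2=> /andP[].
by rewrite (perm_mem pxs) mem_supp2 xB negb_or !negbK=> /andP[/eqP-> /eqP->].
Qed.

Lemma row_pair e f h : perm_eq h [seq (enc4 (w e x), enc4 (w f x)) | x <- supp2 e f] ->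
  perm_eq (row e) [seq c <- unzip1 h | c != c0] /\ perm_eq (row f) [seq c <- unzip2 h | c != c0].
Proof.
have suppE g: {subset supp g <= supp2 e f} -> perm_eq (supp g) [seq x <- supp2 e f | w g x != 0].
  move=> sg; apply: uniq_perm=> [||x].
  - by rewrite filter_uniq ?enum_uniq.
  - by rewrite filter_uniq ?supp2_uniq.
  rewrite mem_supp mem_filter; have := sg x; rewrite mem_supp mem_supp2.
  by case: (x \in Bs)=> //=; case: (w g x == 0)=> //= /(_ isT) ->.
move=> hE; split; rewrite perm_sym (perm_trans (perm_filter _ (perm_map _ hE))) // -map_comp
  filter_map.
  rewrite perm_sym perm_map // (eq_filter (a2:=fun x=> w e x != 0))=> [|x]; last first.
    by rewrite /= enc4_eq0.
  by apply: suppE=> x; rewrite mem_supp mem_supp2=> /andP[-> ->].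
rewrite perm_sym perm_map // (eq_filter (a2:=fun x=> w f x != 0))=> [|x]; last first.
  by rewrite /= enc4_eq0.
by apply: suppE=> x; rewrite mem_supp mem_supp2=> /andP[-> ->]; rewrite orbT.
Qed.

Definition light_row e := perm_eq [:: ca; cb] (row e).
Definition heavy_row e := exists2 t, t \in [:: ca; cb] & perm_eq [:: c1; t; t] (row e).

Lemma row_type e f : e \notin Bs -> f \notin Bs -> e != f -> heavy_row e \/ light_row e.
Proof.
move=> eB fB ef; have [h hg hE] := pair_columns eB fB ef.
have [re _] := row_pair hE; have /hasP[r rr pr] := allP good_forms_rows h hg.
have {pr}pr: perm_eq r (row e) by rewrite (perm_trans pr) // perm_sym.
by move: rr pr; rewrite !inE=> /or3P[]/eqP-> pr; [right|left; exists ca|left; exists cb].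
Qed.

Lemma coef'_eq0 d x : d \notin Bs -> w' d x = 0 -> w d x = 0.
Proof.
move=> dB wx; have := @paired_sum _ _ _ ps d [:: x] isT dB.
by rewrite !big_seq1 wx eqxx=> /eqP.
Qed.

Lemma coef'_opp d x y : d \notin Bs -> x != y -> w d x = w d y -> w' d x = - w' d y.
Proof.
move=> dB xy wxy; apply/eqP; rewrite -addr_eq0.
have := @paired_sum _ _ _ ps d [:: x; y]; rewrite !big_cons !big_nil !addr0=> <- //.
  by rewrite wxy (addrr_pchar2 F2).
by rewrite /= inE xy.
Qed.

Lemma coef'_eqN1 d x : d \notin Bs -> x \in Bs -> w d x = 1 -> w' d x = - 1.
Proof.
move=> dB xB dx; have [_ d1 _ _] := fw dB; have [d1' _] := fw' dB.
by rewrite (@coef'_opp d x d) ?d1' ?d1 //; apply: contraTneq xB=> ->.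
Qed.

Lemma coef'_eq d e x : d \notin Bs -> e \notin Bs -> d != e -> x \in Bs ->
  w d x = w e x -> w' d x = w' e x.
Proof.
move=> dB eB de xB wx; have := @paired_dets _ _ _ ps d e [:: d; e] [:: x].
have [_ d1 d0 _] := fw dB; have [_ e1 e0 _] := fw eB.
have [d1' d0'] := fw' dB; have [e1' e0'] := fw' eB.
have ed: e != d by rewrite eq_sym.
have xn g: g \notin Bs -> g != x by apply: contraNneq=> ->.
rewrite !big_cons !big_nil !addr0 d1 e1 (d0 e) // (e0 d) // d1' e1' (d0' e) // (e0' d) //.
rewrite !addr0 !add0r !mul1r wx eqxx=> E; apply/esym/eqP; rewrite -E //=.
by rewrite !inE negb_or de !xn.
Qed.

Lemma coef'_sum d x y : d \notin Bs -> x \in Bs -> y \in Bs -> x != y ->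
  1 + w d x + w d y = 0 -> w' d y = - (1 + w' d x).
Proof.
move=> dB xB yB xy s0; have := @paired_sum _ _ _ ps d [:: d; x; y].
have [_ d1 _ _] := fw dB; have [d1' _] := fw' dB.
have dn z: z \in Bs -> d != z by move=> zB; apply: contraNneq dB=> ->.
rewrite !big_cons !big_nil !addr0 d1 d1' !addrA s0 eqxx=> E.
by apply/eq_opp/eqP; rewrite -E //= !inE negb_or !dn ?xy.
Qed.

Lemma coef'_det d e x y : d \notin Bs -> e \notin Bs -> d != e -> x != y ->
  w d x * w e y = w e x * w d y -> w' d x * w' e y = w' e x * w' d y.
Proof.
move=> dB eB de xy det; have := @paired_dets _ _ _ ps d e [:: x] [:: y].
by rewrite !big_seq1 det eqxx=> E; apply/eqP; rewrite -E //= inE xy.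
Qed.

Section HeavyTriple.
Variables (g d e u v z : P) (t : F).
Hypotheses (gB : g \notin Bs) (dB : d \notin Bs) (eB : e \notin Bs).
Hypotheses (de : d != e) (dg : d != g) (eg : e != g).
Hypotheses (uB : u \in Bs) (vB : v \in Bs) (zB : z \in Bs).
Hypotheses (uv : u != v) (uz : u != z) (vz : v != z) (t0 : t != 0).
Hypotheses (gu : w g u = 1) (gv : w g v = t) (gz : w g z = t).

Lemma not_three_heavy : w d u = t -> w d v = 1 -> w d z = t -> w e u = t -> w e v = t -> w e z <> 1.
Proof.
move=> du _ dz eu ev _; have dgz := coef'_eq dB gB dg zB; have egv := coef'_eq eB gB eg vB.
have /(self_opp_eq0 K3)/(coef'_eq0 dB)/eqP: w' d u = - w' d u; last by rewrite du (negPf t0).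
rewrite {1}(coef'_opp dB uz) ?du ?dz // dgz ?dz // (coef'_eq dB eB de uB) ?du ?eu //.
by rewrite (coef'_opp eB uv) ?eu ?ev // egv ?ev // opprK (coef'_opp gB vz) ?gv ?gz ?opprK.
Qed.

Lemma not_heavy_two_light : 1 + t + t ^+ 2 = 0 -> w d u = t -> w d v = t ^+ 2 ->
  w d z = 0 -> w e u = t -> w e v = 0 -> w e z <> t ^+ 2.
Proof.
move=> tt du dv _ eu _ ez.
have dvE: w' d v = - (1 + w' d u) by apply: coef'_sum; rewrite ?du ?dv.
have ezE: w' e z = - (1 + w' e u) by apply: coef'_sum; rewrite ?eu ?ez.
have ueq: w' e u = w' d u by apply/esym/coef'_eq; rewrite ?du ?eu.
have gu' := coef'_eqN1 gB uB gu.
have gvz: w' g v = - w' g z by apply: coef'_opp; rewrite ?gv ?gz.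
have dg_det := coef'_det dB gB dg uv; have eg_det := coef'_det eB gB eg uz.
have /(self_opp_eq0 K3) du0: 1 + w' d u = - (1 + w' d u).
  move: dg_det eg_det; rewrite du dv gu gv eu ez gz gu' ueq dvE ezE ueq gvz expr2 mul1r !mulN1r
    !opprK.
  by move=> /(_ erefl) E /(_ erefl) E'; rewrite -{2}E' -E mulrN.
have /(coef'_eq0 dB)/eqP: w' d v = 0 by rewrite dvE du0 oppr0.
by rewrite dv expf_eq0 (negPf t0).
Qed.

End HeavyTriple.

Lemma support_of_heavy g d (s : seq P) : d \notin Bs -> g \notin Bs -> d != g -> uniq s ->
  size s = 3 -> {subset s <= Bs} -> (forall x, x \in s -> w g x != 0) ->
  (forall x, x \in Bs -> x \notin s -> w g x = 0) -> forall x, x \in Bs -> x \notin s -> w d x = 0.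
Proof.
move=> dB gB dg us s3 sB gs gout x xB xs; apply/eqP; apply: contraT=> dx.
have [h hg hE] := pair_columns dB gB dg.
have c3: count (fun c=> c.2 != c0) h = 3.
  rewrite (seq.permP hE) count_map -size_filter -s3; apply/perm_size/uniq_perm=> // [|y].
    by rewrite filter_uniq ?supp2_uniq.
  rewrite mem_filter mem_supp2 /= enc4_eq0; apply/idP/idP=> [/and3P[gy yB _]|ys].
    by apply: contraT=> /(gout y yB) g0; rewrite g0 eqxx in gy.
  by rewrite (sB y ys) gs ?orbT.
have /implyP/(_ (introT eqP c3))/eqP sz := allP good_forms_full_column h hg.
have : all (fun c=> c.2 != c0) h by rewrite all_count c3 sz.
rewrite (perm_all _ hE) all_map=> /allP/(_ x); rewrite mem_supp2 xB dx /= => /(_ isT).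
by rewrite enc4_eq0 gout ?eqxx.
Qed.

Lemma heavy_no_triple g d e : g \notin Bs -> d \notin Bs -> e \notin Bs -> d != e -> d != g ->
  e != g -> ~ heavy_row g.
Proof.
move=> gB dB eB de dg eg [t tt /(perm_map_ex g)[s ps' sE]].
have us: uniq s by rewrite (perm_uniq ps') filter_uniq ?enum_uniq.
have memS x: (x \in s) = (x \in Bs) && (w g x != 0) by rewrite (perm_mem ps') mem_filter mem_enum
  andbT.
have s3: size s = 3 by rewrite -(size_map (fun x=> enc4 (w g x))) sE.
have sB: {subset s <= Bs} by move=> x; rewrite memS=> /andP[].
have gs x: x \in s -> w g x != 0 by rewrite memS=> /andP[].
have gout x: x \in Bs -> x \notin s -> w g x = 0 by rewrite memS=> -> /negbNE/eqP.
have dout := support_of_heavy dB gB dg us s3 sB gs gout.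
have eout := support_of_heavy eB gB eg us s3 sB gs gout.
case: s sE us sB s3 dout eout gout {ps' memS gs}=> [|u [|v [|z []]]] // [gu gv gz] us sB _ dout eout
  gout.
pose code f := (enc4 (w f u), enc4 (w f v), enc4 (w f z)).
have codeE f x y c: code f = (x, y, c) -> [/\ w f u = dec4 x, w f v = dec4 y & w f z = dec4 c].
  by case=> <- <- <-; rewrite !enc4K.
have cols f f': f \notin Bs -> f' \notin Bs -> f != f' ->
    (forall x, x \in Bs -> x \notin [:: u; v; z] -> w f x = 0) ->
    (forall x, x \in Bs -> x \notin [:: u; v; z] -> w f' x = 0) ->
    good_columns (columns3 (code f) (code f')).
  by move=> fB fB' ff o o'; apply: (@good_columns_pair f f' [:: u; v; z])=> // x xB xs;
    rewrite o ?o'.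
have cg: code g = (c1, t, t) by rewrite /code gu gv gz.
have := allP triple_patterns_complete t tt=> /allP/(_ (code d) (mem_triples4 _)).
rewrite -cg cols // => /allP/(_ (code e) (mem_triples4 _)); rewrite !cols //.
have t0: dec4 t != 0 by rewrite dec4_eq0; apply: contraTneq tt=> ->.
have [g1 g2 g3] := codeE g _ _ _ cg; rewrite dec4_1 in g1.
have [uB [vB zB]]: u \in Bs /\ v \in Bs /\ z \in Bs by split; [|split]; apply: sB;
  rewrite !inE eqxx ?orbT.
move: us; rewrite /= !inE !negb_or andbT=> /andP[/andP[uv uz] vz].
have ed: e != d by rewrite eq_sym.
have tt0: 1 + dec4 t + dec4 t ^+ 2 = 0.
  rewrite expr2 -dec4M -dec4_1 -!dec4D -dec4_0.
  by move: tt; rewrite !inE=> /orP[]/eqP->.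
have no_heavy a b: a \notin Bs -> b \notin Bs -> a != b -> a != g -> b != g ->
    code a = (t, c1, t) -> code b = (t, t, c1) -> False.
  move=> aB bB ab ag bg /codeE[a1 a2 a3] /codeE[b1 b2 b3]; rewrite dec4_1 in a2 b3.
  by apply: (not_three_heavy (g:=g) (d:=a) (e:=b) (u:=u) (v:=v) (z:=z) (t:=dec4 t)).
have no_light a b: a \notin Bs -> b \notin Bs -> a != b -> a != g -> b != g ->
    code a = (t, mul4 t t, c0) -> code b = (t, c0, mul4 t t) -> False.
  move=> aB bB ab ag bg /codeE[a1 a2 a3] /codeE[b1 b2 b3].
  rewrite dec4_0 in a3 b2; rewrite dec4M -expr2 in a2 b3.
  by apply: (not_heavy_two_light (g:=g) (d:=a) (e:=b) (u:=u) (v:=v) (z:=z) (t:=dec4 t)).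
have patt A B: (code d, code e) = (A, B) -> code d = A /\ code e = B.
  by case=> <- <-.
case/or4P=> /eqP/patt[cd ce].
- exact: (no_heavy d e).
- exact: (no_heavy e d).
- exact: (no_light d e).
exact: (no_light e d).
Qed.

Lemma ex_light_exchange e f : e \notin Bs -> f \notin Bs -> e != f -> light_row e -> light_row f ->
  perm_eq crossing_form [seq (enc4 (w e x), enc4 (w f x)) | x <- supp2 e f] \/
  exists o y z, [/\ [/\ o \in Bs, y \in Bs & z \in Bs], uniq [:: o; y; z],
  w e o != 0 /\ w f o != 0, w e y != 0 /\ w f y = 0 & w e z = 0 /\ w f z != 0].
Proof.
move=> eB fB ef Le Lf; have [h hg hE] := pair_columns eB fB ef.
have [re rf] := row_pair hE; have := allP good_forms_light h hg.
rewrite (perm_trans Le re) (perm_trans Lf rf) /= inE=> /predU1P[<-|]; first by left.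
case/allpairsP=> -[x y] /= [xx yy hE']; right; have [xs [xE us sB _]] := ex_support_order hE.
rewrite hE' in xE; case: xs xE us sB=> [|o [|y' [|z []]]] // [eo fo ey fy ez fz] us sB.
have nz a c: enc4 (w a c) \in [:: ca; cb] -> w a c != 0.
  by rewrite -enc4_eq0; apply: contraTneq=> ->.
have sq a: a \in [:: ca; cb] -> mul4 a a \in [:: ca; cb] by rewrite !inE=> /orP[]/eqP->.
exists o, y', z; split=> //; first by split; apply: sB; rewrite !inE eqxx ?orbT.
- by rewrite !nz ?eo ?fo.
- by rewrite nz ?ey ?sq //; split=> //; apply/eqP; rewrite -enc4_eq0 fy.
by rewrite nz ?fz ?sq //; split=> //; apply/eqP; rewrite -enc4_eq0 ez.
Qed.

End Basis.

Lemma no_light_overlap Bs w w' e f g o y z : is_basis l Bs -> paired_system Bs w w' ->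
  e \notin Bs -> f \notin Bs -> g \notin Bs -> e != f -> e != g -> f != g ->
  o \in Bs -> y \in Bs -> z \in Bs -> uniq [:: o; y; z] -> w e o != 0 -> w e y != 0 ->
  w f o != 0 -> w f z != 0 -> w e z = 0 -> w f y = 0 -> False.
Proof.
move=> bB ps eB fB gB ef eg fg oB yB zB u3 eo ey fo fz ez fy; have fw := paired_fund ps.
have [w2 [w2' ps2]] := ex_paired_system (exchange_basis fw eB oB eo bB).
have fe: f != e by rewrite eq_sym.
have ge: g != e by rewrite eq_sym.
have gf: g != f by rewrite eq_sym.
have wf x := exchange_other fw eB eo (paired_fund ps2) x fB fe.
have [_ e2 _ _] := fw.2 e eB; have [_ _ f3 _] := fw.2 f fB.
have fB' := exchange_notin o fB fe; have gB' := exchange_notin o gB ge; have oB' :=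
  exchange_out eB oB.
have neqB a b: a \in Bs -> b \notin Bs -> a != b by move=> aB; apply: contraNneq=> <-.
have of_ := neqB o f oB fB; have og := neqB o g oB gB; have fo': f != o by rewrite eq_sym.
have [Qf|Lf] := row_type ps2 fB' oB' fo';
  first exact: (heavy_no_triple ps2 fB' oB' gB' og of_ gf Qf).
move: u3; rewrite /= !inE !negb_or andbT=> /andP[/andP[oy oz] yz].
have : (size [:: e; y; z] <= size (supp (e |: (Bs :\ o)) w2 f))%N.
  apply: uniq_leq_size; first by rewrite /= !inE negb_or yz ![e == _]eq_sym !neqB.
  move=> x; rewrite !inE mem_filter mem_enum andbT !inE wf=> /or3P[]/eqP->.
  - by rewrite eqxx (f3 e) // e2 mulr1 sub0r oppr_eq0 mulf_neq0 ?invr_eq0.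
  - by rewrite yB [y == o]eq_sym oy orbT fy sub0r oppr_eq0 !mulf_neq0 ?invr_eq0.
  by rewrite zB [z == o]eq_sym oz orbT ez mulr0 subr0.
by have := perm_size Lf; rewrite size_map=> <-.
Qed.

Lemma at_most_two Bs e f g : is_basis l Bs -> e \notin Bs -> f \notin Bs -> g \notin Bs ->
  e != f -> e != g -> f != g -> False.
Proof.
move=> bB eB fB gB ef eg fg; have [w [w' ps]] := ex_paired_system bB.
have [fe [ge gf]]: f != e /\ g != e /\ g != f by rewrite ![_ == e]eq_sym [g == f]eq_sym.
have light a b c: a \notin Bs -> b \notin Bs -> c \notin Bs -> b != c -> b != a -> c != a ->
    light_row Bs w a.
  move=> aB bB' cB bc ba ca'; have ab: a != b by rewrite eq_sym.
  by case: (row_type ps aB bB' ab)=> // /(heavy_no_triple ps aB bB' cB bc ba ca').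
have cross a b c: a \notin Bs -> b \notin Bs -> c \notin Bs -> a != b -> a != c -> b != c ->
    light_row Bs w a -> light_row Bs w b ->
    perm_eq crossing_form [seq (enc4 (w a x), enc4 (w b x)) | x <- supp2 Bs w a b].
  move=> aB bB' cB ab ac bc La Lb.
  have [//|[o [y [z [[oB yB zB] u3 [ao bo] [ay by0] [az bz]]]]]] :=
    ex_light_exchange ps aB bB' ab La Lb.
  by case: (no_light_overlap bB ps aB bB' cB ab ac bc oB yB zB u3 ao ay bo bz az by0).
have Le := light e f g eB fB gB fg fe ge; have Lf := light f e g fB eB gB eg ef gf.
have Lg := light g e f gB eB fB ef eg fg.
have pef := cross e f g eB fB gB ef eg fg Le Lf; have peg := cross e g f eB gB fB eg ef gf Le Lg.
have pfg := cross f g e fB gB eB fg fe ge Lf Lg.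
have [x [xB ex]]: exists x, x \in Bs /\ enc4 (w e x) = ca.
  have : ca \in row Bs w e by rewrite -(perm_mem Le) mem_head.
  by case/mapP=> x; rewrite mem_filter=> /andP[/andP[xB _] _] ->; exists x.
have code a b: perm_eq crossing_form [seq (enc4 (w a x), enc4 (w b x)) | x <- supp2 Bs w a b] ->
    enc4 (w a x) != c0 -> (enc4 (w a x), enc4 (w b x)) \in crossing_form.
  move=> pab ax; rewrite (perm_mem pab); apply/mapP; exists x=> //.
  by rewrite mem_supp2 xB -enc4_eq0 ax.
have := code e f pef; have := code e g peg; have := code f g pfg.
rewrite ex=> Efg /(_ isT) Eeg /(_ isT) Eef; move: Eef Eeg Efg.
case: (enc4 (w f x))=> [[] []] //= _.
by case: (enc4 (w g x))=> [[] []] //= _ /(_ isT).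
Qed.

Definition core_forms : seq (seq (c4 * c4)) :=
  [:: crossing_form] ++ overlap_forms ++ [seq [:: (c1, t); (t, c1); (t, t)] | t <- [:: ca; cb]].

Definition core_shape := exists (Bs : {set P}) (w : P -> P -> F) (e f : P) (xs : seq P)
  (h : seq (c4 * c4)), [/\ is_basis l Bs, fund_system l Bs w, e != f /\ ~: Bs = [set e; f],
     uniq xs /\ {subset xs <= Bs} &
     [/\ h \in core_forms, [seq (enc4 (w e x), enc4 (w f x)) | x <- xs] = h &
         forall x, x \in Bs -> x \notin xs -> w e x = 0 /\ w f x = 0]].

Lemma core_shape_heavy_light Bs w e f x y z t : is_basis l Bs -> fund_system l Bs w -> e != f ->
  ~: Bs = [set e; f] -> uniq [:: x; y; z] -> {subset [:: x; y; z] <= Bs} -> t \in [:: ca; cb] ->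
  [seq (enc4 (w e x), enc4 (w f x)) | x <- [:: x; y; z]] = [:: (t, c1); (mul4 t t, t); (c0, t)] ->
  (forall u, u \in Bs -> u \notin [:: x; y; z] -> w e u = 0 /\ w f u = 0) -> core_shape.
Proof.
move=> bB fw ef CB u3 sB tt [] ex fx ey fy ez fz out.
have dE a c: enc4 a = c -> a = dec4 c by move=> <-; rewrite enc4K.
move: (dE _ _ ex) (dE _ _ fx) (dE _ _ ey) (dE _ _ fy) (dE _ _ ez) (dE _ _ fz).
rewrite dec4_1 dec4_0 dec4M=> {}ex {}fx {}ey {}fy {}ez {}fz.
have eB: e \notin Bs by rewrite -in_setC CB !inE eqxx.
have fB: f \notin Bs by rewrite -in_setC CB !inE eqxx orbT.
have [xB [yB zB]]: x \in Bs /\ y \in Bs /\ z \in Bs by split; [|split]; apply: sB;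
  rewrite !inE eqxx ?orbT.
have neqB a b: a \in Bs -> b \notin Bs -> a != b by move=> aB; apply: contraNneq=> <-.
have T3: dec4 t * (dec4 t * dec4 t) = 1.
  by rewrite -!dec4M -dec4_1; move: tt; rewrite !inE=> /orP[]/eqP->.
have tn: dec4 t * dec4 t != 0 by apply: contra_eqN T3=> /eqP->; rewrite mulr0 eq_sym oner_eq0.
have tV: (dec4 t * dec4 t)^-1 = dec4 t by apply: (mulfI tn); rewrite mulfV // mulrC.
have eyn: w e y != 0 by rewrite ey.
have bB' := exchange_basis fw eB yB eyn bB; have [w2 fw2] := ex_fund bB'.1 bB'.2.
have fe: f != e by rewrite eq_sym.
have wy := exchange_entering fw eB yB eyn fw2; have wf v := exchange_other fw eB eyn fw2 v fB fe.
have [_ e2 _ _] := fw.2 e eB; have [_ _ f3 _] := fw.2 f fB.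
move: u3; rewrite /= !inE !negb_or andbT=> /andP[/andP[xy xz] yz].
exists (e |: (Bs :\ y)), w2, y, f, [:: e; x; z], [:: (t, mul4 t t); (mul4 t t, c0); (c0, t)].
split=> //.
- split; first exact: neqB.
  apply/setP=> u; rewrite !inE negb_or negb_and negbK.
  have := congr1 (fun A : {set P}=> u \in A) CB; rewrite !inE=> uCB.
  case: (eqVneq u y)=> [->|uy] /=; first by rewrite neqB.
  by rewrite uCB; case: (eqVneq u e)=> [->|//]; rewrite (negPf ef).
- split; first by rewrite /= !inE !negb_or xz ![e == _]eq_sym !neqB.
  by move=> u; rewrite !inE=> /or3P[]/eqP->; rewrite ?eqxx ?xB ?zB ?xy ?[z == y]eq_sym ?yz ?orbT.
split=> [||u].
- by move: tt; rewrite !inE=> /orP[]/eqP->.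
- rewrite /= !wy !wf e2 (f3 e) // ex ey ez fx fy fz tV mul0r mul1r mulr0 subr0 mulr1 sub0r.
  rewrite (oppr_pchar2 F2) -(mulrA (dec4 t)) T3 subrr -dec4M -dec4_0.
  by rewrite !dec4K.
rewrite !inE !negb_or=> /orP[/eqP->|/andP[uy uB]]; first by rewrite eqxx.
case/and3P=> ue ux uz; have us: u \notin [:: x; y; z] by rewrite !inE !negb_or ux uy uz.
by have [we wf0] := out u uB us; rewrite wy wf we wf0 mul0r mulr0 subrr.
Qed.

Lemma good_forms_core : [seq h <- good_forms | h \notin core_forms] =
  [seq [:: (t, c1); (mul4 t t, t); (c0, t)] | t <- [:: ca; cb]] ++
  [seq [:: (c1, t); (t, mul4 t t); (t, c0)] | t <- [:: ca; cb]].
Proof. by vm_compute. Qed.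

Lemma core_classification Bs e f : is_basis l Bs -> e != f -> ~: Bs = [set e; f] -> core_shape.
Proof.
move=> bB ef CB; have [w [w' ps]] := ex_paired_system bB; have fw := paired_fund ps.
have eB: e \notin Bs by rewrite -in_setC CB !inE eqxx.
have fB: f \notin Bs by rewrite -in_setC CB !inE eqxx orbT.
have [h hg hE] := pair_columns ps eB fB ef; have [xs [xE uxs xsB out]] := ex_support_order hE.
case: (boolP (h \in core_forms))=> [hc|hn]; first by exists Bs, w, e, f, xs, h.
have: h \in [seq h <- good_forms | h \notin core_forms] by rewrite mem_filter hn.
rewrite good_forms_core mem_cat=> /orP[] /mapP[t tt hE']; rewrite hE' in xE;
  case: xs xE uxs xsB out=> [|x [|y [|z []]]] // xE uxs xsB out.
  exact: (core_shape_heavy_light bB fw ef CB uxs xsB tt xE out).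
have fe: f != e by rewrite eq_sym.
have CB': ~: Bs = [set f; e] by rewrite CB setUC.
case: xE=> ex fx ey fy ez fz.
apply: (core_shape_heavy_light bB fw fe CB' uxs xsB tt).
  by rewrite /= ex fx ey fy ez fz.
by move=> u uB us; have [-> ->] := out u uB us.
Qed.

End Core.

End QuaternaryPairs.

(** * Counting the points over a coset *)

Section LinearMaps.
Variable F : fieldType.
Implicit Types vT uT : vectType F.

Lemma ex_lfun vT uT (f : vT -> uT) : linear f -> exists g : 'Hom(vT, uT), forall x, g x = f x.
Proof.
move=> lf; pose fM := GRing.isLinear.Build _ _ _ _ f lf.
by pose fL : {linear vT -> uT} := HB.pack f fM; exists (linfun fL)=> x; rewrite lfunE.
Qed.

Lemma ex_pair0_lfun vT uT : exists i : 'Hom(vT, (vT * uT)%type), forall x, i x = (x, 0).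
Proof.
by apply: ex_lfun=> k x y; rewrite -[RHS]/(k *: x + y, k *: 0 + 0) scaler0 addr0.
Qed.

Lemma same_rk_lfun_inj vT uT E (v : E -> vT) (f : 'Hom(vT, uT)) :
  (forall x, x \in vspan v setT -> f x = 0 -> x = 0) -> same_rk v (f <$> v).
Proof.
move=> fi X; rewrite vspan_lfun limg_dim_eq //; apply/eqP; rewrite -subv0; apply/subvP=> x.
rewrite memv_cap memv_ker memv0=> /andP[xX /eqP fx]; apply/eqP/fi=> //.
by move: xX; apply/subvP/vspanS/subsetT.
Qed.

Lemma same_rk_eq0 vT uT E (v : E -> vT) (u : E -> uT) e : same_rk v u -> (v e == 0) = (u e == 0).
Proof.
by move=> /(_ [set e]); rewrite /vspan !big_set1 !dim_vline; case: (v e == 0); case: (u e == 0).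
Qed.

Lemma dim_lift1_coset vT (P : finType) (p : P -> vT) (a : vT) (W : {vspace vT}) :
  (forall x, p x - a \in W) -> (vdim (lift1 p) setT <= (\dim W).+1)%N.
Proof.
move=> pW; have [i iE] := ex_pair0_lfun vT F^o.
have sub: (vspan (lift1 p) setT <= <[((a, 1%R) : (vT * F^o)%type)]> + (i @: W))%VS.
  apply: vspan_sub=> x _; have -> : lift1 p x = (a, 1) + i (p x - a).
    by rewrite iE; congr (_, _); rewrite ?addr0 // addrC subrK.
  by rewrite memv_add ?memv_line ?memv_img.
apply: leq_trans (dimvS sub) _; apply: leq_trans (dimv_addl_leq _ _) _; rewrite dim_vline.
by rewrite -add1n leq_add ?leq_b1 // -[leqRHS](limg_ker_dim i W) leq_addl.
Qed.

End LinearMaps.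

Section PointBound.
Variables (F : finFieldType) (F4 : #|F| = 4%N) (al : F) (alE : al ^+ 2 = al + 1).
Variables (wT : vectType F) (P Q : finType) (p : P -> wT) (q : Q -> wT).
Hypotheses (pinj : injective p) (o : P) (rp : rep_char3 (@frame_cfg F wT (option P) P Q p q)).

Lemma point_bound : (#|P| <= vdim (lift1 p) setT + 2)%N /\
  (#|P| = vdim (lift1 p) setT + 2 -> core_shape al p)%N.
Proof.
have [K K3 [uT [ph pph]]] := rep_char3_same_blocks o rp.
have K30: 1 + 1 + 1 = 0 :> K by have := pcharf0 K3; rewrite !mulrS addr0 addrA.
have [Bs [_ iB sB cB]] := ex_basis0 (lift1 p) setT.
have bB: is_basis (lift1 p) Bs by split=> // x; rewrite sB mem_vspan ?inE.
have cC: (#|Bs| + #|~: Bs| = #|P|)%N by rewrite cardsC.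
have le2: (#|~: Bs| <= 2)%N.
  rewrite leqNgt; apply/negP=> /card_gt2P[e [f [g [[]]]]]; rewrite !inE=> eB fB gB [ef fg ge].
  by apply: (at_most_two F4 alE K30 pph pinj bB eB fB gB)=> //; rewrite eq_sym.
rewrite -cB; split=> [|card_P]; first by lia.
have /eqP/cards2P[e [f [ef CB]]]: #|~: Bs| = 2 by lia.
exact: (core_classification F4 alE K30 pph pinj bB ef CB).
Qed.

End PointBound.

Section Grounding.
Variables (F : finFieldType) (F4 : #|F| = 4%N).
Variables (wT : vectType F) (P0 Q : finType) (p : option P0 -> wT) (q : Q -> wT).
Hypothesis p0 : p None = 0.

Local Notation cfg R := (frame_cfg (R:=R) p q).

Definition full_frame R E (u : E -> framed F wT R) : Prop :=
  forall i, exists w, (w, unit_vec i) \in vspan u setT.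

(* A joint that is not the projection of a spanned vector can be identified with the
ground, that is, with the point [p None = 0]. *)
Lemma remove_joint R E (g : E -> R * R + (R * option P0 + Q)) (rho : R) :
  (forall e, cfg R (g e) != 0) ->
  (forall w, (w, unit_vec rho) \notin vspan (fun e=> cfg R (g e)) setT) ->
  exists g' : E -> _, same_rk (fun e=> cfg R (g e)) (fun e=> cfg {j : R | j != rho} (g' e)).
Proof.
move=> g0 nrho; pose R' : finType := {j : R | j != rho}.
set u := fun e=> cfg R (g e); set V := vspan u setT.
pose dl (z : framed F wT R) : framed F wT R' := (z.1, [ffun j=> z.2 (val j)]).
have [L LE]: exists L : 'Hom(_, _), forall z, L z = dl z.
  by apply: ex_lfun=> k x y; congr (_, _); apply/ffunP=> j; rewrite !ffunE.
have dlv (i: R) (ir : i != rho) : [ffun j : R'=> unit_vec i (val j)] = unit_vec (Sub i ir) :> vec F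
  R'.
  by apply/ffunP=> j; rewrite !ffunE -val_eqE.
have dl0: [ffun j : R'=> unit_vec rho (val j)] = 0 :> vec F R'.
  by apply/ffunP=> j; rewrite !ffunE (negPf (valP j)).
have dlB (x y: vec F R) : [ffun j : R'=> (x - y) (val j)] =
    [ffun j=> x (val j)] - [ffun j=> y (val j)] :> vec F R'.
  by apply/ffunP=> j; rewrite !ffunE.
have ex e: exists z, cfg R' z = L (u e).
  have uV: u e \in V by rewrite mem_vspan ?inE.
  have := g0 e; move: uV; rewrite LE /u /dl; case: (g e)=> [[i j]|[[i x]|y]] /= uV u0.
  - case: (eqVneq i rho)=> [ir|ir]; case: (eqVneq j rho)=> [jr|jr].
    + by move: u0; rewrite ir jr subrr eqxx.
    + exists (inr (inl (Sub j jr, None))); rewrite /= p0 dlB ir dl0 sub0r dlv; congr (_, _).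
      by rewrite (oppv_pchar2 (F4_char2 F4)).
    + by exists (inr (inl (Sub i ir, None))); rewrite /= p0 dlB jr dl0 subr0 dlv.
    by exists (inl (Sub i ir, Sub j jr)); rewrite /= dlB !dlv.
  - case: (eqVneq i rho)=> [ir|ir]; last by exists (inr (inl (Sub i ir, x))); rewrite /= dlv.
    by case/negP: (nrho (p x)); rewrite -ir.
  by exists (inr (inr y))=> /=; congr (_, _); apply/ffunP=> j; rewrite !ffunE.
have [g' g'E] := fin_all_exists ex; exists g'.
have same_L: same_rk u (L <$> u).
  apply: same_rk_lfun_inj=> -[w x] zV; rewrite LE=> -[/= w0 x0].
  have xE: x = x rho *: unit_vec rho.
    apply/ffunP=> j; rewrite !ffunE; case: (eqVneq j rho)=> [->|jr]; first by rewrite [RHS]mulr1.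
    by have /ffunP/(_ (Sub j jr: R')) := x0; rewrite !ffunE /= => ->; rewrite [RHS]mulr0.
  case: (eqVneq (x rho) 0)=> [xr|xr]; first by rewrite w0 xE xr scale0r.
  have := nrho ((x rho)^-1 *: w); have -> : ((x rho)^-1 *: w, unit_vec rho) = (x rho)^-1 *: (w, x).
    by congr (_, _); rewrite /= -[LHS](scalerK xr) -xE.
  by rewrite rpredZ.
by move=> X; rewrite same_L; congr (\dim _); apply: eq_vspan=> e; rewrite g'E.
Qed.

Lemma ex_full_frame R E (g : E -> R * R + (R * option P0 + Q)) : (forall e, cfg R (g e) != 0) ->
  exists (R' : finType) (g' : E -> R' * R' + (R' * option P0 + Q)),
  same_rk (fun e=> cfg R (g e)) (fun e=> cfg R' (g' e)) /\ full_frame (fun e=> cfg R' (g' e)).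
Proof.
have [n] := ubnP #|R|; elim: n R g=> // n IH R g leR g0.
case: (classic (exists rho, forall w, (w, unit_vec rho) \notin vspan (fun e=> cfg R (g e)) setT))
  => [[rho nrho]|none]; last first.
  exists R, g; split=> // i; apply: NNPP=> no; apply: none; exists i=> w.
  by apply/negP=> wV; apply: no; exists w.
have [g' gg'] := remove_joint g0 nrho.
have cR: (#|{: {j : R | j != rho}}| < n)%N.
  rewrite card_sig; have := cardC1 rho; have : (0 < #|R|)%N by apply/card_gt0P; exists rho.
  by move=> ? cC; rewrite (@eq_card _ _ (predC1 rho)) // cC; lia.
have [|R2 [g2 [g'g2 full]]] := IH _ g' cR; first by move=> e; rewrite -(same_rk_eq0 e gg').
by exists R2, g2; split=> //; apply: same_rk_trans gg' g'g2.
Qed.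

Lemma full_frame_kernel R E (u : E -> framed F wT R) : full_frame u ->
  exists2 W : {vspace wT}, (forall w, (w \in W) = ((w, 0) \in vspan u setT)) &
  vdim u setT = (#|R| + \dim W)%N.
Proof.
move=> full; set V := vspan u setT; have [i iE] := ex_pair0_lfun wT (vec F R).
have [pr prE]: exists pr : 'Hom(framed F wT R, vec F R), forall z, pr z = z.2.
  exact: ex_lfun.
exists (i @^-1: V)%VS=> [w|]; first by rewrite -memv_preim iE.
have <- : \dim (pr @: V) = #|R|.
  have -> : (pr @: V)%VS = fullv; last by rewrite dimvf /dim /= muln1.
  apply/eqP; rewrite eqEsubv subvf; apply/subvP=> x _; rewrite (ffun_unit_sum x).
  by apply: rpred_sum=> r _; have [w wV] := full r;
    rewrite rpredZ // -[unit_vec r]/((w, unit_vec r).2) -prE memv_img.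
rewrite -(limg_ker_dim pr V) addnC; congr (_ + _)%N.
have -> : (V :&: lker pr = i @: (i @^-1: V))%VS.
  apply/vspaceP=> -[w f]; rewrite memv_cap memv_ker prE /=.
  apply/andP/memv_imgP=> [[wV /eqP f0]|[w' w'V]].
    by exists w; rewrite -?memv_preim iE -f0.
  by rewrite iE=> -[-> ->]; move: w'V; rewrite -memv_preim iE.
rewrite limg_dim_eq //; apply/eqP; rewrite -subv0; apply/subvP=> w.
by rewrite memv_cap memv_ker iE memv0=> /andP[_ /eqP[->]].
Qed.

End Grounding.

Definition hval (r : nat) : nat := 'C(r + 3, 2) - 5.

Lemma hval_lower N s : ('C(N, 2) + N * (s + 3) <= hval (N + s) + 2)%N.
Proof.
have bin2E n: (2 * 'C(n, 2) = n * n.-1)%N.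
  rewrite bin2 -{2}(odd_double_half (n * n.-1)) oddM; case: n=> //= n.
  by case: (odd n)=> //=; rewrite -muln2 mulnC; lia.
rewrite /hval; have := bin2E N; have := bin2E (N + s + 3)%N; rewrite (addnS _ 2) /=.
by case: N=> [|N] /=; nia.
Qed.

Lemma missing_pairs R (eqv : rel R) (i0 j0 : R) : equivalence_rel eqv -> ~~ eqv i0 j0 ->
  (#|[set S : {set R} | (#|S| == 2) && [forall i in S, forall j in S, eqv i j]]| + #|R|.-1
     <= 'C(#|R|, 2))%N.
Proof.
move=> eqvP nij; set A := [set S | _].
have eqvC i j: eqv i j -> eqv j i.
  by move=> ij; have [ii E] := eqvP i j i; rewrite -(E ij).
have ij: i0 != j0 by apply: contraNneq nij=> <-; have [] := eqvP i0 i0 i0.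
pose partner k := if eqv k i0 then j0 else i0; pose f k := [set k; partner k].
have nk k: k != i0 -> k != partner k.
  rewrite /partner=> ki; case: ifP=> // ki0; apply: contraNneq nij=> kj; rewrite -kj.
  exact: eqvC.
have finj: {in predC1 i0 &, injective f}.
  move=> k k' /= ki ki' ff; have : k \in f k' by rewrite -ff set21.
  rewrite in_set2=> /orP[/eqP//|/eqP kj]; have k'i0: eqv k' i0.
    by apply: contraT=> nk'; move: ki; rewrite kj /partner (negPf nk') inE eqxx.
  rewrite /partner k'i0 in kj; have : i0 \in f k'.
    rewrite -ff /f /partner kj ifN ?set22 //; apply: contra nij; exact: eqvC.
  by rewrite /f /partner k'i0 in_set2 (negPf ij) orbF=> /eqP k'E; move: ki'; rewrite -k'E inE eqxx.
have sub: f @: predC1 i0 \subset [set S : {set R} | #|S| == 2] :\: A.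
  apply/subsetP=> _ /imsetP[k ki ->]; rewrite !inE cards2 nk // andbT.
  apply/negP=> /forall_inP/(_ k (set21 _ _))/forall_inP/(_ _ (set22 _ _)).
  rewrite /partner; case: ifPn=> [ki0 kj|/negP//].
  by move: nij; have [_ E] := eqvP k i0 j0; rewrite -(E ki0) kj.
have AS: A \subset [set S : {set R} | #|S| == 2] by apply/subsetP=> S; rewrite !inE=> /andP[].
rewrite -card_draws -(cardsID A [set S : {set R} | #|S| == 2%N]) (setIidPr AS) leq_add2l
  -(cardC1 i0) -(card_in_imset finj).
exact: subset_leq_card.
Qed.

Section Count.
Variables (F : finFieldType) (F4 : #|F| = 4%N) (al : F) (alE : al ^+ 2 = al + 1).
Variables (wT : vectType F) (P0 Q : finType) (p : option P0 -> wT) (q : Q -> wT).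
Hypothesis rp : forall R, rep_char3 (frame_cfg (R:=R) p q).
Local Notation P := (option P0).

Definition point_repr (x : P) : P := odflt x [pick y | p y == p x].

Lemma p_point_repr x : p (point_repr x) = p x.
Proof. by rewrite /point_repr; case: pickP=> [y /eqP|]. Qed.

Lemma point_repr_eq x y : p x = p y -> point_repr x = point_repr y.
Proof.
by move=> xy; rewrite /point_repr xy; case: pickP=> // /(_ y); rewrite eqxx.
Qed.

Definition coset_points (a : wT) (W : {vspace wT}) : {set P} :=
  [set x | (point_repr x == x) && (p x - a \in W)].

Section Coset.
Variables (a : wT) (W : {vspace wT}).
Let PX : finType := {x : P | x \in coset_points a W}.
Definition coset_pt (x : PX) : wT := p (val x).

Lemma coset_pt_inj : injective coset_pt.
Proof.
move=> x y /point_repr_eq xy; apply: val_inj; move: (valP x) (valP y); rewrite !inE.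
by move=> /andP[/eqP<- _] /andP[/eqP<- _].
Qed.

Lemma coset_pt_sub x : coset_pt x - a \in W.
Proof. by have := valP x; rewrite inE=> /andP[]. Qed.

Lemma rep_char3_coset R (vT : vectType F) (f : 'Hom(wT, vT)) (D : {set Q}) : lker f = vspan q D ->
  rep_char3 (@frame_cfg F vT R PX Q (fun x=> f (coset_pt x)) (f <$> q)).
Proof.
move=> kf; pose gm (z : R * R + (R * PX + Q)) : R * R + (R * P + Q) :=
  match z with
  | inl ij => inl ij
  | inr (inl (i, x)) => inr (inl (i, val x))
  | inr (inr y) => inr (inr y) end.
have [L LE]: exists L : 'Hom(framed F wT R, framed F vT R), forall z, L z = (f z.1, z.2).
  by apply: ex_lfun=> k x y; rewrite -[RHS]/(k *: f x.1 + f y.1, k *: x.2 + y.2) /= linearP.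
apply: (@rep_char3_minor F _ _ _ _ (frame_cfg (R:=R) p q) gm
    [set inr (inr y) | y in D] L (fun=> 1)) (rp R)=> [|z|z]; last 2 first.
- exact: oner_neq0.
- by rewrite scale1r LE; case: z=> [[i j]|[[i x]|y]] //=; rewrite linear0.
apply: contracts_ker; have [i iE] := ex_pair0_lfun wT (vec F R).
rewrite -vspan_imset (eq_vspan (u:=fun y=> i (q y)))=> [|y]; last by rewrite iE.
rewrite vspan_lfun -kf; apply/vspaceP=> -[w h]; rewrite memv_ker LE /=.
apply/eqP/memv_imgP=> [[fw ->]|[w' w'f]]; first by exists w; rewrite ?memv_ker ?fw ?iE.
by rewrite iE=> -[-> ->]; move: w'f; rewrite memv_ker=> /eqP->.
Qed.

Lemma rep_char3_coset_id R : rep_char3 (@frame_cfg F wT R PX Q coset_pt q).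
Proof.
have k1: lker (\1%VF : 'End(wT)) = vspan q set0.
  by rewrite /vspan big_set0; apply/vspaceP=> x; rewrite memv_ker lfunE memv0.
apply: rep_char3_same (rep_char3_coset R k1)=> X; congr (\dim _).
by apply: eq_vspan=> -[[i j]|[[i x]|y]] //=; rewrite !lfunE.
Qed.

Lemma card_coset_points : (#|coset_points a W| <= \dim W + 3)%N.
Proof.
have [->|[o oX]] := set_0Vmem (coset_points a W); first by rewrite cards0.
have [] := point_bound F4 alE coset_pt_inj (Sub o oX : PX) (rep_char3_coset_id _).
have := dim_lift1_coset coset_pt_sub; rewrite card_sig -[#|coset_points a W|]/(#|_|); lia.
Qed.

Hypothesis cX : #|coset_points a W| = (\dim W + 3)%N.

Lemma card_PX : #|PX| = (\dim W + 3)%N.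
Proof. by rewrite card_sig -cX; apply: eq_card. Qed.

Lemma ex_coset_point : exists x : PX, true.
Proof.
have /card_gt0P[o _]: (0 < #|PX|)%N by rewrite card_PX addn3.
by exists o.
Qed.

Lemma dim_lift1_coset_pt : vdim (lift1 coset_pt) setT = (\dim W).+1.
Proof.
have [o _] := ex_coset_point.
have [] := point_bound F4 alE coset_pt_inj o (rep_char3_coset_id _).
have := dim_lift1_coset coset_pt_sub; rewrite card_PX; lia.
Qed.

Lemma coset_core_shape : core_shape al coset_pt.
Proof.
have [o _] := ex_coset_point.
have [_] := point_bound F4 alE coset_pt_inj o (rep_char3_coset_id _).
by apply; rewrite card_PX dim_lift1_coset_pt; lia.
Qed.

(* Contracting a direction that is not a difference of points would leave too many points. *)
Lemma coset_direction y : q y \in W -> q y != 0 -> exists (x x' : PX) (k : F),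
  [/\ x != x', k != 0 & q y = k *: (coset_pt x - coset_pt x')].
Proof.
move=> yW y0; have [] := boolP [exists x : PX, exists x' : PX,
    (x != x') && (coset_pt x - coset_pt x' \in <[q y]>%VS)].
  case/existsP=> x /existsP[x' /andP[xx /vlineP[c cE]]].
  have c0: c != 0.
    by apply: contraNneq xx=> c0; move: cE; rewrite c0 scale0r=> /subr0_eq/coset_pt_inj->.
  by exists x, x', c^-1; rewrite invr_eq0 c0 xx cE scalerK.
move=> no; exfalso; have [f kf] := ex_quotient <[q y]>%VS.
have kf': lker f = vspan q [set y] by rewrite kf /vspan big_set1.
have finj: injective (fun x : PX=> f (coset_pt x)).
  move=> x x' fx; apply/eqP; apply: contraNT no=> xx; apply/existsP; exists x.
  by apply/existsP; exists x'; rewrite xx -kf memv_ker linearB /= fx subrr.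
have [o _] := ex_coset_point; have [+ _] := point_bound F4 alE finj o (rep_char3_coset _ kf').
have : (vdim (lift1 (fun x : PX=> f (coset_pt x))) setT <= (\dim (f @: W)).+1)%N.
  by apply: (@dim_lift1_coset _ _ _ _ (f a))=> x; rewrite -linearB memv_img ?coset_pt_sub.
have := limg_ker_dim f W; rewrite kf (capv_idPr _) -?memvE // dim_vline y0 card_PX; lia.
Qed.

End Coset.

Section CountBound.
Variables (R E : finType) (g : E -> R * R + (R * P + Q)).
Local Notation u := (fun e=> frame_cfg (R:=R) p q (g e)).
Local Notation V := (vspan u setT).
Hypotheses (full : full_frame u) (simp : simple_on u setT).
Variables (W : {vspace wT}) (s : R -> wT).
Hypothesis WE : forall w, (w \in W) = ((w, 0) \in V).
Hypothesis sE : forall i, (s i, unit_vec i) \in V.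

Let uV e : u e \in V.
Proof. by rewrite (mem_vspan u) ?inE. Qed.

Lemma edge_coset e i j : g e = inl (i, j) -> s i - s j \in W.
Proof.
move=> ge; rewrite WE.
have -> : (s i - s j, 0) = (s i, unit_vec i) - (s j, unit_vec j) - u e :> framed F wT R.
  rewrite ge /= -[RHS]/(s i - s j - 0, unit_vec i - unit_vec j - (unit_vec i - unit_vec j)).
  by rewrite subr0 subrr.
by rewrite !rpredB ?sE ?uV.
Qed.

Lemma point_coset e i x : g e = inr (inl (i, x)) -> p x - s i \in W.
Proof.
move=> ge; rewrite WE.
have -> : (p x - s i, 0) = u e - (s i, unit_vec i) :> framed F wT R.
  by rewrite ge /= -[RHS]/(p x - s i, unit_vec i - unit_vec i) subrr.
by rewrite rpredB ?sE ?uV.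
Qed.

Definition element_code e : {set R} + (R * P + Q) :=
  match g e with
  | inl (i, j) => inl [set i; j]
  | inr (inl (i, x)) => inr (inl (i, point_repr x))
  | inr (inr y) => inr (inr y) end.

Lemma element_code_inj : injective element_code.
Proof.
have [u0 u_par] := simp; move=> e e'; rewrite /element_code=> ee.
apply: (u_par e e' 1); rewrite ?inE // scale1r; move: ee (u0 e (in_setT _)) (u0 e' (in_setT _)).
case: (g e)=> [[i j]|[[i x]|y]]; case: (g e')=> [[i' j']|[[i' x']|y']] //= []; last 2 first.
- by move=> -> xx _ _; rewrite -(p_point_repr x) xx p_point_repr.
- by move=> ->.
move=> SE ij0 ij0'; have ij: i != j by apply: contraNneq ij0=> ->; rewrite subrr.
have: i \in [set i'; j'] by rewrite -SE set21.
have: j \in [set i'; j'] by rewrite -SE set22.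
rewrite !inE=> /orP[]/eqP jE /orP[]/eqP iE; first by rewrite iE jE eqxx in ij.
- by rewrite iE jE -opprB (oppv_pchar2 (F4_char2 F4)).
- by rewrite iE jE.
by rewrite iE jE eqxx in ij.
Qed.

Definition same_coset : rel R := [rel i j | s i - s j \in W].

Lemma same_coset_equiv : equivalence_rel same_coset.
Proof.
move=> i j k; rewrite /same_coset /=; split; first by rewrite subrr rpred0.
by move=> ij; rewrite -(subrK (s j) (s i)) -addrA rpredDl.
Qed.

Lemma card_elements : (#|E| <= #|[set S : {set R} |
  (#|S| == 2) && [forall i in S, forall j in S, same_coset i j]]| +
  ((\sum_i #|coset_points (s i) W|) + #|Q|))%N.
Proof.
set A := [set S | _]; pose B := [set ix : R * P | ix.2 \in coset_points (s ix.1) W].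
have <- : #|B| = (\sum_i #|coset_points (s i) W|)%N.
  under eq_bigr do rewrite -sum1_card; rewrite pair_big_dep /= -sum1_card.
  by apply: eq_bigl=> -[i x]; rewrite inE.
have sub: element_code @: [set: E] \subset
    [set inl S | S in A] :|: ([set inr (inl b) | b in B] :|: [set inr (inr y) | y : Q]).
  have [u0 _] := simp; apply/subsetP=> _ /imsetP[e _ ->]; rewrite /element_code.
  have ne := u0 e (in_setT _); move: ne (@edge_coset e) (@point_coset e).
  case: (g e)=> [[i j]|[[i x]|y]] /= ne edge point.
  - have ij: i != j by apply: contraNneq ne=> ->; rewrite subrr.
    apply/setUP; left; apply: imset_f; rewrite inE cards2 ij /=.
    have ijW := edge i j erefl; have jiW: s j - s i \in W by rewrite -rpredN opprB.
    apply/forall_inP=> k; rewrite !inE=> /orP[]/eqP->; apply/forall_inP=> m;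
      by rewrite !inE=> /orP[]/eqP->; rewrite /same_coset /= ?subrr ?rpred0.
  - apply/setUP; right; apply/setUP; left; apply: imset_f; rewrite inE /= inE.
    by rewrite (point_repr_eq (p_point_repr x)) eqxx p_point_repr (point i x).
  by apply/setUP; right; apply/setUP; right; apply: imset_f.
rewrite -cardsT -(card_imset _ element_code_inj); apply: leq_trans (subset_leq_card sub) _.
apply: leq_trans (leq_card_setU _ _) _; apply: leq_add; first exact: leq_imset_card.
by apply: leq_trans (leq_card_setU _ _) _; apply: leq_add; apply: leq_imset_card.
Qed.

End CountBound.

Lemma count_dichotomy R E (g : E -> R * R + (R * P + Q)) :
  let u := fun e=> frame_cfg (R:=R) p q (g e) in
  full_frame u -> simple_on u setT -> (\dim {:wT} + #|Q| + 6 <= vdim u setT)%N ->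
  (#|E| < hval (vdim u setT))%N \/ exists (a : wT) (W : {vspace wT}),
  [/\ forall w, (w \in W) = ((w, 0) \in vspan u setT), vdim u setT = (#|R| + \dim W)%N,
      #|coset_points a W| = (\dim W + 3)%N & forall i x e, g e = inr (inl (i, x)) -> p x - a \in W].
Proof.
move=> u full simp big; have [W WE dV] := full_frame_kernel full.
have [s sE] := fin_all_exists full; rewrite dV in big *.
have dW: (\dim W <= \dim {:wT})%N by apply/dimvS/subvf.
have := card_elements simp WE sE; set A := [set S | _]=> cE.
have cA: (#|A| <= 'C(#|R|, 2))%N.
  by rewrite -card_draws; apply/subset_leq_card/subsetP=> S; rewrite !inE=> /andP[].
have cB: (\sum_i #|coset_points (s i) W| <= #|R| * (\dim W + 3))%N.
  by rewrite -sum_nat_const; apply: leq_sum=> i _; apply: card_coset_points.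
have lower := hval_lower #|R| (\dim W).
have [/existsP[i /existsP[j nij]]|alle] := boolP [exists i, exists j, ~~ same_coset W s i j].
  by left; have := missing_pairs (same_coset_equiv W s) nij; rewrite -/A; lia.
have alleq i j: s i - s j \in W.
  by move: alle; rewrite negb_exists=> /forallP/(_ i); rewrite negb_exists=> /forallP/(_ j)/negbNE.
have /card_gt0P[i0 _]: (0 < #|R|)%N by lia.
have shift i x: (p x - s i \in W) = (p x - s i0 \in W).
  by rewrite -(subrK (s i0) (p x)) -addrA rpredDr ?alleq // addrK.
have Xeq i: coset_points (s i) W = coset_points (s i0) W by apply/setP=> x; rewrite !inE shift.
case: (eqVneq #|coset_points (s i0) W| (\dim W + 3)%N)=> [eq3|ne3].
  by right; exists (s i0), W; split=> // i x e ge; rewrite -(shift i) (point_coset WE sE ge).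
left; have lt3: (#|coset_points (s i0) W| <= \dim W + 2)%N.
  by have := card_coset_points (s i0) W; move: ne3; lia.
have {}cB: (\sum_i #|coset_points (s i) W| <= #|R| * (\dim W + 2))%N.
  by rewrite -sum_nat_const; apply: leq_sum=> i _; rewrite Xeq.
have : (#|R| * (\dim W + 3) = #|R| * (\dim W + 2) + #|R|)%N by rewrite addn3 addn2 mulnS addnC.
lia.
Qed.

End Count.

(** * The extremal configurations *)

Definition std_vec F (topT : vectType F) R (C : topT -> Prop) (z : framed F topT R) : Prop :=
  [\/ exists r r', r != r' /\ z = (0, unit_vec r - unit_vec r'),
      exists r c, C c /\ z = (c, unit_vec r) | exists2 d, d != 0 & z = (d, 0)].

Definition std_multiples F (topT : vectType F) R E (C : topT -> Prop)
  (v : E -> framed F topT R) : Prop :=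
  forall e, exists2 k, k != 0 & exists2 z, v e = k *: z & std_vec C z.

Lemma std_multiplesS F (topT : vectType F) R E (C C' : topT -> Prop) (v : E -> framed F topT R) :
  (forall c, C c -> C' c) -> std_multiples C v -> std_multiples C' v.
Proof.
move=> CC' Cv e; have [k k0 [z vE zC]] := Cv e; exists k=> //; exists z=> //.
case: zC=> [z1|[r [c [cC zE]]]|z3]; [exact: Or31|apply: Or32|exact: Or33].
by exists r, c; split=> //; apply: CC'.
Qed.

Definition frame_elements F (wT : vectType F) (PX R E : finType) (px : PX -> wT)
  (u : E -> framed F wT R) : Prop :=
  forall e, [\/ exists i j, i != j /\ u e = (0, unit_vec i - unit_vec j),
                exists i x, u e = (px x, unit_vec i) |
                exists x x' k, [/\ x != x', k != 0 & u e = (k *: (px x - px x'), 0)]].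

Section Embed.
Variables (F : finFieldType) (F4 : #|F| = 4%N).
Variables (wT topT : vectType F) (PX R E : finType) (px : PX -> wT).
Variables (Bs : {set PX}) (w : PX -> PX -> F) (xs : seq PX) (Cx : PX -> topT).
Hypotheses (bB : is_basis (lift1 px) Bs) (fw : fund_system (lift1 px) Bs w).
Hypotheses (uxs : uniq xs) (sxs : {subset xs <= Bs}).
Hypothesis w_out : forall e x, e \notin Bs -> x \in Bs -> x \notin xs -> w e x = 0.
Hypothesis Cx_basis : forall x, x \in Bs -> x \notin xs -> Cx x = 0.
Hypothesis Cx_out : forall e, e \notin Bs -> Cx e = \sum_(b <- xs) w e b *: Cx b.
Hypothesis Cx_free : forall c : PX -> F, \sum_(b <- xs) c b = 0 ->
  \sum_(b <- xs) c b *: Cx b = 0 -> forall b, b \in xs -> c b = 0.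

Let F2 := F4_char2 F4.
Local Notation l := (lift1 px).
Local Notation B' := {b : PX | (b \in Bs) && (b \notin xs)}.
Local Notation R' := (R + B')%type.

Definition extra_coord (x : PX) : vec F B' := [ffun b=> (val b == x)%:R].

Lemma extra_coord0 x : ~~ ((x \in Bs) && (x \notin xs)) -> extra_coord x = 0.
Proof.
by move=> nx; apply/ffunP=> b; rewrite !ffunE; case: eqP=> // bx; case/negP: nx;
  rewrite -bx (valP b).
Qed.

Lemma card_new_joints : #|{: R'}| = (#|R| + (#|Bs| - size xs))%N.
Proof.
rewrite card_sum card_sig; congr (_ + _)%N.
transitivity #|Bs :\: [set x in xs]|; first by apply: eq_card=> x; rewrite !inE andbC.
rewrite cardsDS; last by apply/subsetP=> x; rewrite inE=> /sxs.
by congr (_ - _)%N; rewrite -(card_uniqP uxs); apply: eq_card=> x; rewrite inE.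
Qed.

Lemma sum_basis (V : lmodType F) (c : PX -> F) (t : PX -> V) :
  (forall b, b \in Bs -> b \notin xs -> c b = 0) -> \sum_(b in Bs) c b *: t b = \sum_(b <- xs) c b
  *: t b.
Proof.
move=> c0; rewrite big_uniq // (bigID (mem xs)) /= [X in _ + X]big1 ?addr0=> [|b /andP[bB' bx]].
  by apply: eq_bigl=> b; apply/andb_idl/sxs.
by rewrite c0 ?scale0r.
Qed.

(* The basis points outside [xs] become new joints, placed over the origin of the top. *)
Lemma ex_recoordinate : exists T : 'Hom((wT * F^o)%type, framed F topT B'),
  (forall x, T (l x) = (Cx x, extra_coord x)) /\
  (forall y, (y, 0) \in vspan l Bs -> T (y, 0) = 0 -> y = 0).
Proof.
have [iB sB] := bB; have [ph [ph_span _ ph_basis]] := ex_coord iB.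
have [T TE]: exists T : 'Hom((wT * F^o)%type, framed F topT B'),
    forall z, T z = (\sum_(b in Bs) ph z b *: Cx b, [ffun b=> ph z (val b)]).
  apply: ex_lfun=> k x y; rewrite -[RHS]/(k *: _ + _, k *: _ + _); congr (_, _).
    rewrite scaler_sumr -big_split; apply: eq_bigr=> b _.
    by rewrite linearP /= !ffunE scalerDl scalerA.
  by apply/ffunP=> b; rewrite !ffunE linearP /= !ffunE.
have TB x: x \in Bs -> T (l x) = (Cx x, extra_coord x).
  move=> xB; rewrite TE ph_basis //; congr (_, _); last by apply/ffunP=> b; rewrite !ffunE.
  by under eq_bigr do rewrite ffunE; rewrite sum_delta xB scale1r.
exists T; split=> [x|y yB].
  have [xB|xB] := boolP (x \in Bs); first exact: TB.
  have [s0 x1 x0 _] := fw.2 x xB; have lE: l x = \sum_(b <- xs) w x b *: l b.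
    rewrite -sum_basis=> [|b bB' bx]; last exact: w_out.
    move: s0; rewrite (bigD1 x) //= x1 scale1r (bigID (mem Bs)) /= [X in _ + (_ + X)]big1;
      last first.
      by move=> b /andP[bx bB']; rewrite x0 ?scale0r.
    move/eqP; rewrite addr0 addr_eq0 (oppv_pchar2 F2)=> /eqP->; apply: eq_bigl=> b.
    by case: (eqVneq b x)=> [->|//]; rewrite (negPf xB).
  rewrite lE linear_sum /= (eq_big_seq (fun b=> w x b *: (Cx b, 0)))=> [|b bx]; last first.
    by rewrite linearZ /= TB ?sxs // extra_coord0 // bx andbF.
  rewrite Cx_out // extra_coord0 ?(negPf xB) // [LHS]surjective_pairing !raddf_sum /=.
  by congr (_, _); rewrite big1 // => b _; rewrite scaler0.
rewrite TE=> -[top0 extra0]; have y_out b: b \in Bs -> b \notin xs -> ph (y, 0) b = 0.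
  move=> bB' bx; have hb: (b \in Bs) && (b \notin xs) by rewrite bB'.
  by have /ffunP/(_ (Sub b hb)) := extra0; rewrite !ffunE.
have yE := ph_span _ yB; rewrite sum_basis // in yE; rewrite sum_basis // in top0.
have sum0: \sum_(b <- xs) ph (y, 0) b = 0.
  by have /(congr1 snd) := yE; rewrite raddf_sum /= => /esym s0; rewrite -[RHS]s0; apply: eq_bigr=>
    b _; rewrite [RHS]mulr1.
have y0 := Cx_free sum0 top0; have : (y, 0) = 0 :> (wT * F^o)%type; last by case.
by rewrite yE big_seq big1 // => b /y0->; rewrite scale0r.
Qed.

Definition new_coord (x : PX) : vec F R' := [ffun r=> if r is inr b then extra_coord x b else 0].

Lemma new_coordP x : (x \in xs) || (x \notin Bs) /\ new_coord x = 0 \/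
  exists2 b : B', x = val b & new_coord x = unit_vec (inr b).
Proof.
have [xb|xb] := boolP ((x \in Bs) && (x \notin xs)); [right|left].
  by exists (Sub x xb)=> //; apply/ffunP=> -[i|b]; rewrite !ffunE.
split; first by rewrite negb_and negbK orbC in xb.
by apply/ffunP=> -[i|b]; rewrite [LHS]ffunE [RHS]ffunE // extra_coord0 ?ffunE.
Qed.

Variable u : E -> framed F wT R.
Hypothesis u_frame : frame_elements px u.

Lemma ex_embedding_map : exists L : 'Hom(framed F wT R, framed F topT R'),
  [/\ forall i j, L (0, unit_vec i - unit_vec j) = (0, unit_vec (inl i) - unit_vec (inl j)),
     forall i x, L (px x, unit_vec i) = (Cx x, unit_vec (inl i) + new_coord x),
     forall x x' k, L (k *: (px x - px x'), 0) = k *: (Cx x - Cx x', new_coord x - new_coord x') &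
     same_rk u (L <$> u)].
Proof.
have [T [Tpt Tinj]] := ex_recoordinate; have [iB sB] := bB.
have sum_unit i: \sum_j (unit_vec i : vec F R) j = 1.
  by rewrite (bigD1 i) //= ffunE eqxx big1 ?addr0 // => j ji; rewrite ffunE (negPf ji).
have sumB (f h: vec F R) : \sum_j (f - h) j = \sum_j f j - \sum_j h j.
  by rewrite -sumrB; apply: eq_bigr=> j _; rewrite !ffunE.
have sum0: \sum_j (0 : vec F R) j = 0 by rewrite big1 // => j _; rewrite ffunE.
have [S SE]: exists S : 'Hom(framed F wT R, (wT * F^o)%type), forall z, S z = (z.1, \sum_i z.2 i).
  apply: ex_lfun=> k x y; rewrite -[RHS]/(k *: x.1 + y.1, k * _ + _); congr (_, _).
  by rewrite mulr_sumr -big_split; apply: eq_bigr=> i _; rewrite !ffunE.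
have Sdiff x x' k: S (k *: (px x - px x'), 0) = k *: (l x - l x').
  by rewrite SE /= sum0 -[RHS]/(k *: (px x - px x'), k * (1 - 1)) subrr mulr0.
have Su e: S (u e) \in vspan l Bs.
  case: (u_frame e)=> [[i [j [_ ->]]]|[i [x ->]]|[x [x' [k [_ _ ->]]]]].
  - by rewrite SE /= sumB !sum_unit subrr rpred0.
  - by rewrite SE /= sum_unit; apply: sB.
  by rewrite Sdiff rpredZ // rpredB ?sB.
have [L LE]: exists L : 'Hom(_, framed F topT R'), forall z,
    L z = ((T (S z)).1, [ffun r => match r with inl i => z.2 i | inr b => (T (S z)).2 b end]).
  apply: ex_lfun=> k x y; rewrite -[RHS]/(k *: _ + _, k *: _ + _) !linearP /=; congr (_, _).
  by apply/ffunP=> -[i|b]; rewrite !ffunE.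
exists L; split=> [i j|i x|x x' k|].
- rewrite LE SE /= sumB !sum_unit subrr linear0; congr (_, _).
  by apply/ffunP=> -[i'|b]; rewrite !ffunE //= subrr.
- rewrite LE SE /= sum_unit Tpt; congr (_, _).
  by apply/ffunP=> -[i'|b]; rewrite !ffunE /= ?addr0 // add0r.
- rewrite LE Sdiff linearZ linearB /= !Tpt; congr (_, _).
  by apply/ffunP=> -[i'|b]; rewrite !ffunE ?subrr ?scaler0.
apply: same_rk_lfun_inj=> -[y f] zV; rewrite LE=> -[/= top low].
have f0: f = 0 by apply/ffunP=> i; have /ffunP/(_ (inl i)) := low; rewrite !ffunE.
have S0: S (y, f) = (y, 0) by rewrite SE f0 /= sum0.
rewrite f0; congr (_, _); apply: Tinj; rewrite -S0.
  suff /subvP: (S @: vspan u setT <= vspan l Bs)%VS by apply; apply: memv_img.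
  by rewrite -vspan_lfun; apply: vspan_sub=> e _.
rewrite [LHS]surjective_pairing top; congr (_, _).
by apply/ffunP=> b; have /ffunP/(_ (inr b)) := low; rewrite !ffunE.
Qed.

Lemma embed : {in [pred x | (x \in xs) || (x \notin Bs)] &, injective Cx} ->
  exists v : E -> framed F topT R', same_rk u v /\
  std_multiples (fun c=> exists2 x, (x \in xs) || (x \notin Bs) & c = Cx x) v.
Proof.
move=> Cinj; have [L [edgeE pointE diffE uL]] := ex_embedding_map; exists (L <$> u).
split=> // e; have Cb (b: B') : Cx (val b) = 0 by have /andP[? ?] := valP b; apply: Cx_basis.
have negE (f h: vec F R') : f + h = f - h by rewrite (oppv_pchar2 F2).
case: (u_frame e)=> [[i [j [ij ->]]]|[i [x ->]]|[x [x' [k [xx k0 ->]]]]].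
- exists 1; rewrite ?oner_neq0 // edgeE; eexists; first by rewrite scale1r.
  by apply: Or31; exists (inl i), (inl j).
- exists 1; rewrite ?oner_neq0 // pointE; eexists; first by rewrite scale1r.
  case: (new_coordP x)=> [[xc ->]|[b xb ->]].
    by rewrite addr0; apply: Or32; exists (inl i), (Cx x); split=> //; exists x.
  by apply: Or31; exists (inl i), (inr b); rewrite xb Cb negE.
exists k=> //; rewrite diffE; eexists; first by [].
case: (new_coordP x) (new_coordP x')=> [[xc ->]|[b xb ->]] [[xc' ->]|[b' xb' ->]].
- rewrite subrr; apply: Or33; exists (Cx x - Cx x')=> //.
  by rewrite subr_eq0; apply: contraNneq xx=> CC; apply/eqP/Cinj.
- rewrite xb' Cb subr0 sub0r (oppv_pchar2 F2); apply: Or32; exists (inr b'), (Cx x).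
  by split=> //; exists x.
- rewrite xb Cb subr0 sub0r (oppv_pchar2 F2); apply: Or32; exists (inr b), (Cx x').
  by split=> //; exists x'.
rewrite xb xb' !Cb subrr; apply: Or31; exists (inr b), (inr b'); split=> //.
by apply: contraNneq xx=> -[bb]; rewrite xb xb' bb.
Qed.

End Embed.

Lemma card_Kedge n : #|Kedge n| = 'C(n, 2).
Proof.
rewrite card_sig -sum1_card -bin2_sum big_mkord.
rewrite (eq_bigl (fun ij : 'I_n * 'I_n=> true && (ij.1 < ij.2)%N)) //.
rewrite -(pair_big_dep xpredT (fun i j : 'I_n=> (i < j)%N) (fun _ _=> 1%N)) /=.
rewrite (exchange_big_dep xpredT) //=; apply: eq_bigr=> j _; have jn: (j <= n)%N :=
  ltnW (ltn_ord j).
by rewrite -(big_ord_widen n (fun=> 1%N) jn) sum_nat_const card_ord muln1.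
Qed.

Definition T2_ncols n := ((1 + n) + (#|Kedge n| + (n + (n + n))))%N.
Definition GH_ncols n := ((1 + (1 + n)) + (#|Kedge n| + (n + (n + (n + (n + (1 + (1 + 1))))))))%N.

Lemma bin2_addn n k : 'C(n + k, 2) = ('C(n, 2) + n * k + 'C(k, 2))%N.
Proof.
elim: k=> [|k IH]; rewrite ?addn0 ?muln0 ?addn0 //.
by rewrite addnS binS IH bin1 [in RHS]binS bin1; nia.
Qed.

Lemma T2_ncolsE n : T2_ncols n = hval n.+1.
Proof.
rewrite /T2_ncols /hval card_Kedge (_ : n.+1 + 3 = n + 4)%N; last by lia.
by rewrite bin2_addn (_ : 'C(4, 2) = 6)%N //; lia.
Qed.

Lemma GH_ncolsE n : GH_ncols n = hval n.+2.
Proof.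
rewrite /GH_ncols /hval card_Kedge (_ : n.+2 + 3 = n + 5)%N; last by lia.
by rewrite bin2_addn (_ : 'C(5, 2) = 10)%N //; lia.
Qed.

Section GenericMatrices.
Variable S : comNzRingType.

Definition edge_mx (n : nat) : 'M[S]_(n, #|Kedge n|) :=
  \matrix_(i, j) let p := val (enum_val j) in if i == p.1 then 1 else if i == p.2 then -1 else 0.

Definition point_mx1 (n : nat) (c : S) : 'M[S]_(1 + n, n) := col_mx (const_mx c) 1%:M.

Definition T2_mx (a : S) (n : nat) := row_mx (1%:M : 'M[S]_(1 + n))
 (row_mx (col_mx 0 (edge_mx n) : 'M_(1 + n, _))
 (row_mx (point_mx1 n 1) (row_mx (point_mx1 n a) (point_mx1 n (a ^+ 2))))).

Definition point_mx2 (n : nat) (c : S * S) : 'M[S]_(1 + (1 + n), n) :=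
  col_mx (const_mx c.1) (col_mx (const_mx c.2) 1%:M).

Definition top_col (n : nat) (d : S) : 'cV[S]_(1 + (1 + n)) := col_mx 1%:M (col_mx d%:M 0).

Definition GH_mx (c1 c2 c3 c4 : S * S) (d1 d2 d3 : S) (n : nat) :=
  row_mx (1%:M : 'M[S]_(1 + (1 + n)))
 (row_mx (col_mx 0 (col_mx 0 (edge_mx n)) : 'M_(1 + (1 + n), _))
 (row_mx (point_mx2 n c1) (row_mx (point_mx2 n c2) (row_mx (point_mx2 n c3) (row_mx (point_mx2 n c4)
 (row_mx (top_col n d1) (row_mx (top_col n d2) (top_col n d3)))))))).

End GenericMatrices.

Section Columns.
Variables (F : fieldType) (a : F).

Definition has_col m n (A : 'M[F]_(m, n)) (c : 'cV_m) : bool := [exists j, col j A == c].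

Lemma has_colP m n (A : 'M[F]_(m, n)) c : reflect (exists j, col j A = c) (has_col A c).
Proof. exact: 'exists_eqP. Qed.

Lemma has_col_row_mx m n1 n2 (A : 'M[F]_(m, n1)) (B : 'M_(m, n2)) c :
  has_col (row_mx A B) c = has_col A c || has_col B c.
Proof.
apply/has_colP/orP=> [[j <-]|[]/has_colP[j <-]].
- by case: (split_ordP j)=> k ->; rewrite ?colKl ?colKr; [left|right]; apply/has_colP; exists k.
- by exists (lshift _ j); rewrite colKl.
by exists (rshift _ j); rewrite colKr.
Qed.

Lemma has_col_col_mx0 m n p (A : 'M[F]_(m, n)) c :
  has_col A c -> has_col (col_mx (0 : 'M_(p, n)) A) (col_mx 0 c).
Proof.
case/has_colP=> j <-; apply/has_colP; exists j; apply/colP=> x; rewrite mxE.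
by case: (split_ordP x)=> x' ->; rewrite ?col_mxEu ?col_mxEd !mxE.
Qed.

Lemma has_col_unit m (i : 'I_m) : has_col (1%:M : 'M[F]_m) (delta_mx i 0).
Proof. by apply/has_colP; exists i; rewrite col1. Qed.

Lemma has_col_edge n (i j : 'I_n) : i != j ->
  exists2 k : F, k != 0 & has_col (edge_mx F n) (k *: (delta_mx i 0 - delta_mx j 0)).
Proof.
have edgeE (e: Kedge n) : has_col (edge_mx F n) (delta_mx (val e).1 0 - delta_mx (val e).2 0).
  apply/has_colP; exists (enum_rank e); apply/colP=> k; rewrite !mxE enum_rankK !eqxx !andbT /=.
  case: (eqVneq k (val e).1)=> [->|_]; first by rewrite (negPf (Kedge_neq e)) subr0.
  by rewrite -[false%:R]/(0 : F) sub0r; case: (k == _)=> /=; rewrite ?oppr0.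
move=> ij; case: (ltngtP i j)=> lt_ij; last by move: ij; rewrite (val_inj lt_ij) eqxx.
  by exists 1; rewrite ?oner_neq0 // scale1r; apply: (edgeE (Sub (i, j) lt_ij)).
exists (-1); rewrite ?oppr_eq0 ?oner_eq0 // scaleN1r opprB.
exact: (edgeE (Sub (j, i) lt_ij)).
Qed.

Lemma has_col_point1 n (c : F) i : has_col (point_mx1 n c) (col_mx c%:M (delta_mx i 0)).
Proof.
apply/has_colP; exists i; apply/colP=> k; rewrite mxE; case: (split_ordP k)=> k' ->;
  by rewrite ?col_mxEu ?col_mxEd !mxE ?ord1 ?eqxx ?andbT // eq_sym.
Qed.

Lemma has_col_point2 n (c : F * F) i :
  has_col (point_mx2 n c) (col_mx c.1%:M (col_mx c.2%:M (delta_mx i 0))).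
Proof.
apply/has_colP; exists i; apply/colP=> k; rewrite mxE; case: (split_ordP k)=> k' ->.
  by rewrite !col_mxEu !mxE ord1 eqxx.
by rewrite !col_mxEd; case: (split_ordP k')=> k'' ->; rewrite ?col_mxEu ?col_mxEd !mxE ?ord1 ?eqxx
  ?andbT.
Qed.

Lemma has_col_top n (d : F) : has_col (top_col n d) (col_mx 1%:M (col_mx d%:M 0)).
Proof. by apply/has_colP; exists 0; apply/colP=> x; rewrite !mxE. Qed.

Lemma delta_scalar1 : delta_mx 0 0 = 1%:M :> 'M[F]_1.
Proof. by apply/matrixP=> i j; rewrite !ord1 !mxE. Qed.

Definition T2_columns n nc (A : 'M[F]_(1 + n, nc)) : Prop :=
  [/\ forall i j : 'I_n, i != j -> exists2 k : F, k != 0 &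
        has_col A (k *: col_mx 0 (delta_mx i 0 - delta_mx j 0)),
     forall c i, c \in [:: 0; 1; a; a ^+ 2] -> has_col A (col_mx c%:M (delta_mx i 0)) &
     has_col A (col_mx 1%:M 0)].

Definition GH_columns n nc (A : 'M[F]_(1 + (1 + n), nc)) (C : seq (F * F)) : Prop :=
  [/\ forall i j : 'I_n, i != j -> exists2 k : F, k != 0 &
        has_col A (k *: col_mx 0 (col_mx 0 (delta_mx i 0 - delta_mx j 0))),
     forall c i, c \in C -> has_col A (col_mx c.1%:M (col_mx c.2%:M (delta_mx i 0))),
     has_col A (col_mx 0 (col_mx 1%:M 0)) &
     forall c, c \in [:: 0; 1; a; a ^+ 2] -> has_col A (col_mx 1%:M (col_mx c%:M 0))].

Lemma T2_mx_columns n : T2_columns (T2_mx a n).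
Proof.
split=> [i j /has_col_edge[k k0 ek]|c i|]; rewrite /T2_mx.
- exists k=> //; rewrite !has_col_row_mx scale_col_mx scaler0.
  by rewrite (has_col_col_mx0 _ ek) orbT.
- rewrite !has_col_row_mx !inE=> /or4P[]/eqP->; rewrite ?has_col_point1 ?orbT //.
  by rewrite raddf0 -delta_mx_dshift has_col_unit.
by rewrite !has_col_row_mx -delta_scalar1 -delta_mx_ushift has_col_unit.
Qed.

Definition G_points : seq (F * F) := [:: (0, 0); (1, 0); (0, 1); (a, 0); (0, a)].
Definition HP_points : seq (F * F) := [:: (0, 0); (a, 0); (0, 1); (a, a); (a ^+ 2, 1)].

Lemma GH_mx_columns n c1 c2 c3 c4 :
  GH_columns (GH_mx c1 c2 c3 c4 1 a (a ^+ 2) n) [:: (0, 0); c1; c2; c3; c4].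
Proof.
split=> [i j /has_col_edge[k k0 ek]|c i||c]; rewrite /GH_mx.
- exists k=> //; rewrite !has_col_row_mx !scale_col_mx !scaler0.
  by rewrite (has_col_col_mx0 _ (has_col_col_mx0 _ ek)) orbT.
- rewrite !has_col_row_mx !inE=> /orP[/eqP->|/or4P[]/eqP->]; rewrite ?has_col_point2 ?orbT //.
  by rewrite /= raddf0 -!delta_mx_dshift has_col_unit.
- by rewrite !has_col_row_mx -delta_scalar1 -delta_mx_ushift -delta_mx_dshift has_col_unit.
rewrite !has_col_row_mx !inE=> /or4P[]/eqP->; rewrite ?has_col_top ?orbT //.
by rewrite raddf0 col_mx0 -delta_scalar1 -delta_mx_ushift has_col_unit.
Qed.

Lemma Gmx_columns n : GH_columns (Gmx a n) G_points.
Proof. exact: (GH_mx_columns n (1, 0) (0, 1) (a, 0) (0, a)). Qed.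

Lemma HPmx_columns n : GH_columns (HPmx a n) HP_points.
Proof. exact: (GH_mx_columns n (a, 0) (0, 1) (a, a) (a ^+ 2, 1)). Qed.

End Columns.

Lemma simple_on_pair F (uT : vectType F) E (u : E -> uT) e e' :
  simple_on u setT -> e != e' -> vdim u [set e; e'] = 2.
Proof.
case=> n0 par ee; rewrite dim_vspanU1 /vspan big_set1 ?dim_vline ?n0 ?inE //.
by apply/negP=> /vlineP[k ek]; move: ee; rewrite (par e e' k) ?inE ?eqxx.
Qed.

Lemma msimpleP F (vT : vectType F) E (u : E -> vT) (M : matroid E) :
  (forall X, rk M X = vdim u X) -> msimple M <-> simple_on u setT.
Proof.
move=> rkE; split=> [ms|su X].
  split=> [e _|e e' k _ _ ue].
    by have := ms [set e]; rewrite cards1 rkE /vspan big_set1 dim_vline=> /(_ isT); case: eqP.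
  apply/eqP; apply: contraT=> ee; have := ms [set e; e']; rewrite cards2 ee rkE=> /(_ isT).
  have le: (vspan u [set e; e'] <= <[u e']>)%VS.
    by apply: vspan_sub=> x; rewrite !inE=> /orP[]/eqP->; rewrite ?ue ?rpredZ // memv_line.
  by have := dimvS le; rewrite dim_vline=> + h; rewrite h; case: (u e' == 0).
rewrite leq_eqVlt ltnS leq_eqVlt ltnS leqn0=> /or3P[/cards2P[e [e' [ee ->]]]|/cards1P[e ->]|].
- by rewrite rkE (simple_on_pair su ee) cards2 ee.
- by rewrite rkE /vspan big_set1 dim_vline cards1; have [n0 _] := su; rewrite n0 ?inE.
by rewrite cards_eq0=> /eqP->; rewrite rkE /vspan big_set0 dimv0 cards0.
Qed.

Lemma simple_on_same_rk F (uT vT : vectType F) E (u : E -> uT) (v : E -> vT) :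
  same_rk u v -> simple_on u setT -> simple_on v setT.
Proof. by move=> uv /(msimpleP (M:=vmatroid u) (fun=> erefl))/(msimpleP (M:=vmatroid u) uv). Qed.

Lemma miso_same_rk E E' (M M' : matroid E) (N : matroid E') :
  (forall X, rk M X = rk M' X) -> miso M' N -> miso M N.
Proof. by move=> MM' [f bf fE]; exists f=> // X; rewrite fE MM'. Qed.

Section ExtremalBound.
Variables (F : finFieldType) (al : F).

Definition three_iso r E (M : matroid E) : Prop :=
  [\/ miso M (T2 al r), miso M (Gr al r) | miso M (HP al r)].

Definition extremal_bound r E (M : matroid E) : Prop :=
  (#|E| <= hval r)%N /\ (#|E| = hval r -> three_iso r M).

Lemma extremal_bound_same_rk r E (M M' : matroid E) :
  (forall X, rk M X = rk M' X) -> extremal_bound r M' -> extremal_bound r M.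
Proof.
move=> MM' [le iso]; split=> // /iso[] isoM; [apply: Or31|apply: Or32|apply: Or33];
  exact: miso_same_rk MM' isoM.
Qed.

Lemma extremal_bound_lt r E (M : matroid E) : (#|E| < hval r)%N -> extremal_bound r M.
Proof. by move=> lt; split=> [|eq]; [apply: ltnW|rewrite eq ltnn in lt]. Qed.

End ExtremalBound.

Definition columns_bounded F (uT : vectType F) E (u : E -> uT) m nc (A : 'M[F]_(m, nc)) : Prop :=
  (#|E| <= nc)%N /\ (#|E| = nc -> miso (vmatroid u) (column_matroid A)).

Lemma columns_bound F (uT vT : vectType F) E (u : E -> uT) (v : E -> vT) m nc
  (A : 'M[F]_(m, nc)) (f : 'Hom(vT, 'cV[F]_m)) :
  simple_on u setT -> same_rk u v -> (forall x, f x = 0 -> x = 0) ->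
  (forall e, exists2 k : F, k != 0 & exists2 c, f (v e) = k *: c & has_col A c) ->
  columns_bounded u A.
Proof.
move=> su uv fi ex.
have /fin_all_exists[Jk JkE] e: exists Jk, Jk.2 != 0 /\ f (v e) = Jk.2 *: col Jk.1 A.
  by have [k k0 [c fE /has_colP[j jE]]] := ex e; exists (j, k); rewrite jE.
pose J e := (Jk e).1; have rkE X: vdim u X = rk (column_matroid A) (J @: X).
  rewrite uv (same_rk_lfun_inj (v:=v) (f:=f))=> [|x _]; last exact: fi.
  rewrite (vspan_scale (v:=fun e=> col (J e) A) (c:=fun e=> (Jk e).2))=> [|e|e].
  - by rewrite (vspan_imset (fun j=> col j A)).
  - by have [] := JkE e.
  by have [] := JkE e.
have Jinj: injective J.
  move=> e e' JJ; apply/eqP; apply: contraT=> ee; have := simple_on_pair su ee.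
  rewrite rkE imsetU !imset_set1 JJ setUid.
  by have := rk_card (column_matroid A) [set J e']; rewrite cards1=> + r2; rewrite r2.
split=> [|cE]; first by rewrite -[nc]card_ord; apply: leq_card Jinj.
exists J; last by move=> X; rewrite -rkE.
by apply: inj_card_bij; rewrite // card_ord cE.
Qed.

Section Rows.
Variables (F : fieldType) (R : finType).

Definition row_col (f : vec F R) : 'cV[F]_#|R| := \col_i f (enum_val i).

Lemma row_col_unit r : row_col (unit_vec r) = delta_mx (enum_rank r) 0.
Proof.
apply/colP=> i; rewrite !mxE ffunE andbT; congr (nat_of_bool _)%:R.
by rewrite -(inj_eq enum_rank_inj) enum_valK.
Qed.

Lemma row_colP k f f' : row_col (k *: f + f') = k *: row_col f + row_col f'.
Proof. by apply/colP=> i; rewrite !mxE !ffunE. Qed.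

Lemma row_col0 : row_col 0 = 0.
Proof. by apply/colP=> i; rewrite !mxE ffunE. Qed.

Lemma row_col_eq0 f : row_col f = 0 -> f = 0.
Proof.
by move=> /colP f0; apply/ffunP=> r; have := f0 (enum_rank r); rewrite !mxE enum_rankK ffunE.
Qed.

Lemma row_col_edge r r' :
  row_col (unit_vec r - unit_vec r') = delta_mx (enum_rank r) 0 - delta_mx (enum_rank r') 0.
Proof. by rewrite -!row_col_unit; apply/colP=> i; rewrite !mxE !ffunE. Qed.

End Rows.

Section ExtremalConfigurations.
Variables (F : finFieldType) (F4 : #|F| = 4%N) (al : F) (alE : al ^+ 2 = al + 1).
Local Notation dec := (dec4 al).
Local Notation enc := (enc4 al).
Local Notation dec2 k := ((dec k.1 : F^o, dec k.2 : F^o)).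

Section StandardBound.
Variables (R E : finType) (uT : vectType F) (u : E -> uT).
Hypothesis su : simple_on u setT.

Lemma scalarZ (k c : F) : (k * c)%:M = k *: c%:M :> 'M[F]_1.
Proof. by rewrite scale_scalar_mx. Qed.

Lemma T2_bound (v : E -> framed F (F^o) R) nc (A : 'M[F]_(1 + #|R|, nc)) :
  same_rk u v -> T2_columns al A ->
  @std_multiples F F^o R E (fun c=> (c : F) \in [:: 0; 1; al; al ^+ 2]) v -> columns_bounded u A.
Proof.
move=> uv [Aedge Apoint Atop] v_std.
have [f fE]: exists f : 'Hom(_, 'cV[F]_(1 + #|R|)),
    forall z : framed F (F^o) R, f z = col_mx (z.1 : F)%:M (row_col z.2).
  apply: ex_lfun=> k x y /=; rewrite row_colP scale_col_mx add_col_mx.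
  by congr col_mx; rewrite raddfD /= scalarZ.
apply: (columns_bound su uv (f:=f))=> [x|e].
  rewrite fE -(col_mx0 _ 1 #|R| 1)=> /eq_col_mx[top /row_col_eq0 low].
  by rewrite [x]surjective_pairing low; congr (_, _); have /matrixP/(_ 0 0) := top; rewrite !mxE.
have [k k0 [z vE z_std]] := v_std e; rewrite vE linearZ /= fE.
case: z_std=> [[r [r' [rr ->]]]|[r [c [hc ->]]]|[d d0 ->]] /=.
- have [k' k'0 Ak] := Aedge _ _ (contra_neq (@enum_rank_inj _ r r') rr).
  exists (k / k'); rewrite ?mulf_neq0 ?invr_eq0 //; eexists; last exact: Ak.
  by rewrite row_col_edge raddf0 scalerA divfK.
- by exists k=> //; eexists; first by []; rewrite row_col_unit Apoint.
exists (k * d); rewrite ?mulf_neq0 //; eexists; last exact: Atop.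
by rewrite -scalerA; congr (_ *: _); rewrite row_col0 scale_col_mx scaler0 -scalarZ mulr1.
Qed.

Lemma GH_bound (v : E -> framed F (F^o * F^o)%type R) nc (A : 'M[F]_(1 + (1 + #|R|), nc)) C :
  same_rk u v -> GH_columns al A C ->
  @std_multiples F (F^o * F^o)%type R E (fun c=> (c : F * F) \in C) v -> columns_bounded u A.
Proof.
move=> uv [Aedge Apoint A01 A1] v_std.
have [f fE]: exists f : 'Hom(_, 'cV[F]_(1 + (1 + #|R|))), forall z : framed F (F^o * F^o)%type R,
    f z = col_mx (z.1.1 : F)%:M (col_mx (z.1.2 : F)%:M (row_col z.2)).
  apply: ex_lfun=> k x y /=; rewrite row_colP !scale_col_mx !add_col_mx.
  by congr col_mx; [|congr col_mx]; rewrite raddfD /= scalarZ.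
apply: (columns_bound su uv (f:=f))=> [x|e].
  rewrite fE -(col_mx0 _ 1 (1 + #|R|) 1) -(col_mx0 _ 1 #|R| 1).
  move=> /eq_col_mx[top1 /eq_col_mx[top2 /row_col_eq0 low]].
  rewrite [x]surjective_pairing low [x.1]surjective_pairing; congr ((_, _), _).
    by have /matrixP/(_ 0 0) := top1; rewrite !mxE.
  by have /matrixP/(_ 0 0) := top2; rewrite !mxE.
have [k k0 [z vE z_std]] := v_std e; rewrite vE linearZ /= fE.
case: z_std=> [[r [r' [rr ->]]]|[r [c [hc ->]]]|[d d0 ->]] /=.
- have [k' k'0 Ak] := Aedge _ _ (contra_neq (@enum_rank_inj _ r r') rr).
  exists (k / k'); rewrite ?mulf_neq0 ?invr_eq0 //; eexists; last exact: Ak.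
  by rewrite row_col_edge !raddf0 scalerA divfK.
- by exists k=> //; eexists; first by []; rewrite row_col_unit Apoint.
rewrite row_col0; case: (eqVneq d.1 0)=> [d10|d1].
  have d2: d.2 != 0 by apply: contraNneq d0=> d2; rewrite [d]surjective_pairing d10 d2.
  exists (k * d.2); rewrite ?mulf_neq0 //; eexists; last exact: A01.
  by rewrite -scalerA d10 raddf0 !scale_col_mx !scaler0 -!scalarZ mulr1.
have ratio: d.2 / d.1 \in [:: 0; 1; al; al ^+ 2].
  by have := F4_cases F4 alE (d.2 / d.1); rewrite -alE=> -[]->; rewrite !inE eqxx ?orbT.
exists (k * d.1); rewrite ?mulf_neq0 //; eexists; last exact: A1 ratio.
by rewrite -scalerA; congr (_ *: _); rewrite !scale_col_mx scaler0 -!scalarZ mulr1 mulrC divfK.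
Qed.

End StandardBound.

Section Frame.
Variables (wT : vectType F) (PX R E : finType) (px : PX -> wT).
Variable u : E -> framed F wT R.
Hypotheses (u_frame : frame_elements px u) (su : simple_on u setT).

Section Core.
Variables (Bs : {set PX}) (w : PX -> PX -> F) (e0 f0 : PX) (xs : seq PX).
Hypotheses (bB : is_basis (lift1 px) Bs) (fw : fund_system (lift1 px) Bs w).
Hypotheses (ef : e0 != f0) (CB : ~: Bs = [set e0; f0]).
Hypotheses (uxs : uniq xs) (sxs : {subset xs <= Bs}).
Hypothesis out : forall x, x \in Bs -> x \notin xs -> w e0 x = 0 /\ w f0 x = 0.

Local Notation codes := [seq (enc (w e0 x), enc (w f0 x)) | x <- xs].

Lemma embed_placement (topT : vectType F) (ks : seq topT) (ke kf : topT) :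
  size ks = size xs -> uniq (ks ++ [:: ke; kf]) -> (forall Cx : PX -> topT, map Cx xs = ks ->
  [/\ ke = \sum_(b <- xs) w e0 b *: Cx b, kf = \sum_(b <- xs) w f0 b *: Cx b &
     forall c : PX -> F, \sum_(b <- xs) c b = 0 -> \sum_(b <- xs) c b *: Cx b = 0 ->
       forall b, b \in xs -> c b = 0]) -> exists (R' : finType) (v : E -> framed F topT R'),
  [/\ #|R'| = (#|R| + (#|Bs| - size xs))%N, same_rk u v &
     std_multiples (fun c=> c \in ks ++ [:: ke; kf]) v].
Proof.
move=> sz uks hks; have notB x: (x \notin Bs) = (x \in [:: e0; f0]) by rewrite -in_setC CB !inE.
set core := xs ++ [:: e0; f0]; set pos := ks ++ [:: ke; kf] in uks *.
have ucore: uniq core.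
  rewrite cat_uniq uxs /= inE ef !andbT orbF negb_or; apply/andP; split; apply/negP=> /sxs;
    by apply/negP; rewrite notB !inE eqxx ?orbT.
have szc: size core = size pos by rewrite !size_cat sz.
pose Cx x := nth 0 pos (index x core).
have posE: map Cx core = pos.
  apply: (@eq_from_nth _ 0); rewrite size_map // => i ic.
  by rewrite (nth_map e0) // /Cx index_uniq.
have coreE x: (x \in core) = (x \in xs) || (x \notin Bs) by rewrite mem_cat notB.
have Cx0 x: x \notin core -> Cx x = 0 by move=> xc; rewrite /Cx memNindex // szc nth_default.
have mapE: map Cx xs = ks /\ map Cx [:: e0; f0] = [:: ke; kf].
  by move/eqP: posE; rewrite map_cat eqseq_cat ?size_map // => /andP[/eqP-> /eqP->].
have [xsE [e0E f0E]] := mapE; have [keE kfE Cx_free] := hks Cx xsE.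
have w_out e x: e \notin Bs -> x \in Bs -> x \notin xs -> w e x = 0.
  by rewrite notB !inE=> /orP[]/eqP-> xB xn; have [] := out xB xn.
have Cx_basis x: x \in Bs -> x \notin xs -> Cx x = 0.
  by move=> xB xn; rewrite Cx0 // coreE (negPf xn) xB.
have Cx_out e: e \notin Bs -> Cx e = \sum_(b <- xs) w e b *: Cx b.
  by rewrite notB !inE=> /orP[]/eqP->; rewrite ?e0E ?f0E.
have Cinj: {in [pred x | (x \in xs) || (x \notin Bs)] &, injective Cx}.
  move=> x y; rewrite !inE -!coreE=> xc yc /eqP; rewrite nth_uniq -?szc ?index_mem // => /eqP xy.
  by rewrite -(nth_index e0 xc) xy nth_index.
have [v [uv hv]] := embed F4 bB fw uxs sxs w_out Cx_basis Cx_out Cx_free u_frame Cinj.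
exists (R + {b : PX | (b \in Bs) && (b \notin xs)})%type, v; split=> //.
  exact: card_new_joints.
by apply: std_multiplesS hv=> c [x xc ->]; apply: mem_nth; rewrite -szc index_mem coreE.
Qed.

Lemma size_core : (size xs <= #|Bs|)%N.
Proof. by rewrite -(card_uniqP uxs); apply/subset_leq_card/subsetP. Qed.

Lemma dec2_inj : injective (fun k : c4 * c4=> dec2 k).
Proof. by move=> [k k'] [m m'] [/(dec4_inj F4 alE)-> /(dec4_inj F4 alE)->]. Qed.

Lemma crossing_bound : codes = crossing_form -> extremal_bound al (#|R| + #|Bs|).-1 (vmatroid u).
Proof.
set r := _.-1=> codesE; have [x [y xsE]]: exists x y, xs = [:: x; y].
  by move: codesE; case: (xs)=> [|x [|y []]] // _; exists x, y.
have dE a c: enc a = c -> a = dec c by move=> <-; rewrite (enc4K F4 alE).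
move: codesE; rewrite xsE=> -[/dE ex /dE fx /dE ey /dE fy].
have [|||R' [v [cR uv v_std]]] := @embed_placement F^o [:: 0; 1] (dec cb) (dec ca).
- by rewrite xsE.
- have -> : [:: 0; 1] ++ [:: dec cb; dec ca] = map dec [:: c0; c1; cb; ca].
    by rewrite /= !(dec4E alE).
  by rewrite (map_inj_uniq (dec4_inj F4 alE)).
- rewrite xsE=> Cx [Cx0 Cy1]; rewrite !big_cons !big_nil Cx0 Cy1 !scaler0 !addr0 !add0r ey fy.
  split=> [||c]; [exact/esym/mulr1|exact/esym/mulr1|].
  rewrite !big_cons !big_nil Cx0 Cy1 scaler0 !addr0 add0r=> cxy cy.
  have cy0: c y = 0 by rewrite -[LHS]mulr1.
  by move=> b; rewrite !inE=> /orP[]/eqP-> //; move: cxy; rewrite cy0 addr0.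
have -> : r = #|R'|.+1 by have := size_core; rewrite cR /r xsE /=; lia.
rewrite /extremal_bound -T2_ncolsE.
suff [le eq]: columns_bounded u (T2mx al #|R'|) by split=> // /eq; apply: Or31.
apply: (T2_bound su uv (T2_mx_columns al _)); apply: std_multiplesS v_std=> c.
by rewrite /= !(dec4E alE) !inE=> /or4P[]/eqP->; rewrite eqxx ?orbT.
Qed.

Definition lin3 (h1 h2 h3 : c4) (k1 k2 k3 : c4 * c4) : c4 * c4 :=
  (add4 (mul4 h1 k1.1) (add4 (mul4 h2 k2.1) (mul4 h3 k3.1)),
   add4 (mul4 h1 k1.2) (add4 (mul4 h2 k2.2) (mul4 h3 k3.2))).
Definition sub4 (x y : c4 * c4) : c4 * c4 := (add4 x.1 y.1, add4 x.2 y.2).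

(* The placement [k1 k2 k3] of the basis points carries the two other points of the form
to [ke] and [kf]. *)
Definition placement (h1 h2 h3 k1 k2 k3 ke kf : c4 * c4) : bool :=
  [&& uniq [:: k1; k2; k3; ke; kf], ke == lin3 h1.1 h2.1 h3.1 k1 k2 k3,
      kf == lin3 h1.2 h2.2 h3.2 k1 k2 k3 & det4 (sub4 k2 k1) (sub4 k3 k1) != c0].

Lemma affine_free3 (k1 k2 k3 : c4 * c4) (a b c : F) : det4 (sub4 k2 k1) (sub4 k3 k1) != c0 ->
  a + b + c = 0 -> a * dec k1.1 + b * dec k2.1 + c * dec k3.1 = 0 ->
  a * dec k1.2 + b * dec k2.2 + c * dec k3.2 = 0 -> [/\ a = 0, b = 0 & c = 0].
Proof.
have two0: 2%:R = 0 :> F := pcharf0 (F4_char2 F4).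
rewrite -(dec4_eq0 F4 alE) (dec4_det F4 alE) /sub4 /= !(dec4D F4).
set p := dec k2.1 + dec k1.1; set q := dec k3.2 + dec k1.2; set s := dec k2.2 + _; set t :=
  dec k3.1 + _.
move=> det sum0 top1 top2.
have aE: a = b + c by apply/eqP; rewrite -(oppr_pchar2 (F4_char2 F4) (b + c)) -addr_eq0 addrA sum0.
have pt: b * p + c * t = 0 by rewrite -[RHS]top1 aE /p /t; ring.
have sq: b * s + c * q = 0 by rewrite -[RHS]top2 aE /s /q; ring.
have b0: b = 0.
  apply: (mulIf det); rewrite mul0r; transitivity (q * (b * p + c * t) + t * (b * s + c * q)).
    by ring: two0.
  by rewrite pt sq !mulr0 addr0.
have c0': c = 0.
  apply: (mulIf det); rewrite mul0r; transitivity (p * (b * s + c * q) + s * (b * p + c * t)).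
    by ring: two0.
  by rewrite pt sq !mulr0 addr0.
by rewrite aE b0 c0' addr0.
Qed.

Lemma placement_bound h1 h2 h3 k1 k2 k3 ke kf (l : seq (c4 * c4)) :
  codes = [:: h1; h2; h3] -> placement h1 h2 h3 k1 k2 k3 ke kf ->
  all (mem l) [:: k1; k2; k3; ke; kf] ->
  exists2 n, (#|R| + #|Bs|).-1 = n.+2 & forall nc (A : 'M[F]_(1 + (1 + n), nc)),
  GH_columns al A [seq (dec k.1, dec k.2) | k <- l] -> columns_bounded u A.
Proof.
move=> codesE /and4P[uks /eqP keE /eqP kfE det] ksl.
have [x [y [z xsE]]]: exists x y z, xs = [:: x; y; z].
  by move: codesE; case: (xs)=> [|x [|y [|z []]]] // _; exists x, y, z.
move: codesE; rewrite xsE=> -[] E1 E2 E3; rewrite -E1 -E2 -E3 /= in keE kfE.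
have [|||R' [v [cR uv v_std]]] := @embed_placement (F^o * F^o)%type [:: dec2 k1; dec2 k2;
  dec2 k3] (dec2 ke) (dec2 kf).
- by rewrite xsE.
- by rewrite -(map_inj_uniq dec2_inj) /= in uks.
- rewrite xsE=> Cx [Cx1 Cx2 Cx3]; rewrite !big_cons !big_nil Cx1 Cx2 Cx3 !addr0.
  split=> [||c]; first by rewrite keE /lin3 /= !(dec4D F4) !(dec4M F4 alE) !(enc4K F4 alE).
    by rewrite kfE /lin3 /= !(dec4D F4) !(dec4M F4 alE) !(enc4K F4 alE).
  rewrite !big_cons !big_nil Cx1 Cx2 Cx3 !addr0 !addrA=> s0 [t1 t2].
  have [cx cy cz] := affine_free3 det s0 t1 t2.
  by move=> b; rewrite !inE=> /or3P[]/eqP->.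
exists #|R'|; first by have := size_core; rewrite cR xsE /=; lia.
move=> nc A A_cols; apply: (GH_bound su uv A_cols); apply: std_multiplesS v_std=> c.
case/(mapP (s:=[:: k1; k2; k3; ke; kf]) (f:=fun k=> dec2 k))=> m mk ->.
by apply/map_f/(allP ksl).
Qed.

End Core.

Lemma core_shape_bound :
  core_shape al px -> extremal_bound al (#|R| + (vdim (lift1 px) setT).-1)%N (vmatroid u).
Proof.
case=> Bs [w [e0 [f0 [xs [h [bB fw [ef CB] [uxs sxs] [hc hE out]]]]]]].
set r := (_ + _)%N; have rE: (#|R| + #|Bs|).-1 = r.
  have [iB sB] := bB; rewrite /r; have <- : vdim (lift1 px) Bs = vdim (lift1 px) setT.
    by congr (\dim _); apply/eqP; rewrite eqEsubv vspanS ?subsetT //=; apply: vspan_sub=> x _.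
  rewrite (eqP iB); have : (0 < #|Bs|)%N; last by lia.
  move: (size_core uxs sxs) hE; case: (xs)=> [|x s]; first by move=> _ hE; rewrite -hE in hc.
  by move=> /= + _; lia.
pose realizable l := forall n, exists2 A : 'M_(1 + (1 + n), GH_ncols n),
  GH_columns al A [seq (dec k.1, dec k.2) | k <- l] &
  forall M : matroid E, miso M (column_matroid A) -> three_iso al n.+2 M.
have place l: realizable l -> forall k1 k2 k3 ke kf h1 h2 h3, h = [:: h1; h2; h3] ->
    placement h1 h2 h3 k1 k2 k3 ke kf -> all (mem l) [:: k1; k2; k3; ke; kf] ->
    extremal_bound al r (vmatroid u).
  move=> Al k1 k2 k3 ke kf h1 h2 h3 h3E pl kl; rewrite h3E in hE.
  have [n rn bound] := placement_bound bB fw ef CB uxs sxs out hE pl kl.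
  have [A /bound[le eq] isoA] := Al n.
  by split; rewrite -rE rn -GH_ncolsE // => /eq/isoA.
have /place G_bound: realizable [:: (c0, c0); (c1, c0); (c0, c1); (ca, c0); (c0, ca)].
  move=> n; exists (Gmx al n)=> [|M iso]; last exact: Or32.
  by rewrite /= !(dec4E alE); apply: Gmx_columns.
have /place HP_bound: realizable [:: (c0, c0); (ca, c0); (c0, c1); (ca, ca); (cb, c1)].
  move=> n; exists (HPmx al n)=> [|M iso]; last exact: Or33.
  by rewrite /= !(dec4E alE); apply: HPmx_columns.
move: hc; rewrite inE=> /orP[/eqP h_cross|].
  by rewrite -rE; apply: (crossing_bound bB fw ef CB uxs sxs out); rewrite hE.
rewrite !inE=> /orP[|/orP[|/orP[|/orP[|/orP[]]]]] /eqP.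
- by move/(G_bound (c0, c0) (ca, c0) (c0, ca) (c1, c0) (c0, c1)); apply.
- by move/(G_bound (c0, c0) (ca, c0) (c0, c1) (c1, c0) (c0, ca)); apply.
- by move/(G_bound (c0, c0) (c1, c0) (c0, ca) (ca, c0) (c0, c1)); apply.
- by move/(G_bound (c0, c0) (c1, c0) (c0, c1) (ca, c0) (c0, ca)); apply.
- by move/(HP_bound (ca, c0) (c0, c1) (c0, c0) (ca, ca) (cb, c1)); apply.
by move/(HP_bound (c0, c0) (ca, c0) (ca, ca) (c0, c1) (cb, c1)); apply.
Qed.

End Frame.

Variables (wT : vectType F) (P0 Q : finType) (p : option P0 -> wT) (q : Q -> wT).
Hypothesis p0 : p None = 0.
Hypothesis rp : forall R, rep_char3 (frame_cfg (R:=R) p q).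

Lemma frame_elements_coset R E (g : E -> R * R + (R * option P0 + Q)) (a : wT) (W : {vspace wT}) :
  let u := fun e=> frame_cfg (R:=R) p q (g e) in
  simple_on u setT -> (forall w, (w \in W) = ((w, 0) \in vspan u setT)) ->
  #|coset_points p a W| = (\dim W + 3)%N ->
  (forall i x e, g e = inr (inl (i, x)) -> p x - a \in W) ->
  frame_elements (@coset_pt F wT P0 p a W) u.
Proof.
move=> u [u0 _] WE cX points e; have := u0 e (in_setT _).
have : u e \in vspan u setT by rewrite mem_vspan ?inE.
rewrite /u; move: (fun i x=> points i x e); case: (g e)=> [[i j]|[[i x]|y]] /= pW uV n0.
- by apply: Or31; exists i, j; split=> //; apply: contraNneq n0=> ->; rewrite subrr.
- have xX: point_repr p x \in coset_points p a W.
    by rewrite inE (point_repr_eq (p_point_repr p x)) eqxx p_point_repr (pW i x erefl).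
  by apply: Or32; exists i, (Sub (point_repr p x) xX); rewrite /coset_pt /= p_point_repr.
have yW: q y \in W by rewrite WE.
have y0: q y != 0 by apply: contraNneq n0=> ->.
have [x [x' [k [xx k0 qE]]]] := coset_direction F4 alE rp cX yW y0.
by apply: Or33; exists x, x', k; rewrite -qE.
Qed.

Lemma config_bound : exists r0, forall (R E : finType) (g : E -> R * R + (R * option P0 + Q)),
  let u := fun e=> frame_cfg (R:=R) p q (g e) in
  simple_on u setT -> (r0 <= vdim u setT)%N -> extremal_bound al (vdim u setT) (vmatroid u).
Proof.
exists (\dim {:wT} + #|Q| + 6)%N=> R1 E g1 u1 su1 big.
have g0 e: frame_cfg p q (g1 e) != 0 by have [u0 _] := su1; rewrite u0 ?inE.
have [R [g [uu full]]] := ex_full_frame F4 p0 g0.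
set u := fun e=> frame_cfg p q (g e) in uu full; have su := simple_on_same_rk uu su1.
apply: (extremal_bound_same_rk (M:=vmatroid _) (M':=vmatroid _) uu); rewrite uu in big *.
have [lt|[a [W [WE dV cX points]]]] := count_dichotomy F4 alE rp full su big.
  exact: extremal_bound_lt.
have := core_shape_bound (frame_elements_coset su WE cX points) su (coset_core_shape F4 alE rp cX).
by rewrite (dim_lift1_coset_pt F4 alE rp cX) /= -dV.
Qed.

End ExtremalConfigurations.

Section MaximumSize.
Local Open Scope nat_scope.

Lemma bin3_double r : (2 * 'C(r + 3, 2) = (r + 3) * (r + 2)).
Proof. by elim: r=> [|r IH] //; rewrite addSn binS mulnDr IH bin1; nia. Qed.

Lemma hvalE r : (0 < r) -> (hval r + 5 = 'C(r + 3, 2)).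
Proof. by move=> r0; rewrite /hval; have := bin3_double r; nia. Qed.

Lemma bin3_growth a r : (a <= r) -> ('C(a + 3, 2) + (r - a) * (a + 3) <= 'C(r + 3, 2)).
Proof. by move=> ar; have := bin3_double a; have := bin3_double r; nia. Qed.

Lemma hval_growth a r : (0 < a < r) -> (hval a + (a + 3) <= hval r).
Proof.
move=> /andP[a0 ar]; have := hvalE a0; have := hvalE (leq_trans a0 (ltnW ar)).
have : (a + 3 <= (r - a) * (a + 3)) by apply: leq_pmull; lia.
by have := bin3_growth (ltnW ar); lia.
Qed.

Lemma bin3_split a b r k : (b <= a) -> (a < r) -> (a + b <= r + k) -> (2 * k + 2 <= b) ->
  ('C(a + 3, 2) + 'C(b + 3, 2) <= 'C(r + 3, 2)).
Proof.
move=> ba ar abr kb; have := bin3_growth (ltnW ar); have := bin3_double b.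
have le_codim: (b - k <= r - a) by lia.
have : ((b - k) * (a + 3) <= (r - a) * (a + 3)) by rewrite leq_mul2r le_codim orbT.
have : ((b + 2) * (b + 3) <= (2 * (b - k)) * (a + 3)) by apply: leq_mul; lia.
by nia.
Qed.

Lemma hval_split a b r k c : (b <= a) -> (a < r) -> (a + b <= r + k) -> (2 * k + 4 * c + 8 <= b) ->
  ('C(a + 3, 2) + c * a + ('C(b + 3, 2) + c * b) < hval r).
Proof.
move=> ba ar abr kb; have r0: (0 < r) by lia.
have := hvalE r0; have := bin3_growth (ltnW ar); have := bin3_double b.
have le_codim: ((b - k) * (a + 3) <= (r - a) * (a + 3)).
  by rewrite leq_mul2r; apply/orP; right; lia.
have le_double: ((b + 2 + 4 * c + 6) * (a + 3) <= (2 * (b - k)) * (a + 3)).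
  by rewrite leq_mul2r; apply/orP; right; lia.
have le_b: ((b + 3) * (b + 2) <= (b + 2) * (a + 3)).
  by rewrite mulnC leq_mul2l; apply/orP; right; lia.
have le_c: (c * b <= c * a) by rewrite leq_mul2l ba orbT.
have expand: ((b + 2 + 4 * c + 6) * (a + 3)
    = (b + 2) * (a + 3) + 4 * (c * a) + 12 * c + 6 * a + 18) by ring.
move: le_codim le_double le_b le_c expand; rewrite -mulnA.
move: ((b + 2) * (a + 3)) ((b + 3) * (b + 2)) ((b + 2 + 4 * c + 6) * (a + 3))=> x y z.
by move: ((b - k) * (a + 3)) ((r - a) * (a + 3)) (c * a) (c * b)=> ? ? ? ?; lia.
Qed.

Lemma leq_pow4 a b : (a <= b) -> (4 ^ a <= 4 ^ b).
Proof. by move=> ab; rewrite leq_exp2l. Qed.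

Section Recursion.
Variables (G : nat -> nat -> Prop) (k R0 : nat).
Hypothesis G_le_pow4 : forall r m, G r m -> (m <= 4 ^ r).

Definition splits (r a b : nat) : Prop := (b <= a < r) /\ (r <= a + b <= r + k).
Definition decomposes (r m : nat) : Prop :=
  exists a b m1 m2, [/\ G a m1, G b m2, m = (m1 + m2) & splits r a b].

Hypothesis G_dec : forall r m, (R0 <= r) -> G r m -> (m <= hval r) \/ decomposes r m.

Lemma linear_error_rank : exists c T : nat,
  forall r m, (T <= r) -> G r m -> (m <= 'C(r + 3, 2) + c * (r - k)).
Proof.
set T := (2 * k + 2); set R1 := (R0 + T + 4 ^ T); set c := (4 ^ R1).
exists c, T=> r m.
have [n] := ubnP r; elim: n r m=> // n IH r m rn Tr Gm.
have Lr: (c <= c * (r - k)) by apply: leq_pmulr; rewrite /T in Tr; lia.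
case: (leqP r R1)=> [rR|rR].
  by have := G_le_pow4 Gm; have := leq_pow4 rR; rewrite -/c; lia.
have [|le|[a [b [m1 [m2 [Ga Gb -> [/andP[ba ar] /andP[rab abr]]]]]]]] := G_dec _ Gm.
- by rewrite /R1 in rR; lia.
- by have := hvalE (leq_ltn_trans (leq0n _) rR); lia.
have aT: (T <= a) by have : (T < 4 ^ T) := @ltn_expl 4 T isT; rewrite /R1 in rR; lia.
have le1 := IH a m1 (leq_trans ar rn) aT Ga.
case: (leqP T b)=> bT.
  have le2 := IH b m2 (leq_ltn_trans ba (leq_trans ar rn)) bT Gb.
  have : (c * (a - k) + c * (b - k) <= c * (r - k)).
    by rewrite -mulnDr leq_mul2l; apply/orP; right; rewrite /T in bT aT; lia.
  by have := @bin3_split a b r k ba ar abr bT; lia.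
have le2 := G_le_pow4 Gb; have le3 := leq_pow4 (ltnW bT); have := bin3_growth (ltnW ar).
have : (a + 3 <= (r - a) * (a + 3)) by apply: leq_pmull; lia.
have : (c * (a - k) <= c * (r - k)) by rewrite leq_mul2l; apply/orP; right; lia.
have : (4 ^ T <= a + 3) by rewrite /R1 in rR; lia.
by lia.
Qed.

Lemma linear_error : exists c, forall r m, (0 < r) -> G r m -> (m <= 'C(r + 3, 2) + c * r).
Proof.
have [c [T bound]] := linear_error_rank; exists (c + 4 ^ T)=> r m r0 Gm.
have le_r: (4 ^ T <= 4 ^ T * r) by apply: leq_pmulr.
rewrite mulnDl; case: (leqP T r)=> Tr.
  have : (c * (r - k) <= c * r) by rewrite leq_mul2l leq_subr orbT.
  by have := bound r m Tr Gm; lia.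
by have := G_le_pow4 Gm; have := leq_pow4 (ltnW Tr); lia.
Qed.

Lemma large_pieces : exists2 T : nat, (0 < T) & forall r a b m1 m2,
  G a m1 -> G b m2 -> splits r a b -> (T < b) -> (m1 + m2 < hval r).
Proof.
have [c lin] := linear_error; exists (2 * k + 4 * c + 8); first by rewrite addnS.
move=> r a b m1 m2 Ga Gb [/andP[ba ar] /andP[_ abr]] Tb; have b0: (0 < b) by lia.
have le1 := lin a m1 (leq_trans b0 ba) Ga; have le2 := lin b m2 b0 Gb.
by have := @hval_split a b r k c ba ar abr (ltnW Tb); lia.
Qed.

Section SmallPieces.
Variable T : nat.
Hypotheses (T0 : (0 < T)) (large : forall r a b m1 m2,
  G a m1 -> G b m2 -> splits r a b -> (T < b) -> (m1 + m2 < hval r)).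

(* Splitting off a piece of rank at most T gains more than a constant on hval, so that the
excess decreases until it vanishes. *)
Lemma excess_bound : exists B r0, forall r m, (r0 <= r) -> G r m ->
  (m <= hval r) \/ (T * m + r <= B + T * hval r).
Proof.
set R := (R0 + T + 4 ^ T); exists (T * 4 ^ (R + T) + R + T), R=> r m.
have [n] := ubnP r; elim: n r m=> // n IH r m rn Rr Gm.
have [|le|[a [b [m1 [m2 [Ga Gb mE spl]]]]]] := G_dec _ Gm; [by rewrite /R in Rr; lia|by left|].
have [/andP[ba ar] /andP[rab _]] := spl; subst m.
case: (ltnP T b)=> Tb; first by left; apply: ltnW; apply: large spl Tb.
have m2T: (m2 <= 4 ^ T) := leq_trans (G_le_pow4 Gb) (leq_pow4 Tb).
case: (leqP R a)=> aR.
  have growth: (hval a + (a + 3) <= hval r).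
    by apply: hval_growth; rewrite ar andbT; rewrite /R in aR; lia.
  have a4: (4 ^ T <= a) by rewrite /R in aR; lia.
  have [le|le] := IH a m1 (leq_trans ar rn) aR Ga; first by left; lia.
  right; have : (T * (hval a + (m2 + 1)) <= T * hval r).
    by rewrite leq_mul2l; apply/orP; right; lia.
  by move: le; rewrite !mulnDr muln1; lia.
right; have : (m1 + m2 <= 4 ^ (R + T)).
  by apply: leq_trans (G_le_pow4 Gm) (leq_pow4 _); lia.
by rewrite -(leq_pmul2l T0); lia.
Qed.

Lemma recursion_bound : exists r0, forall r m, (r0 <= r) -> G r m -> (m <= hval r).
Proof.
have [B [R bound]] := excess_bound; exists (B + R + 1)=> r m Rr Gm.
have [|//|le] := bound r m _ Gm; first by lia.
by rewrite -(leq_pmul2l T0); lia.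
Qed.

Lemma recursion_strict_bound : exists r0, forall r m, (r0 <= r) -> decomposes r m -> (m < hval r).
Proof.
have [R bound] := recursion_bound; exists (R + T + 4 ^ T + 1)=> r m Rr.
move=> [a [b [m1 [m2 [Ga Gb -> spl]]]]].
case: (ltnP T b)=> Tb; first exact: large spl Tb.
have m2T: (m2 <= 4 ^ T) := leq_trans (G_le_pow4 Gb) (leq_pow4 Tb).
have [/andP[_ ar] /andP[rab _]] := spl.
have growth: (hval a + (a + 3) <= hval r) by apply: hval_growth; rewrite ar andbT; lia.
by have := bound a m1 _ Ga; lia.
Qed.

End SmallPieces.

Theorem recursion_bounds : exists r0, forall r m, (r0 <= r) ->
  (G r m -> (m <= hval r)) /\ (decomposes r m -> (m < hval r)).
Proof.
have [T T0 large] := large_pieces; have [R1 bound] := recursion_bound T0 large.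
have [R2 strict] := recursion_strict_bound T0 large; exists (R1 + R2)=> r m Rr.
by split; [apply: bound|apply: strict]; lia.
Qed.

End Recursion.

End MaximumSize.

Section NoFanoPlane.

Lemma PG_is_point n (x : 'rV['F_2]_n) : x != 0 -> is_point (fun p : PGpoint 'F_2 n=> val p) x.
Proof.
move=> x0; have F2E (k: 'F_2) : k != 0 -> k = 1 by case: k=> [[|[|[]]] lt] //= _; apply: val_inj.
have /existsP[i1 xi1]: [exists i, x 0 i != 0].
  apply: contraNT x0=> /existsPn x0; apply/eqP/rowP=> i; rewrite mxE.
  by apply/eqP; move: (x0 i); rewrite negbK.
case: (@arg_minnP _ i1 (fun i=> x 0 i != 0) val xi1)=> i xi0 i_min.
have xP: [exists i, (x 0 i == 1) && [forall j : 'I_n, (j < i)%N ==> (x 0 j == 0)]].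
  apply/existsP; exists i; rewrite (F2E _ xi0) eqxx; apply/forallP=> j; apply/implyP=> ji.
  by apply: contraLR ji=> xj; rewrite -leqNgt i_min.
by exists (Sub x xP), 1; rewrite scale1r oner_neq0.
Qed.

Lemma PG_not_rep_char3 : ~ rep_char3 (fun p : PGpoint 'F_2 3=> val p).
Proof.
move=> r3; pose e i : 'rV['F_2]_3 := delta_mx 0 i.
pose i0 : 'I_3 := @Ordinal 3 0 isT; pose i1 : 'I_3 := @Ordinal 3 1 isT.
pose i2 : 'I_3 := @Ordinal 3 2 isT.
apply: (no_fano (a:=e i0) (b:=e i1) (c:=e i2) _ r3); first exact: pchar_Fp.
  suff : free (in_tuple [:: e i0; e i1; e i2]) by [].
  apply/freeP=> k.
  rewrite !big_ord_recl big_ord0=> /rowP k0 i.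
  have := (k0 i0, k0 i1, k0 i2); rewrite !mxE /= !(mulr0, mulr1, addr0, add0r)=> -[[h0 h1] h2].
  case: i=> [[|[|[|//]]] lt]; [rewrite -[RHS]h0|rewrite -[RHS]h1|rewrite -[RHS]h2];
    by congr (k _); apply: val_inj.
move=> x; rewrite !inE=> xs; apply: PG_is_point.
have ne i: x 0 i = 1 -> x != 0.
  by move=> xi; apply/eqP=> x0; move/eqP: xi; rewrite x0 mxE eq_sym oner_eq0.
case/or4P: xs=> [|||/or4P[]] /eqP xE; by
  [apply: (ne i0); rewrite xE !mxE /= ?addr0|apply: (ne i1); rewrite xE !mxE /= ?addr0 ?add0r
  |apply: (ne i2); rewrite xE !mxE /= ?addr0 ?add0r].
Qed.

Lemma rep_char3_no_PG F E (M : matroid E) (vT : vectType F) (v : E -> vT) :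
  (forall X, rk M X = vdim v X) -> rep_char3 v -> ~ has_minor M (PG 'F_2 3).
Proof.
move=> rkE r3 [C [D [f bf fE]]]; apply: PG_not_rep_char3.
have [h ch _] := ex_contraction v C; pose g x : E := val (val (f x)).
apply: rep_char3_same (rep_char3_sub g (rep_char3_contract ch r3))=> X.
rewrite -[LHS]/(rk (PG 'F_2 3) X) -fE [LHS](rk_mcontract M) !rkE.
rewrite (vspan_imset (h <$> v) g) vspan_lfun (dim_contracts _ ch) setUC.
by congr (vdim v (_ :|: _) - _)%N; rewrite -!imset_comp.
Qed.

End NoFanoPlane.

Lemma simple_card_le_exp (F : finFieldType) (vT : vectType F) E (u : E -> vT) :
  simple_on u setT -> (#|E| <= #|F| ^ vdim u setT)%N.
Proof.
move=> [_ par]; have [J [_ iJ sJ cJ]] := ex_basis0 u setT; have [f [fE _ _]] := ex_coord iJ.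
pose c e : {ffun {j : E | j \in J} -> F} := [ffun j=> f (u e) (val j)].
have c_inj: injective c.
  move=> e e' cc; apply: (par e e' 1); rewrite ?inE // scale1r.
  have uE x: u x = \sum_(j in J) f (u x) j *: u j by apply: fE; rewrite sJ mem_vspan ?inE.
  rewrite [LHS]uE [RHS]uE; apply: eq_bigr=> j jJ.
  by have /ffunP/(_ (Sub j jJ)) := cc; rewrite !ffunE /= => ->.
have card_J: #|{: {j : E | j \in J}}| = #|J| by rewrite card_sig; apply: eq_card.
by have := leq_card c c_inj; rewrite card_ffun card_J cJ.
Qed.

Lemma ex_repmatroid F (vT : vectType F) E (u : E -> vT) :
  exists U : repmatroid F E, same_rk (rep_vec U) u.
Proof.
have [J [_ iJ sJ _]] := ex_basis0 u setT; have [f [fE _ _]] := ex_coord iJ.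
exists (@row_space F E E (fun b e=> f (u e) b)); apply: same_rk_trans (row_space_rk _) _.
apply: same_rk_sym=> X; rewrite (same_rk_lfun_inj (v:=u) (f:=f))=> [|x xV fx]; last first.
  by rewrite (fE x) ?sJ // fx big1 // => e _; rewrite ffunE scale0r.
by congr (\dim _); apply: eq_bigr=> e _; congr <[_]>%VS; apply/ffunP=> b; rewrite !ffunE.
Qed.

Section UpperBound.
Variables (F : finFieldType) (F4 : #|F| = 4%N) (al : F) (alE : al ^+ 2 = al + 1).
Implicit Types vT : vectType F.

Local Notation bounded r u := (extremal_bound al r (vmatroid u)).

Definition simple_char3 (r m : nat) : Prop := exists vT E (u : E -> vT),
  [/\ rep_char3 u, simple_on u setT, vdim u setT = r & #|E| = m].

Lemma template_bound (Phi : frame_template F) :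
  (forall E (U : repmatroid F E), template_class Phi U -> rep_char3 (rep_vec U)) ->
  exists r0, forall E (U : repmatroid F E), template_class Phi U -> simple_on (rep_vec U) setT ->
  (r0 <= vdim (rep_vec U) setT)%N -> bounded (vdim (rep_vec U) setT) (rep_vec U).
Proof.
move=> tc; have [wT [p [q [p0 rp cfg]]]] := template_frame_cfg F4 alE tc.
have [r0 bound] := config_bound F4 alE p0 rp; exists r0=> E U tU su big.
have [n0 _] := su; have [R [g ug]] := cfg E U tU (fun e=> n0 e (in_setT e)).
apply: (extremal_bound_same_rk (M:=vmatroid _) (M':=vmatroid _) ug); have :=
  bound R E g (simple_on_same_rk ug su).
by rewrite -ug=> /(_ big).
Qed.

Lemma simple_char3_sub vT E (u : E -> vT) (Y : {set E}) :
  rep_char3 u -> simple_on u setT -> simple_char3 (vdim u Y) #|Y|.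
Proof.
move=> ru [n0 par]; exists vT, {x : E | x \in Y}, (fun x=> u (val x)); split.
- exact: rep_char3_sub.
- split=> [x _|x y c _ _ h]; first by rewrite n0 ?inE.
  by apply: val_inj; apply: (par _ _ c); rewrite ?inE.
- rewrite (vspan_imset u val); congr (vdim u _); apply/setP=> x.
  by apply/imsetP/idP=> [[y _ ->]|xY]; [apply: valP|exists (Sub x xY)].
by rewrite card_sig; apply: eq_card.
Qed.

Lemma separation_decomposes k r vT E (u : E -> vT) (X : {set E}) :
  rep_char3 u -> simple_on u setT -> vdim u setT = r ->
  (vdim u X + vdim u (~: X) < r + k)%N -> vdim u X != r -> vdim u (~: X) != r ->
  decomposes simple_char3 k r #|E|.
Proof.
move=> ru su rE lam nX nX'.
have le_r Y: (vdim u Y <= r)%N by rewrite -rE; apply/dimvS/vspanS/subsetT.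
have ge_r: (r <= vdim u X + vdim u (~: X))%N.
  by rewrite -rE -(setUCr X) vspanU; apply: dimv_addl_leq.
have ltX: (vdim u X < r)%N by rewrite ltn_neqAle nX le_r.
have ltX': (vdim u (~: X) < r)%N by rewrite ltn_neqAle nX' le_r.
have sub Y := simple_char3_sub Y ru su; rewrite -(cardsC X).
case: (leqP (vdim u (~: X)) (vdim u X))=> le.
  exists (vdim u X), (vdim u (~: X)), #|X|, #|~: X|; split=> //.
  by split; apply/andP; split=> //; lia.
exists (vdim u (~: X)), (vdim u X), #|~: X|, #|X|; split=> //; first by rewrite addnC.
by split; apply/andP; split=> //; lia.
Qed.

Lemma clique_free_bound n : exists r0, forall r, (r0 <= r)%N ->
  forall vT E (u : E -> vT), rep_char3 u -> simple_on u setT ->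
  vdim u setT = r -> ~ has_clique n.+1 u -> bounded r u.
Proof.
have [R1 sparse] := clique_free_sparse n F4 alE; exists (R1 + 10)%N=> r Rr vT E u ru su rE nK.
have := sparse r _ vT E u setT ru nK su; rewrite rE cardsT=> /(_ _ (leqnn r)) lt.
have {}lt := lt (leq_trans (leq_addr _ _) Rr).
have r0: (0 < r)%N by lia.
apply: extremal_bound_lt; move: lt; have := hvalE r0; have := bin3_double r.
by rewrite -mulnn; nia.
Qed.

Theorem extremal_or_decomposes : HypothesisB -> exists k r0, forall r, (r0 <= r)%N ->
  forall vT E (u : E -> vT), rep_char3 u -> simple_on u setT ->
  vdim u setT = r -> bounded r u \/ decomposes simple_char3 k r #|E|.
Proof.
move=> hB; have [k [n [s [t [Phi [Psi [[k0 n0] sub _ cover _]]]]]]] :=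
  hB F 2 (F4_char2 F4) 3 isT (@char3_class F) (@char3_class_minor_closed F).
have [r0 bound] := fin_all_exists (fun i=> template_bound (sub i)).
case: n n0 cover=> // n _ cover; have [R1 sparse] := clique_free_bound n.
exists k, (R1 + \max_i r0 i)%N=> r Rr vT E u ru su rE.
have [U uU] := ex_repmatroid u; have Uu := same_rk_sym uU.
have rkU X: rk (abstract U) X = vdim u X by rewrite rk_abstract uU.
have mr: mrank (abstract U) = r by rewrite /mrank rkU rE.
have [Kn|nKn] := classic (has_clique n.+1 u); last by left; apply: sparse nKn=> //; lia.
have [vc|nvc] := classic (vertically_connected k (abstract U)); last first.
  have [X nX] := not_all_ex_not _ _ nvc; have [lam /not_or_and[nX1 nX2]] := imply_to_and _ _ nX.
  right; move: lam nX1 nX2; rewrite /spanning mr !rkU=> lam /eqP nX1 /eqP nX2.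
  by apply: (separation_decomposes (u:=u) (X:=X))=> //; lia.
left; have ms: msimple (abstract U) by apply/(msimpleP (u:=u)).
have CU: char3_class U by apply: rep_char3_same uU ru.
have [i ti] := cover E U CU ms vc (has_clique_minor rkU Kn) (rep_char3_no_PG rkU ru).
have := bound i E U ti (simple_on_same_rk Uu su); rewrite (uU setT) rE=> le.
by apply: (extremal_bound_same_rk (M:=vmatroid _) (M':=vmatroid _) Uu) (le _); have :=
  leq_bigmax i (F:=r0); lia.
Qed.

Theorem rep_char3_extremal_bound : HypothesisB -> exists r0, forall r, (r0 <= r)%N ->
  forall vT E (u : E -> vT), rep_char3 u -> simple_on u setT -> (vdim u setT <= r)%N -> bounded r u.
Proof.
move=> hB; have [k [R0 dec]] := extremal_or_decomposes hB.
have le_pow4 r m: simple_char3 r m -> (m <= 4 ^ r)%N.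
  by case=> vT [E [u [_ su <- <-]]]; rewrite -F4; apply: simple_card_le_exp.
have G_dec r m: (R0 <= r)%N -> simple_char3 r m -> (m <= hval r)%N \/ decomposes simple_char3 k r m.
  by move=> Rr [vT [E [u [ru su rE <-]]]]; have [[]|] := dec r Rr vT E u ru su rE; [left|right].
have [R bound] := recursion_bounds le_pow4 G_dec.
exists (R + R0 + 4 ^ R + 5)%N=> r Rr vT E u ru su; set r' := vdim u setT=> le.
have Gr': simple_char3 r' #|E| by exists vT, E, u.
have r0: (0 < r)%N by lia.
case: (ltngtP r' r) le=> // [lt _|eq _].
  apply: extremal_bound_lt; have := hvalE r0; have := bin3_double r.
  case: (leqP R r')=> Rr'; last by have := le_pow4 _ _ Gr'; have := leq_pow4 (ltnW Rr'); nia.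
  have [/(_ Gr') le' _] := bound r' #|E| Rr'; case: (posnP r')=> [z|r'0].
    by have := le_pow4 _ _ Gr'; rewrite z expn0; nia.
  by have := @hval_growth r' r; rewrite r'0 lt=> /(_ isT); lia.
have [Rr1 Rr2]: (R <= r)%N /\ (R0 <= r)%N by lia.
have [//|dec_r] := dec r Rr2 vT E u ru su eq; apply: extremal_bound_lt.
by have [_ /(_ dec_r)] := bound r #|E| Rr1.
Qed.

End UpperBound.

Section MatroidIsomorphism.
Variables (E E' E'' : finType) (M : matroid E) (N : matroid E') (P : matroid E'').

Lemma miso_refl : miso M M.
Proof. by exists id=> [|X]; [exists id|rewrite imset_id]. Qed.

Lemma miso_sym : miso M N -> miso N M.
Proof.
move=> [f [g fg gf] fE]; exists g=> [|X]; first by exists f.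
by rewrite -fE -imset_comp (eq_imset (g:=id)) ?imset_id // => x; rewrite /= gf.
Qed.

Lemma miso_trans : miso M N -> miso N P -> miso M P.
Proof.
move=> [f bf fE] [g bg gE]; exists (g \o f)=> [|X]; first exact: bij_comp.
by rewrite imset_comp gE fE.
Qed.

End MatroidIsomorphism.

(** * Representations over the golden mean *)

Lemma indep_minorP K m n (A : 'M[K]_(m, n)) k (g : 'I_k -> 'I_n) : injective g ->
  reflect (exists f : 'I_k -> 'I_m, injective f /\ \det (mxsub f g A) != 0)
          (indep (fun j=> col j A) (g @: setT)).
Proof.
move=> g_inj.
have sumE (c: 'I_n -> K) : \sum_(j in g @: setT) c j *: col j A = colsub g A *m \col_i c (g i).
  rewrite big_imset /= => [|x y _ _]; last exact: g_inj.
  apply/colP=> i; rewrite summxE !mxE.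
  by apply: eq_big=> [x|x _]; rewrite ?inE // !mxE mulrC.
have rowsubE (f: 'I_k -> 'I_m) : mxsub f g A = rowsub f (colsub g A).
  by apply/matrixP=> i j; rewrite !mxE.
apply: (iffP idP)=> [ind|[f [_ d0]]].
  have rfree: row_free (colsub g A)^T.
    apply: inj_row_free=> v /(congr1 trmx); rewrite trmx_mul trmxK trmx0=> vA.
    have := indep_coef ind (c:=fun j=> if [pick i | g i == j] is Some i then v 0 i else 0).
    have pickE i: [pick i' | g i' == g i] = Some i.
      by case: pickP=> [i' /eqP/g_inj->|/(_ i)]; rewrite ?eqxx.
    rewrite sumE (_ : \col_i _ = v^T) ?vA=> [/(_ erefl) c0|]; last first.
      by apply/colP=> i; rewrite !mxE pickE.
    by apply/rowP=> i; have := c0 (g i); rewrite imset_f ?inE // pickE mxE=> ->.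
  have rfull: row_full (colsub g A) by rewrite /row_free mxrank_tr in rfree; rewrite /row_full.
  exists (fullrankfun rfull); split; first exact: fullrankfun_inj.
  by rewrite rowsubE -unitfE -unitmxE -row_full_unit /row_full mxrank_fullrowsub.
apply: indepP=> c; rewrite sumE; set v := \col_i c (g i)=> Av.
have v0: v = 0.
  have unit_sub: mxsub f g A \in unitmx by rewrite unitmxE unitfE.
  rewrite -(mulKmx unit_sub v) rowsubE mul_rowsub_mx Av.
  by rewrite (_ : rowsub f 0 = 0) ?mulmx0 //; apply/matrixP=> i j; rewrite !mxE.
by move=> _ /imsetP[i _ ->]; have /colP/(_ i) := v0; rewrite !mxE.
Qed.

Lemma same_rk_indep F K (vT : vectType F) (wT : vectType K) E (v : E -> vT) (w : E -> wT) :
  (forall X, indep v X = indep w X) -> same_rk v w.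
Proof.
move=> vw X; apply/eqP; rewrite eqn_leq; apply/andP; split.
  have [J [JX iJ _ <-]] := ex_basis0 v X; rewrite vw in iJ.
  by rewrite -(eqP iJ); apply/dimvS/vspanS.
have [J [JX iJ _ <-]] := ex_basis0 w X; rewrite -vw in iJ.
by rewrite -(eqP iJ); apply/dimvS/vspanS.
Qed.

Lemma same_rk_minors F K m n (A : 'M[F]_(m, n)) (B : 'M[K]_(m, n)) :
  (forall k (f : 'I_k -> 'I_m) (g : 'I_k -> 'I_n), injective f -> injective g ->
     (\det (mxsub f g A) == 0) = (\det (mxsub f g B) == 0)) ->
  same_rk (fun j=> col j A) (fun j=> col j B).
Proof.
move=> dets; apply: same_rk_indep=> X.
have enum_inj: injective (@enum_val _ (mem X)) by apply: enum_val_inj.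
have <- : @enum_val _ (mem X) @: [set: 'I_#|X|] = X.
  apply/setP=> x; apply/imsetP/idP=> [[i _ ->]|xX]; first exact: enum_valP.
  by exists (enum_rank_in xX x); rewrite ?inE // enum_rankK_in.
apply/(indep_minorP A enum_inj)/(indep_minorP B enum_inj)=> -[f [f_inj d0]]; exists f.
  by rewrite -dets.
by rewrite dets.
Qed.

Definition eval_int (K : comNzRingType) (t : K) : {rmorphism {poly int} -> K} :=
  horner_eval t \o map_poly intr.

Lemma eval_intX (K : comNzRingType) (t : K) : eval_int t 'X = t.
Proof. by rewrite /= /horner_eval map_polyX hornerX. Qed.

Lemma eval_intC (K : comNzRingType) (t : K) (c : int) : eval_int t c%:P = c%:~R.
Proof. by rewrite /= /horner_eval map_polyC hornerC. Qed.

Section GoldenMean.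
Variable R : realType.
Local Notation tau := (golden_ratio R).

Lemma golden_ratio_sqr : tau ^+ 2 = tau + 1.
Proof.
have s5: Num.sqrt (5 : R) ^+ 2 = 5 by rewrite sqr_sqrtr // ler0n.
rewrite /golden_ratio; apply: (mulfI (_ : 4 != 0)); first by rewrite pnatr_eq0.
transitivity (1 + 2 * Num.sqrt 5 + Num.sqrt 5 ^+ 2 : R); first by field.
by rewrite s5; field.
Qed.

Lemma golden_ratio_neq0 : tau != 0.
Proof.
apply/eqP=> t0; have := golden_ratio_sqr; rewrite t0 expr0n add0r=> /esym/eqP.
by rewrite oner_eq0.
Qed.

Lemma golden_ratio_inv : tau^-1 = tau - 1.
Proof.
apply: (mulfI golden_ratio_neq0).
by rewrite mulfV ?golden_ratio_neq0 // mulrBr mulr1 -expr2 golden_ratio_sqr; ring.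
Qed.

Lemma golden_ratio_independent (a b : int) : a%:~R + b%:~R * tau = 0 -> a = 0 /\ b = 0.
Proof.
move=> ab0; have s5: Num.sqrt (5 : R) ^+ 2 = 5 by rewrite sqr_sqrtr // ler0n.
have sqrt5E: (2 * a + b)%:~R + b%:~R * Num.sqrt 5 = 0 :> R.
  transitivity (2 * (a%:~R + b%:~R * tau)); last by rewrite ab0 mulr0.
  by rewrite /golden_ratio rmorphD rmorphM /=; field.
have sqrE: ((2 * a + b) ^+ 2)%:~R = (5 * b ^+ 2)%:~R :> R.
  rewrite !rmorphXn /= rmorphM /= rmorphXn /= -[5%:~R]/(5 : R) -s5 -exprMn.
  by move/eqP: sqrt5E; rewrite addr_eq0=> /eqP->; rewrite sqrrN [b%:~R * _]mulrC.
move/eqP: sqrE; rewrite eqr_int=> /eqP sqrE.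
have sqr_absz: (absz (2 * a + b)%R ^ 2 = 5 * absz b ^ 2)%N by rewrite -!abszX sqrE abszM.
(* the 5-adic valuations of both sides have different parities *)
have b0: b = 0.
  apply/eqP; rewrite -absz_eq0; apply: contraT; rewrite -lt0n=> b_gt0.
  have := congr1 (logn 5) sqr_absz; rewrite lognM ?expn_gt0 ?b_gt0 // !lognX.
  by move/(congr1 odd); rewrite !mul2n oddD !odd_double.
by split=> //; move: ab0; rewrite b0 mul0r addr0=> /eqP; rewrite intr_eq0=> /eqP.
Qed.

Lemma eval_int_eq0 (K : comNzRingType) (t : K) (P : {poly int}) :
  t ^+ 2 = t + 1 -> eval_int tau P = 0 -> eval_int t P = 0.
Proof.
move=> t2; have [a [b [Q PE]]]: exists (a b : int) Q,
    P = Q * ('X ^+ 2 - 'X - 1) + (a%:P + b%:P * 'X).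
  elim/poly_ind: P=> [|P c [a [b [Q ->]]]]; first by exists 0, 0, 0; rewrite !polyC0; ring.
  by exists (b + c), (a + b), (Q * 'X + b%:P); rewrite !polyCD; ring.
have evalE (K': comNzRingType) (s : K') : s ^+ 2 = s + 1 -> eval_int s P = a%:~R + b%:~R * s.
  move=> s2; rewrite PE rmorphD !rmorphM !rmorphB rmorphXn rmorph1 rmorphD rmorphM.
  by rewrite !eval_intX !eval_intC s2 -addrA -opprD subrr mulr0 add0r.
rewrite !evalE ?golden_ratio_sqr // => /golden_ratio_independent[-> ->].
by rewrite mul0r addr0.
Qed.

Definition golden_power (x : R) : Prop := x = 0 \/ exists i : int, x = tau ^ i \/ x = - tau ^ i.

Lemma golden_power1 : golden_power 1.
Proof. by right; exists 0; left; rewrite expr0z. Qed.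

Lemma golden_powerN x : golden_power x -> golden_power (- x).
Proof.
case=> [->|[i [->|->]]]; first by left; rewrite oppr0.
  by right; exists i; right.
by right; exists i; left; rewrite opprK.
Qed.

Lemma ex_golden_poly x : golden_power x -> exists P, eval_int tau P = x.
Proof.
have powE (i: int) : exists P, eval_int tau P = tau ^ i.
  case: i=> n; first by exists ('X ^+ n); rewrite rmorphXn eval_intX.
  exists (('X - 1) ^+ n.+1); rewrite rmorphXn rmorphB rmorph1 eval_intX.
  by rewrite -golden_ratio_inv NegzE -exprnN exprVn.
case=> [->|[i [->|->]]]; [by exists 0; rewrite rmorph0|exact: powE|].
by have [P PE] := powE i; exists (- P); rewrite rmorphN PE.
Qed.

Lemma eval_int_golden_power_eq0 K (t : K) (P : {poly int}) :
  t ^+ 2 = t + 1 -> golden_power (eval_int tau P) -> (eval_int tau P == 0) = (eval_int t P == 0).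
Proof.
move=> t2; have t0: t != 0.
  by apply/eqP=> t0; move: t2; rewrite t0 expr0n add0r=> /esym/eqP; rewrite oner_eq0.
have pow_neq0 (Q: {poly int}) (i : int) : eval_int tau Q = tau ^ i -> eval_int t Q != 0.
  case: i=> n QE.
    have /(eval_int_eq0 t2)/eqP: eval_int tau (Q - 'X ^+ n) = 0.
      by rewrite rmorphB rmorphXn eval_intX QE subrr.
    by rewrite rmorphB rmorphXn eval_intX subr_eq0=> /eqP->; apply: expf_neq0.
  have /(eval_int_eq0 t2)/eqP: eval_int tau (Q * 'X ^+ n.+1 - 1) = 0.
    rewrite rmorphB rmorphM rmorphXn rmorph1 eval_intX QE NegzE -exprnN.
    by rewrite mulVf ?subrr // expf_neq0 // golden_ratio_neq0.
  rewrite rmorphB rmorphM rmorphXn rmorph1 eval_intX subr_eq0=> /eqP Q1.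
  by apply: contra_eqN Q1=> /eqP->; rewrite mul0r eq_sym oner_eq0.
have tau_neq0 i: (tau ^ i == 0) = false by rewrite expfz_eq0 (negPf golden_ratio_neq0) andbF.
case=> [P0|[i [PE|PE]]].
- by rewrite P0 eqxx (eval_int_eq0 t2 P0) eqxx.
- by rewrite (negPf (pow_neq0 _ _ PE)) PE tau_neq0.
have NPE: eval_int tau (- P) = tau ^ i by rewrite rmorphN PE opprK.
by have := pow_neq0 _ _ NPE; rewrite rmorphN oppr_eq0=> /negPf->; rewrite PE oppr_eq0 tau_neq0.
Qed.

Definition golden_mx m n (A : 'M[R]_(m, n)) : Prop :=
  forall k (f : 'I_k -> 'I_m) (g : 'I_k -> 'I_n), injective f -> injective g ->
  golden_power (\det (mxsub f g A)).

Lemma golden_mx_same_rk K (t : K) m n (B : 'M[{poly int}]_(m, n)) :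
  t ^+ 2 = t + 1 -> golden_mx (map_mx (eval_int tau) B) ->
  same_rk (fun j=> col j (map_mx (eval_int tau) B)) (fun j=> col j (map_mx (eval_int t) B)).
Proof.
move=> t2 goldB; apply: same_rk_minors=> k f g f_inj g_inj.
have subE (K': comNzRingType) (s : K') :
    mxsub f g (map_mx (eval_int s) B) = map_mx (eval_int s) (mxsub f g B).
  by apply/matrixP=> i j; rewrite !mxE.
have := goldB k f g f_inj g_inj; rewrite !subE !det_map_mx.
exact: eval_int_golden_power_eq0.
Qed.

Lemma golden_mx_lift m n (A : 'M[R]_(m, n)) : golden_mx A -> exists B, A = map_mx (eval_int tau) B.
Proof.
move=> goldA; have entryP (ij: 'I_m * 'I_n) : exists P, eval_int tau P = A ij.1 ij.2.
  apply: ex_golden_poly; have := goldA 1 (fun=> ij.1) (fun=> ij.2).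
  by rewrite det_mx11 mxE; apply=> x y _; rewrite !ord1.
have [B BE] := fin_all_exists entryP; exists (\matrix_(i, j) B (i, j)).
by apply/matrixP=> i j; rewrite !mxE BE.
Qed.

Lemma GM_golden_mx E (M : matroid E) : GM R M <->
  exists m n (A : 'M[R]_(m, n)), golden_mx A /\ miso M (column_matroid A).
Proof.
split=> -[m [n [A [minors isoM]]]]; exists m, n, A; split=> // k f g f_inj g_inj.
  case: (eqVneq (\det (mxsub f g A)) 0)=> [->|d0]; first by left.
  by right; apply: minors.
by move=> d0; case: (minors k f g f_inj g_inj)=> [z|//]; rewrite z eqxx in d0.
Qed.

Lemma GM_representable E (M : matroid E) K (t : K) : t ^+ 2 = t + 1 -> GM R M -> representable K M.
Proof.
move=> t2 /GM_golden_mx[m [n [A [goldA isoM]]]].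
have [B AE] := golden_mx_lift goldA; subst A.
exists m, n, (map_mx (eval_int t) B); apply: miso_trans isoM _.
apply: (miso_same_rk (M:=column_matroid _) (M':=column_matroid _)) (miso_refl _).
exact: golden_mx_same_rk.
Qed.

Lemma GM_eval_int K (t : K) m n (B : 'M[{poly int}]_(m, n)) :
  t ^+ 2 = t + 1 -> golden_mx (map_mx (eval_int tau) B) ->
  GM R (column_matroid (map_mx (eval_int t) B)).
Proof.
move=> t2 goldB; apply/GM_golden_mx; exists m, n, (map_mx (eval_int tau) B); split=> //.
apply: (miso_same_rk (M:=column_matroid _) (M':=column_matroid _)) (miso_refl _).
exact/same_rk_sym/golden_mx_same_rk.
Qed.

Lemma ex_golden_field p : prime p ->
  exists2 K : fieldType, p \in [pchar K] & exists t : K, t ^+ 2 = t + 1.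
Proof.
move=> pp; pose P : {poly 'F_p} := 'X ^+ 2 - 'X - 1.
have sP: size P = 3.
  have s2: size ('X + 1 : {poly 'F_p}) = 2 by rewrite -polyC1 size_XaddC.
  by rewrite /P -addrA -opprD size_polyDl ?size_polyXn ?size_polyN ?s2.
have P0: P != 0 by rewrite -size_poly_eq0 sP.
have [L [rs PE _]] := FinSplittingFieldFor P0.
exists L; first by rewrite (pchar_lalg L) pchar_Fp.
case: rs PE=> [|t rs] PE.
  by move: (eqp_size PE); rewrite big_nil size_poly1 size_map_poly sP.
exists t; have : root (map_poly (in_alg L) P) t by rewrite (eqp_root PE) root_prod_XsubC mem_head.
rewrite /root /P !rmorphB rmorphXn /= map_polyX rmorph1 !hornerE=> /eqP P_t.
by apply/eqP; rewrite -subr_eq0 opprD addrA P_t.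
Qed.

Lemma GM_AC4 (F : finFieldType) (al : F) E (M : matroid E) : al ^+ 2 = al + 1 -> GM R M -> AC4 F M.
Proof.
move=> alE gM; split; first exact: GM_representable alE gM.
  by exists R; [apply: pchar_num|have [m [n [A [_ isoM]]]] := gM; exists m, n, A].
move=> p /ex_golden_field[K Kp [t t2]]; exists K=> //.
exact: GM_representable t2 gM.
Qed.

End GoldenMean.

Lemma det_mx22 (K : comNzRingType) (A : 'M[K]_2) : \det A = A 0 0 * A 1 1 - A 0 1 * A 1 0.
Proof.
rewrite (expand_det_row _ 0) !big_ord_recl big_ord0 addr0 /cofactor !det_mx11 !mxE /=.
have -> : lift 0 0 = 1 :> 'I_2 by apply: val_inj.
have -> : lift 1 0 = 0 :> 'I_2 by apply: val_inj.
by rewrite expr0 expr1 mul1r mulN1r mulrN.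
Qed.

Lemma det_pivot K n (A : 'M[K]_n.+1) i0 j0 : A i0 j0 != 0 ->
  \det A = (-1) ^+ (i0 + j0) * (A i0 j0 * \det (\matrix_(i, j)
  (A (lift i0 i) (lift j0 j) - (A i0 j0)^-1 * A (lift i0 i) j0 * A i0 (lift j0 j)))).
Proof.
move=> p0; pose v j := if j == j0 then 0 else (A i0 j0)^-1 * A i0 j.
pose U : 'M[K]_n.+1 := \matrix_(i, j) ((i == j)%:R - (i == j0)%:R * v j).
have neq_lift0 (i: 'I_n) : (lift j0 i == j0) = false by rewrite eq_sym (negPf (neq_lift _ _)).
have detU: \det U = 1.
  rewrite (expand_det_col _ j0) (bigD1 j0) //= big1=> [|i ij]; last first.
    by rewrite !mxE (negPf ij) mul0r subr0 mul0r.
  rewrite addr0 /cofactor addnn -signr_odd odd_double !mxE eqxx /v eqxx mulr0 subr0 !mul1r.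
  rewrite -[RHS](det1 _ n); congr (\det _); apply/matrixP=> i j.
  by rewrite !mxE (inj_eq lift_inj) neq_lift0 mul0r subr0.
have AU i j: (A *m U) i j = A i j - A i j0 * v j.
  rewrite mxE; under eq_bigr do rewrite mxE mulrBr.
  rewrite sumrB (bigD1 j) //= eqxx mulr1 big1 ?addr0=> [|l lj]; last by rewrite (negPf lj) mulr0.
  by rewrite (bigD1 j0) //= eqxx mul1r big1 ?addr0 // => l lj; rewrite (negPf lj) mul0r mulr0.
have -> : \det A = \det (A *m U) by rewrite det_mulmx detU mulr1.
rewrite (expand_det_row _ i0) (bigD1 j0) //= big1=> [|j jj]; last first.
  by rewrite AU /v (negPf jj) mulVKf // subrr mul0r.
rewrite addr0 AU /v eqxx mulr0 subr0 /cofactor mulrCA; congr (_ * (_ * \det _)).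
by apply/matrixP=> i j; rewrite [LHS]mxE [LHS]mxE AU mxE /v neq_lift0; ring.
Qed.

(* As D contains the differences of C, the shape of the columns is stable under pivoting. *)
Section FrameMatrices.
Variable R : realType.
Variables C D : seq (R * R).
Hypothesis subC : forall c c', c \in C -> c' \in C -> (c.1 - c'.1, c.2 - c'.2) \in D.
Hypothesis C0 : (0, 0) \in C.
Hypothesis D_power : forall d, d \in D -> golden_power d.1 /\ golden_power d.2.
Hypothesis D_det : forall d d', d \in D -> d' \in D -> golden_power (d.1 * d'.2 - d.2 * d'.1).

Definition row_label := (bool + nat)%type.

Definition frame_entry (top : R * R) (low : nat -> R) (l : row_label) : R :=
  match l with inl b => if b then top.1 else top.2 | inr x => low x end.

Definition is_sign (s : R) : Prop := s = 1 \/ s = -1.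

Definition frame_col (top : R * R) (low : nat -> R) : Prop :=
  [\/ exists x y s, [/\ x != y, is_sign s, top = (0, 0) &
        forall z, low z = s * ((z == x)%:R - (z == y)%:R)],
      exists c x s, [/\ c \in C, is_sign s, top = (s * c.1, s * c.2) &
        forall z, low z = s * (z == x)%:R] | top \in D /\ forall z, low z = 0].

Definition frame_mx m n (lab : 'I_m -> row_label) (A : 'M[R]_(m, n)) : Prop :=
  forall j, exists top low, frame_col top low /\ forall i, A i j = frame_entry top low (lab i).

Lemma is_signN s : is_sign s -> is_sign (- s).
Proof. by case=> ->; [right|left; rewrite opprK]. Qed.

Lemma is_sign_exp n : is_sign ((-1) ^+ n).
Proof. by rewrite -signr_odd; case: (odd n); [right|left]. Qed.

Lemma is_sign_sqr s : is_sign s -> s * s = 1 /\ s^-1 = s.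
Proof. by case=> ->; rewrite ?mulr1 ?invr1 // mulrNN mulr1 invrN invr1. Qed.

Lemma golden_power_sign s x : is_sign s -> golden_power x -> golden_power (s * x).
Proof. by case=> ->; rewrite ?mul1r ?mulN1r //; apply: golden_powerN. Qed.

Lemma D0 : (0, 0) \in D.
Proof. by have := subC C0 C0; rewrite !subrr. Qed.

Lemma frame_col_top top low : frame_col top low -> top \in D.
Proof.
case=> [[x [y [s [_ _ -> _]]]]|[c [x [s [cC ss -> _]]]]|[//]]; first exact: D0.
by case: ss=> ->; [have := subC cC C0|have := subC C0 cC]; rewrite /= ?subr0 ?sub0r ?mul1r ?mulN1r.
Qed.

Lemma frame_col_at top low x : frame_col top low -> low x != 0 ->
  exists s, [/\ is_sign s, low x = s &
  (exists y, [/\ y != x, top = (0, 0) & forall z, low z = s * ((z == x)%:R - (z == y)%:R)]) \/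
  (exists c, [/\ c \in C, top = (s * c.1, s * c.2) & forall z, low z = s * (z == x)%:R])].
Proof.
case=> [[x1 [y1 [s [xy ss tE lE]]]]|[c [x1 [s [cC ss tE lE]]]]|[_ lE]] n0.
- case: (eqVneq x x1)=> [xx|xx].
    subst x1; exists s; split=> //; first by rewrite lE eqxx (negPf xy) subr0 mulr1.
    by left; exists y1; split=> //; rewrite eq_sym.
  case: (eqVneq x y1)=> [xy1|xy1]; last first.
    by rewrite lE (negPf xx) (negPf xy1) subrr mulr0 eqxx in n0.
  subst y1; exists (- s); split; first exact: is_signN.
    by rewrite lE (negPf xx) eqxx sub0r mulrN1.
  by left; exists x1; split=> // z; rewrite lE; ring.
- case: (eqVneq x x1)=> [xx|xx]; last by rewrite lE (negPf xx) mulr0 eqxx in n0.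
  subst x1; exists s; split=> //; first by rewrite lE eqxx mulr1.
  by right; exists c.
by rewrite lE eqxx in n0.
Qed.

Lemma frame_col_pivot top0 low0 top low x :
  frame_col top0 low0 -> frame_col top low -> low0 x != 0 ->
  exists top' low', frame_col top' low' /\ forall l, l != inr x -> frame_entry top' low' l =
  frame_entry top low l - (low0 x)^-1 * frame_entry top0 low0 l * low x.
Proof.
move=> col0 col n0; case: (eqVneq (low x) 0)=> [lx|n1].
  by exists top, low; split=> // l _; rewrite lx mulr0 subr0.
have [s0 [ss0 e0 shape0]] := frame_col_at col0 n0; have [s [ss e shape]] := frame_col_at col n1.
rewrite e0 e; have [s0s0 s0V] := is_sign_sqr ss0; rewrite s0V.
have cancel_s0 k: s0 * (s0 * k) * s = s * k by rewrite mulrA s0s0 mul1r mulrC.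
case: shape0=> [[y0 [_ t0 l0]]|[k0 [k0C t0 l0]]]; case: shape=> [[y [_ t l]]|[k [kC t l]]].
- exists (0, 0), (fun z=> s * ((z == y0)%:R - (z == y)%:R)); split.
    case: (eqVneq y0 y)=> [->|yy]; last by apply: Or31; exists y0, y, s.
    by apply: Or33; split=> [|z]; [exact: D0|rewrite subrr mulr0].
  case=> [b|z] _ /=; first by rewrite t t0 /=; case: b; rewrite mulr0 mul0r subr0.
  by rewrite l l0 cancel_s0; ring.
- exists (s * k.1, s * k.2), (fun z=> s * (z == y0)%:R); split.
    by apply: Or32; exists k, y0, s.
  case=> [b|z] _ /=; first by rewrite t t0 /=; case: b; rewrite mulr0 mul0r subr0.
  by rewrite l l0 cancel_s0; ring.
- exists (- s * k0.1, - s * k0.2), (fun z=> - s * (z == y)%:R); split.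
    by apply: Or32; exists k0, y, (- s); split=> //; apply: is_signN.
  case=> [b|z] _ /=; first by rewrite t t0 /=; case: b; rewrite cancel_s0; ring.
  by rewrite l l0 cancel_s0; ring.
exists (s * (k.1 - k0.1), s * (k.2 - k0.2)), (fun=> 0); split.
  apply: Or33; split=> //; case: ss=> ->; first by rewrite !mul1r; apply: subC.
  by rewrite !mulN1r !opprB; apply: subC.
case=> [b _|z zx] /=; first by rewrite t t0 /=; case: b; rewrite cancel_s0; ring.
by rewrite l l0 cancel_s0 subrr.
Qed.

Lemma frame_mx_pivot n (A : 'M[R]_n.+1) lab i0 j0 x :
  injective lab -> frame_mx lab A -> lab i0 = inr x -> A i0 j0 != 0 ->
  is_sign (A i0 j0) /\ frame_mx (lab \o lift i0) (\matrix_(i, j)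
  (A (lift i0 i) (lift j0 j) - (A i0 j0)^-1 * A (lift i0 i) j0 * A i0 (lift j0 j))).
Proof.
move=> lab_inj frA labi0; have [top0 [low0 [col0 E0]]] := frA j0.
have pE: A i0 j0 = low0 x by rewrite E0 labi0.
rewrite pE=> p0; split; first by have [s [ss -> _]] := frame_col_at col0 p0.
move=> j; have [top [low [col E]]] := frA (lift j0 j).
have [top' [low' [col' E']]] := frame_col_pivot col0 col p0; exists top', low'; split=> // i.
rewrite mxE E' ?E ?E0 ?labi0 // -labi0 (inj_eq lab_inj).
by rewrite eq_sym neq_lift.
Qed.

Lemma frame_det_top n (A : 'M[R]_n) lab : injective lab -> frame_mx lab A ->
  (forall i, exists b, lab i = inl b) -> golden_power (\det A).
Proof.
move=> lab_inj frA top; have [b bE] := fin_all_exists top.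
have b_inj: injective b by move=> i i' bb; apply: lab_inj; rewrite !bE bb.
have n2: (n <= 2)%N by have := leq_card b b_inj; rewrite card_ord card_bool.
have colE j: exists2 d, d \in D & forall i, A i j = if b i then d.1 else d.2.
  by have [t [low [col E]]] := frA j; exists t=> [|i]; [apply: frame_col_top col|rewrite E bE].
case: n A lab lab_inj frA top b bE b_inj n2 colE => [|[|[|//]]] A lab _ _ _ b _ b_inj _ colE.
- by rewrite det_mx00; apply: golden_power1.
- rewrite det_mx11; have [d dD E] := colE 0; have [d1 d2] := D_power dD; rewrite E.
  by case: (b 0).
have [d dD E] := colE 0; have [d' dD' E'] := colE 1.
have b1: b 1 = ~~ b 0.
  have : b 1 != b 0 by rewrite (inj_eq b_inj).
  by case: (b 1); case: (b 0).
rewrite det_mx22 !E !E' b1; have gold := D_det dD dD'; case: (b 0)=> /=.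
  by rewrite [d'.1 * _]mulrC.
by rewrite [d'.2 * _]mulrC -opprB; apply: golden_powerN.
Qed.

Lemma frame_det n (A : 'M[R]_n) lab : injective lab -> frame_mx lab A -> golden_power (\det A).
Proof.
elim: n A lab=> [|n IH] A lab lab_inj frA; first by rewrite det_mx00; apply: golden_power1.
case: (pickP (fun i=> if lab i is inr _ then true else false))=> [i0|all_top]; last first.
  apply: frame_det_top lab_inj frA _=> i; have := all_top i.
  by case: (lab i)=> // b _; exists b.
case labi0 : (lab i0)=> [//|x] _.
case: (pickP (fun j=> A i0 j != 0))=> [j0 p0|row0]; last first.
  left; rewrite (expand_det_row _ i0) big1 // => j _.
  by have := row0 j=> /negbFE/eqP->; rewrite mul0r.
have [sgn frB] := frame_mx_pivot lab_inj frA labi0 p0; rewrite (det_pivot p0).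
apply: golden_power_sign (is_sign_exp _) (golden_power_sign sgn (IH _ _ _ frB)).
by move=> i i' /lab_inj/lift_inj.
Qed.

Lemma frame_mx_golden m n (A : 'M[R]_(m, n)) lab : injective lab -> frame_mx lab A -> golden_mx A.
Proof.
move=> lab_inj frA k f g f_inj g_inj; apply: (@frame_det _ _ (lab \o f)).
  by move=> i i' /lab_inj/f_inj.
move=> j; have [top [low [col E]]] := frA (g j); exists top, low; split=> // i.
by rewrite mxE E.
Qed.

Lemma frame_row_mx m n1 n2 lab (A : 'M[R]_(m, n1)) (B : 'M_(m, n2)) :
  frame_mx lab A -> frame_mx lab B -> frame_mx lab (row_mx A B).
Proof.
move=> frA frB j; case: (split_ordP j)=> k ->.
  by have [t [l [col E]]] := frA k; exists t, l; split=> // i; rewrite row_mxEl.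
by have [t [l [col E]]] := frB k; exists t, l; split=> // i; rewrite row_mxEr.
Qed.

Lemma frame_unit_mx m (lab : 'I_m -> row_label) : injective lab ->
  (1, 0) \in D -> (0, 1) \in D -> frame_mx lab (1%:M : 'M_m).
Proof.
move=> lab_inj D10 D01 j.
have mx1E i: (1%:M : 'M[R]_m) i j = (lab i == lab j)%:R by rewrite mxE (inj_eq lab_inj).
case labj : (lab j)=> [[]|x].
- exists (1, 0), (fun=> 0); split; first exact: Or33.
  by move=> i; rewrite mx1E labj; case: (lab i)=> [[]|].
- exists (0, 1), (fun=> 0); split; first exact: Or33.
  by move=> i; rewrite mx1E labj; case: (lab i)=> [[]|].
exists (0, 0), (fun z=> 1 * (z == x)%:R); split; last first.
  by move=> i; rewrite mx1E labj; case: (lab i)=> [[]|z] //=; rewrite mul1r.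
by apply: Or32; exists (0, 0), x, 1; rewrite mulr0; split=> //; left.
Qed.

Definition frame_lower m n (top : R * R) (W : 'M[R]_(m, n)) : Prop :=
  forall j, exists2 low, frame_col top low & forall k : 'I_m, W k j = low k.

Lemma frame_lower_edge n : frame_lower (0, 0) (edge_mx R n).
Proof.
move=> j; set e := enum_val j; have ne: (val (val e).1 != val (val e).2) := Kedge_neq e.
exists (fun z=> 1 * ((z == val (val e).1)%:R - (z == val (val e).2)%:R)).
  by apply: Or31; exists (val (val e).1), (val (val e).2), 1; split=> //; left.
move=> k; rewrite mxE mul1r -/e /=; rewrite -!val_eqE /=.
case: eqP=> [->|_]; first by rewrite (negPf ne) subr0.
by rewrite sub0r; case: eqP=> _; rewrite ?oppr0.
Qed.

Lemma frame_lower_point n c : c \in C -> frame_lower c (1%:M : 'M_n).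
Proof.
move=> cC j; exists (fun z : nat=> 1 * (z == j :> nat)%:R); last by move=> k; rewrite mxE mul1r.
by apply: Or32; exists c, (j : nat), 1; rewrite !mul1r -surjective_pairing; split=> //; left.
Qed.

Lemma frame_lower_dir m n d : d \in D -> frame_lower d (0 : 'M_(m, n)).
Proof. by move=> dD j; exists (fun=> 0)=> [|k]; [apply: Or33|rewrite mxE]. Qed.

Definition row_label1 n (i : 'I_(1 + n)) : row_label :=
  match split i with inl _ => inl true | inr k => inr (val k) end.

Definition row_label2 n (i : 'I_(1 + (1 + n))) : row_label :=
  match split i with
  | inl _ => inl true
  | inr i' => match split i' with inl _ => inl false | inr k => inr (val k) end end.

Lemma row_label1_inj n : injective (@row_label1 n).
Proof.
move=> i j; rewrite /row_label1; case: (split_ordP i)=> i' ->; case: (split_ordP j)=> j' -> //.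
  by rewrite !ord1.
by case=> /val_inj->.
Qed.

Lemma row_label2_inj n : injective (@row_label2 n).
Proof.
move=> i j; rewrite /row_label2; case: (split_ordP i)=> i' ->; case: (split_ordP j)=> j' -> //.
- by rewrite !ord1.
- by case: (split_ordP j')=> k' ->.
- by case: (split_ordP i')=> k' ->.
case: (split_ordP i')=> k ->; case: (split_ordP j')=> k' -> //; first by rewrite !ord1.
by case=> /val_inj->.
Qed.

Lemma frame_col_mx1 m n (a : R) (t : 'rV[R]_m) (W : 'M_(n, m)) :
  (forall j, t 0 j = a) -> frame_lower (a, 0) W -> frame_mx (@row_label1 n) (col_mx t W).
Proof.
move=> tE frW j; have [low col E] := frW j; exists (a, 0), low; split=> // i.
rewrite /row_label1; case: (split_ordP i)=> k ->; rewrite ?col_mxEu ?col_mxEd //=.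
by rewrite ord1.
Qed.

Lemma frame_col_mx2 m n (a b : R) (t1 t2 : 'rV[R]_m) (W : 'M_(n, m)) :
  (forall j, t1 0 j = a) -> (forall j, t2 0 j = b) -> frame_lower (a, b) W ->
  frame_mx (@row_label2 n) (col_mx t1 (col_mx t2 W)).
Proof.
move=> t1E t2E frW j; have [low col E] := frW j; exists (a, b), low; split=> // i.
rewrite /row_label2; case: (split_ordP i)=> k ->; rewrite ?col_mxEu ?col_mxEd /=.
  by rewrite ord1.
by case: (split_ordP k)=> k' ->; rewrite ?col_mxEu ?col_mxEd //= ord1.
Qed.

Lemma frame_T2_mx a n : (1, 0) \in D -> (0, 1) \in D ->
  {subset [:: (1, 0); (a, 0); (a ^+ 2, 0)] <= C} -> frame_mx (@row_label1 n) (T2_mx a n).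
Proof.
move=> D10 D01 subset_C.
have point c: (c, 0) \in C -> frame_mx (@row_label1 n) (point_mx1 n c).
  by move=> cC; apply: (frame_col_mx1 (a:=c)) (frame_lower_point cC)=> j; rewrite mxE.
apply: frame_row_mx; first exact: frame_unit_mx (@row_label1_inj n) D10 D01.
apply: frame_row_mx.
  by apply: (frame_col_mx1 (a:=0)) (@frame_lower_edge n)=> j; rewrite mxE.
by do ![apply: frame_row_mx|apply/point/subset_C; rewrite !inE eqxx ?orbT].
Qed.

Lemma frame_GH_mx c1 c2 c3 c4 d1 d2 d3 n : {subset [:: c1; c2; c3; c4] <= C} ->
  {subset [:: (1, 0); (0, 1); (1, d1); (1, d2); (1, d3)] <= D} ->
  frame_mx (@row_label2 n) (GH_mx c1 c2 c3 c4 d1 d2 d3 n).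
Proof.
move=> subset_C subset_D.
have point c: c \in [:: c1; c2; c3; c4] -> frame_mx (@row_label2 n) (point_mx2 n c).
  case: c=> a b /subset_C cC.
  by apply: (frame_col_mx2 (a:=a) (b:=b)) (frame_lower_point cC)=> j; rewrite mxE.
have dir d: (1, d) \in D -> frame_mx (@row_label2 n) (top_col n d).
  move=> dD; rewrite /top_col; apply: (frame_col_mx2 (a:=1) (b:=d))=> [j|j|].
  - by rewrite ord1 mxE.
  - by rewrite ord1 mxE.
  exact: frame_lower_dir.
apply: frame_row_mx.
  by apply: frame_unit_mx (@row_label2_inj n) _ _; apply: subset_D; rewrite !inE eqxx ?orbT.
apply: frame_row_mx.
  by apply: (frame_col_mx2 (a:=0) (b:=0)) (@frame_lower_edge n)=> j; rewrite mxE.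
by do ![apply: frame_row_mx|apply: point; rewrite !inE eqxx ?orbT
  |apply/dir/subset_D; rewrite !inE eqxx ?orbT].
Qed.

End FrameMatrices.

Section GenericMatrixMorphism.
Variables (S S' : comNzRingType) (f : {rmorphism S -> S'}).

Lemma map_edge_mx n : map_mx f (edge_mx S n) = edge_mx S' n.
Proof. by apply/matrixP=> i j; rewrite !mxE /=; do 2?case: ifP=> _;
  rewrite ?(rmorphN, rmorph1, rmorph0). Qed.

Lemma map_T2_mx a n : map_mx f (T2_mx a n) = T2_mx (f a) n.
Proof.
rewrite /T2_mx /point_mx1 !map_row_mx !map_col_mx !map_mx0 !map_const_mx !map_mx1 map_edge_mx.
by rewrite rmorph1 rmorphXn.
Qed.

Lemma map_GH_mx c1 c2 c3 c4 d1 d2 d3 n : map_mx f (GH_mx c1 c2 c3 c4 d1 d2 d3 n) =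
  GH_mx (f c1.1, f c1.2) (f c2.1, f c2.2) (f c3.1, f c3.2) (f c4.1, f c4.2) (f d1) (f d2) (f d3) n.
Proof.
rewrite /GH_mx /point_mx2 /top_col !map_row_mx !map_col_mx !map_mx0 !map_const_mx.
by rewrite !map_scalar_mx map_edge_mx !rmorph1.
Qed.

End GenericMatrixMorphism.

(* The pair (a, b) stands for a + b t, where t ^ 2 = t + 1. *)
Definition zgolden := (int * int)%type.
Definition z0 : zgolden := (0, 0).
Definition z1 : zgolden := (1, 0).
Definition ztau : zgolden := (0, 1).
Definition ztau2 : zgolden := (1, 1).
Definition ztau_inv : zgolden := (-1, 1).
Definition zsub (x y : zgolden) : zgolden := (x.1 - y.1, x.2 - y.2).
Definition zmul (x y : zgolden) : zgolden :=
  (x.1 * y.1 + x.2 * y.2, x.1 * y.2 + x.2 * y.1 + x.2 * y.2).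
Definition zsub2 (c c' : zgolden * zgolden) : zgolden * zgolden := (zsub c.1 c'.1, zsub c.2 c'.2).

Definition zpowers : seq zgolden :=
  [seq iter i (zmul y) z1 | y <- [:: ztau; ztau_inv], i <- iota 0 5].
Definition zpower_test (x : zgolden) : bool := [|| x == z0, x \in zpowers | zsub z0 x \in zpowers].

Definition zdirs (C X : seq (zgolden * zgolden)) : seq (zgolden * zgolden) :=
  [seq zsub2 c c' | c <- C, c' <- C] ++ X.
Definition zpower_dets (C X : seq (zgolden * zgolden)) : bool :=
  all (fun d=> [&& zpower_test d.1, zpower_test d.2 & all (fun d' =>
  zpower_test (zsub (zmul d.1 d'.2) (zmul d.2 d'.1))) (zdirs C X)]) (zdirs C X).

Section GoldenConfigurations.
Variables (K : comNzRingType) (t : K).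

Definition zval (x : zgolden) : K := x.1%:~R + x.2%:~R * t.
Definition zval2 (c : zgolden * zgolden) : K * K := (zval c.1, zval c.2).

Lemma zvalE : [/\ zval z0 = 0, zval z1 = 1 & zval ztau = t].
Proof. by split; rewrite /zval /= ?mulr0z ?mulr1z ?mul0r ?mul1r ?addr0 ?add0r. Qed.

Lemma zvalB x y : zval (zsub x y) = zval x - zval y.
Proof. by rewrite /zval /zsub /= !rmorphB /=; ring. Qed.

Hypothesis t2 : t ^+ 2 = t + 1.

Lemma zvalM x y : zval (zmul x y) = zval x * zval y.
Proof.
rewrite /zval /zmul /= !rmorphD !rmorphM /=.
transitivity (x.1%:~R * y.1%:~R + (x.1%:~R * y.2%:~R + x.2%:~R * y.1%:~R) * t
    + x.2%:~R * y.2%:~R * t ^+ 2); last by ring.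
by rewrite t2; ring.
Qed.

Lemma zvalX x i : zval (iter i (zmul x) z1) = zval x ^+ i.
Proof.
have [_ one _] := zvalE; elim: i=> [|i IH]; first by rewrite one.
by rewrite iterS zvalM IH exprS.
Qed.

End GoldenConfigurations.

Section GoldenMatrices.
Variable R : realType.
Local Notation tau := (golden_ratio R).

Lemma zpowersP x : x \in zpowers -> exists i : int, zval tau x = tau ^ i.
Proof.
case/allpairsP=> -[y i] /= [ys _ ->]; rewrite (zvalX (golden_ratio_sqr R)).
move: ys; rewrite !inE=> /orP[]/eqP->.
  by exists i; have [_ _ ->] := zvalE tau.
exists (- i%:Z); rewrite -exprnN -exprVn golden_ratio_inv; congr (_ ^+ i).
by rewrite /zval /= mulrN1z mulr1z mul1r addrC.
Qed.

Lemma zpower_testP x : zpower_test x -> golden_power (zval tau x).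
Proof.
have [zero _ _] := zvalE tau.
case/or3P=> [/eqP->|/zpowersP[i xE]|/zpowersP[i]]; first by left.
  by right; exists i; left.
by rewrite zvalB zero sub0r=> xE; right; exists i; right; rewrite -xE opprK.
Qed.

Lemma zframe_golden (C X : seq (zgolden * zgolden)) m n (A : 'M[R]_(m, n)) lab :
  zpower_dets C X -> (z0, z0) \in C -> injective lab ->
  frame_mx (map (zval2 tau) C) (map (zval2 tau) (zdirs C X)) lab A -> golden_mx A.
Proof.
move=> /allP test C0 lab_inj; apply: frame_mx_golden lab_inj.
- move=> _ _ /mapP[c cC ->] /mapP[c' c'C ->].
  apply/mapP; exists (zsub2 c c'); last by rewrite /zval2 /= !zvalB.
  by rewrite mem_cat; apply/orP; left; apply/allpairsP; exists (c, c').
- by apply/mapP; exists (z0, z0); rewrite // /zval2 /=; have [-> _ _] := zvalE tau.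
- move=> _ /mapP[d dD ->]; have /and3P[test1 test2 _] := test d dD.
  by split; apply: zpower_testP.
move=> _ _ /mapP[d dD ->] /mapP[d' dD' ->]; have /and3P[_ _ /allP/(_ d' dD') test_det] := test d dD.
by have := zpower_testP test_det; rewrite zvalB !(zvalM (golden_ratio_sqr R)).
Qed.

Lemma golden_T2_mx n : golden_mx (T2_mx tau n).
Proof.
pose C := [:: (z0, z0); (z1, z0); (ztau, z0); (ztau2, z0)]; pose X := [:: (z1, z0); (z0, z1)].
have [zero one tauE] := zvalE tau.
have tau2E: zval tau ztau2 = tau ^+ 2 by rewrite /zval /= golden_ratio_sqr mul1r addrC.
apply: (@zframe_golden C X _ _ _ _ _ isT (@row_label1_inj n)); first by vm_compute.
apply: frame_T2_mx=> [|||c].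
- by apply/mapP; exists (z0, z0); rewrite // /zval2 /= zero.
- by apply/mapP; exists (z1, z0); rewrite // /zval2 /= zero one.
- by apply/mapP; exists (z0, z1); rewrite // /zval2 /= zero one.
rewrite /C /= /zval2 /= zero one tauE tau2E !inE.
by case/or3P=> /eqP->; rewrite eqxx ?orbT.
Qed.

Definition GH_dirs (e1 e2 e3 : zgolden) : seq (zgolden * zgolden) :=
  [:: (z1, z0); (z0, z1); (z1, e1); (z1, e2); (z1, e3)].

Lemma golden_GH_mx n k1 k2 k3 k4 e1 e2 e3 :
  zpower_dets [:: (z0, z0); k1; k2; k3; k4] (GH_dirs e1 e2 e3) ->
  golden_mx (GH_mx (zval2 tau k1) (zval2 tau k2) (zval2 tau k3) (zval2 tau k4)
  (zval tau e1) (zval tau e2) (zval tau e3) n).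
Proof.
move=> test; have [zero one _] := zvalE tau.
apply: (zframe_golden test (mem_head _ _) (@row_label2_inj n)).
apply: frame_GH_mx=> [|c|d].
- by rewrite /= /zval2 /= zero mem_head.
- by move=> cC; rewrite [map _ _]/= in_cons cC orbT.
by rewrite /zdirs map_cat mem_cat=> dX; apply/orP; right; move: dX; rewrite /= /zval2 /= zero one.
Qed.

Variables (F : finFieldType) (F4 : #|F| = 4%N) (al : F) (alE : al ^+ 2 = al + 1).

Lemma GM_T2 r : GM R (T2 al r).
Proof.
have := GM_eval_int (R:=R) (B:=T2_mx 'X r.-1) alE.
by rewrite !map_T2_mx !eval_intX; apply; apply: golden_T2_mx.
Qed.

Lemma eval_int_zval (K : comNzRingType) (t : K) x : eval_int t (zval 'X x) = zval t x.
Proof. by rewrite /zval rmorphD rmorphM eval_intX !rmorph_int. Qed.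

Lemma GM_GH n k1 k2 k3 k4 e1 e2 e3 : zpower_dets [:: (z0, z0); k1; k2; k3; k4] (GH_dirs e1 e2 e3) ->
  GM R (column_matroid (GH_mx (zval2 al k1) (zval2 al k2) (zval2 al k3) (zval2 al k4)
  (zval al e1) (zval al e2) (zval al e3) n)).
Proof.
move=> test; have := GM_eval_int (R:=R) (B:=GH_mx (zval2 'X k1) (zval2 'X k2) (zval2 'X k3)
  (zval2 'X k4) (zval 'X e1) (zval 'X e2) (zval 'X e3) n) alE.
by rewrite !map_GH_mx !eval_int_zval; apply; apply: golden_GH_mx test.
Qed.

(* Modulo 2 the negative powers -1, -tau, 1 - tau and 2 - tau become 1, al, al ^ 2 and al. *)
Lemma zval_F4 : [/\ zval al ztau2 = al ^+ 2, zval al (-1, 0) = 1, zval al (0, -1) = al,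
  zval al (1, -1) = al ^+ 2 & zval al (2, -1) = al].
Proof.
have opp x: - x = x := oppr_pchar2 (F4_char2 F4) x.
have two: 1 + 1 = 0 :> F by rewrite -{2}[1]opp subrr.
split; rewrite /zval /= ?mulrN1z ?mulr0z ?mulr1z ?mulN1r ?mul1r ?mul0r ?addr0 ?add0r ?opp ?alE //.
- by rewrite addrC.
- by rewrite addrC.
by rewrite -[2%:~R]/(1 + 1 : F) two add0r.
Qed.

Lemma GM_G r : GM R (Gr al r).
Proof.
have := @GM_GH r.-2 (z1, z0) (z0, z1) (ztau, z0) (z0, ztau) (-1, 0) (0, -1) (1, -1).
rewrite /zval2 /=; have [-> -> ->] := zvalE al; have [_ -> -> -> _] := zval_F4.
by apply; vm_compute.
Qed.

Lemma GM_HP r : GM R (HP al r).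
Proof.
have := @GM_GH r.-2 (ztau, z0) (z0, z1) (ztau, ztau) (ztau2, z1) z1 (2, -1) (1, -1).
rewrite /zval2 /=; have [-> -> ->] := zvalE al; have [-> _ _ -> ->] := zval_F4.
by apply; vm_compute.
Qed.

End GoldenMatrices.

Section StandardFamily.
Variables (F : fieldType) (V : vectType F) (n : nat) (TC TD : finType) (c : TC -> V) (d : TD -> V).
Hypotheses (c_inj : injective c) (d_simple : simple_on d setT).

Local Notation std_index := (Kedge n + (TC * 'I_n) + TD)%type.

Definition std_family (s : std_index) : framed F V 'I_n :=
  match s with
  | inl (inl e) => (0, unit_vec (val e).1 - unit_vec (val e).2)
  | inl (inr p) => (c p.1, unit_vec p.2)
  | inr t => (d t, 0) end.

Definition std_supp (s : std_index) : {set 'I_n} :=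
  match s with
  | inl (inl e) => [set (val e).1; (val e).2]
  | inl (inr p) => [set p.2]
  | inr _ => set0 end.

Lemma std_suppE s : [set r | (std_family s).2 r != 0] = std_supp s.
Proof.
apply/setP=> r; rewrite !inE; case: s=> [[e|p]|t] /=.
- rewrite !ffunE !inE; case: (eqVneq r (val e).1)=> [->|_] /=.
    by rewrite (negPf (Kedge_neq e)) subr0 oner_eq0.
  by rewrite sub0r oppr_eq0; case: (r == _); rewrite ?oner_eq0 ?eqxx.
- by rewrite ffunE !inE; case: (r == _); rewrite ?oner_eq0 ?eqxx.
by rewrite ffunE eqxx inE.
Qed.

Lemma std_family_neq0 s : std_family s != 0.
Proof.
apply/eqP=> s0; have supp0: std_supp s = set0.
  by rewrite -std_suppE s0; apply/setP=> r; rewrite !inE ffunE eqxx.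
case: s s0 supp0=> [[e|p]|t] /= s0.
- by move/setP/(_ (val e).1); rewrite !inE eqxx.
- by move/setP/(_ p.2); rewrite !inE eqxx.
by move=> _; have [d0 _] := d_simple; have := d0 t (in_setT _); case: s0=> ->; rewrite eqxx.
Qed.

Lemma edge_supp_inj (e e' : Kedge n) :
  [set (val e).1; (val e).2] = [set (val e').1; (val e').2] -> e = e'.
Proof.
move=> /setP ee; apply: val_inj; have := valP e; have := valP e'.
have := ee (val e).1; have := ee (val e).2; rewrite !inE !eqxx !orbT=> /esym/orP ee2 /esym/orP ee1.
rewrite [val e]surjective_pairing [val e']surjective_pairing.
case: ee1=> /eqP->; case: ee2=> /eqP-> //; rewrite ?ltnn // => lt1 lt2.
by have := ltn_trans lt1 lt2; rewrite ltnn.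
Qed.

Lemma std_family_simple : simple_on std_family setT.
Proof.
split=> [s _|s s' k _ _ sE]; first exact: std_family_neq0.
have k0: k != 0 by apply: contraNneq (std_family_neq0 s)=> k0; rewrite sE k0 scale0r.
have supp_eq: std_supp s = std_supp s'.
  by rewrite -!std_suppE; apply/setP=> r; rewrite !inE sE /= ffunE mulf_eq0 (negPf k0).
have card_edge (e: Kedge n) : #|[set (val e).1; (val e).2]| = 2 by rewrite cards2 Kedge_neq.
case: s s' sE supp_eq=> [[e|p]|t] [[e'|p']|t'] sE supp_eq;
  have cards := congr1 (fun X : {set 'I_n}=> #|X|) supp_eq;
  rewrite /= ?card_edge ?cards1 ?cards0 in cards=> //.
- by rewrite (edge_supp_inj supp_eq).
- have pp: p.2 = p'.2 by apply/set1P; rewrite -(_ : [set p.2] = [set p'.2]) ?set11.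
  move: sE=> /= [cE /ffunP/(_ p.2)]; rewrite !ffunE pp eqxx=> k1.
  move: cE; rewrite -[k]mulr1 -[k * 1]k1 scale1r=> /c_inj cE.
  by rewrite [p]surjective_pairing [p']surjective_pairing cE pp.
move: sE=> /= [dE _]; have [_ par] := d_simple.
by congr inr; apply: par dE; rewrite inE.
Qed.

Lemma card_std_family : #|{: std_index}| = (#|Kedge n| + #|TC| * n + #|TD|)%N.
Proof. by rewrite !card_sum card_prod card_ord. Qed.

Lemma std_family_std (C : V -> Prop) s : (forall t, C (c t)) ->
  exists2 k : F, k != 0 & exists2 z, std_family s = k *: z & std_vec C z.
Proof.
move=> Cc; exists 1; rewrite ?oner_eq0 //; exists (std_family s); first by rewrite scale1r.
case: s=> [[e|p]|t] /=.
- by apply: Or31; exists (val e).1, (val e).2; split=> //; apply: Kedge_neq.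
- by apply: Or32; exists p.2, (c p.1).
by apply: Or33; exists (d t)=> //; have [d0 _] := d_simple; apply: d0; rewrite inE.
Qed.

End StandardFamily.

Lemma msimple_miso E E' (M : matroid E) (N : matroid E') : miso M N -> msimple M -> msimple N.
Proof.
move=> [f [g fg gf] fE] ms X X2.
have XE: X = f @: (g @: X).
  by rewrite -imset_comp -[LHS]imset_id; apply: eq_imset=> x; rewrite /= gf.
have cX: #|g @: X| = #|X| by apply: card_imset; apply: can_inj gf.
by rewrite XE fE ms ?cX // card_imset ?cX //; apply: can_inj fg.
Qed.

Lemma msimple_std F (vT : vectType F) E E' (u : E -> vT) (N : matroid E') :
  simple_on u setT -> miso (vmatroid u) N -> msimple N.
Proof. by move=> su iso; apply: msimple_miso iso _; apply/(msimpleP (u:=u)). Qed.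

Lemma mrank_miso E E' (M : matroid E) (N : matroid E') : miso M N -> mrank M = mrank N.
Proof.
move=> [f [g fg gf] fE]; rewrite /mrank -fE; congr (rk N _); apply/setP=> x; rewrite inE.
by apply/imsetP; exists (g x); rewrite ?gf ?inE.
Qed.

Lemma mrank_unit_cols F m n (A : 'M[F]_(m, n)) :
  (forall i, exists j, col j A = delta_mx i 0) -> mrank (column_matroid A) = m.
Proof.
move=> units; rewrite /mrank /= (_ : vspan _ _ = fullv); first by rewrite dimvf /dim /= muln1.
apply/eqP; rewrite eqEsubv subvf; apply/subvP=> x _; rewrite (matrix_sum_delta x).
apply: memv_suml=> i _; rewrite big_ord1; apply: memvZ; have [j <-] := units i.
by apply: (@mem_vspan F _ _ (fun j=> col j A) setT j); rewrite inE.
Qed.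

Lemma mrank_unit_row_mx F m n (A : 'M[F]_(m, n)) : mrank (column_matroid (row_mx 1%:M A)) = m.
Proof. by apply: mrank_unit_cols=> i; exists (lshift n i); rewrite colKl col1. Qed.

Section ThreeFamilies.
Variables (F : finFieldType) (F4 : #|F| = 4%N) (al : F) (alE : al ^+ 2 = al + 1).

Local Notation dec := (dec4 al).
Local Notation F4_elements := [:: 0; 1; al; al ^+ 2].

Lemma F4_elements_uniq : uniq F4_elements.
Proof.
have <- : map dec [:: c0; c1; ca; cb] = F4_elements by rewrite /= !(dec4E alE).
by rewrite (map_inj_uniq (dec4_inj F4 alE)).
Qed.

Lemma nth_uniq_inj (T : eqType) (x0 : T) (s : seq T) :
  uniq s -> injective (fun t : 'I_(size s)=> nth x0 s t).
Proof. by move=> us i j /eqP; rewrite nth_uniq // => /eqP/val_inj. Qed.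

Lemma T2_simple r : (0 < r)%N -> msimple (T2 al r).
Proof.
case: r=> // n _; pose c (t : 'I_(size F4_elements)) : F^o := nth 0 F4_elements t.
pose d (_ : unit) : F^o := 1.
have c_inj: injective c := nth_uniq_inj F4_elements_uniq.
have d_simple: simple_on d setT.
  by split=> [t _|t t']; [apply: oner_neq0|case: t; case: t'].
have simple_std := @std_family_simple F _ n _ _ c d c_inj d_simple.
have card_le: #|'I_n| = n := card_ord n.
have [_] := @T2_bound F al 'I_n _ _ _ simple_std _ _ _ (fun X=> erefl _) (T2_mx_columns al _)
  (fun s=> @std_family_std F F^o n _ _ c d d_simple _ s (fun t=> mem_nth 0 (ltn_ord t))).
rewrite card_le=> iso; apply: (msimple_std simple_std (iso _)).
by rewrite card_std_family card_ord card_unit /=; lia.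
Qed.

Definition top_points (t : option 'I_(size F4_elements)) : (F^o * F^o)%type :=
  if t is Some t then (1, nth 0 F4_elements t) else (0, 1).

Lemma top_points_simple : simple_on top_points setT.
Proof.
split=> [[t|] _|[t|] [t'|] k _ _] //=.
- by apply/eqP=> -[/eqP]; rewrite oner_eq0.
- by apply/eqP=> -[/eqP]; rewrite oner_eq0.
- move=> tE; have k1: k = 1 := etrans (esym (mulr1 k)) (esym (congr1 fst tE)).
  by have := congr1 snd tE; rewrite k1 scale1r=> /(nth_uniq_inj F4_elements_uniq)->.
- by move=> tE; have /eqP := etrans (congr1 fst tE) (mulr0 k : _ = 0); rewrite oner_eq0.
move=> tE; have k0: k = 0 := etrans (esym (mulr1 k)) (esym (congr1 fst tE)).
by have := congr1 snd tE; rewrite k0 scale0r=> /eqP; rewrite oner_eq0.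
Qed.

Lemma GH_simple (A : forall n, 'M[F]_(1 + (1 + n), GH_ncols n)) (C : seq (F * F)) :
  (forall n, GH_columns al (A n) C) -> uniq C -> size C = 5 ->
  forall n, msimple (column_matroid (A n)).
Proof.
move=> colsA uC sC n; pose c (t : 'I_(size C)) : (F^o * F^o)%type := nth 0 C t.
have c_inj: injective c := nth_uniq_inj uC.
have simple_std := @std_family_simple F _ n _ _ c top_points c_inj top_points_simple.
have card_le: #|'I_n| = n := card_ord n.
have [_] := @GH_bound F F4 al alE 'I_n _ _ _ simple_std _ _ (A #|'I_n|) C (fun X=> erefl _)
  (colsA _) (fun s=> @std_family_std F (F^o * F^o)%type n _ _ c top_points top_points_simple _ s
    (fun t=> mem_nth 0 (ltn_ord t))).
rewrite card_le=> iso; apply: (msimple_std simple_std (iso _)).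
by rewrite card_std_family card_option !card_ord sC /GH_ncols /=; lia.
Qed.

Lemma dec_pairs_uniq (s : seq (c4 * c4)) : uniq s -> uniq [seq (dec x.1, dec x.2) | x <- s].
Proof.
by move=> us; rewrite map_inj_uniq // => -[x y] [x' y'] [/(dec4_inj F4 alE)-> /(dec4_inj F4 alE)->].
Qed.

Lemma G_simple r : msimple (Gr al r).
Proof.
apply: (GH_simple (A:=Gmx al) (@Gmx_columns F al))=> //.
have := @dec_pairs_uniq [:: (c0, c0); (c1, c0); (c0, c1); (ca, c0); (c0, ca)] isT.
by rewrite /= !(dec4E alE).
Qed.

Lemma HP_simple r : msimple (HP al r).
Proof.
apply: (GH_simple (A:=HPmx al) (@HPmx_columns F al))=> //.
have := @dec_pairs_uniq [:: (c0, c0); (ca, c0); (c0, c1); (ca, ca); (cb, c1)] isT.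
by rewrite /= !(dec4E alE).
Qed.

Lemma three_iso_card r E (M : matroid E) : (1 < r)%N -> three_iso al r M -> #|E| = hval r.
Proof.
case: r=> [|[|n]] // _ [] [f /bij_eq_card-> _]; rewrite card_ord;
  [exact: (T2_ncolsE n.+1)|exact: (GH_ncolsE n)|exact: (GH_ncolsE n)].
Qed.

Lemma three_iso_simple r E (M : matroid E) :
  (1 < r)%N -> three_iso al r M -> msimple M /\ mrank M = r.
Proof.
case: r=> [|[|n]] // _ []iso; rewrite (mrank_miso iso); split; try exact: mrank_unit_row_mx;
  apply: (msimple_miso (miso_sym iso)); [exact: T2_simple|exact: G_simple|exact: HP_simple].
Qed.

End ThreeFamilies.

Lemma GM_miso (R : realType) E E' (M : matroid E) (N : matroid E') : miso M N -> GM R N -> GM R M.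
Proof. by move=> iso [m [n [A [minors isoN]]]]; exists m, n, A; split=> //; apply: miso_trans isoN.
  Qed.

Lemma rank_one_flats_simple E (M : matroid E) : msimple M -> #|rank_one_flats M| = #|E|.
Proof.
move=> ms; have set1_inj: injective (set1 : E -> {set E}).
  by move=> x y /setP/(_ x); rewrite !inE eqxx=> /esym/eqP.
rewrite -[RHS]cardsT -(card_imset _ set1_inj); congr #|pred_of_set _|; apply/setP=> X.
have rk1 x: rk M [set x] = 1%N by rewrite ms cards1.
rewrite inE; apply/andP/imsetP=> [[flatX /eqP X1]|[x _ ->]].
  have [x xX]: exists x, x \in X.
    by apply/set0Pn; apply: contra_eqN X1=> /eqP->; rewrite ms cards0.
  exists x; rewrite ?inE //; apply/eqP; rewrite eqEsubset sub1set xX andbT; apply/subsetP=> y yX.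
  rewrite inE; apply/eqP; apply: contraTeq (leqnn 1)=> yx; rewrite -{1}X1 -ltnNge.
  have : (rk M [set x; y] <= rk M X)%N by apply: rk_mono; rewrite subUset !sub1set xX.
  by rewrite ms cards2 eq_sym yx.
split; last by rewrite rk1.
by apply/forallP=> e; apply/implyP; rewrite inE rk1=> ex; rewrite ms cards2 ex.
Qed.

Section ExtremalMatroids.
Variables (F : finFieldType) (F4 : #|F| = 4%N) (al : F) (alE : al ^+ 2 = al + 1).
Hypothesis hB : HypothesisB.

Lemma AC4_extremal_bound : exists r0, forall r, (r0 <= r)%N ->
  forall E (M : matroid E), AC4 F M -> msimple M -> (mrank M <= r)%N -> extremal_bound al r M.
Proof.
have [R bound] := rep_char3_extremal_bound F4 alE hB; exists R=> r Rr E M [repF _ repp] ms mr.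
have [vT [u uE]] := representable_family repF.
have [K K3 /representable_family[wT [w wE]]] := repp 3 isT.
have u3: rep_char3 u by exists K=> //; exists wT, w=> X; rewrite -uE -wE.
have su: simple_on u setT by apply/(msimpleP uE).
by apply: (extremal_bound_same_rk (M':=vmatroid _) uE) (bound r Rr vT E u u3 su _); rewrite -uE.
Qed.

Variable C : matroid_class.
Hypothesis C_AC4 : forall E (M : matroid E), C M -> AC4 F M.
Hypothesis C_three : forall r E (M : matroid E), three_iso al r M -> C M.

Theorem class_extremal : exists r0, forall r, (r0 <= r)%N -> extremal_value C r (hval r) /\
  (forall E (M : matroid E), extremal C r M <-> three_iso al r M).
Proof.
have [R bound] := AC4_extremal_bound; exists (R + 2)%N=> r Rr.
have [r1 {}Rr]: (1 < r)%N /\ (R <= r)%N by lia.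
have isoT2: three_iso al r (T2 al r) by apply/Or31/miso_refl.
have [simpleT2 rankT2] := three_iso_simple F4 alE r1 isoT2.
have value: extremal_value C r (hval r).
  split=> [|E M cM ms mr]; last by have [] := bound r Rr E M (C_AC4 cM) ms mr.
  exists _, (T2 al r); split=> //; [exact: C_three isoT2|by rewrite rankT2|].
  exact: three_iso_card r1 isoT2.
split=> // E M; split=> [[cM ms mr [_ le_flats]]|isoM].
  rewrite rank_one_flats_simple // in le_flats.
  have [|le] := bound r Rr E M (C_AC4 cM) ms; first by rewrite mr.
  apply; apply/eqP; rewrite eqn_leq le -(three_iso_card r1 isoT2).
  by apply: (le_flats _ (T2 al r))=> //; [exact: C_three isoT2|rewrite rankT2].
have [ms mr] := three_iso_simple F4 alE r1 isoM; split=> //; first exact: C_three isoM.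
by rewrite rank_one_flats_simple // (three_iso_card r1 isoM).
Qed.

End ExtremalMatroids.

Theorem theorem10p8 (R : realType) (F4 : finFieldType) (hF4 : #|F4| = 4%N)
    (alpha : F4) (halpha : alpha ^+ 2 = alpha + 1) (hB : HypothesisB) :
  (exists r0 : nat, forall r : nat, (r0 <= r)%N ->
     (forall (E : finType) (M : matroid E),
        extremal (AC4 F4) r M <->
        [\/ miso M (T2 alpha r), miso M (Gr alpha r) | miso M (HP alpha r)]) /\
     (forall (E : finType) (M : matroid E),
        extremal (GM R) r M <->
        [\/ miso M (T2 alpha r), miso M (Gr alpha r) | miso M (HP alpha r)])) /\
  (exists r0 : nat, forall r : nat, (r0 <= r)%N ->
     extremal_value (AC4 F4) r ('C(r + 3, 2) - 5)%N /\
     extremal_value (GM R) r ('C(r + 3, 2) - 5)%N).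
Proof.
have three_GM r (E : finType) (M : matroid E) : three_iso alpha r M -> GM R M.
  by case=> /GM_miso; apply; [apply: GM_T2|apply: GM_G|apply: GM_HP].
have three_AC4 r (E : finType) (M : matroid E) : three_iso alpha r M -> AC4 F4 M.
  by move=> /three_GM; apply: GM_AC4 halpha.
have [R1 ac4] := class_extremal hF4 halpha hB (C := AC4 F4) (fun E M => id) three_AC4.
have [R2 gm] := class_extremal hF4 halpha hB (fun E M => @GM_AC4 R F4 alpha E M halpha) three_GM.
split; exists (R1 + R2)%N => r Rr; have [v1 e1] := ac4 r ltac:(lia);
  by have [v2 e2] := gm r ltac:(lia).
Qed.
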